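(* Let $(K,v)$ be a henselian defectless valued field and let $(L|K,v)$ be an extension of valued fields without transcendence defect. Then $(L|K,v)$ satisfies the AKE$^\exists$ Principle: if $vK$ is existentially closed in $vL$ (in the language of ordered groups) and $Kv$ is existentially closed in $Lv$ (in the language of fields), then $(K,v)$ is existentially closed in $(L,v)$ (in the language of valued fields).
   Context: For a valued field $(K,v)$, $vK$ denotes its value group and $Kv$ its residue field. A valued field is henselian if $v$ extends uniquely to every algebraic extension field. A finite extension $(L|K,v)$ with $v_1,\dots,v_g$ the extensions of $v$ to $L$ is defectless if $[L:K]=\sum_i (v_iL:vK)[Lv_i:Kv]$; $(K,v)$ is a defectless field if all its finite extensions are defectless. An extension $(L|K,v)$ with $L|K$ of finite transcendence degree is without transcendence defect if $\mathrm{trdeg}\, L|K = \mathrm{trdeg}\, Lv|Kv + \dim_{\mathbb Q}(\mathbb Q\otimes vL/vK)$; if $L|K$ has infinite transcendence degree, it is without transcendence defect if every subextension of finite transcendence degree is. The language of valued fields is $\{+,-,\cdot,{}^{-1},0,1,\mathcal O\}$ where $\mathcal O$ is interpreted as the valuation ring (equivalently valuation divisibility $va\ge vb$). A structure $A$ is existentially closed in an extension $B$ if every existential sentence with parameters from $A$ true in $B$ is true in $A$. *)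

(* Defs.v *)
From HB Require Import structures.
From mathcomp Require Import all_boot all_order all_algebra all_field.
From mathcomp Require Import mpoly.
Set Implicit Arguments. Unset Strict Implicit. Unset Printing Implicit Defensive.
Import GRing.Theory.
Local Open Scope ring_scope.

Definition valuation_ring (K : fieldType) (O : K -> Prop) : Prop :=
  [/\ O 1,
      (forall x y, O x -> O y -> O (x - y)),
      (forall x y, O x -> O y -> O (x * y)) &
      (forall x, x != 0 -> O x \/ O x^-1)].

Definition vunit (K : fieldType) (O : K -> Prop) (x : K) : Prop :=
  [/\ x != 0, O x & O x^-1].
Definition vmax (K : fieldType) (O : K -> Prop) (x : K) : Prop :=
  O x /\ ~ vunit O x.

Definition extends (K L : fieldType) (j : K -> L) (O : K -> Prop)
  (O' : L -> Prop) : Prop := forall a, O' (j a) <-> O a.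

(* A value group of (L,O): an abelian group G with an order relation le
   and a surjective homomorphism v : L^x -> G with kernel the units of O
   and  v x <= v y  <->  y/x in O.  (Any such G is isomorphic to vL.) *)
Definition value_group_map (L : fieldType) (O : L -> Prop) (G : zmodType)
  (le : G -> G -> Prop) (v : L -> G) : Prop :=
  [/\ (forall x y, x != 0 -> y != 0 -> v (x * y) = v x + v y),
      (forall g, exists x, x != 0 /\ v x = g),
      (forall x, x != 0 -> (v x = 0 <-> vunit O x)) &
      (forall x y, x != 0 -> y != 0 -> (le (v x) (v y) <-> O (y / x)))].

Definition residue_map (L : fieldType) (O : L -> Prop) (k : fieldType)
  (res : L -> k) : Prop :=
  [/\ (forall x y, O x -> O y -> res (x + y) = res x + res y),
      (forall x y, O x -> O y -> res (x * y) = res x * res y),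
      res 1 = 1,
      (forall z, exists x, O x /\ res x = z) &
      (forall x, O x -> (res x = 0 <-> vmax O x))].

Definition henselian (K : fieldType) (O : K -> Prop) : Prop :=
  forall (L : fieldType) (j : {rmorphism K -> L}),
    (forall x : L, exists p : {poly K}, p != 0 /\ root (map_poly j p) x) ->
    exists O' : L -> Prop,
      [/\ valuation_ring O', extends j O O' &
          forall O'' : L -> Prop, valuation_ring O'' -> extends j O O'' ->
            forall x, O'' x <-> O' x].

(* For an extension (L',O') of (K,O) along j:
   the index (v'L' : vK) is n, i.e. L'^x / (j(K^x) . O'^x) has n elements *)
Definition ram_index_is (K L : fieldType) (j : K -> L) (O : K -> Prop)
  (O' : L -> Prop) (n : nat) : Prop :=
  exists x : 'I_n -> L,
    [/\ (forall i, x i != 0),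
        (forall y, y != 0 -> exists i a, a != 0 /\ vunit O' (y / (x i * j a))) &
        (forall i i' a, a != 0 -> vunit O' (x i / (x i' * j a)) -> i = i')].

(* the residue degree [L'v' : Kv] is n: residues of y_1..y_n form a basis
   of L'v' over (the image of) Kv *)
Definition res_degree_is (K L : fieldType) (j : K -> L) (O : K -> Prop)
  (O' : L -> Prop) (n : nat) : Prop :=
  exists y : 'I_n -> L,
    [/\ (forall i, O' (y i)),
        (forall z, O' z -> exists a : 'I_n -> K,
            (forall i, O (a i)) /\ vmax O' (z - \sum_i j (a i) * y i)) &
        (forall a : 'I_n -> K, (forall i, O (a i)) ->
            vmax O' (\sum_i j (a i) * y i) -> forall i, vmax O (a i))].

Definition defectless (K : fieldType) (O : K -> Prop) : Prop :=
  forall L' : fieldExtType K,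
    exists (g : nat) (Os : 'I_g -> L' -> Prop) (e f : 'I_g -> nat),
      [/\ (forall i, valuation_ring (Os i) /\ extends (in_alg L') O (Os i)),
          (forall i i', (forall x, Os i x <-> Os i' x) -> i = i'),
          (forall O'' : L' -> Prop, valuation_ring O'' ->
              extends (in_alg L') O O'' ->
              exists i, forall x, O'' x <-> Os i x),
          (forall i, ram_index_is (in_alg L') O (Os i) (e i) /\
                     res_degree_is (in_alg L') O (Os i) (f i)) &
          \dim {: L'} = (\sum_i e i * f i)%N].

Definition alg_indep (R : fieldType) (S : R -> Prop) (n : nat)
  (x : 'I_n -> R) : Prop :=
  forall p : {mpoly R[n]}, p != 0 -> (forall m, S (p@_m)) -> p.@[x] != 0.

Definition trdeg_is (R : fieldType) (S F : R -> Prop) (n : nat) : Prop :=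
  (exists x : 'I_n -> R, (forall i, F (x i)) /\ alg_indep S x) /\
  ~ (exists x : 'I_n.+1 -> R, (forall i, F (x i)) /\ alg_indep S x).

(* dim_Q (Q (x) A/B) = r  for subgroups B subset A of G *)
Definition rat_rank_is (G : zmodType) (B A : G -> Prop) (r : nat) : Prop :=
  (exists a : 'I_r -> G, (forall i, A (a i)) /\
     forall c : 'I_r -> int, B (\sum_i a i *~ c i) -> forall i, c i = 0) /\
  ~ (exists a : 'I_r.+1 -> G, (forall i, A (a i)) /\
     forall c : 'I_r.+1 -> int, B (\sum_i a i *~ c i) -> forall i, c i = 0).

Section TrDefect.
Variables (K L : fieldType) (iota : K -> L) (OK : K -> Prop) (OL : L -> Prop)
  (G : zmodType) (v : L -> G) (k : fieldType) (res : L -> k).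

Definition imK (x : L) : Prop := exists a, x = iota a.
Definition vK_img (g : G) : Prop := exists a, a != 0 /\ v (iota a) = g.
Definition Kv_img (z : k) : Prop := exists a, OK a /\ res (iota a) = z.
Definition vF_img (F : L -> Prop) (g : G) : Prop :=
  exists x, [/\ F x, x != 0 & v x = g].
Definition Fv_img (F : L -> Prop) (z : k) : Prop :=
  exists x, [/\ F x, OL x & res x = z].

Definition intermediate_field (F : L -> Prop) : Prop :=
  [/\ (forall a, F (iota a)),
      (forall x y, F x -> F y -> F (x - y)),
      (forall x y, F x -> F y -> F (x * y)) &
      (forall x, F x -> F x^-1)].

Definition no_td_sub (F : L -> Prop) : Prop :=
  forall n, trdeg_is imK F n ->
    exists r s, [/\ trdeg_is Kv_img (Fv_img F) r,
                    rat_rank_is vK_img (vF_img F) s & n = (r + s)%N].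

Definition without_transcendence_defect : Prop :=
  (no_td_sub (fun _ => True)) /\
  ((forall n, ~ trdeg_is imK (fun _ => True) n) ->
     forall F, intermediate_field F -> no_td_sub F).
End TrDefect.

Inductive rterm (T : Type) : Type :=
| RVar of nat | RConst of T | RZero | ROne
| RAdd of rterm T & rterm T | ROpp of rterm T
| RMul of rterm T & rterm T | RInv of rterm T.

Fixpoint reval (R : fieldType) (e : nat -> R) (t : rterm R) : R :=
  match t with
  | RVar n => e n | RConst c => c | RZero => 0 | ROne => 1
  | RAdd t1 t2 => reval e t1 + reval e t2 | ROpp t1 => - reval e t1
  | RMul t1 t2 => reval e t1 * reval e t2 | RInv t1 => (reval e t1)^-1
  end.

Fixpoint rconsts (T : Type) (S : T -> Prop) (t : rterm T) : Prop :=
  match t with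
  | RConst c => S c
  | RAdd t1 t2 | RMul t1 t2 => rconsts S t1 /\ rconsts S t2
  | ROpp t1 | RInv t1 => rconsts S t1
  | _ => True
  end.

Inductive gterm (T : Type) : Type :=
| GVar of nat | GConst of T | GZero | GAdd of gterm T & gterm T | GOpp of gterm T.

Fixpoint geval (G : zmodType) (e : nat -> G) (t : gterm G) : G :=
  match t with
  | GVar n => e n | GConst c => c | GZero => 0
  | GAdd t1 t2 => geval e t1 + geval e t2 | GOpp t1 => - geval e t1
  end.

Fixpoint gconsts (T : Type) (S : T -> Prop) (t : gterm T) : Prop :=
  match t with
  | GConst c => S c
  | GAdd t1 t2 => gconsts S t1 /\ gconsts S t2
  | GOpp t1 => gconsts S t1
  | _ => True
  end.

Inductive qf (A : Type) : Type :=
| QAtom of A | QTrue | QFalse | QNot of qf A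
| QAnd of qf A & qf A | QOr of qf A & qf A.

Fixpoint qf_holds (A : Type) (I : A -> Prop) (f : qf A) : Prop :=
  match f with
  | QAtom a => I a | QTrue => True | QFalse => False
  | QNot f1 => ~ qf_holds I f1
  | QAnd f1 f2 => qf_holds I f1 /\ qf_holds I f2
  | QOr f1 f2 => qf_holds I f1 \/ qf_holds I f2
  end.

Fixpoint qf_all (A : Type) (P : A -> Prop) (f : qf A) : Prop :=
  match f with
  | QAtom a => P a | QTrue | QFalse => True
  | QNot f1 => qf_all P f1
  | QAnd f1 f2 | QOr f1 f2 => qf_all P f1 /\ qf_all P f2
  end.

Definition ec_in (T A : Type) (S : T -> Prop) (params_in : A -> Prop)
  (sat : (nat -> T) -> A -> Prop) : Prop :=
  forall f : qf A, qf_all params_in f ->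
    (exists e : nat -> T, qf_holds (sat e) f) ->
    exists e : nat -> T, (forall n, S (e n)) /\ qf_holds (sat e) f.

Inductive field_atom (T : Type) : Type := FEq of rterm T & rterm T.
Definition ec_field (k : fieldType) (S : k -> Prop) : Prop :=
  ec_in S (fun a : field_atom k => let: FEq t1 t2 := a in
                                    rconsts S t1 /\ rconsts S t2)
          (fun e a => let: FEq t1 t2 := a in reval e t1 = reval e t2).

Inductive og_atom (T : Type) : Type :=
| OEq of gterm T & gterm T | OLe of gterm T & gterm T.
Definition ec_ordered_group (G : zmodType) (le : G -> G -> Prop)
  (S : G -> Prop) : Prop :=
  ec_in S (fun a : og_atom G => match a with
                                | OEq t1 t2 | OLe t1 t2 =>
                                    gconsts S t1 /\ gconsts S t2 end)
          (fun e a => match a with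
                      | OEq t1 t2 => geval e t1 = geval e t2
                      | OLe t1 t2 => le (geval e t1) (geval e t2) end).

Inductive vf_atom (T : Type) : Type :=
| VEq of rterm T & rterm T | VInO of rterm T.
Definition ec_valued_field (L : fieldType) (O : L -> Prop)
  (S : L -> Prop) : Prop :=
  ec_in S (fun a : vf_atom L => match a with
                                | VEq t1 t2 => rconsts S t1 /\ rconsts S t2
                                | VInO t => rconsts S t end)
          (fun e a => match a with
                      | VEq t1 t2 => reval e t1 = reval e t2
                      | VInO t => O (reval e t) end).

(* Main.v *)
(** It suffices to embed each finitely generated subextension F of L isometrically over K
    into an ultrapower of K. As L has no transcendence defect, F is algebraic over some
    E = K(x, y), where the values of x are independent modulo vK and the residues of y are
    algebraically independent over Kv. Existential closedness of vK and Kv lets one choose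
    x and y such that vF = vE and Fv is separable over Ev, say Fv = Ev(zeta).
      The field E is again defectless with respect to the maximum norm over all embeddings of
    F: after refining the valuation, x and y together have independent values; then best
    approximations from finite-dimensional spaces over the algebraic closure of K exist, so,
    K being henselian and defectless, finite-dimensional K-subspaces of F have orthogonal
    bases. Comparing the dimensions of spaces of polynomials of bounded degree, one finds
    that a maximal E-orthogonal family of F has [F : E] members. Hence F = E(a) for some a
    with residue zeta which is small for the other extensions of the valuation of E; its
    characteristic polynomial is congruent to X^(n-f) times the minimal polynomial of zeta,
    so that zeta is a simple residual root.
      Existential closedness of vK and Kv provides copies of x, y and zeta in an ultrapower
    of K, where Hensel's lemma yields a root of the transferred characteristic polynomial.
    The resulting embedding of F is isometric because a is a unit for only one of the
    valuation rings of F above that of E. *)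
Require Import Defs.
From HB Require Import structures.
From mathcomp Require Import all_boot all_order all_algebra all_field.
From mathcomp Require Import mpoly.
From mathcomp Require Import ring zify.
From mathcomp Require filter.
From mathcomp Require Import boolp classical_sets.
Set Implicit Arguments. Unset Strict Implicit. Unset Printing Implicit Defensive.
Import GRing.Theory.
Local Open Scope ring_scope.

(** * Valuation rings as predicates *)

(** The obstacle is that E need not be henselian: F may carry several valuations above that of E,
    and the hypotheses on K speak only of algebraic extensions of K. The refinement turns the
    leading part of a polynomial in x and y into a single monomial, so that norms determine
    exponents; orthogonality survives the return to the coarser ring, since it consists of weak
    inequalities. The count compares growth rates in m: polynomials of degree at most m in each of d
    variables, times a basis of F, give [F : E](m+1)^d vectors independent over K, whereas a maximal
    orthogonal family of r members accounts for at most r(m+c)^d of them up to smaller norm, with c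
    independent of m. That a generates F is not proved by a degree argument: for the characteristic
    polynomial P of a, every product P'(a)u is a polynomial in a, and P'(a) is a unit. The
    ultrapower plays the part of a saturated extension: a finite set of conditions on values or on
    residues is one existential sentence. *)

(* [vle O x y] is |x| <= |y| in multiplicative notation, i.e. v x >= v y. *)
Definition vle (R : fieldType) (O : R -> Prop) (x y : R) : Prop :=
  exists2 o, O o & x = o * y.
Definition vlt (R : fieldType) (O : R -> Prop) (x y : R) : Prop := ~ vle O y x.
Definition veq (R : fieldType) (O : R -> Prop) (x y : R) : Prop :=
  vle O x y /\ vle O y x.

Section Val.
Variables (R : fieldType) (O : R -> Prop).
Hypothesis vO : valuation_ring O.
Local Notation "x <=| y" := (vle O x y) (at level 70).
Local Notation "x <| y" := (vlt O x y) (at level 70).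
Local Notation "x =| y" := (veq O x y) (at level 70).

Lemma vr1 : O 1. Proof. by case: vO. Qed.
Lemma vrB x y : O x -> O y -> O (x - y). Proof. by case: vO => _ h _ _; apply: h. Qed.
Lemma vrM x y : O x -> O y -> O (x * y). Proof. by case: vO => _ _ h _; apply: h. Qed.
Lemma vr0 : O 0. Proof. by rewrite -(subrr 1); apply: vrB; apply: vr1. Qed.
Lemma vrN x : O x -> O (- x).
Proof. by move=> Ox; rewrite -sub0r; apply: vrB => //; apply: vr0. Qed.
Lemma vrD x y : O x -> O y -> O (x + y).
Proof. by move=> Ox Oy; rewrite -[y]opprK; apply: vrB => //; apply: vrN. Qed.
Lemma vrX x n : O x -> O (x ^+ n).
Proof. by move=> Ox; elim: n => [|n IH]; rewrite ?expr0 ?exprS; [exact: vr1|exact: vrM]. Qed.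
Lemma vr_sum (I : Type) (r : seq I) (P : pred I) (F : I -> R) :
  (forall i, P i -> O (F i)) -> O (\sum_(i <- r | P i) F i).
Proof. by move=> h; apply: big_ind => //; [exact: vr0|exact: vrD]. Qed.
Lemma vr_prod (I : Type) (r : seq I) (P : pred I) (F : I -> R) :
  (forall i, P i -> O (F i)) -> O (\prod_(i <- r | P i) F i).
Proof. by move=> h; apply: big_ind => //; [exact: vr1|exact: vrM]. Qed.
Lemma vr_total x : x != 0 -> O x \/ O x^-1.
Proof. by case: vO => _ _ _; apply. Qed.

Lemma vle1 x : x <=| 1 <-> O x.
Proof. by split=> [[o Oo ->]|Ox]; [rewrite mulr1|exists x; rewrite ?mulr1]. Qed.
Lemma vleP x y : y != 0 -> x <=| y <-> O (x / y).
Proof.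
move=> y0; split=> [[o Oo ->]|h]; first by rewrite mulfK.
by exists (x / y); rewrite ?divfK.
Qed.
Lemma vle_refl x : x <=| x. Proof. by exists 1; rewrite ?mul1r //; apply: vr1. Qed.
Lemma vle_trans y x z : x <=| y -> y <=| z -> x <=| z.
Proof. by case=> o Oo -> [p Op ->]; exists (o * p); rewrite ?mulrA //; apply: vrM. Qed.
Lemma vle0 y : 0 <=| y. Proof. by exists 0; rewrite ?mul0r //; apply: vr0. Qed.
Lemma vle_0 x : x <=| 0 -> x = 0. Proof. by case=> o _ ->; rewrite mulr0. Qed.
Lemma vle_total x y : x <=| y \/ y <=| x.
Proof.
have [->|x0] := eqVneq x 0; first by left; exact: vle0.
have [->|y0] := eqVneq y 0; first by right; exact: vle0.
case: (@vr_total (x / y)); first by rewrite mulf_neq0 ?invr_eq0.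
  by left; apply/vleP.
by right; apply/vleP => //; rewrite -invf_div.
Qed.
Lemma vleD x y z : x <=| z -> y <=| z -> x + y <=| z.
Proof. by case=> o Oo -> [p Op ->]; exists (o + p); rewrite ?mulrDl //; apply: vrD. Qed.
Lemma vleN x z : x <=| z -> - x <=| z.
Proof. by case=> o Oo ->; exists (- o); rewrite ?mulNr //; apply: vrN. Qed.
Lemma vleNr x z : x <=| z -> x <=| - z.
Proof. by case=> o Oo ->; exists (- o); rewrite ?mulrNN //; apply: vrN. Qed.
Lemma vleB x y z : x <=| z -> y <=| z -> x - y <=| z.
Proof. by move=> ? ?; apply: vleD => //; apply: vleN. Qed.
Lemma vle_sum (I : Type) (r : seq I) (P : pred I) (F : I -> R) z :
  (forall i, P i -> F i <=| z) -> \sum_(i <- r | P i) F i <=| z.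
Proof. by move=> h; apply: (big_ind (fun x => x <=| z)) => // [|x y ? ?]; [exact: vle0|exact: vleD]. Qed.
Lemma vleM x y x' y' : x <=| y -> x' <=| y' -> x * x' <=| y * y'.
Proof. by case=> o Oo -> [p Op ->]; exists (o * p); [exact: vrM|rewrite mulrACA]. Qed.
Lemma vleM2l z x y : x <=| y -> z * x <=| z * y.
Proof. by move=> h; apply: vleM => //; apply: vle_refl. Qed.
Lemma vleM2r z x y : x <=| y -> x * z <=| y * z.
Proof. by move=> h; apply: vleM => //; apply: vle_refl. Qed.
Lemma vleM2lE z x y : z != 0 -> z * x <=| z * y <-> x <=| y.
Proof.
move=> z0; split; last exact: vleM2l.
by case=> o Oo; rewrite mulrCA => /(mulfI z0) ->; exists o.
Qed.
Lemma vleM2rE z x y : z != 0 -> x * z <=| y * z <-> x <=| y.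
Proof. by move=> z0; rewrite ![_ * z]mulrC; apply: vleM2lE. Qed.
Lemma vleX n x y : x <=| y -> x ^+ n <=| y ^+ n.
Proof. by case=> o Oo ->; exists (o ^+ n); [exact: vrX|rewrite exprMn]. Qed.

Lemma vltW x y : x <| y -> x <=| y.
Proof. by move=> h; case: (vle_total x y) => // /h. Qed.
Lemma vlt_irr x : ~ x <| x. Proof. by apply; apply: vle_refl. Qed.
Lemma vle_lt_trans y x z : x <=| y -> y <| z -> x <| z.
Proof. by move=> h1 h2 h3; apply: h2; apply: vle_trans h3 h1. Qed.
Lemma vlt_le_trans y x z : x <| y -> y <=| z -> x <| z.
Proof. by move=> h1 h2 h3; apply: h1; apply: vle_trans h2 h3. Qed.
Lemma vleVlt x y : x <=| y \/ y <| x.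
Proof. by case: (EM (x <=| y)); [left|right]. Qed.
Lemma vlt0 x : 0 <| x <-> x != 0.
Proof. by split=> [h|/eqP h /vle_0 //]; apply/eqP => x0; apply: h; rewrite x0; apply: vle0. Qed.
Lemma vlt_neq0 x y : x <| y -> y != 0.
Proof. by move=> h; apply/eqP => y0; apply: h; rewrite y0; apply: vle0. Qed.
Lemma vltN x y : x <| y -> - x <| y.
Proof. by move=> h1 /vleNr; rewrite opprK. Qed.
Lemma vltD x y z : x <| z -> y <| z -> x + y <| z.
Proof.
move=> h1 h2; case: (vle_total x y) => h.
  by apply: vle_lt_trans h2; apply: vleD => //; apply: vle_refl.
by apply: vle_lt_trans h1; apply: vleD => //; apply: vle_refl.
Qed.
Lemma vltB x y z : x <| z -> y <| z -> x - y <| z.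
Proof. by move=> ? ?; apply: vltD => //; apply: vltN. Qed.
Lemma vlt_sum (I : Type) (r : seq I) (P : pred I) (F : I -> R) z :
  z != 0 -> (forall i, P i -> F i <| z) -> \sum_(i <- r | P i) F i <| z.
Proof. by move=> z0 h; apply: (big_ind (fun x => x <| z)) => // [|x y ? ?]; [apply/vlt0|exact: vltD]. Qed.
Lemma vltM2lE z x y : z != 0 -> z * x <| z * y <-> x <| y.
Proof. by move=> z0; split=> h1 h2; apply: h1; [apply: vleM2l|move/(vleM2lE _ _ z0): h2]. Qed.
Lemma vltM2rE z x y : z != 0 -> x * z <| y * z <-> x <| y.
Proof. by move=> z0; split=> h1 h2; apply: h1; [apply: vleM2r|move/(vleM2rE _ _ z0): h2]. Qed.
Lemma vlt_leM x y x' y' : x <| y -> x' <=| y' -> y' != 0 -> x * x' <| y * y'.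
Proof.
move=> h1 h2 y0; apply: (@vle_lt_trans (x * y')); first exact: vleM2l.
exact/vltM2rE.
Qed.
Lemma vltM x y x' y' : x <| y -> x' <| y' -> x * x' <| y * y'.
Proof. by move=> h1 h2; apply: vlt_leM h1 (vltW h2) (vlt_neq0 h2). Qed.
Lemma vltX n x y : x <| y -> x ^+ n.+1 <| y ^+ n.+1.
Proof. by move=> h; elim: n => [|n IH]; rewrite ?expr1 // ![_ ^+ n.+2]exprS; apply: vltM. Qed.
Lemma vleXE n x y : (0 < n)%N -> x ^+ n <=| y ^+ n <-> x <=| y.
Proof.
case: n => // n _; split; last exact: vleX.
by case: (vleVlt x y) => // h /(vltX h).
Qed.
Lemma vleV x y : x != 0 -> x <=| y -> y^-1 <=| x^-1.
Proof.
move=> x0 h; have y0 : y != 0.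
  by apply: contraNneq x0 => y0; move: h; rewrite y0 => /vle_0 ->.
by apply/(@vleM2lE (x * y)); rewrite ?mulf_neq0 // mulfK // mulrC mulKf.
Qed.

Lemma veq_refl x : x =| x. Proof. by split; apply: vle_refl. Qed.
Lemma veq_sym x y : x =| y -> y =| x. Proof. by case. Qed.
Lemma veq_trans y x z : x =| y -> y =| z -> x =| z.
Proof. by move=> [h1 h2] [h3 h4]; split; [exact: vle_trans h3|exact: vle_trans h2]. Qed.
Lemma veqM x y x' y' : x =| y -> x' =| y' -> x * x' =| y * y'.
Proof. by move=> [h1 h2] [h3 h4]; split; apply: vleM. Qed.
Lemma veqX n x y : x =| y -> x ^+ n =| y ^+ n.
Proof. by move=> [h1 h2]; split; apply: vleX. Qed.
Lemma veqXE n x y : (0 < n)%N -> x ^+ n =| y ^+ n <-> x =| y.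
Proof. by move=> n0; split=> -[h1 h2]; split; apply/(vleXE _ _ n0). Qed.
Lemma veq_neq0 x y : x =| y -> x != 0 -> y != 0.
Proof. by move=> [h _]; apply: contraNneq => y0; move: h; rewrite y0 => /vle_0 ->. Qed.
Lemma veqV x y : x =| y -> x^-1 =| y^-1.
Proof.
move=> h; have [x0|x0] := eqVneq x 0.
  by move: h; rewrite x0 => -[_ /vle_0 ->]; apply: veq_refl.
by have y0 := veq_neq0 h x0; case: h => h1 h2; split; apply: vleV.
Qed.
Lemma veqM2lE z x y : z != 0 -> z * x =| z * y <-> x =| y.
Proof. by move=> z0; split=> -[h1 h2]; split; apply/(vleM2lE _ _ z0). Qed.
Lemma veqM2rE z x y : z != 0 -> x * z =| y * z <-> x =| y.
Proof. by move=> z0; rewrite ![_ * z]mulrC; apply: veqM2lE. Qed.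
Lemma veqN x : - x =| x.
Proof. by split; [apply: vleN|apply: vleNr]; apply: vle_refl. Qed.
Lemma veq_addl x y : y <| x -> x + y =| x.
Proof.
move=> h; split; first by apply: vleD; [exact: vle_refl|exact: vltW].
case: (vleVlt x (x + y)) => // h2; exfalso; apply: (@vlt_irr x).
by rewrite -{1}[x](addrK y); apply: vltB.
Qed.
Lemma veq_close x y : x - y <| y -> x =| y.
Proof. by move=> h; rewrite -[x](subrK y) addrC; apply: veq_addl. Qed.
Lemma vlt_veqr x y z : x <| y -> y =| z -> x <| z.
Proof. by move=> h [h1 _]; apply: vlt_le_trans h1. Qed.
Lemma vlt_veql x y z : x =| y -> y <| z -> x <| z.
Proof. by case=> h1 _; apply: vle_lt_trans. Qed.
Lemma vmaxP x : vmax O x <-> x <| 1.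
Proof.
rewrite /vmax /vunit /vlt /vle; split=> [[Ox nu] [o Oo e]|h].
  apply: nu; have x0 : x != 0.
    by apply/eqP => x0; move: e; rewrite x0 mulr0 => /eqP; rewrite oner_eq0.
  split=> //; suff -> : x^-1 = o by [].
  by rewrite -[o](mulfK x0) -e mul1r.
split; last by case=> x0 _ Ov; apply: h; exists x^-1; rewrite ?mulVf.
have [->|x0] := eqVneq x 0; first exact: vr0.
by case: (vr_total x0) => // Ov; case: h; exists x^-1; rewrite ?mulVf.
Qed.
Lemma vunitP x : vunit O x <-> x =| 1.
Proof.
split=> [[x0 Ox Ov]|[/vle1 Ox h]].
  by split; [apply/vle1|exists x^-1; rewrite ?mulVf].
have x0 : x != 0 by apply/eqP => x0; move: h; rewrite x0 => /vle_0/eqP; rewrite oner_eq0.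
by split=> //; move/vleP: h => /(_ x0); rewrite div1r.
Qed.

Lemma vmax_exists (I : finType) (P : pred I) (F : I -> R) i0 :
  P i0 -> exists2 i, P i & forall j, P j -> F j <=| F i.
Proof.
move=> Pi0; have: exists s : seq I, s =i P.
  by exists (enum P) => i; rewrite mem_enum.
case=> s Es; suff: forall s' : seq I, (forall i, i \in s' -> P i) -> s' != [::] ->
    exists2 i, P i & forall j, j \in s' -> F j <=| F i.
  case/(_ s) => [i||i Pi h].
  - by rewrite Es.
  - by apply/eqP => s0; have := Es i0; rewrite s0 in_nil -topredE /= Pi0.
  - by exists i => // j Pj; apply: h; rewrite Es.
elim=> [//|i [|i' s'] IH] hP _.
  by exists i; [apply: hP; rewrite inE|move=> j; rewrite inE => /eqP ->; exact: vle_refl].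
case: IH => // [j js|k Pk hk]; first by apply: hP; rewrite inE js orbT.
case: (vle_total (F i) (F k)) => h.
  by exists k => // j; rewrite inE => /orP[/eqP -> //|]; apply: hk.
exists i; first by apply: hP; rewrite inE eqxx.
move=> j; rewrite inE => /orP[/eqP ->|/hk hj]; first exact: vle_refl.
exact: vle_trans hj h.
Qed.

Lemma vle_sum_max (I : finType) (P : pred I) (F : I -> R) :
  \sum_(i | P i) F i != 0 -> exists2 i, P i & \sum_(i | P i) F i <=| F i.
Proof.
move=> s0; have [i0 Pi0] : exists i, P i.
  apply: contrapT => h; move/eqP: s0; apply; rewrite big1 // => i Pi.
  by case: h; exists i.
by case: (vmax_exists F Pi0) => i Pi h; exists i => //; apply: vle_sum.
Qed.

(* The strictly largest term of a sum dominates it. *)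
Lemma veq_sum_dom (I : finType) (P : pred I) (F : I -> R) i :
  P i -> F i != 0 -> (forall j, P j -> j != i -> F j <| F i) ->
  \sum_(j | P j) F j - F i <| F i.
Proof.
move=> Pi Fi h; rewrite (bigD1 i) //= addrAC subrr add0r.
by apply: vlt_sum => // j /andP[Pj ji]; apply: h.
Qed.

(** If the maximum were attained only once, that term would dominate the sum, which is zero. Applied
    to an algebraic equation this yields a slope of its Newton polygon. *)
Lemma sum0_two_max (I : finType) (F : I -> R) i0 :
  \sum_i F i = 0 -> F i0 != 0 ->
  exists i j, [/\ i != j, F i != 0 & F i =| F j].
Proof.
move=> s0 F0; have [i _ hi] := @vmax_exists I xpredT F i0 isT.
have Fi : F i != 0 by apply/vlt0; apply: vlt_le_trans (hi i0 isT); apply/vlt0.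
apply: contrapT => h; have := @veq_sum_dom I xpredT F i isT Fi.
rewrite s0 sub0r => H; apply: (@vlt_irr (F i)); apply: (vlt_veql (y := - F i)).
  exact/veq_sym/veqN.
apply: H => j _ ji hj; apply: h; exists i, j; rewrite eq_sym ji; split=> //; split=> //.
exact: hi.
Qed.

End Val.

(** * Subfields as predicates *)

(** Subfields of one large field are predicates, so that K, E, F and their relative algebraic
    closures are compared by mere implication. They become field types [sft] only where matrices or
    finite extensions need a base field. *)
Definition is_subfield (R : fieldType) (S : R -> Prop) : Prop :=
  [/\ S 1, (forall x y, S x -> S y -> S (x - y)),
      (forall x y, S x -> S y -> S (x * y)) & (forall x, S x -> S x^-1)].

Section SubfieldType.
Variables (R : fieldType) (S : R -> Prop) (hS : is_subfield S).

(* The closure proof is a phantom parameter, so that the algebraic instances can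
   be inferred from the type. *)
Definition sf_pred of is_subfield S : {pred R} := fun x => `[< S x >].

Lemma sf_divring : divring_closed (sf_pred hS).
Proof.
case: (hS) => S1 SB SM SV; split=> [|x y|x y]; first exact/asboolP.
  by move=> /asboolP ? /asboolP ?; apply/asboolP; apply: SB.
by move=> /asboolP ? /asboolP ?; apply/asboolP; apply: SM => //; apply: SV.
Qed.

HB.instance Definition _ := GRing.isDivringClosed.Build R (sf_pred hS) sf_divring.

Record sft (h : is_subfield S) := Sft {sfv : R; _ : sfv \in sf_pred h}.
HB.instance Definition _ := [isSub for @sfv hS].
HB.instance Definition _ := [Choice of sft hS by <:].
HB.instance Definition _ := [SubChoice_isSubIntegralDomain of sft hS by <:].
HB.instance Definition _ := [SubIntegralDomain_isSubField of sft hS by <:].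

Lemma sfvP (x : sft hS) : S (val x). Proof. by case: x => x /= /asboolP. Qed.
Lemma sfv_ex x : S x -> exists y : sft hS, val y = x.
Proof. by move=> Sx; exists (@Sft hS x (introT (asboolP _) Sx)). Qed.

Lemma sf1 : S 1. Proof. by case: hS. Qed.
Lemma sfB x y : S x -> S y -> S (x - y). Proof. by case: hS => _ h _ _; apply: h. Qed.
Lemma sfM x y : S x -> S y -> S (x * y). Proof. by case: hS => _ _ h _; apply: h. Qed.
Lemma sfV x : S x -> S x^-1. Proof. by case: hS => _ _ _ h; apply: h. Qed.
Lemma sf0 : S 0. Proof. by rewrite -(subrr 1); apply: sfB; apply: sf1. Qed.
Lemma sfN x : S x -> S (- x). Proof. by rewrite -sub0r; apply: sfB sf0. Qed.
Lemma sfD x y : S x -> S y -> S (x + y).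
Proof. by move=> Sx Sy; rewrite -[y]opprK; apply: sfB => //; apply: sfN. Qed.
Lemma sf_div x y : S x -> S y -> S (x / y).
Proof. by move=> ? ?; apply: sfM => //; apply: sfV. Qed.
Lemma sfX x n : S x -> S (x ^+ n).
Proof. by move=> Sx; elim: n => [|n IH]; rewrite ?expr0 ?exprS; [exact: sf1|exact: sfM]. Qed.
Lemma sf_sum (I : Type) (r : seq I) (P : pred I) (F : I -> R) :
  (forall i, P i -> S (F i)) -> S (\sum_(i <- r | P i) F i).
Proof. by move=> h; apply: (big_ind S) => //; [exact: sf0|exact: sfD]. Qed.
Lemma sf_prod (I : Type) (r : seq I) (P : pred I) (F : I -> R) :
  (forall i, P i -> S (F i)) -> S (\prod_(i <- r | P i) F i).
Proof. by move=> h; apply: (big_ind S) => //; [exact: sf1|exact: sfM]. Qed.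

Lemma sf_horner (p : {poly R}) x : (forall i, S p`_i) -> S x -> S p.[x].
Proof.
by move=> hp Sx; rewrite horner_coef; apply: sf_sum => i _; apply: sfM => //; apply: sfX.
Qed.

Lemma sf_poly (p : {poly R}) : (forall i, S p`_i) ->
  exists q : {poly sft hS}, map_poly (val : sft hS -> R) q = p.
Proof.
move=> hp; exists (\poly_(i < size p) sval (cid (sfv_ex (hp i)))).
apply/polyP => i; rewrite coef_map_id0 //= coef_poly.
by case: ltnP => h /=; [case: (cid _)|rewrite nth_default].
Qed.

End SubfieldType.

(** * Elements algebraic over a subfield *)

Definition alg (R : fieldType) (S : R -> Prop) (x : R) : Prop :=
  exists p : {poly R}, [/\ p != 0, forall i, S p`_i & root p x].

Section Algebraic.
Variables (R : fieldType).
Implicit Types (S : R -> Prop) (x y : R).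

Lemma algE S (hS : is_subfield S) x :
  alg S x <-> algebraicOver (val : sft hS -> R) x.
Proof.
split=> [[p [p0 hp px]]|[q q0 qx]].
  have [q Eq] := sf_poly hS hp; exists q; last by rewrite Eq.
  by apply: contraNneq p0 => q0; rewrite -Eq q0 rmorph0.
exists (map_poly (val : sft hS -> R) q); split=> //.
  by rewrite map_poly_eq0.
by move=> i; rewrite coef_map_id0 //=; apply: sfvP.
Qed.

Lemma alg_incl S x : is_subfield S -> S x -> alg S x.
Proof.
move=> hS Sx; exists ('X - x%:P); split; rewrite ?polyXsubC_eq0 ?root_XsubC //.
move=> i; rewrite coefB coefX coefC; case: i => [|[|i]] /=;
  rewrite ?(subr0, sub0r).
- exact: (sfN hS).
- exact: (sf1 hS).
- exact: (sf0 hS).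
Qed.

Lemma alg_mono S S' x : (forall y, S y -> S' y) -> alg S x -> alg S' x.
Proof. by move=> h [p [p0 hp px]]; exists p; split=> // i; apply: h. Qed.

Lemma alg_subfield S : is_subfield S -> is_subfield (alg S).
Proof.
move=> hS; split=> [|x y|x y|x].
- by apply: alg_incl => //; apply: sf1.
- by rewrite !(algE hS); apply: algebraic_sub.
- by rewrite !(algE hS); apply: algebraic_mul.
- by rewrite !(algE hS); apply: algebraic_inv.
Qed.

Lemma alg_alg S x : is_subfield S -> alg (alg S) x -> alg S x.
Proof.
move=> hS [p [p0 hp px]]; apply/(algE hS)/integral_algebraic.
apply: (integral_root p0 px) => _ /(nthP 0)[i _ <-].
exact/integral_algebraic/algE.
Qed.

Definition alg_closed := forall p : {poly R}, size p != 1 -> exists x, root p x.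

Lemma alg_closed_split (p : {poly R}) : alg_closed ->
  exists rs : seq R, p = lead_coef p *: \prod_(r <- rs) ('X - r%:P).
Proof.
move=> cl; have [n] := ubnP (size p); elim: n p => // n IH p; rewrite ltnS => hp.
have [p1|p1] := eqVneq (size p) 1.
  exists [::]; rewrite big_nil alg_polyC; case/eqP/size_poly1P: p1 => c c0 ->.
  by rewrite lead_coefC.
have [p0|p0] := eqVneq p 0; first by exists [::]; rewrite p0 lead_coef0 scale0r.
have [x /factor_theorem [q Eq]] := cl p p1.
have q0 : q != 0 by apply: contraNneq p0 => q0; rewrite Eq q0 mul0r.
have [|rs Ers] := IH q; first by rewrite Eq size_Mmonic ?monicXsubC // size_XsubC addn2 in hp.
exists (x :: rs); rewrite big_cons Eq lead_coefM lead_coefXsubC mulr1 {1}Ers.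
by rewrite -scalerAl mulrC.
Qed.

Lemma alg_roots S (p : {poly R}) rs : is_subfield S -> p != 0 ->
  (forall i, alg S p`_i) -> p = lead_coef p *: \prod_(r <- rs) ('X - r%:P) ->
  forall r, r \in rs -> alg S r.
Proof.
move=> hS p0 hp Ep r rrs; apply: alg_alg => //; exists p; split=> //.
by rewrite Ep rootZ ?lead_coef_eq0 // root_prod_XsubC.
Qed.

End Algebraic.

(** * The field generated by a subfield and a finite family *)

Section RationalFunctions.
Variables (R : fieldType) (S : R -> Prop) (d : nat) (T : 'I_d -> R).
Hypothesis hS : is_subfield S.

Definition polyT (x : R) : Prop :=
  exists p : {mpoly R[d]}, (forall m, S p@_m) /\ x = p.@[T].
(** The field S(T). It is made of fractions of values of polynomials, so that nothing is presupposed
    about the independence of T. *)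
Definition ratT (x : R) : Prop :=
  exists a b, [/\ polyT a, polyT b, b != 0 & x = a / b].

Lemma polyT_const x : S x -> polyT x.
Proof.
move=> Sx; exists x%:MP; split; last by rewrite mevalC.
by move=> m; rewrite mcoeffC; case: eqP => _; rewrite ?mulr1 ?mulr0 //; apply: sf0.
Qed.
Lemma polyT_var i : polyT (T i).
Proof.
exists 'X_i; split; last by rewrite mevalXU.
by move=> m; rewrite mcoeffX; case: eqP => _ /=; [exact: sf1|exact: sf0].
Qed.
Lemma mcoefB (p q : {mpoly R[d]}) : (forall m, S p@_m) -> (forall m, S q@_m) ->
  forall m, S (p - q)@_m.
Proof. by move=> hp hq m; rewrite mcoeffB; apply: sfB. Qed.
Lemma mcoefD (p q : {mpoly R[d]}) : (forall m, S p@_m) -> (forall m, S q@_m) ->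
  forall m, S (p + q)@_m.
Proof. by move=> hp hq m; rewrite mcoeffD; apply: sfD. Qed.
Lemma mcoefM (p q : {mpoly R[d]}) : (forall m, S p@_m) -> (forall m, S q@_m) ->
  forall m, S (p * q)@_m.
Proof. by move=> hp hq m; rewrite mcoeffM; apply: sf_sum => // i _; apply: sfM. Qed.
Lemma polyTB x y : polyT x -> polyT y -> polyT (x - y).
Proof.
by move=> [p [hp ->]] [q [hq ->]]; exists (p - q); split; [exact: mcoefB|rewrite mevalB].
Qed.
Lemma polyTM x y : polyT x -> polyT y -> polyT (x * y).
Proof.
by move=> [p [hp ->]] [q [hq ->]]; exists (p * q); split; [exact: mcoefM|rewrite mevalM].
Qed.

Lemma ratT_poly x : polyT x -> ratT x.
Proof.
move=> h; exists x, 1; rewrite divr1 oner_neq0; split=> //.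
by apply: polyT_const; apply: sf1.
Qed.
Lemma ratT_const x : S x -> ratT x. Proof. by move/polyT_const/ratT_poly. Qed.
Lemma ratT_var i : ratT (T i). Proof. exact/ratT_poly/polyT_var. Qed.

Lemma ratT_subfield : is_subfield ratT.
Proof.
split=> [|x y|x y|x].
- by apply: ratT_const; apply: sf1.
- move=> [a [b [ha hb b0 ->]]] [a' [b' [ha' hb' b'0 ->]]].
  exists (a * b' - a' * b), (b * b'); rewrite mulf_neq0 //; split=> //; last first.
  + by field; rewrite b0 b'0.
  + exact: polyTM.
  + by apply: polyTB; apply: polyTM.
- move=> [a [b [ha hb b0 ->]]] [a' [b' [ha' hb' b'0 ->]]].
  exists (a * a'), (b * b'); rewrite mulf_neq0 // mulf_div; split=> //; exact: polyTM.
- move=> [a [b [ha hb b0 ->]]]; have [a0|a0] := eqVneq a 0.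
    by rewrite a0 mul0r invr0; apply: ratT_const; apply: sf0.
  by exists b, a; rewrite invf_div; split.
Qed.

Lemma ratT_min (P : R -> Prop) : is_subfield P -> (forall x, S x -> P x) ->
  (forall i, P (T i)) -> forall x, ratT x -> P x.
Proof.
move=> hP SP PT x; have h y : polyT y -> P y.
  case=> p [hp ->]; rewrite mevalE; apply: sf_sum => // m _; apply: sfM => //.
    exact: SP.
  by apply: sf_prod => // i _; apply: sfX.
by move=> [a [b [/h ha /h hb _ ->]]]; apply: sf_div.
Qed.

End RationalFunctions.

(** * Ultraproducts of fields *)

Definition ultra (J : Type) (U : (J -> Prop) -> Prop) : Prop :=
  [/\ (forall A B : J -> Prop, U A -> (forall j, A j -> B j) -> U B),
      (forall A B : J -> Prop, U A -> U B -> U (fun j => A j /\ B j)),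
      ~ U (fun _ => False) & forall A : J -> Prop, U A \/ U (fun j => ~ A j)].

(** Directedness makes the sets [B i] a filter base, and the ultrafilter lemma does the rest. Every
    ultrafilter of the development is obtained here, whether the base consists of finite lists of
    polynomials, of ever better approximations, or of finite sets of conditions to be realized. *)
Lemma ultra_exists (I J : Type) (B : I -> J -> Prop) (i0 : I) :
  (forall i i', exists k, forall j, B k j -> B i j /\ B i' j) ->
  (forall i, exists j, B i j) ->
  exists U, ultra U /\ forall i, U (B i).
Proof.
move=> dir ne; pose F : set_system J := fun A => exists i, forall j, B i j -> A j.
have pF : filter.ProperFilter F.
  split; first by case=> i h; case: (ne i) => j /h.
  split=> [|A A' [i h] [i' h']|A A' sAA' [i h]]; first by exists i0.
    by case: (dir i i') => k hk; exists k => j /hk [/h ? /h' ?].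
  by exists i => j /h /sAA'.
case: (filter.ultraFilterLemma pF) => G [uG FG]; exists G; split; last first.
  by move=> i; apply: FG; exists i.
have [pG _] := uG; have [ne0 [gT gI gS]] := pG.
split=> [A A' GA sAA'|A A' GA GA'||A].
- exact: gS sAA' GA.
- exact: gI.
- exact: ne0.
- exact: filter.in_ultra_setVsetC.
Qed.

Section Ultraproduct.
Variables (J : Type) (U : (J -> Prop) -> Prop) (hU : ultra U).
Variable (M : J -> fieldType).
Local Notation fam := (forall j, M j).
Implicit Types f g : fam.

Lemma uS (A B : J -> Prop) : U A -> (forall j, A j -> B j) -> U B.
Proof. by case: hU => h _ _ _; apply: h. Qed.
Lemma uI (A B C : J -> Prop) : U A -> U B -> (forall j, A j -> B j -> C j) -> U C.
Proof.
by case: hU => h1 h2 _ _ UA UB h; apply: h1 (h2 _ _ UA UB) _ => j []; apply: h.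
Qed.
Lemma uN (A : J -> Prop) : U (fun j => ~ A j) <-> ~ U A.
Proof.
split=> [h h'|]; last by case: hU => _ _ _ /(_ A) [].
by case: hU => _ _ + _; apply; apply: (uI h h').
Qed.
Lemma uT (A : J -> Prop) : (forall j, A j) -> U A.
Proof.
move=> h; apply: contrapT => /uN nA; case: hU => h1 _ h3 _; apply: h3.
by apply: h1 nA _ => j; apply; apply: h.
Qed.
Lemma uE (A : J -> Prop) : U A -> exists j, A j.
Proof.
move=> UA; apply: contrapT => h; case: hU => h1 _ + _; apply; apply: h1 UA _ => j Aj.
by apply: h; exists j.
Qed.
Lemma uOr (A B : J -> Prop) : U (fun j => A j \/ B j) -> U A \/ U B.
Proof.
move=> h; case: (EM (U A)) => [|/uN nA]; [by left|right].
by apply: (uI h nA) => j [].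
Qed.
Lemma u_all (I : finType) (P : pred I) (A : I -> J -> Prop) :
  (forall i, P i -> U (A i)) -> U (fun j => forall i, P i -> A i j).
Proof.
move=> h; suff: forall s : seq I, U (fun j => forall i, i \in s -> P i -> A i j).
  by move/(_ (enum I)) => H; apply: (uS H) => j + i; apply; rewrite mem_enum.
elim=> [|i s IH]; first by apply: uT => j i; rewrite in_nil.
have Hi : U (fun j => P i -> A i j).
  by case Pi: (P i); [apply: (uS (h i Pi)) => j + _|apply: uT].
by apply: (uI IH Hi) => j h1 h2 k; rewrite inE => /orP[/eqP ->|]; [exact: h2|exact: h1].
Qed.

Definition ueq f g : Prop := U (fun j => f j = g j).
Lemma ueq_refl f : ueq f f. Proof. exact: uT. Qed.
Definition upick (P : fam -> Prop) (h : exists f, P f) : fam := sval (cid h).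
Lemma upick_eq P Q (p : exists f, P f) (q : exists f, Q f) : P = Q -> upick p = upick q.
Proof. by move=> E; move: p q; rewrite E => p q; congr upick; apply: Prop_irrelevance. Qed.
(** Equivalent families define the same predicate [ueq f], up to extensionality, so the choice
    returns the same representative. The quotient is thus the type of fixed points of [urep]. *)
Definition urep f : fam := upick (ex_intro (ueq f) f (ueq_refl f)).
Lemma urepP f : ueq f (urep f). Proof. by rewrite /urep /upick; case: (cid _). Qed.
Lemma urep_eq f g : ueq f g -> urep f = urep g.
Proof.
move=> h; have E : ueq f = ueq g.
  apply/funext => k; apply/propext; split=> h'; first by apply: (uI h h') => j -> .
  by apply: (uI h h') => j ->.
exact: upick_eq.
Qed.

Record uprod := UProd {ufun : fam; _ : urep ufun = ufun}.
HB.instance Definition _ := gen_eqMixin uprod.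
HB.instance Definition _ := gen_choiceMixin uprod.

Lemma urepK f : urep (urep f) = urep f.
Proof. by apply/esym/urep_eq/urepP. Qed.
Definition umk f : uprod := @UProd (urep f) (urepK f).
Lemma umkP f g : umk f = umk g <-> U (fun j => f j = g j).
Proof.
split=> [[E]|h]; last first.
  rewrite /umk; move: (urepK f) (urepK g); rewrite (urep_eq h) => p q.
  by congr UProd; apply: Prop_irrelevance.
by move: (urepP f) (urepP g); rewrite /ueq E => h1 h2; apply: (uI h1 h2) => j -> ->.
Qed.
Lemma ufunK x : umk (ufun x) = x.
Proof.
case: x => f Ef /=; rewrite /umk; move: (urepK f); rewrite Ef => p.
by congr UProd; apply: Prop_irrelevance.
Qed.
Lemma umkK f : U (fun j => ufun (umk f) j = f j).
Proof. by apply/umkP; rewrite ufunK. Qed.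

Definition uzero := umk (fun j => 0).
Definition uone := umk (fun j => 1).
Definition uopp (x : uprod) := umk (fun j => - ufun x j).
Definition uadd (x y : uprod) := umk (fun j => ufun x j + ufun y j).
Definition umul (x y : uprod) := umk (fun j => ufun x j * ufun y j).
Definition uinv (x : uprod) := umk (fun j => (ufun x j)^-1).

Lemma uaddE f g : uadd (umk f) (umk g) = umk (fun j => f j + g j).
Proof. by apply/umkP; apply: (uI (umkK f) (umkK g)) => j -> ->. Qed.
Lemma umulE f g : umul (umk f) (umk g) = umk (fun j => f j * g j).
Proof. by apply/umkP; apply: (uI (umkK f) (umkK g)) => j -> ->. Qed.
Lemma uoppE f : uopp (umk f) = umk (fun j => - f j).
Proof. by apply/umkP; apply: (uS (umkK f)) => j ->. Qed.
Lemma uinvE f : uinv (umk f) = umk (fun j => (f j)^-1).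
Proof. by apply/umkP; apply: (uS (umkK f)) => j ->. Qed.

Lemma umk_ind (P : uprod -> Prop) : (forall f, P (umk f)) -> forall x, P x.
Proof. by move=> h x; rewrite -(ufunK x). Qed.

Lemma uaddA : associative uadd.
Proof.
elim/umk_ind=> f; elim/umk_ind=> g; elim/umk_ind=> k; rewrite !uaddE.
by apply/umkP; apply: uT => j; rewrite addrA.
Qed.
Lemma uaddC : commutative uadd.
Proof.
elim/umk_ind=> f; elim/umk_ind=> g; rewrite !uaddE.
by apply/umkP; apply: uT => j; rewrite addrC.
Qed.
Lemma uadd0 : left_id uzero uadd.
Proof. by elim/umk_ind=> f; rewrite uaddE; apply/umkP; apply: uT => j; rewrite add0r. Qed.
Lemma uaddN : left_inverse uzero uopp uadd.
Proof.
by elim/umk_ind=> f; rewrite uoppE uaddE; apply/umkP; apply: uT => j; rewrite addNr.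
Qed.
HB.instance Definition _ := GRing.isZmodule.Build uprod uaddA uaddC uadd0 uaddN.

Lemma umulA : associative umul.
Proof.
elim/umk_ind=> f; elim/umk_ind=> g; elim/umk_ind=> k; rewrite !umulE.
by apply/umkP; apply: uT => j; rewrite mulrA.
Qed.
Lemma umulC : commutative umul.
Proof.
elim/umk_ind=> f; elim/umk_ind=> g; rewrite !umulE.
by apply/umkP; apply: uT => j; rewrite mulrC.
Qed.
Lemma umul1 : left_id uone umul.
Proof. by elim/umk_ind=> f; rewrite umulE; apply/umkP; apply: uT => j; rewrite mul1r. Qed.
Lemma umulD : left_distributive umul uadd.
Proof.
elim/umk_ind=> f; elim/umk_ind=> g; elim/umk_ind=> k; rewrite !(umulE, uaddE).
by apply/umkP; apply: uT => j; rewrite mulrDl.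
Qed.
Lemma uone_neq0 : uone != uzero :> uprod.
Proof. by apply/eqP => /umkP /uE [j /eqP]; rewrite oner_eq0. Qed.
HB.instance Definition _ :=
  GRing.Zmodule_isComNzRing.Build uprod umulA umulC umul1 umulD uone_neq0.

Lemma umk_eq0 f : umk f = 0 <-> U (fun j => f j = 0).
Proof. exact: umkP. Qed.
Lemma umulV (x : uprod) : x != 0 -> umul (uinv x) x = uone.
Proof.
elim/umk_ind: x => f /eqP; rewrite umk_eq0 -uN uinvE umulE => h.
by apply/umkP; apply: (uS h) => j /eqP f0; rewrite mulVf.
Qed.
Lemma uinv0 : uinv 0 = 0.
Proof. by apply/esym; rewrite [LHS]/GRing.zero /= uinvE; apply/umkP; apply: uT => j; rewrite invr0. Qed.
HB.instance Definition _ := GRing.ComNzRing_isField.Build uprod umulV uinv0.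

Lemma umkD f g : umk f + umk g = umk (fun j => f j + g j). Proof. exact: uaddE. Qed.
Lemma umkM f g : umk f * umk g = umk (fun j => f j * g j). Proof. exact: umulE. Qed.
Lemma umkN f : - umk f = umk (fun j => - f j). Proof. exact: uoppE. Qed.
Lemma umkV f : (umk f)^-1 = umk (fun j => (f j)^-1). Proof. exact: uinvE. Qed.
Lemma umk0 : umk (fun j => 0) = 0. Proof. by []. Qed.
Lemma umk1 : umk (fun j => 1) = 1. Proof. by []. Qed.
Lemma umkX f n : umk f ^+ n = umk (fun j => f j ^+ n).
Proof.
elim: n => [|n IH]; first by rewrite expr0 -umk1; apply/umkP; apply: uT => j; rewrite expr0.
by rewrite exprS IH umkM; apply/umkP; apply: uT => j; rewrite exprS.
Qed.
Lemma umk_sum (I : Type) (r : seq I) (P : pred I) (F : I -> fam) :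
  \sum_(i <- r | P i) umk (F i) = umk (fun j => \sum_(i <- r | P i) F i j).
Proof.
elim: r => [|i r IH]; first by rewrite big_nil -umk0; apply/umkP; apply: uT => j; rewrite big_nil.
rewrite big_cons IH; case Pi: (P i); rewrite ?umkD; apply/umkP; apply: uT => j; by rewrite big_cons Pi.
Qed.

Definition uO (O : forall j, M j -> Prop) (x : uprod) : Prop :=
  U (fun j => O j (ufun x j)).
Lemma uO_mk O f : uO O (umk f) <-> U (fun j => O j (f j)).
Proof.
by split=> h; apply: (uI h (umkK f)) => j; [move=> + <-|move=> + ->].
Qed.

Lemma uO_valuation O : (forall j, valuation_ring (O j)) -> valuation_ring (uO O).
Proof.
move=> vO; split=> [|x y|x y|x].
- by rewrite -umk1; apply/uO_mk; apply: uT => j; apply: vr1.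
- elim/umk_ind: x => f; elim/umk_ind: y => g; rewrite umkN umkD !uO_mk => h1 h2.
  by apply: (uI h1 h2) => j ? ?; apply: vrB.
- elim/umk_ind: x => f; elim/umk_ind: y => g; rewrite umkM !uO_mk => h1 h2.
  by apply: (uI h1 h2) => j ? ?; apply: vrM.
elim/umk_ind: x => f /eqP; rewrite umk_eq0 -uN umkV !uO_mk => h; apply: uOr.
by apply: (uS h) => j /eqP f0; apply: vr_total.
Qed.

Lemma uO_vle O f g : (forall j, valuation_ring (O j)) ->
  vle (uO O) (umk f) (umk g) <-> U (fun j => vle (O j) (f j) (g j)).
Proof.
move=> vO; split.
  case=> o; elim/umk_ind: o => o /uO_mk Oo; rewrite umkM => /umkP E.
  by apply: (uI Oo E) => j Oj ->; exists (o j).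
move=> h; pose P j o := O j o /\ f j = o * g j.
have Hex j : exists o, vle (O j) (f j) (g j) -> P j o.
  by case: (EM (vle (O j) (f j) (g j))) => [[o Oo E]|?]; [exists o|exists 0].
pose o j := sval (cid (Hex j)); have ho j : vle (O j) (f j) (g j) -> P j (o j).
  by rewrite /o; case: (cid _).
exists (umk o); first by apply/uO_mk; apply: (uS h) => j /ho [].
by rewrite umkM; apply/umkP; apply: (uS h) => j /ho [].
Qed.

(** The components of the chosen representatives of the coefficients. The degree of p is kept only
    in almost all components, by [upoly_size]. *)
Definition upoly (p : {poly uprod}) j : {poly M j} := \poly_(i < size p) ufun p`_i j.

Lemma upoly_horner p f : p.[umk f] = umk (fun j => (upoly p j).[f j]).
Proof.
rewrite horner_coef.
under eq_bigr => i _ do rewrite -[p`_i]ufunK umkX umkM.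
rewrite umk_sum; apply/umkP; apply: uT => j.
by rewrite horner_poly.
Qed.

Lemma upoly_size p : U (fun j => size (upoly p j) = size p).
Proof.
have [->|p0] := eqVneq p 0.
  by apply: uT => j; rewrite /upoly size_poly0 poly_def big_ord0 size_poly0.
have : lead_coef p != 0 by rewrite lead_coef_eq0.
rewrite -(ufunK (lead_coef p)) => /eqP; rewrite umk_eq0 -uN => h.
by apply: (uS h) => j /eqP lj; apply: size_poly_eq; rewrite ?size_poly_gt0.
Qed.

Lemma uprod_closed : (forall j, alg_closed (M j)) -> alg_closed uprod.
Proof.
move=> cl p p1; have Hex j : exists x, size (upoly p j) != 1 -> root (upoly p j) x.
  by case: eqP => // [_|/eqP /cl [x]]; [exists 0|exists x].
exists (umk (fun j => sval (cid (Hex j)))); rewrite rootE upoly_horner.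
apply/eqP/umk_eq0; apply: (uS (upoly_size p)) => j Ej.
by case: (cid _) => x /= /(_ _)/eqP; apply; rewrite Ej.
Qed.

Section Mor.
Variables (L : fieldType) (iota : forall j, {rmorphism L -> M j}).
Definition umor (x : L) : uprod := umk (fun j => iota j x).
Lemma umor_zmod : zmod_morphism umor.
Proof. by move=> x y; rewrite /umor umkN umkD; apply/umkP; apply: uT => j; rewrite rmorphB. Qed.
Lemma umor_monoid : monoid_morphism umor.
Proof.
split; first by rewrite /umor -umk1; apply/umkP; apply: uT => j; rewrite rmorph1.
by move=> x y; rewrite /umor umkM; apply/umkP; apply: uT => j; rewrite rmorphM.
Qed.
HB.instance Definition _ := GRing.isZmodMorphism.Build L uprod umor umor_zmod.
HB.instance Definition _ := GRing.isMonoidMorphism.Build L uprod umor umor_monoid.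
End Mor.

End Ultraproduct.

(** * Algebraic closure *)

Section SubfieldLift.
Variables (R L : fieldType) (S : R -> Prop) (hS : is_subfield S).
Variables (f : {rmorphism L -> R}) (hf : forall x, S (f x)).
Definition sf_lift (x : L) : sft hS := sval (cid (sfv_ex hS (hf x))).
Lemma sf_liftK x : val (sf_lift x) = f x.
Proof. by rewrite /sf_lift; case: (cid _). Qed.
Lemma sf_lift_zmod : zmod_morphism sf_lift.
Proof. by move=> x y; apply: val_inj; rewrite rmorphB /= !sf_liftK rmorphB. Qed.
Lemma sf_lift_monoid : monoid_morphism sf_lift.
Proof.
split=> [|x y]; apply: val_inj; first by rewrite sf_liftK !rmorph1.
by rewrite rmorphM /= !sf_liftK rmorphM.
Qed.
HB.instance Definition _ := GRing.isZmodMorphism.Build L (sft hS) sf_lift sf_lift_zmod.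
HB.instance Definition _ := GRing.isMonoidMorphism.Build L (sft hS) sf_lift sf_lift_monoid.
End SubfieldLift.

Lemma irred_factor (F : fieldType) (p : {poly F}) : p != 0 -> size p != 1 ->
  exists2 q, irreducible_poly q & q %| p.
Proof.
have [n] := ubnP (size p); elim: n p => // n IH p; rewrite ltnS => pn p0 p1.
have [ip|] := EM (irreducible_poly p); first by exists p.
move=> nip; have [q [q1 qp nqp]] : exists q : {poly F}, [/\ size q != 1, q %| p & ~~ (q %= p)].
  apply: contrapT => h; apply: nip; split; first by rewrite ltn_neqAle eq_sym p1 size_poly_gt0.
  by move=> q q1 qp; apply: contrapT => /negP nqp; apply: h; exists q.
have q0 : q != 0 by apply: contraNneq p0 => q0; move: qp; rewrite q0 dvd0p.
have qn : (size q < n)%N.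
  by apply: leq_trans pn; rewrite ltn_neqAle (dvdp_leq p0 qp) andbT (dvdp_size_eqp qp).
by have [r ir rq] := IH q qn q0 q1; exists r => //; apply: dvdp_trans rq qp.
Qed.

Lemma ext_root (F : fieldType) (p : {poly F}) : size p != 1 ->
  exists (M : fieldType) (j : {rmorphism F -> M}) (x : M), root (map_poly j p) x.
Proof.
have [-> _|p0 p1] := eqVneq p 0.
  by exists F, idfun, 0; rewrite rmorph0 root0.
have [q iq qp] := irred_factor p0 p1; have [M _ [z qz _]] := irredp_FAdjoin iq.
exists M, (GRing.in_alg M), z; have /dvdpP [r ->] := qp.
by rewrite rmorphM rootM qz orbT.
Qed.

Definition splits (F : fieldType) (p : {poly F}) :=
  exists rs : seq F, p = lead_coef p *: \prod_(r <- rs) ('X - r%:P).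

Lemma splits_map (F M : fieldType) (j : {rmorphism F -> M}) (p : {poly F}) :
  splits p -> splits (map_poly j p).
Proof.
case=> rs E; exists (map j rs); rewrite {1}E lead_coef_map map_polyZ rmorph_prod big_map.
by congr (_ *: _); apply: eq_bigr => r _; rewrite rmorphB /= map_polyX map_polyC.
Qed.

Lemma ext_split (F : fieldType) (p : {poly F}) :
  exists (M : fieldType) (j : {rmorphism F -> M}), splits (map_poly j p).
Proof.
have [n] := ubnP (size p); elim: n F p => // n IH F p; rewrite ltnS => pn.
have [p1|p1] := eqVneq (size p) 1.
  exists F, idfun, [::]; rewrite map_poly_id // big_nil alg_polyC.
  by case/eqP/size_poly1P: p1 => c c0 ->; rewrite lead_coefC.
have [p0|p0] := eqVneq p 0.
  by exists F, idfun, [::]; rewrite p0 rmorph0 lead_coef0 scale0r.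
have [M [j [x /factor_theorem [q E]]]] := ext_root p1.
have q0 : q != 0.
  by apply: contraNneq p0 => q0; move/eqP: E; rewrite q0 mul0r map_poly_eq0.
have sq : (size q < n)%N.
  have := congr1 (fun r : {poly M} => size r) E.
  rewrite size_map_poly size_Mmonic ?monicXsubC // size_XsubC addn2 /= => sE.
  by rewrite sE in pn.
have [M' [j' [rs Ers]]] := IH M q sq.
exists M', (j' \o j), (j' x :: rs); rewrite map_poly_comp E rmorphM /= rmorphB /= map_polyX map_polyC /=.
by rewrite lead_coefM lead_coefXsubC mulr1 big_cons {1}Ers -scalerAl mulrC.
Qed.

Lemma ext_split_seq (F : fieldType) (ps : seq {poly F}) :
  exists (M : fieldType) (j : {rmorphism F -> M}), forall p, p \in ps -> splits (map_poly j p).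
Proof.
elim: ps => [|p ps [M [j IH]]]; first by exists F, idfun.
have [M' [j' h]] := ext_split (map_poly j p).
exists M', (j' \o j) => q; rewrite inE map_poly_comp => /orP[/eqP -> //|/IH].
exact: splits_map.
Qed.

Section UltraPolynomials.
Variables (J : Type) (U : (J -> Prop) -> Prop) (hU : ultra U) (M : J -> fieldType).

Lemma umk_prod_XsubC n (r : 'I_n -> forall j, M j) k :
  (\prod_(i < n) ('X - (umk hU (r i))%:P))`_k =
  umk hU (fun j => (\prod_(i < n) ('X - (r i j)%:P))`_k).
Proof.
elim: n r k => [|n IH] r k.
  rewrite big_ord0 coef1; case: eqP => k0; rewrite -?umk1 -?umk0; apply/umkP; apply: uT => // j;
  by rewrite big_ord0 coef1; case: eqP.
rewrite big_ord_recl mulrBl coefB coefXM coefCM !IH; case: k => [|k] /=.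
  rewrite -umk0 umkM umkN umkD; apply/umkP; apply: uT => // j.
  by rewrite big_ord_recl mulrBl coefB coefXM coefCM.
rewrite umkM umkN umkD; apply/umkP; apply: uT => // j.
by rewrite big_ord_recl mulrBl coefB coefXM coefCM.
Qed.

(** Field morphisms preserve the degree n, so the lists of roots have the same length in almost all
    components. Indexed by ['I_n], they combine into n elements of the ultraproduct. *)
Lemma umor_splits (L : fieldType) (iota : forall j, {rmorphism L -> M j}) (p : {poly L}) :
  U (fun j => splits (map_poly (iota j) p)) -> splits (map_poly (umor hU iota) p).
Proof.
have [->|p0] := eqVneq p 0.
  by move=> _; exists [::]; rewrite rmorph0 lead_coef0 scale0r.
move=> h; pose n := (size p).-1.
have Hex j : exists r : 'I_n -> M j, splits (map_poly (iota j) p) ->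
   map_poly (iota j) p = iota j (lead_coef p) *: \prod_(i < n) ('X - (r i)%:P).
  have [[rs Ers]|ns] := EM (splits (map_poly (iota j) p)); last by exists (fun=> 0).
  have Es : size rs = n.
    have := congr1 (fun q : {poly M j} => size q) Ers.
    rewrite size_scale ?lead_coef_eq0 ?map_poly_eq0 // size_prod_XsubC size_map_poly.
    by rewrite /n => ->.
  exists (fun i => nth 0 rs i) => _; rewrite {1}Ers lead_coef_map.
  by congr (_ *: _); rewrite (big_nth 0) Es big_mkord.
pose r i j := sval (cid (Hex j)) i.
exists (codom (fun i : 'I_n => umk hU (r i))); rewrite lead_coef_map big_map big_enum /=.
apply/polyP => k; rewrite coef_map coefZ umk_prod_XsubC /= /umor umkM.
apply/umkP; apply: (uS hU h) => j; rewrite /r; case: (cid _) => rr /= /[apply] E.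
by rewrite -coef_map E coefZ.
Qed.

End UltraPolynomials.

(** Splitting fields of finite lists of polynomials exist by iterated adjunction. Their ultraproduct
    along an ultrafilter containing, for each list, the set of all larger lists splits every
    polynomial over L, and the elements of it that are algebraic over L form an algebraically closed
    field. *)
Lemma exists_alg_closure (L : fieldType) :
  exists (M : fieldType) (j : {rmorphism L -> M}), alg_closed M.
Proof.
have HM (s : seq {poly L}) : {M : fieldType & {j : {rmorphism L -> M} |
    forall p, p \in s -> splits (map_poly j p)}}.
  by have /cid [M /cid [j h]] := ext_split_seq s; exists M, j.
pose M s := projT1 (HM s); pose iota s : {rmorphism L -> M s} := sval (projT2 (HM s)).
have hM s p : p \in s -> splits (map_poly (iota s) p).
  by rewrite /iota /M; case: (HM s) => M' [j h]; apply: h.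
have [U [hU Up]] : exists U, ultra U /\ forall s : seq {poly L}, U (fun s' : seq {poly L} => {subset s <= s'}).
  apply: (@ultra_exists (seq {poly L}) (seq {poly L}) (fun s s' => {subset s <= s'}) [::])
    => [s s'|s]; last by exists s.
  exists (s ++ s') => t h; split=> x xs; apply: h; rewrite mem_cat xs ?orbT //.
pose P := uprod hU M; pose io : {rmorphism L -> P} := umor hU iota.
have spl (p : {poly L}) : splits (map_poly io p).
  apply: umor_splits; apply: (uS hU (Up [:: p])) => s h; apply: hM; apply: h.
  by rewrite inE.
pose imL (x : P) := exists a, x = io a.
have himL : is_subfield imL.
  split; first by exists 1; rewrite rmorph1.
  - by move=> _ _ [a ->] [b ->]; exists (a - b); rewrite rmorphB.
  - by move=> _ _ [a ->] [b ->]; exists (a * b); rewrite rmorphM.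
  - by move=> _ [a ->]; exists a^-1; rewrite fmorphV.
have hA := alg_subfield himL.
have ioA x : alg imL (io x) by apply: alg_incl => //; exists x.
exists (sft hA), (sf_lift hA ioA) => p p1.
set ka := sf_lift hA ioA.
have vka (q : {poly L}) : map_poly (val : sft hA -> P) (map_poly ka q) = map_poly io q.
  by rewrite -map_poly_comp; apply: eq_map_poly => x /=; rewrite sf_liftK.
have algA a : algebraicOver ka a.
  have /(algE himL) [q q0 qa] := sfvP a; have hq i : imL (val q`_i) := sfvP _.
  pose q' : {poly L} := \poly_(i < size q) sval (cid (hq i)).
  have Eq' : map_poly io q' = map_poly (val : sft himL -> P) q.
    apply/polyP => i; rewrite !coef_map coef_poly /=; case: ltnP => h.
      by case: (cid _).
    by rewrite rmorph0 nth_default // rmorph0.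
  exists q'; first by rewrite -(map_poly_eq0 io) Eq' map_poly_eq0.
  rewrite -(fmorph_root (val : {rmorphism sft hA -> P})).
  by rewrite vka Eq'.
have [B [j [x px]]] := ext_root p1.
have [p0|p0] := eqVneq p 0; first by exists 0; rewrite p0 root0.
have [m m0 mx] : algebraicOver (j \o ka) x.
  apply/integral_algebraic; apply: (integral_root _ px); first by rewrite map_poly_eq0.
  move=> _ /(nthP 0)[i _ <-]; apply/integral_algebraic; rewrite coef_map /=.
  have [q q0 qa] := algA p`_i; exists q => //.
  by rewrite map_poly_comp fmorph_root.
(* The root x of p lies in some extension of the relative closure and is a root of m, which has
   coefficients in L. As m already splits with roots algebraic over L, x comes from the closure
   itself. *)
have [rs Ers] := spl m.
have rsA r : r \in rs -> alg imL r.
  move=> rrs; apply: (alg_roots himL _ _ Ers) => //; first by rewrite map_poly_eq0.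
  by move=> i; rewrite coef_map; apply: ioA.
have [rs' Ers'] : exists rs' : seq (sft hA), rs = map val rs'.
  elim: (rs) rsA => [|r s IH] h; first by exists [::].
  case: IH => [t ts|s' ->]; first by apply: h; rewrite inE ts orbT.
  have [|r' <-] := @sfv_ex _ _ hA r; first by apply: h; rewrite inE eqxx.
  by exists (r' :: s').
have Em : map_poly ka m = lead_coef (map_poly ka m) *: \prod_(r <- rs') ('X - r%:P).
  apply: (map_poly_inj (val : {rmorphism sft hA -> P})); rewrite vka Ers.
  rewrite map_polyZ rmorph_prod Ers' big_map -lead_coef_map vka; congr (_ *: _).
  by apply: eq_bigr => r _; rewrite [RHS]map_polyXsubC.
move: mx; rewrite map_poly_comp Em map_polyZ rmorph_prod rootZ; last first.
  by rewrite fmorph_eq0 lead_coef_eq0 map_poly_eq0.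
under eq_bigr => r _ do rewrite rmorphB /= map_polyX map_polyC /=.
rewrite -(big_map j xpredT (fun r => 'X - r%:P)) root_prod_XsubC => /mapP [a _ Ea].
by exists a; move: px; rewrite Ea fmorph_root.
Qed.

(** * Chevalley's extension theorem *)

Section Chevalley.
Variable (F : fieldType).
(** A subring with a proper ideal, ordered by inclusion in both components. A maximal pair turns out
    to be a valuation ring. *)
Definition local_pair (A I : F -> Prop) : Prop :=
  [/\ [/\ A 1, (forall x y, A x -> A y -> A (x - y)) & (forall x y, A x -> A y -> A (x * y))],
      (forall x, I x -> A x), (forall x y, I x -> I y -> I (x - y)),
      (forall a x, A a -> I x -> I (a * x)) & I 0 /\ ~ I 1].

Section Maximal.
Variables (A I : F -> Prop) (hAI : local_pair A I).
Hypothesis max : forall A' I', local_pair A' I' -> (forall x, A x -> A' x) ->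
  (forall x, I x -> I' x) -> forall x, A' x -> A x.

Let A1 : A 1. Proof. by case: hAI => -[]. Qed.
Let AB x y : A x -> A y -> A (x - y). Proof. by case: hAI => -[_ h _] _ _ _ _; apply: h. Qed.
Let AM x y : A x -> A y -> A (x * y). Proof. by case: hAI => -[_ _ h] _ _ _ _; apply: h. Qed.
Let IA x : I x -> A x. Proof. by case: hAI => _ h _ _ _; apply: h. Qed.
Let IB x y : I x -> I y -> I (x - y). Proof. by case: hAI => _ _ h _ _; apply: h. Qed.
Let IM a x : A a -> I x -> I (a * x). Proof. by case: hAI => _ _ _ h _; apply: h. Qed.
Let I0 : I 0. Proof. by case: hAI => _ _ _ _ []. Qed.
Let In1 : ~ I 1. Proof. by case: hAI => _ _ _ _ []. Qed.
Let ID x y : I x -> I y -> I (x + y).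
Proof. by move=> Ix Iy; rewrite -[y]opprK; apply: IB => //; rewrite -[- y]sub0r; apply: IB. Qed.
Let A0 : A 0. Proof. exact: IA. Qed.
Let AD x y : A x -> A y -> A (x + y).
Proof. by move=> Ix Iy; rewrite -[y]opprK; apply: AB => //; rewrite -[- y]sub0r; apply: AB. Qed.
Let AX x n : A x -> A (x ^+ n).
Proof. by move=> h; elim: n => [|n IH]; rewrite ?expr0 ?exprS //; apply: AM. Qed.
Let Isum (K : Type) (r : seq K) (P : pred K) (f : K -> F) :
  (forall i, P i -> I (f i)) -> I (\sum_(i <- r | P i) f i).
Proof. by move=> h; apply: (big_ind I). Qed.
Let Asum (K : Type) (r : seq K) (P : pred K) (f : K -> F) :
  (forall i, P i -> A (f i)) -> A (\sum_(i <- r | P i) f i).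
Proof. by move=> h; apply: (big_ind A). Qed.

(** Unless 1 lies in the ideal generated by I in A[y], this ring with this ideal is a pair above (A,
    I), and maximality gives y in A. *)
Lemma chevalley_adjoin y : A y \/ exists2 p : {poly F}, forall i, I p`_i & p.[y] = 1.
Proof.
have [?|np] := EM (exists2 p : {poly F}, forall i, I p`_i & p.[y] = 1); [by right|left].
pose A' x := exists2 p : {poly F}, forall i, A p`_i & x = p.[y].
pose I' x := exists2 p : {poly F}, forall i, I p`_i & x = p.[y].
have CA c : A c -> A' c.
  move=> Ac; exists c%:P; last by rewrite hornerC.
  by move=> i; rewrite coefC; case: ifP.
have CI c : I c -> I' c.
  move=> Ac; exists c%:P; last by rewrite hornerC.
  by move=> i; rewrite coefC; case: ifP.
apply: (max (A' := A') (I' := I')) => //; last first.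
  by exists 'X; rewrite ?hornerX // => i; rewrite coefX; case: eqP.
split; [split| | | |split] => //.
- exact: CA.
- move=> _ _ [p hp ->] [q hq ->]; exists (p - q); rewrite ?hornerD ?hornerN // => i.
  by rewrite coefB; apply: AB.
- move=> _ _ [p hp ->] [q hq ->]; exists (p * q); rewrite ?hornerM // => i.
  by rewrite coefM; apply: Asum => k _; apply: AM.
- by move=> _ [p hp ->]; exists p => // i; apply: IA.
- move=> _ _ [p hp ->] [q hq ->]; exists (p - q); rewrite ?hornerD ?hornerN // => i.
  by rewrite coefB; apply: IB.
- move=> _ _ [p hp ->] [q hq ->]; exists (p * q); rewrite ?hornerM // => i.
  by rewrite coefM; apply: Isum => k _; apply: IM.
- exact: CI.
- by case=> p hp E; apply: np; exists p.
Qed.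

(** If p(u^-1) = 1 with coefficients in I, multiplication by a power of u puts that power into I.
    Since u is congruent to 1 modulo I, all lower powers follow, down to 1. *)
Lemma chevalley_local u : I (1 - u) -> A u^-1.
Proof.
move=> Iu; case: (chevalley_adjoin u^-1) => // -[p hp E].
have [u0|u0] := eqVneq u 0; first by case: In1; move: Iu; rewrite u0 subr0.
have Au : A u by rewrite -[u](subKr 1); apply: AB => //; apply: IA.
have Iun n : I (u ^+ n) -> I 1.
  elim: n => [|n IH]; first by rewrite expr0.
  move=> h; apply: IH; rewrite -[_ ^+ n](subrK (u ^+ n.+1)); apply: ID => //.
  rewrite exprS -{1}[u ^+ n]mul1r -mulrBl mulrC; apply: IM => //; exact: AX.
case: In1; apply: (Iun (size p)); rewrite -[_ ^+ _]mulr1 -E horner_coef mulr_sumr.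
apply: Isum => i _; rewrite -{1}(subnK (ltnW (ltn_ord i))) exprD -mulrA (mulrCA _ p`_i).
by rewrite exprVn mulfV ?expf_neq0 // mulr1; apply: IM => //; apply: AX.
Qed.

(** With n the degree of p, the equation q(x^-1) = 1 multiplied by x^n reads (1 - q_0) x^n = sum
    over i < n of q_(n-i) x^i. As 1 - q_0 is invertible in A, the leading term of p(x) can be
    replaced by terms of lower degree. *)
Lemma chevalley_reduce x (p q : {poly F}) : x != 0 ->
  (forall i, I p`_i) -> (forall i, I q`_i) -> p.[x] = 1 -> q.[x^-1] = 1 ->
  (size q <= size p)%N ->
  exists2 p' : {poly F}, (size p' < size p)%N & (forall i, I p'`_i) /\ p'.[x] = 1.
Proof.
move=> x0 hp hq Ep Eq sqp; pose n := (size p).-1.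
have sp : size p = n.+1.
  rewrite /n prednK // size_poly_gt0; apply/eqP => p0; move: Ep; rewrite p0 horner0 => /eqP.
  by rewrite eq_sym oner_eq0.
pose u := 1 - q`_0; have Aui : A u^-1 by apply: chevalley_local; rewrite /u subKr.
have u0 : u != 0.
  by apply/eqP => /eqP; rewrite subr_eq0 => /eqP E; apply: In1; rewrite E.
exists (\poly_(i < n) (p`_i + p`_n * (u^-1 * q`_(n - i)))).
  by rewrite sp ltnS size_poly.
split.
  move=> i; rewrite coef_poly; case: ifP => // _; apply: ID => //.
  by apply: IM; [exact: IA|apply: IM].
rewrite horner_poly; under eq_bigr => i _ do rewrite mulrDl.
rewrite big_split /= -[RHS]Ep horner_coef sp big_ord_recr /=; congr (_ + _).
under eq_bigr => i _ do rewrite -!mulrA.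
rewrite -mulr_sumr; congr (_ * _); rewrite -mulr_sumr.
suff -> : \sum_(i < n) q`_(n - i) * x ^+ i = u * x ^+ n by rewrite mulKf.
have Eq' : 1 = \sum_(i < n.+1) q`_i * x^-1 ^+ i.
  by rewrite -Eq (@horner_coef_wide _ n.+1) // -sp.
rewrite /u {1}Eq' big_ord_recl /= expr0 mulr1 addrC addKr mulr_suml.
rewrite (reindex_inj rev_ord_inj) /=; apply: eq_bigr => i _.
rewrite subKn // -mulrA; congr (_ * _).
have -> : x ^+ n = x ^+ (n - i.+1) * x ^+ i.+1 by rewrite -exprD subnK.
by rewrite /bump /= add1n exprVn mulrCA mulVf ?mulr1 ?expf_neq0.
Qed.

(** Infinite descent on the sum of the sizes of two polynomials which witness that neither x nor its
    inverse belongs to A. *)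
Lemma chevalley_total x : x != 0 -> A x \/ A x^-1.
Proof.
move=> x0; case: (chevalley_adjoin x) => [|[p hp Ep]]; first by left.
case: (chevalley_adjoin x^-1) => [|[q hq Eq]]; first by right.
exfalso; have [n] := ubnP (size p + size q)%N.
elim: n x x0 p q hp hq Ep Eq => // n IH x x0 p q hp hq Ep Eq; rewrite ltnS => sn.
have [sqp|/ltnW sqp] := leqP (size q) (size p).
  have [p' sp' [hp' Ep']] := chevalley_reduce x0 hp hq Ep Eq sqp.
  by apply: (IH x x0 p' q hp' hq Ep' Eq); apply: leq_trans sn; rewrite ltn_add2r.
have xv : x^-1 != 0 by rewrite invr_eq0.
have Ep' : p.[x^-1^-1] = 1 by rewrite invrK.
have [q' sq' [hq' Eq']] := chevalley_reduce xv hq hp Eq Ep' sqp.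
by apply: (IH x x0 p q' hp hq' Ep Eq'); apply: leq_trans sn; rewrite ltn_add2l.
Qed.
End Maximal.

Lemma chevalley (A I : F -> Prop) : local_pair A I ->
  exists O : F -> Prop, [/\ valuation_ring O, (forall x, A x -> O x) &
    forall x, I x -> vlt O x 1].
Proof.
(* A pair is coded as one set of tagged elements to be added to (A, I); Zorn's lemma for inclusion
   of sets then applies, and the empty chain yields (A, I) itself. *)
move=> h0; pose AA (X : set (F * bool)) x := A x \/ X (x, true).
pose II (X : set (F * bool)) x := I x \/ X (x, false).
pose P := [set X | local_pair (AA X) (II X)]%classic.
have [FF sFP totF|X [PX maxX]] := @Zorn_bigcup (F * bool) P.
  have [[X0 FX0]|nF] := EM (exists X, FF X); last first.
    rewrite /P /=.
    have -> : AA (\bigcup_(X in FF) X)%classic = A.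
      apply/funext => x; apply/propext; split=> [[//|[X FX _]]|]; last by left.
      by case: nF; exists X.
    have -> : II (\bigcup_(X in FF) X)%classic = I.
      apply/funext => x; apply/propext; split=> [[//|[X FX _]]|]; last by left.
      by case: nF; exists X.
    exact: h0.
  set Y := (\bigcup_(X in FF) X)%classic.
  have toX x : AA Y x -> exists2 X, FF X & AA X x.
    by case=> [Ax|[X FX Xx]]; [exists X0 => //; left|exists X => //; right].
  have toI x : II Y x -> exists2 X, FF X & II X x.
    by case=> [Ax|[X FX Xx]]; [exists X0 => //; left|exists X => //; right].
  have ofX X x : FF X -> AA X x -> AA Y x by move=> FX [|?]; [left|right; exists X].
  have ofI X x : FF X -> II X x -> II Y x by move=> FX [|?]; [left|right; exists X].
  have join X X' : FF X -> FF X' -> exists2 Z, FF Z & (X `<=` Z)%classic /\ (X' `<=` Z)%classic.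
    by move=> FX FX'; case: (totF _ _ FX FX') => s; [exists X'|exists X] => //; split.
  have mA X X' x : (X `<=` X')%classic -> AA X x -> AA X' x by move=> s [|/s]; [left|right].
  have mI X X' x : (X `<=` X')%classic -> II X x -> II X' x by move=> s [|/s]; [left|right].
  split; [split| | | |split].
  - by left; case: h0 => -[].
  - move=> x y /toX [X FX Xx] /toX [X' FX' Xy]; have [Z FZ [s s']] := join _ _ FX FX'.
    apply: (ofX Z) => //; have [[_ h _] _ _ _ _] := sFP _ FZ.
    by apply: h; [apply: mA s _|apply: mA s' _].
  - move=> x y /toX [X FX Xx] /toX [X' FX' Xy]; have [Z FZ [s s']] := join _ _ FX FX'.
    apply: (ofX Z) => //; have [[_ _ h] _ _ _ _] := sFP _ FZ.
    by apply: h; [apply: mA s _|apply: mA s' _].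
  - move=> x /toI [X FX Xx]; apply: (ofX X) => //; have [_ h _ _ _] := sFP _ FX; exact: h.
  - move=> x y /toI [X FX Xx] /toI [X' FX' Xy]; have [Z FZ [s s']] := join _ _ FX FX'.
    apply: (ofI Z) => //; have [_ _ h _ _] := sFP _ FZ.
    by apply: h; [apply: mI s _|apply: mI s' _].
  - move=> x y /toX [X FX Xx] /toI [X' FX' Xy]; have [Z FZ [s s']] := join _ _ FX FX'.
    apply: (ofI Z) => //; have [_ _ _ h _] := sFP _ FZ.
    by apply: h; [apply: mA s _|apply: mI s' _].
  - by left; case: h0 => _ _ _ _ [].
  - by move=> /toI [X FX]; have [_ _ _ _ [_ h]] := sFP _ FX; apply: h.
have [[A1 AB AM] IA IB IM [I0 In1]] := PX.
have mx A' I' : local_pair A' I' -> (forall x, AA X x -> A' x) ->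
    (forall x, II X x -> I' x) -> forall x, A' x -> AA X x.
  move=> h' sA sI x A'x; apply: contrapT => nx.
  pose X' : set (F * bool) := [set z | if z.2 then A' z.1 else I' z.1]%classic.
  have EA : AA X' = A'.
    by apply/funext => y; apply/propext; split=> [[Ay|//]|]; [apply: sA; left|right].
  have EI : II X' = I'.
    by apply/funext => y; apply/propext; split=> [[Ay|//]|]; [apply: sI; left|right].
  apply: (maxX X'); last by rewrite /P /= EA EI.
  split; first by move=> [y []] Xy /=; [apply: sA; right|apply: sI; right].
  by move=> s; apply: nx; right; apply: s.
exists (AA X); split=> //; first by split=> // x x0; apply: (chevalley_total PX mx x0).
  by move=> x Ax; left.
move=> x Ix [o Ao E]; apply: In1; rewrite E; apply: IM => //; by left.
Qed.
End Chevalley.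

(** Chevalley's theorem for the image of the valuation ring and of its maximal ideal. The second is
    what keeps the ring from growing on L: the inverse of an element outside O must become small. *)
Lemma valuation_extends (L M : fieldType) (j : {rmorphism L -> M}) (O : L -> Prop) :
  valuation_ring O -> exists2 O' : M -> Prop, valuation_ring O' & extends j O O'.
Proof.
move=> vO; pose A (y : M) := exists2 x, O x & y = j x.
pose I (y : M) := exists2 x, vlt O x 1 & y = j x.
have [|O' [vO' AO' IO']] := @chevalley M A I.
  split; [split| | | |split].
  - by exists 1; [exact: vr1|rewrite rmorph1].
  - by move=> _ _ [x Ox ->] [y Oy ->]; exists (x - y); [exact: vrB|rewrite rmorphB].
  - by move=> _ _ [x Ox ->] [y Oy ->]; exists (x * y); [exact: vrM|rewrite rmorphM].
  - by move=> _ [x xm ->]; exists x => //; apply/vle1; apply: vltW.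
  - by move=> _ _ [x Ox ->] [y Oy ->]; exists (x - y); [exact: vltB|rewrite rmorphB].
  - move=> _ _ [x Ox ->] [y ym ->]; exists (x * y); last by rewrite rmorphM.
    by apply: vle_lt_trans ym => //; rewrite -{2}[y]mul1r; apply: vleM2r => //; apply/vle1.
  - by exists 0; [apply/(vlt0 vO); exact: oner_neq0|rewrite rmorph0].
  - case=> x xm; rewrite -(rmorph1 j) => /fmorph_inj E.
    by apply: (vlt_irr vO (x := 1)); rewrite {1}E.
exists O' => // x; split=> [Ox|Ox]; last by apply: AO'; exists x.
have [->|x0] := eqVneq x 0; first exact: vr0.
case: (vleVlt O x 1) => [/vle1 //|x1].
have : vlt O' (j x)^-1 1.
  apply: IO'; exists x^-1; last by rewrite fmorphV.
  by apply/(vltM2lE vO _ _ x0); rewrite mulfV // mulr1.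
case; exists (j x); rewrite ?mulfV ?fmorph_eq0 //.
Qed.

(** * Norms on row vectors *)

Section ValMore.
Variables (R : fieldType) (O : R -> Prop) (vO : valuation_ring O).

Lemma vmax_seq (I : eqType) (s : seq I) (F : I -> R) : s != [::] ->
  exists2 i, i \in s & forall j, j \in s -> vle O (F j) (F i).
Proof.
elim: s => [//|i [|i' s'] IH] _.
  by exists i; [rewrite inE|move=> j; rewrite inE => /eqP ->; exact: vle_refl].
case: IH => // k ks hk; case: (vle_total vO (F i) (F k)) => h.
  by exists k; [rewrite inE ks orbT|move=> j; rewrite inE => /orP[/eqP -> //|]; apply: hk].
exists i; first by rewrite inE eqxx.
move=> j; rewrite inE => /orP[/eqP ->|/hk hj]; first exact: vle_refl.
exact: vle_trans hj h.
Qed.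

End ValMore.

Lemma vle_ext (L M : fieldType) (j : {rmorphism L -> M}) (O : L -> Prop) (O' : M -> Prop) a b :
  valuation_ring O -> valuation_ring O' -> extends j O O' ->
  vle O' (j a) (j b) <-> vle O a b.
Proof.
move=> vO vO' ex; have [->|b0] := eqVneq b 0.
  rewrite rmorph0; split=> [/vle_0/eqP|/vle_0 ->]; last by rewrite rmorph0; apply: vle0.
  by rewrite fmorph_eq0 => /eqP ->; apply: vle0.
by rewrite !vleP ?fmorph_eq0 // -fmorph_div; apply: ex.
Qed.

(** Comparison of maximum norms without a value group: each coordinate of f is bounded by some
    coordinate of h. *)
Definition nle (R : fieldType) (O : R -> Prop) g (f h : 'rV[R]_g) : Prop :=
  forall s, exists s', vle O (f 0 s) (h 0 s').
Definition nlt (R : fieldType) (O : R -> Prop) g (f h : 'rV[R]_g) : Prop := ~ nle O h f.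

Section Norm.
Variables (R : fieldType) (O : R -> Prop) (vO : valuation_ring O) (g : nat).
Implicit Types (f h k : 'rV[R]_g) (a b : R).

Lemma nmax f : f != 0 -> exists2 s, f 0 s != 0 & forall s', vle O (f 0 s') (f 0 s).
Proof.
move=> f0; have [s fs] : exists s, f 0 s != 0.
  apply: contrapT => h; move/eqP: f0; apply; apply/rowP => s; rewrite mxE.
  by apply: contrapT => /eqP fs; apply: h; exists s.
have [i _ hi] := @vmax_exists _ _ vO _ xpredT (fun s => f 0 s) s isT.
exists i => [|s']; last exact: hi.
by apply/(vlt0 vO); apply: (vlt_le_trans vO _ (hi s isT)); apply/(vlt0 vO).
Qed.

Lemma nle_refl f : nle O f f. Proof. by move=> s; exists s; apply: vle_refl. Qed.
Lemma nle_trans h f k : nle O f h -> nle O h k -> nle O f k.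
Proof. by move=> h1 h2 s; have [t ht] := h1 s; have [u hu] := h2 t; exists u; apply: vle_trans hu. Qed.
Lemma nle0 f : nle O 0 f.
Proof. by move=> s; exists s; rewrite mxE; apply: vle0. Qed.
Lemma nle_0 f : nle O f 0 -> f = 0.
Proof. by move=> h; apply/rowP => s; have [t] := h s; rewrite !mxE => /vle_0. Qed.
Lemma nle_total f h : nle O f h \/ nle O h f.
Proof.
have [->|/nmax [s _ hs]] := eqVneq h 0; first by right; apply: nle0.
have [|] := EM (forall t, vle O (f 0 t) (h 0 s)); first by left=> t; exists s.
move/existsNP => [t /(vltW vO) ht]; right=> u; exists t; exact: vle_trans (hs u) ht.
Qed.
Lemma nltW f h : nlt O f h -> nle O f h.
Proof. by move=> n; case: (nle_total f h) => // /n. Qed.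
Lemma nleVlt f h : nle O f h \/ nlt O h f.
Proof. by case: (EM (nle O f h)); [left|right]. Qed.
Lemma nle_lt_trans h f k : nle O f h -> nlt O h k -> nlt O f k.
Proof. by move=> h1 h2 h3; apply: h2; apply: nle_trans h3 h1. Qed.
Lemma nlt_le_trans h f k : nlt O f h -> nle O h k -> nlt O f k.
Proof. by move=> h1 h2 h3; apply: h1; apply: nle_trans h2 h3. Qed.
Lemma nlt_neq0 f h : nlt O f h -> h != 0.
Proof. by move=> n; apply/eqP => h0; apply: n; rewrite h0; apply: nle0. Qed.
Lemma nlt0 f : f != 0 -> nlt O 0 f.
Proof. by move=> /eqP f0 /nle_0. Qed.

Lemma nleD f h k : nle O f k -> nle O h k -> nle O (f + h) k.
Proof.
move=> h1 h2; have [k0|k0] := eqVneq k 0.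
  by move: h1 h2; rewrite k0 => /nle_0 -> /nle_0 ->; rewrite addr0; apply: nle_refl.
have [s _ hs] := nmax k0; move=> t; exists s; rewrite mxE; apply: vleD => //.
  by have [u hu] := h1 t; apply: vle_trans hu (hs u).
by have [u hu] := h2 t; apply: vle_trans hu (hs u).
Qed.
Lemma nleN f k : nle O f k -> nle O (- f) k.
Proof. by move=> h s; have [t ht] := h s; exists t; rewrite mxE; apply: vleN. Qed.
Lemma nleB f h k : nle O f k -> nle O h k -> nle O (f - h) k.
Proof. by move=> ? ?; apply: nleD => //; apply: nleN. Qed.
Lemma nle_sum (I : Type) (r : seq I) (P : pred I) (F : I -> 'rV[R]_g) k :
  (forall i, P i -> nle O (F i) k) -> nle O (\sum_(i <- r | P i) F i) k.
Proof. by move=> h; apply: (big_ind (fun x => nle O x k)) => //; [exact: nle0|move=> *; apply: nleD]. Qed.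
Lemma nltD f h k : nlt O f k -> nlt O h k -> nlt O (f + h) k.
Proof.
move=> h1 h2; case: (nle_total f h) => n.
  by apply: nle_lt_trans h2; apply: nleD => //; apply: nle_refl.
by apply: nle_lt_trans h1; apply: nleD => //; apply: nle_refl.
Qed.
Lemma nlt_sum (I : Type) (r : seq I) (P : pred I) (F : I -> 'rV[R]_g) k :
  k != 0 -> (forall i, P i -> nlt O (F i) k) -> nlt O (\sum_(i <- r | P i) F i) k.
Proof. by move=> k0 h; apply: (big_ind (fun x => nlt O x k)) => //; [exact: nlt0|move=> *; apply: nltD]. Qed.
Lemma nleZ a b f h : vle O a b -> nle O f h -> nle O (a *: f) (b *: h).
Proof. by move=> ab n s; have [t ht] := n s; exists t; rewrite !mxE; apply: vleM. Qed.
Lemma nleZE a f h : a != 0 -> nle O (a *: f) (a *: h) <-> nle O f h.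
Proof.
move=> a0; split=> n; last by apply: nleZ => //; apply: vle_refl.
have := nleZ (vle_refl vO a^-1) n; by rewrite !scalerA mulVf // !scale1r.
Qed.
Lemma nltZE a f h : a != 0 -> nlt O (a *: f) (a *: h) <-> nlt O f h.
Proof. by move=> a0; split=> n1 n2; apply: n1; apply/(nleZE _ _ a0). Qed.
Lemma nleZr a b f : f != 0 -> nle O (a *: f) (b *: f) <-> vle O a b.
Proof.
move=> f0; split=> [n|ab]; last by apply: nleZ => //; apply: nle_refl.
have [s fs hs] := nmax f0; have [t] := n s; rewrite !mxE => ht.
by apply/(vleM2rE vO _ _ fs); apply: vle_trans ht _ => //; apply: vleM2l.
Qed.
Lemma nltZr a b f : f != 0 -> nlt O (a *: f) (b *: f) <-> vlt O a b.
Proof. by move=> f0; split=> n1 n2; apply: n1; apply/(nleZr _ _ f0). Qed.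
End Norm.

(** * Extensions by a value-independent family *)

Section Monomials.
Variables (R : fieldType) (d : nat).
Definition tmon (T : 'I_d -> R) (m : 'I_d -> nat) : R := \prod_i T i ^+ m i.

Lemma tmonD T m n : tmon T (fun i => m i + n i)%N = tmon T m * tmon T n.
Proof. by rewrite -big_split; apply: eq_bigr => i _; rewrite exprD. Qed.
Lemma tmonX T m k : tmon T m ^+ k = tmon T (fun i => m i * k)%N.
Proof. by rewrite -prodrXl; apply: eq_bigr => i _; rewrite exprM. Qed.
Lemma tmon_neq0 T m : (forall i, T i != 0) -> tmon T m != 0.
Proof. by move=> h; apply/prodf_neq0 => i _; rewrite expf_neq0. Qed.

(** Natural exponents suffice: a relation with integer exponents is brought into this form by moving
    the negative ones to the other side. So this says that the values of T are linearly independent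
    over the integers modulo those of K. *)
Definition vindep (O K : R -> Prop) (T : 'I_d -> R) : Prop :=
  (forall i, T i != 0) /\
  forall c c' m n, K c -> K c' -> c != 0 -> c' != 0 ->
    veq O (c * tmon T m) (c' * tmon T n) -> m =1 n.

(** The terms of a polynomial at T have pairwise distinct values, so the largest one dominates the
    sum of the others. *)
Lemma vindep_lead (O S : R -> Prop) T (p : {mpoly R[d]}) : valuation_ring O ->
  vindep O S T -> (forall m, S p@_m) -> p != 0 ->
  exists m, [/\ m \in msupp p, p@_m * tmon T m != 0 &
    vlt O (p.@[T] - p@_m * tmon T m) (p@_m * tmon T m)].
Proof.
move=> vO [T0 iT] hp p0.
have [|m ms hm] := @vmax_seq _ _ vO _ (msupp p) (fun m : 'X_{1..d} => p@_m * tmon T m).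
  by rewrite msupp_eq0.
have h0 (n : 'X_{1..d}) : n \in msupp p -> p@_n * tmon T n != 0.
  by rewrite mcoeff_msupp => pn; rewrite mulf_neq0 // tmon_neq0.
exists m; split=> //; first exact: h0.
rewrite mevalE (bigD1_seq m) //= addrAC subrr add0r big_seq_cond.
apply: vlt_sum => //; first exact: h0.
move=> n /andP[ns nm] h; move/eqP: nm; apply; apply/mnmP => i.
by apply: (iT p@_n p@_m n m) => //; rewrite -?mcoeff_msupp //; split; [exact: hm|].
Qed.

Lemma vindep_meval (O S : R -> Prop) T (p : {mpoly R[d]}) : valuation_ring O ->
  vindep O S T -> (forall m, S p@_m) -> p.@[T] = 0 -> p = 0.
Proof.
move=> vO iT hp e; apply: contrapT => /eqP p0.
have [m [_ h0]] := vindep_lead vO iT hp p0; rewrite e sub0r => h.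
by apply: (vlt_irr vO (x := p@_m * tmon T m)); apply: (vlt_veql vO _ h); apply/veq_sym/veqN.
Qed.
End Monomials.

Section Adjunction.
Variables (R : fieldType).
Definition adj (S : R -> Prop) (z : R) := ratT S (fun _ : 'I_1 => z).

Lemma polyT1 (S : R -> Prop) z x : is_subfield S -> polyT S (fun _ : 'I_1 => z) x ->
  exists2 p : {poly R}, forall i, S p`_i & x = p.[z].
Proof.
move=> hS [p [hp ->]]; exists (\sum_(m <- msupp p) p@_m *: 'X^(m ord0)).
  move=> i; rewrite coef_sum; apply: sf_sum => // m _; rewrite coefZ coefXn.
  by case: eqP => _; rewrite ?mulr1 ?mulr0 //; apply: sf0.
rewrite mevalE horner_sum; apply: eq_bigr => m _.
by rewrite hornerZ hornerXn big_ord_recl big_ord0 mulr1.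
Qed.

Lemma ratT_denom (S : R -> Prop) d (T : 'I_d -> R) (p : {poly R}) : is_subfield S ->
  (forall i, ratT S T p`_i) ->
  exists b, [/\ polyT S T b, b != 0 & forall i, polyT S T (b * p`_i)].
Proof.
move=> hS hp; have hP : forall n, exists b, [/\ polyT S T b, b != 0 &
    forall i, (i < n)%N -> polyT S T (b * p`_i)].
  elim=> [|n [b [hb b0 IH]]].
    by exists 1; split; rewrite ?oner_neq0 //; apply: polyT_const => //; apply: sf1.
  have [a [c [ha hc c0 E]]] := hp n; exists (b * c); split.
  - exact: polyTM.
  - by rewrite mulf_neq0.
  - move=> i; rewrite ltnS leq_eqVlt => /orP[/eqP ->|/IH h].
      by rewrite E -mulrA (mulrC a) mulVKf //; apply: polyTM.
    by rewrite mulrAC; apply: polyTM.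
have [b [hb b0 h]] := hP (size p); exists b; split=> // i.
case: (ltnP i (size p)) => [/h //|si]; rewrite nth_default // mulr0.
by apply: polyT_const => //; apply: sf0.
Qed.

Lemma alg_clos_root (S : R -> Prop) n b : alg_closed R -> is_subfield S ->
  (forall x, alg S x -> S x) -> (0 < n)%N -> S b -> exists2 c, S c & c ^+ n = b.
Proof.
move=> cl hS aS n0 Sb; have sz : size ('X^n - b%:P) = n.+1 by rewrite size_XnsubC.
have [|c hc] := cl ('X^n - b%:P); first by rewrite sz eqSS -lt0n.
exists c; last by move: hc; rewrite rootE !hornerE subr_eq0 => /eqP.
apply: aS; exists ('X^n - b%:P); split=> //; first by rewrite -size_poly_gt0 sz.
move=> i; rewrite coefB coefXn coefC; apply: sfB => //.
  by case: eqP => _; [exact: sf1|exact: sf0].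
by case: eqP => _ //; exact: sf0.
Qed.

(** A polynomial over S splits into linear factors with roots in S, so its value at z is a product
    of values |z - a|, all of which are values of S. For u algebraic over S(z), two terms of its
    equation have equal value; hence a power of u has the value of an element of S, and S contains
    the required roots. *)
Lemma adj_immediate (O S : R -> Prop) z : valuation_ring O -> alg_closed R ->
  is_subfield S -> (forall x, alg S x -> S x) ->
  (forall a, S a -> exists2 b, S b & veq O (z - a) b) ->
  forall u, alg (adj S z) u -> exists2 b, S b & veq O u b.
Proof.
move=> vO cl hS aS hz u.
have hP x : polyT S (fun _ : 'I_1 => z) x -> exists2 b, S b & veq O x b.
  move=> /(polyT1 hS) [p hp ->]; have [->|p0] := eqVneq p 0.
    by exists 0; [exact: sf0|rewrite horner0; apply: veq_refl].
  have [rs E] := alg_closed_split p cl.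
  have Srs r : r \in rs -> S r.
    by move=> h; apply: aS; apply: (alg_roots hS p0 _ E) => // i; apply: alg_incl.
  suff [b Sb hb] : exists2 b, S b & veq O (\prod_(r <- rs) (z - r)) b.
    exists (lead_coef p * b); first by apply: sfM => //; apply: hp.
    rewrite {1}E hornerZ horner_prod; apply: veqM => //; first exact: veq_refl.
    by under eq_bigr => r _ do rewrite hornerXsubC.
  elim: (rs) Srs => [|r s IH] hs.
    by exists 1; [exact: sf1|rewrite big_nil; apply: veq_refl].
  have [|b Sb hb] := IH; first by move=> t ts; apply: hs; rewrite inE ts orbT.
  have [c Sc hc] := hz r (hs r (mem_head _ _)).
  by exists (c * b); [exact: sfM|rewrite big_cons; apply: veqM].
have hR x : adj S z x -> exists2 b, S b & veq O x b.
  case=> [a [c [/hP [a' Sa' ha] /hP [c' Sc' hc] c0 ->]]].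
  by exists (a' / c'); [exact: sf_div|apply: veqM => //; apply: veqV].
have [->|u0] := eqVneq u 0; first by exists 0; [exact: sf0|apply: veq_refl].
move=> [p [p0 hp /rootP]]; rewrite horner_coef => E.
pose F (i : 'I_(size p)) := p`_i * u ^+ i.
have sp : (0 < size p)%N by rewrite size_poly_gt0.
have spp : ((size p).-1 < size p)%N by rewrite ltn_predL.
have [||i [j [ij Fi Fij]]] := @sum0_two_max _ _ vO _ F (Ordinal spp); first exact: E.
  by rewrite mulf_neq0 ?expf_neq0 //= -lead_coefE lead_coef_eq0.
wlog ltij : i j ij Fi Fij / (i < j)%N => [H|].
  case: (ltngtP i j) => [|lt|/val_inj e]; first exact: H.
    apply: (H j i) => //; [by rewrite eq_sym|exact: veq_neq0 Fij Fi|exact: veq_sym].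
  by rewrite e eqxx in ij.
have pi0 : p`_i != 0 by apply: contraNneq Fi => e; rewrite /F e mul0r.
have Fj := veq_neq0 Fij Fi.
have pj0 : p`_j != 0 by apply: contraNneq Fj => e; rewrite /F e mul0r.
have hu : veq O (u ^+ (j - i)) (p`_i / p`_j).
  apply/(veqM2lE vO _ _ pj0); rewrite mulrCA mulfV // mulr1.
  apply/(veqM2rE vO _ _ (expf_neq0 i u0)); rewrite -mulrA -exprD subnK; last exact: ltnW.
  exact: veq_sym.
have [b Sb hb] : exists2 b, S b & veq O (p`_i / p`_j) b.
  by apply: hR; apply: sf_div => //; apply: ratT_subfield.
have [|c Sc Ec] := alg_clos_root cl hS aS _ Sb (n := (j - i)%N); first by rewrite subn_gt0.
exists c => //; apply/(veqXE vO _ _ (n := (j - i)%N)); first by rewrite subn_gt0.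
by rewrite Ec; apply: veq_trans hb.
Qed.
End Adjunction.

(** * Best approximations over an algebraically closed base *)

Section Ultrapower.
Variables (J : Type) (U : (J -> Prop) -> Prop) (hU : ultra U) (R : fieldType).
Local Notation M := (uprod hU (fun _ : J => R)).
Definition udiag : R -> M := umor hU (fun _ : J => (idfun : {rmorphism R -> R})).
HB.instance Definition _ := GRing.RMorphism.on udiag.

Lemma udiagE a : udiag a = umk hU (fun _ => a). Proof. by []. Qed.

Lemma udiag_ext (O : R -> Prop) : extends udiag O (uO (hU := hU) (fun _ => O)).
Proof.
by move=> a; rewrite udiagE uO_mk; split=> [/(uE hU) [] //|Oa]; apply: (uT hU).
Qed.

Lemma uO_subfield (S : R -> Prop) : is_subfield S -> is_subfield (uO (hU := hU) (fun _ => S)).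
Proof.
move=> hS; split=> [|x y|x y|x].
- by rewrite -umk1; apply/uO_mk; apply: (uT hU) => j; apply: sf1.
- elim/umk_ind: x => f; elim/umk_ind: y => g; rewrite umkN umkD !uO_mk => h1 h2.
  by apply: (uI hU h1 h2) => j ? ?; apply: sfB.
- elim/umk_ind: x => f; elim/umk_ind: y => g; rewrite umkM !uO_mk => h1 h2.
  by apply: (uI hU h1 h2) => j ? ?; apply: sfM.
by elim/umk_ind: x => f; rewrite umkV !uO_mk => h; apply: (uS hU h) => j ?; apply: sfV.
Qed.

Lemma uO_alg (S : R -> Prop) x : is_subfield S -> (forall y, alg S y -> S y) ->
  alg (uO (hU := hU) (fun _ => S)) x -> uO (hU := hU) (fun _ => S) x.
Proof.
move=> hS aS [p [p0 hp]]; elim/umk_ind: x => f /rootP.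
rewrite upoly_horner => /umk_eq0 h1; apply/uO_mk.
have h2 := @u_all _ _ hU 'I_(size p) xpredT (fun i j => S (ufun p`_i j)) (fun i _ => hp i).
have h3 := uI hU h1 (upoly_size p) (fun j a b => conj a b).
apply: (uI hU h2 h3) => j hj [rj sj]; apply: aS; exists (upoly p j); split.
- by rewrite -size_poly_gt0 sj size_poly_gt0.
- move=> i; rewrite coef_poly; case: ltnP => hi; last exact: sf0.
  exact: (hj (Ordinal hi)).
- exact/rootP.
Qed.

Lemma umkv_nle (O : R -> Prop) g (F : J -> 'rV[R]_g) (h : 'rV[R]_g) : valuation_ring O ->
  U (fun j => nle O (F j) h) ->
  nle (uO (hU := hU) (fun _ => O)) (\row_s umk hU (fun j => F j 0 s)) (map_mx udiag h).
Proof.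
move=> vO hF; have [h0|h0] := eqVneq h 0.
  move=> s; exists s; rewrite !mxE h0 mxE udiagE; apply/uO_vle => //.
  by apply: (uS hU hF) => j; rewrite h0 => /nle_0 ->; rewrite mxE; apply: vle0.
have [t _ ht] := nmax vO h0 => s; exists t; rewrite !mxE udiagE; apply/uO_vle => //.
by apply: (uS hU hF) => j /(_ s) [u hu]; apply: (vle_trans vO hu); apply: ht.
Qed.
End Ultrapower.

Definition image (R M : Type) (j : R -> M) (S : R -> Prop) (y : M) := exists2 x, S x & y = j x.

Section ImageSubfield.
Variables (R M : fieldType) (j : {rmorphism R -> M}) (S : R -> Prop) (hS : is_subfield S).

Lemma image_subfield : is_subfield (image j S).
Proof.
split=> [|_ _ [x Sx ->] [y Sy ->]|_ _ [x Sx ->] [y Sy ->]|_ [x Sx ->]].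
- by exists 1; rewrite ?rmorph1 //; apply: sf1.
- by exists (x - y); rewrite ?rmorphB //; apply: sfB.
- by exists (x * y); rewrite ?rmorphM //; apply: sfM.
- by exists x^-1; rewrite ?fmorphV //; apply: sfV.
Qed.

Lemma image_alg (x : R) : alg S x -> alg (image j S) (j x).
Proof.
move=> [p [p0 hp px]]; exists (map_poly j p); split; rewrite ?map_poly_eq0 ?fmorph_root //.
by move=> i; rewrite coef_map; exists p`_i.
Qed.

Lemma image_ratT d (T : 'I_d -> R) x : ratT S T x -> ratT (image j S) (j \o T) (j x).
Proof.
have hI := ratT_subfield (j \o T) image_subfield.
apply: (ratT_min (P := fun x => ratT (image j S) (j \o T) (j x))) => //.
- split=> [|y z|y z|y]; rewrite ?rmorph1 ?rmorphB ?rmorphM ?fmorphV.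
  + exact: sf1.
  + exact: sfB.
  + exact: sfM.
  + exact: sfV.
- by move=> y Sy; apply: ratT_const; [exact: image_subfield|exists y].
- by move=> i; apply: (ratT_var (j \o T) image_subfield).
Qed.

Lemma image_alg_closed (x : M) : alg_closed R -> (forall y, alg S y -> S y) ->
  alg (image j S) x -> image j S x.
Proof.
move=> cl aS [p [p0 hp px]].
have hq i : exists y, S y /\ p`_i = j y by case: (hp i) => y; exists y.
pose q : {poly R} := \poly_(i < size p) sval (cid (hq i)).
have Eq : map_poly j q = p.
  apply/polyP => i; rewrite coef_map coef_poly; case: ltnP => h.
    by case: (cid _) => y /= [_ e]; exact/esym.
  by rewrite nth_default //; exact: (rmorph0 j).
have q0 : q != 0 by rewrite -(map_poly_eq0 j) Eq.
have Sq i : S q`_i.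
  by rewrite coef_poly; case: ifP => _; [case: (cid _) => y []|exact: sf0].
have [rs Ers] := alg_closed_split q cl.
move: px; rewrite -Eq Ers map_polyZ rmorph_prod rootZ ?fmorph_eq0 ?lead_coef_eq0 //.
under eq_bigr => r _ do rewrite /= map_polyXsubC.
rewrite -(big_map j xpredT (fun r => 'X - r%:P)) root_prod_XsubC => /mapP [r rrs ->].
exists r => //; apply: aS; apply: (alg_roots hS q0 _ Ers) => // i; exact: alg_incl.
Qed.
End ImageSubfield.

Lemma ratT_mono (R : fieldType) (S S' : R -> Prop) d (T : 'I_d -> R) x :
  is_subfield S' -> (forall y, S y -> S' y) -> ratT S T x -> ratT S' T x.
Proof.
move=> hS' h [a [b [[p [hp ->]] [q [hq ->]] b0 ->]]].
by exists p.@[T], q.@[T]; split=> //; [exists p|exists q]; split=> // m; apply: h.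
Qed.

(** Here W is algebraic over K(T), so that all transcendence of W over K is accounted for by values.
    These are the properties that survive when a limit is adjoined to K and W inside an ultrapower
    of R. *)
Record abhyankar (R : fieldType) (O K W : R -> Prop) d (T : 'I_d -> R) : Prop := Abhyankar {
  ab_vr : valuation_ring O;
  ab_closed : alg_closed R;
  ab_K : is_subfield K;
  ab_W : is_subfield W;
  ab_KW : forall x, K x -> W x;
  ab_Kalg : forall x, alg K x -> K x;
  ab_Walg : forall x, alg W x -> W x;
  ab_T : vindep O K T;
  ab_alg : forall x, W x -> alg (ratT K T) x }.

Section Scalar.
Variables (R : fieldType) (O K W : R -> Prop) (d : nat) (T : 'I_d -> R).
Hypothesis ab : abhyankar O K W T.
Let vO := ab_vr ab.
Let hK := ab_K ab.

Lemma vindep_immediate (S : R -> Prop) : (forall u, S u -> exists2 b, K b & veq O u b) ->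
  vindep O S T.
Proof.
move=> h; have [T0 iT] := ab_T ab; split=> // c c' m n /h [b Kb hb] /h [b' Kb' hb'] c0 c'0 e.
apply: (iT b b') => //; [exact: veq_neq0 hb c0|exact: veq_neq0 hb' c'0|].
apply: (veq_trans vO (y := c * tmon T m)).
  by apply: veqM => //; [exact: veq_sym|exact: veq_refl].
by apply: veq_trans e _ => //; apply: veqM => //; exact: veq_refl.
Qed.

(* Otherwise K(a) would be an immediate extension of K, T would still be
   value-independent over K(a), and a would be transcendental over K(T). *)
Lemma best_scalar a : W a -> exists2 c, K c & forall c', K c' -> vle O (a - c) (a - c').
Proof.
move=> Wa; apply: contrapT => nb.
have {}nb c : K c -> exists2 c', K c' & vlt O (a - c') (a - c).
  move=> Kc; apply: contrapT => h; apply: nb; exists c => // c' Kc'.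
  by case: (vleVlt O (a - c) (a - c')) => // h'; case: h; exists c'.
have nKa : ~ K a.
  by move=> /nb [c' _]; rewrite subrr; apply; apply: vle0.
(* An element c' of K closer to a than c makes c' - c have the same value as a - c. *)
have hz c : K c -> exists2 b, K b & veq O (a - c) b.
  move=> Kc; have [c' Kc' h] := nb c Kc; exists (c' - c); first exact: sfB.
  apply: veq_sym; apply: veq_close => //.
  by rewrite opprB addrA subrK -opprB; apply: vltN.
have imm := adj_immediate vO (ab_closed ab) hK (ab_Kalg ab) hz.
have hA : is_subfield (adj K a) by apply: ratT_subfield.
have hAA := alg_subfield hA.
have iT := vindep_immediate imm.
have [p [p0 hp /rootP pa]] := ab_alg ab Wa.
have [b [hb b0 hbp]] := ratT_denom hK hp.
have hq i : exists q : {mpoly R[d]}, (forall m, K q@_m) /\ b * p`_i = q.@[T] by exact: hbp.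
pose q i := sval (cid (hq i)).
have Kq i m : K (q i)@_m by rewrite /q; case: (cid _) => ? [].
have Eq i : b * p`_i = (q i).@[T] by rewrite /q; case: (cid _) => ? [].
have Ka x : K x -> alg (adj K a) x by move=> Kx; apply: alg_incl => //; apply: ratT_const.
have aa : alg (adj K a) a by apply: alg_incl => //; exact: (ratT_var (fun _ : 'I_1 => a) hK ord0).
(* The equation of a over K(T), freed of denominators, is read as a polynomial in T with
   coefficients in K(a). It vanishes at T, hence identically. *)
pose P := \sum_(i < size p) a ^+ i *: q i.
have P0 : P = 0.
  apply: (vindep_meval vO iT) => [m|].
    rewrite raddf_sum /=; apply: sf_sum => // i _; rewrite mcoeffZ; apply: sfM => //.
      exact: sfX.
    exact: Ka.
  rewrite raddf_sum /=; transitivity (b * p.[a]); last by rewrite pa mulr0.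
  rewrite horner_coef mulr_sumr.
  by apply: eq_bigr => i _; rewrite mevalZ -Eq mulrCA [a ^+ i * _]mulrC.
(* Each coefficient of P is a polynomial in a over K; were it not identically zero, a would be
   algebraic over K and so belong to K. *)
have q0 i m : (i < size p)%N -> (q i)@_m = 0.
  move=> ip; apply: contrapT => qim; apply: nKa; apply: (ab_Kalg ab).
  pose r := \poly_(i < size p) (q i)@_m; exists r; split.
  - by apply/eqP => /polyP /(_ i); rewrite coef_poly ip coef0.
  - by move=> k; rewrite coef_poly; case: ifP => // _; apply: sf0.
  - rewrite rootE horner_poly; move/mpolyP: P0 => /(_ m); rewrite mcoeff0 raddf_sum /= => h.
    by apply/eqP; rewrite -[RHS]h; apply: eq_bigr => k _; rewrite mcoeffZ mulrC.
move/eqP: p0; apply; apply/polyP => i; rewrite coef0.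
case: (ltnP i (size p)) => ip; last by rewrite nth_default.
apply: (mulfI b0); rewrite mulr0 Eq mevalE big1_seq // => m _.
by rewrite q0 // mul0r.
Qed.
End Scalar.

Definition best (R : fieldType) (O K : R -> Prop) g N (b : 'I_N -> 'rV[R]_g) f :=
  exists2 c : 'I_N -> R, forall i, K (c i) & forall c' : 'I_N -> R, (forall i, K (c' i)) ->
    nle O (f - \sum_i c i *: b i) (f - \sum_i c' i *: b i).

(** The statement ranges over all fields because the induction on N applies its hypothesis in an
    ultrapower, with K and W enlarged. *)
Definition best_rv N := forall (R : fieldType) (O K W : R -> Prop) d (T : 'I_d -> R) g
  (b : 'I_N -> 'rV[R]_g) (f : 'rV[R]_g), abhyankar O K W T ->
  (forall i s, W (b i 0 s)) -> (forall s, W (f 0 s)) -> best O K b f.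

Section BestStep.
Variable (N : nat) (IH : best_rv N).
Variables (R : fieldType) (O K W : R -> Prop) (d : nat) (T : 'I_d -> R) (g : nat).
Variables (b0 : 'rV[R]_g) (b : 'I_N -> 'rV[R]_g) (f : 'rV[R]_g).
Hypothesis ab : abhyankar O K W T.
Hypotheses (Wb0 : forall s, W (b0 0 s)) (Wb : forall i s, W (b i 0 s)) (Wf : forall s, W (f 0 s)).
Hypothesis orth : forall c0 (c : 'I_N -> R), K c0 -> (forall i, K (c i)) ->
  nle O (c0 *: b0) (c0 *: b0 + \sum_i c i *: b i).
Let vO := ab_vr ab.
Let hK := ab_K ab.
Let hW := ab_W ab.
Let res c0 (c : 'I_N -> R) := f - c0 *: b0 - \sum_i c i *: b i.

(** Changing the first coefficient of a residual from c0' to c0 alters it by a vector no larger than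
    the residual. So c0 may be fixed, and f - c0 b0 is approximated by N vectors. *)
Lemma best_step_limit c0 : K c0 ->
  (forall c0' c', K c0' -> (forall i, K (c' i)) -> nle O ((c0 - c0') *: b0) (res c0' c')) ->
  exists2 c : 'I_N -> R, forall i, K (c i) & forall c0' c', K c0' -> (forall i, K (c' i)) ->
    nle O (res c0 c) (res c0' c').
Proof.
move=> Kc0 lim; have [|c Kc hc] := IH (f := f - c0 *: b0) ab Wb.
  by move=> s; rewrite !mxE; apply: sfB => //; apply: sfM => //; exact: (ab_KW ab Kc0).
exists c => // c0' c' Kc0' Kc'; apply: (nle_trans vO (hc c' Kc')).
have -> : f - c0 *: b0 - \sum_i c' i *: b i = res c0' c' - (c0 - c0') *: b0.
  by apply/rowP => s; rewrite /res !mxE; ring.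
by apply: nleB => //; [exact: nle_refl|exact: lim].
Qed.

Definition ktuple := {c : R * ('I_N -> R) | K c.1 /\ forall i, K (c.2 i)}.
Definition kres (c : ktuple) := res (sval c).1 (sval c).2.

Lemma kt0 : ktuple.
Proof. by exists (0, fun=> 0); split=> [|i]; apply: sf0. Qed.

Lemma kres_ultra : exists U, ultra U /\
  forall c : ktuple, U (fun c' => nle O (kres c') (kres c)).
Proof.
apply: (@ultra_exists ktuple ktuple (fun c c' => nle O (kres c') (kres c)) kt0) => [c c'|c].
  case: (nle_total vO (kres c) (kres c')) => h.
    by exists c => c'' h''; split=> //; apply: nle_trans h.
  by exists c' => c'' h''; split=> //; apply: nle_trans h.
by exists c; apply: nle_refl.
Qed.

(** By [orth], the vector (c0' - c0) b0 is bounded by the difference of the two residuals. The first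
    coefficients of ever better residuals thus behave like a pseudo-Cauchy family. *)
Lemma kres_diff (c c' : ktuple) : nle O (kres c') (kres c) ->
  nle O (((sval c').1 - (sval c).1) *: b0) (kres c).
Proof.
case: c c' => [[c0 c] /= [Kc0 Kc]] [[c0' c'] /= [Kc0' Kc']]; rewrite /kres /= => h.
have := @orth (c0' - c0) (fun i => c' i - c i); move=> /(_ _ _)/nle_trans; apply => //.
- exact: sfB.
- by move=> i; apply: sfB.
have -> : (c0' - c0) *: b0 + \sum_i (c' i - c i) *: b i = res c0 c - res c0' c'.
  under eq_bigr => i _ do rewrite scalerBl.
  rewrite sumrB scalerBl /res !opprB !addrA; apply/eqP; rewrite -subr_eq0; apply/eqP.
  by apply/rowP => s; rewrite !mxE; ring.
by apply: nleB => //; apply: nle_refl.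
Qed.

(** * No element of K is a limit of the first coefficients: a limit is found in an ultrapower *)

Section NoLimit.
Hypothesis nolim : forall c0, K c0 -> exists c : ktuple,
  nlt O (kres c) ((c0 - (sval c).1) *: b0).
Variables (U : (ktuple -> Prop) -> Prop) (hU : ultra U).
Hypothesis Ures : forall c : ktuple, U (fun c' => nle O (kres c') (kres c)).
Local Notation M := (uprod hU (fun _ : ktuple => R)).
Local Notation io := (udiag hU (R := R)).
Let OM : M -> Prop := uO (hU := hU) (fun _ => O).
Let vOM : valuation_ring OM. Proof. by apply: uO_valuation => j; exact: vO. Qed.
Let z : M := umk hU (fun c => (sval c).1).
Let iK := image io K.
Let iW := image io W.
Let hiK : is_subfield iK. Proof. exact: image_subfield. Qed.
Let hiW : is_subfield iW. Proof. exact: image_subfield. Qed.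
Let ex : extends io O OM. Proof. exact: udiag_ext. Qed.
Let vex a c : vle OM (io a) (io c) <-> vle O a c. Proof. exact: vle_ext. Qed.
Let K1 := alg (adj iK z).
Let W1 := alg (adj iW z).
Let hK1 : is_subfield K1. Proof. by apply: alg_subfield; apply: ratT_subfield. Qed.
Let hW1 : is_subfield W1. Proof. by apply: alg_subfield; apply: ratT_subfield. Qed.

Lemma limit_dist (c : ktuple) : nle OM ((z - io (sval c).1) *: map_mx io b0) (map_mx io (kres c)).
Proof.
have := @umkv_nle _ _ hU R O g (fun c' => ((sval c').1 - (sval c).1) *: b0) (kres c) vO.
move=> H; have : U (fun c' => nle O (((sval c').1 - (sval c).1) *: b0) (kres c)).
  by apply: (uS hU (Ures c)) => c' /kres_diff.
move=> /H; apply: (nle_trans vOM).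
move=> s; exists s; rewrite !mxE /z udiagE umkN umkD udiagE umkM.
have -> : umk hU (fun j => ((sval j).1 - (sval c).1) * b0 0 s) =
  umk hU (fun j => (((sval j).1 - (sval c).1) *: b0) 0 s).
  by apply/umkP; apply: (uT hU) => j; rewrite mxE.
exact: vle_refl.
Qed.

(** Let ca be a best approximation of a in K. As ca is no limit, some residual is smaller than (ca -
    c) b0, where c is its first coefficient, and it bounds (z - c) b0; moreover |ca - c| <= |a - c|.
    Consequently z - a has the value of c - a, and adjoining z to W adds no value. *)
Lemma limit_close a : W a -> exists2 c, K c & vlt OM (z - io c) (io (a - c)).
Proof.
move=> Wa; have [ca Kca hca] := best_scalar ab Wa; have [c hc] := nolim Kca.
have [Kc0 _] := svalP c; exists (sval c).1 => //.
have b00 : b0 != 0 by apply: contraNneq (nlt_neq0 vO hc) => ->; rewrite scaler0.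
have h1 : vlt OM (z - io (sval c).1) (io (ca - (sval c).1)).
  apply/(nltZr vOM _ _ (f := map_mx io b0)).
    by rewrite map_mx_eq0.
  apply: (nle_lt_trans vOM (limit_dist c)) => h; apply: hc => s.
  have [t] := h s; rewrite !mxE -rmorphM => /vex ht; exists t; rewrite ?mxE //.
apply: (vlt_le_trans vOM h1); apply/vex.
rewrite -[ca - _](subrKA a) -opprB.
by apply: vleD => //; [apply: vleN => //; exact: hca|exact: vle_refl].
Qed.

Lemma limit_veq a : W a -> exists2 c, K c & veq OM (z - io a) (io (c - a)).
Proof.
move=> Wa; have [c Kc h] := limit_close Wa; exists c => //; apply: veq_close => //.
have -> : z - io a - io (c - a) = z - io c by rewrite rmorphB opprB addrA subrK.
by apply: (vlt_veqr vOM h); rewrite -opprB rmorphN; apply: veqN.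
Qed.

Lemma limit_K1 u : K1 u -> exists2 c, K c & veq OM u (io c).
Proof.
move=> K1u; have [|||_ [c Kc ->] hc] := adj_immediate vOM _ hiK _ _ K1u.
- by apply: uprod_closed => j; exact: (ab_closed ab).
- by move=> x; apply: image_alg_closed => //; [exact: (ab_closed ab)|exact: (ab_Kalg ab)].
- move=> _ [a Ka ->]; have [c Kc h] := limit_veq (ab_KW ab Ka).
  by exists (io (c - a)) => //; exists (c - a) => //; apply: sfB.
- by exists c.
Qed.

Lemma limit_W1 u : W1 u -> exists2 c, W c & veq OM u (io c).
Proof.
move=> W1u; have [|||_ [c Wc ->] hc] := adj_immediate vOM _ hiW _ _ W1u.
- by apply: uprod_closed => j; exact: (ab_closed ab).
- by move=> x; apply: image_alg_closed => //; [exact: (ab_closed ab)|exact: (ab_Walg ab)].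
- move=> _ [a Wa ->]; have [c Kc h] := limit_veq Wa.
  by exists (io (c - a)) => //; exists (c - a) => //; apply: sfB => //; exact: (ab_KW ab Kc).
- by exists c.
Qed.

(** No values are added to K, so T remains value-independent; z is adjoined to the base as well as
    to W, so that the larger field remains algebraic over the new base and T. *)
Lemma abhyankar_limit : abhyankar OM K1 W1 (io \o T).
Proof.
have hA := ratT_subfield (fun _ : 'I_1 => z) hiK.
have hB := ratT_subfield (fun _ : 'I_1 => z) hiW.
have iKW x : iK x -> iW x by case=> y Ky ->; exists y => //; exact: (ab_KW ab Ky).
split=> //.
- by apply: uprod_closed => j; exact: (ab_closed ab).
- by move=> x; apply: alg_mono => y; apply: ratT_mono.
- by move=> x; apply: alg_alg.
- by move=> x; apply: alg_alg.
- have [T0 iT] := ab_T ab; split=> [i|]; first by rewrite /= fmorph_eq0.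
  have tm m : tmon (io \o T) m = io (tmon T m).
    by rewrite rmorph_prod; apply: eq_bigr => i _; rewrite rmorphXn.
  move=> c c' m n /limit_K1 [e Ke he] /limit_K1 [e' Ke' he'] c0 c'0; rewrite !tm => h.
  apply: (iT e e' _ _ Ke Ke').
  + by rewrite -(fmorph_eq0 io); apply: veq_neq0 he c0.
  + by rewrite -(fmorph_eq0 io); apply: veq_neq0 he' c'0.
  suff: veq OM (io (e * tmon T m)) (io (e' * tmon T n)).
    by case=> /vex ? /vex ?.
  rewrite !rmorphM /=; apply: (veq_trans vOM (y := c * io (tmon T m))).
    by apply: veqM => //; [exact: veq_sym|exact: veq_refl].
  by apply: veq_trans h _ => //; apply: veqM => //; exact: veq_refl.
move=> x; set A := alg (ratT K1 (io \o T)).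
have hK1T := ratT_subfield (io \o T) hK1; have hAA : is_subfield A by apply: alg_subfield.
have K1K y : iK y -> K1 y by move=> h; apply: alg_incl => //; apply: ratT_const.
have WA y : iW y -> A y.
  case=> w Ww ->; have := image_alg io (ab_alg ab Ww); apply: alg_mono => u.
  case=> v hv ->; apply: (ratT_mono hK1 K1K); exact: image_ratT.
move=> W1x; apply: alg_alg => //; move: W1x; apply: alg_mono.
apply: ratT_min => // _; apply: alg_incl => //; apply: ratT_const => //.
by apply: alg_incl => //; exact: (ratT_var (fun _ : 'I_1 => z) hiK ord0).
Qed.

(** In the ultrapower the induction hypothesis approximates f - z b0, and its residual r1 is at most
    every residual formed over K. The inequalities are then read in a single component of the
    ultrapower, whose coefficients lie in K. *)
Lemma best_step_nolimit : exists c : ktuple, forall c', nle O (kres c) (kres c').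
Proof.
have abM := abhyankar_limit.
have W1i y : W y -> W1 (io y).
  by move=> Wy; apply: alg_incl; [exact: ratT_subfield|apply: ratT_const => //; exists y].
have W1z : W1 z.
  by apply: alg_incl; [exact: ratT_subfield|exact: (ratT_var (fun _ : 'I_1 => z) hiW ord0)].
have [||c K1c hc] := IH (b := fun i => map_mx io (b i)) (f := map_mx io f - z *: map_mx io b0) abM.
- by move=> i s; rewrite mxE; apply: W1i.
- by move=> s; rewrite !mxE; apply: sfB => //; [|apply: sfM => //]; rewrite ?mxE; apply: W1i.
set r1 := _ - _ in hc.
have W1c i : W1 (c i) by exact: (ab_KW abM).
have W1r s : W1 (r1 0 s).
  rewrite !mxE summxE; apply: sfB => //; [apply: sfB => //; [|apply: sfM => //]|].
  - exact: W1i.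
  - exact: W1i.
  - by apply: sf_sum => // i _; rewrite !mxE; apply: sfM => //; apply: W1i.
(* The coefficients are algebraic over K(z), while the ultrapower of K contains z and is relatively
   algebraically closed. *)
have Kc i : uO (hU := hU) (fun _ => K) (c i).
  apply: (uO_alg hK (ab_Kalg ab)); move: (K1c i); apply: alg_mono.
  apply: ratT_min; first exact: uO_subfield.
    by move=> _ [y Ky ->]; rewrite udiagE; apply/uO_mk; apply: (uT hU).
  by move=> _; apply/uO_mk; apply: (uT hU) => j; case: (svalP j).
have r1_le (c' : ktuple) : nle OM r1 (map_mx io (kres c')).
  have [_ Kc'] := svalP c'.
  have := hc (fun i => io ((sval c').2 i)); move=> /(_ _)/nle_trans; apply => //.
    move=> i; apply: alg_incl; first exact: ratT_subfield.
    by apply: ratT_const => //; exists ((sval c').2 i).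
  have -> : map_mx io f - z *: map_mx io b0 - \sum_i io ((sval c').2 i) *: map_mx io (b i) =
     map_mx io (kres c') - (z - io (sval c').1) *: map_mx io b0.
    apply/rowP => s; rewrite !mxE !summxE !rmorphB rmorphM rmorph_sum /=.
    under eq_bigr => i _ do rewrite !mxE.
    under [X in _ = _ - X - _]eq_bigr => i _ do rewrite mxE rmorphM.
    by ring.
  by apply: nleB => //; [exact: nle_refl|exact: limit_dist].
(* The norm of r1 is the value of some D in R, since W1 has no values beyond those of W. This makes
   it comparable with residuals in R and lets the bound pass to the components. *)
have [D [hD1 hD2]] : exists D, (forall s, vle OM (r1 0 s) (io D)) /\
    forall c' : ktuple, nle O (\row_(s < g) D) (kres c').
  have [r10|/(nmax vOM) [s _ hs]] := eqVneq r1 0.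
    exists 0; split=> [s|c']; first by rewrite r10 mxE rmorph0; apply: vle_refl.
    by move=> s; exists s; rewrite mxE; apply: vle0.
  have [D _ [e1 e2]] := limit_W1 (W1r s); exists D; split=> [s'|c'].
    exact: vle_trans (hs s') e1.
  move=> s'; have [t ht] := r1_le c' s; exists t; rewrite mxE; apply/vex.
  by move: ht; rewrite [map_mx _ _ _ _]mxE; apply: vle_trans e2.
pose rj (j : ktuple) : 'rV[R]_g := f - (sval j).1 *: b0 - \sum_i ufun (c i) j *: b i.
have Er s : r1 0 s = umk hU (fun j => rj j 0 s).
  rewrite /r1 !mxE summxE.
  under eq_bigr => i _ do rewrite !mxE -{1}(ufunK (c i)) udiagE umkM.
  rewrite umk_sum !udiagE /z umkM !umkN [X in X + _ = _]umkD umkD; apply/umkP; apply: (uT hU) => j.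
  by rewrite !mxE summxE; congr (_ - _); apply: eq_bigr => i _; rewrite mxE.
have h1 : U (fun j => forall s, vle O (rj j 0 s) D).
  have := @u_all _ _ hU 'I_g xpredT (fun s j => vle O (rj j 0 s) D).
  move=> h; apply: (uS hU (h _)) => [s _|j hj s]; last exact: hj.
  by have := hD1 s; rewrite Er udiagE => /uO_vle; apply.
have h2 := @u_all _ _ hU 'I_N xpredT (fun i j => K (ufun (c i) j)) (fun i _ => Kc i).
have [j [hj1 hj2]] := uE hU (uI hU h1 h2 (fun j x y => conj x y)).
have [Kj _] := svalP j.
have Kt : K (sval j).1 /\ forall i, K (ufun (c i) j) by split=> // i; apply: hj2.
exists (exist _ ((sval j).1, fun i => ufun (c i) j) Kt) => c'.
apply: (nle_trans vO _ (hD2 c')) => s; exists s; rewrite mxE; exact: hj1.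
Qed.
End NoLimit.

Lemma best_step : exists c : ktuple, forall c', nle O (kres c) (kres c').
Proof.
have [U [hU Ures]] := kres_ultra.
have [[c0 [Kc0 lim]]|nolim] := EM (exists c0, K c0 /\ forall c : ktuple,
    nle O ((c0 - (sval c).1) *: b0) (kres c)).
  have [|c Kc hc] := @best_step_limit c0 Kc0.
    by move=> c0' c' Kc0' Kc'; apply: (lim (exist _ (c0', c') (conj Kc0' Kc'))).
  exists (exist _ (c0, c) (conj Kc0 Kc)) => -[[c0' c'] [Kc0' Kc']]; exact: hc.
apply: (best_step_nolimit _ hU Ures) => c0 Kc0; apply: contrapT => h; apply: nolim.
by exists c0; split=> // c; apply: contrapT => h'; apply: h; exists c.
Qed.
End BestStep.

Theorem best_approximation N : best_rv N.
Proof.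
elim: N => [|N IH] R O K W d T g b f ab Wb Wf.
  by exists (fun i => 0) => [[]//|c' _]; rewrite !big_ord0; apply: nle_refl; exact: ab_vr ab.
have vO := ab_vr ab; have hK := ab_K ab; have hW := ab_W ab.
pose b1 i := b (lift ord0 i); have Wb1 i s : W (b1 i 0 s) by exact: Wb.
(* Subtracting from the first vector a best approximation by the others leaves the span unchanged
   and makes it orthogonal to the span of the others. *)
have [e Ke he] := IH R O K W d T g b1 (b ord0) ab Wb1 (Wb ord0).
pose b0 := b ord0 - \sum_i e i *: b1 i.
have Wb0 s : W (b0 0 s).
  rewrite !mxE summxE; apply: sfB => //; apply: sf_sum => // i _; rewrite mxE.
  by apply: sfM => //; apply: (ab_KW ab).
have orth c0 (c : 'I_N -> R) : K c0 -> (forall i, K (c i)) ->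
    nle O (c0 *: b0) (c0 *: b0 + \sum_i c i *: b1 i).
  move=> Kc0 Kc; have [->|c00] := eqVneq c0 0; first by rewrite scale0r; apply: nle0.
  have -> : c0 *: b0 + \sum_i c i *: b1 i =
      c0 *: (b ord0 - \sum_i (e i - c i / c0) *: b1 i).
    under [in RHS]eq_bigr => i _ do rewrite scalerBl.
    rewrite /b0 sumrB opprB addrCA [RHS]scalerDr [RHS]addrC; congr (_ + _); rewrite scaler_sumr.
    by apply: eq_bigr => i _; rewrite scalerA mulrC divfK.
  by apply/nleZE => //; apply: he => i; apply: sfB => //; apply: sf_div.
have [[[c0 c] /= [Kc0 Kc]] hc] := best_step IH ab Wb0 Wb1 Wf orth.
have tr k0 (k : 'I_N -> R) : f - k0 *: b0 - \sum_i k i *: b1 i =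
  f - (k0 *: b ord0 + \sum_i (k i - k0 * e i) *: b1 i).
  under [in RHS]eq_bigr => i _ do rewrite scalerBl -scalerA.
  rewrite sumrB -scaler_sumr /b0; apply/rowP => s; rewrite !mxE; ring.
(* The coefficients with respect to the original family, before the first vector was replaced by
   b0. *)
exists (fun i => if unlift ord0 i is Some k then c k - c0 * e k else c0).
  by move=> i; case: unliftP => [k _|_] //; apply: sfB => //; apply: sfM.
move=> c' Kc'; rewrite !big_ord_recl unlift_none.
under eq_bigr => i _ do rewrite liftK.
rewrite -tr; pose k i := c' (lift ord0 i) + c' ord0 * e i.
have Kt : K (c' ord0) /\ forall i, K (k i) by split=> // i; apply: sfD => //; apply: sfM.
have := hc (exist _ (c' ord0, k) Kt); rewrite /kres /= tr => /nle_trans; apply => //.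
rewrite tr; apply: eq_ind (nle_refl vO _) _ _; congr (_ - (_ + _)).
by apply: eq_bigr => i _; rewrite /k addrK.
Qed.

(** * Finite extensions inside a field *)

Lemma min_irreducible (F L : fieldType) (iota : {rmorphism F -> L}) (x : L) :
  algebraicOver iota x -> exists2 p, irreducible_poly p & root (map_poly iota p) x.
Proof.
case=> p p0 px.
pose Q n := `[< exists q : {poly F}, [/\ q != 0, root (map_poly iota q) x & size q = n] >].
have exQ : exists n, Q n by exists (size p); apply/asboolP; exists p.
case: (ex_minnP exQ) => n /asboolP [q [q0 qx sq]] min.
exists q => //; apply/(subfx_irreducibleP qx q0) => r rx r0.
by rewrite sq; apply: min; apply/asboolP; exists r.
Qed.

(** Roots of irreducible polynomials are adjoined one after the other. The last clause is an
    induction principle: the image of M is no larger than the field generated by the base and s. *)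
Lemma generated_extension (F L : fieldType) (iota : {rmorphism F -> L}) (s : seq L) :
  (forall x, x \in s -> algebraicOver iota x) ->
  exists (M : fieldExtType F) (phi : {rmorphism M -> L}),
    [/\ forall a, phi a%:A = iota a, forall x, x \in s -> exists y, phi y = x &
     forall P : L -> Prop, is_subfield P -> (forall a, P (iota a)) -> (forall x, x \in s -> P x) ->
       forall u, P (phi u)].
Proof.
elim: s => [_|x s IH hs].
  (* The trivial extension is obtained by adjoining the root 0 of X, which gives F the required
     structure over itself. *)
  have r0 : root (map_poly iota 'X) 0 by rewrite map_polyX rootX.
  have ir0 : irreducible_poly ('X : {poly F}) by rewrite -['X]subr0 -polyC0; apply: irredp_XsubC.
  exists (SubFieldExtType r0 ir0), subfx_inj; split=> // [a|P hP P0 _ u].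
    exact: (subfx_inj_base r0 (irredp_neq0 ir0)).
  have [p ->] := subfxE u; rewrite [X in P X](subfx_inj_eval r0 (irredp_neq0 ir0) p).
  by apply: (sf_horner hP); [move=> i; rewrite coef_map; exact: P0|exact: sf0].
have [|M [phi [phiE phis gen]]] := IH; first by move=> y ys; apply: hs; rewrite inE ys orbT.
have [p p0 px] := hs x (mem_head _ _).
have algx : algebraicOver phi x.
  exists (map_poly (GRing.in_alg M) p); rewrite ?map_poly_eq0 // -map_poly_comp.
  by rewrite (eq_map_poly (g := iota)) // => a /=; apply: phiE.
have [q iq qx] := min_irreducible algx.
pose N : fieldExtType M := SubFieldExtType qx iq.
pose psi : {rmorphism N -> L} := subfx_inj.
exists (baseFieldType N), (psi : {rmorphism baseFieldType N -> L}); split.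
- move=> a; have -> : (a%:A : baseFieldType N) = ((a%:A : M)%:A : N).
    exact: (baseField_scaleE a (1 : N)).
  by rewrite -phiE; apply: (subfx_inj_base qx (irredp_neq0 iq)).
- move=> y; rewrite inE => /orP[/eqP ->|/phis [z <-]].
    by exists (subfx_root phi x q); apply: (subfx_inj_root qx (irredp_neq0 iq)).
  by exists (z%:A : N); apply: (subfx_inj_base qx (irredp_neq0 iq)).
move=> P hP P0 Ps u; have [r ->] := subfxE (u : N).
have -> : psi (subfx_eval phi x q r) = (map_poly phi r).[x].
  exact: (subfx_inj_eval qx (irredp_neq0 iq)).
apply: (sf_horner hP) => [i|]; last by apply: Ps; rewrite mem_head.
by rewrite coef_map; apply: gen => // y ys; apply: Ps; rewrite inE ys orbT.
Qed.

Lemma finite_subextension (F L : fieldType) (iota : {rmorphism F -> L}) (s : seq L) :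
  (forall x, x \in s -> algebraicOver iota x) ->
  exists (M : fieldExtType F) (phi : {rmorphism M -> L}),
    (forall a, phi a%:A = iota a) /\ forall x, x \in s -> exists y, phi y = x.
Proof. by move=> /generated_extension [M [phi [h1 h2 _]]]; exists M, phi. Qed.

(** * Orthogonal families *)

Definition subspace (R : fieldType) (S : R -> Prop) (V : lmodType R) (X : V -> Prop) :=
  [/\ X 0, (forall x y, X x -> X y -> X (x + y)) & forall a x, S a -> X x -> X (a *: x)].

Definition lcomb (R : fieldType) (S : R -> Prop) (V : lmodType R) (I : finType)
  (P : pred I) (u : I -> V) (x : V) :=
  exists2 c : I -> R, forall i, S (c i) & x = \sum_(i | P i) c i *: u i.

Section LinearCombinations.
Variables (R : fieldType) (S : R -> Prop) (hS : is_subfield S) (V : lmodType R).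

Lemma subspace_sum (X : V -> Prop) (I : Type) (r : seq I) (P : pred I) (F : I -> V) :
  subspace S X -> (forall i, P i -> X (F i)) -> X (\sum_(i <- r | P i) F i).
Proof. by move=> [X0 XD XZ] h; apply: (big_ind X). Qed.

Lemma subspaceN (X : V -> Prop) x : subspace S X -> X x -> X (- x).
Proof. by move=> [_ _ XZ] Xx; rewrite -scaleN1r; apply: XZ => //; apply: sfN => //; apply: sf1. Qed.

Lemma lcomb_subspace (I : finType) (P : pred I) (u : I -> V) : subspace S (lcomb S P u).
Proof.
split=> [|_ _ [c hc ->] [c' hc' ->]|a _ Sa [c hc ->]].
- by exists (fun=> 0) => [_|]; [exact: sf0|rewrite big1 // => i _; rewrite scale0r].
- exists (fun i => c i + c' i) => [i|]; first exact: sfD.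
  by rewrite -big_split; apply: eq_bigr => i _; rewrite scalerDl.
- exists (fun i => a * c i) => [i|]; first exact: sfM.
  by rewrite scaler_sumr; apply: eq_bigr => i _; rewrite scalerA.
Qed.

Lemma lcomb_gen (I : finType) (P : pred I) (u : I -> V) i : P i -> lcomb S P u (u i).
Proof.
move=> Pi; exists (fun k => (k == i)%:R).
  by move=> k; case: eqP => _; [exact: sf1|exact: sf0].
rewrite (bigD1 i) //= eqxx scale1r big1 ?addr0 // => k /andP[_ /negPf ->].
by rewrite scale0r.
Qed.

Lemma lcomb_sub (X : V -> Prop) (I : finType) (P : pred I) (u : I -> V) x :
  subspace S X -> (forall i, P i -> X (u i)) -> lcomb S P u x -> X x.
Proof.
by move=> sX h [c hc ->]; apply: subspace_sum => // i Pi; have [_ _ XZ] := sX; apply: XZ => //; apply: h.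
Qed.
End LinearCombinations.

(** Together with the ultrametric inequality: the norm of a combination is the maximum of the norms
    of its terms. *)
Definition orth (R : fieldType) (O S : R -> Prop) g (I : finType) (u : I -> 'rV[R]_g) :=
  forall c : I -> R, (forall i, S (c i)) -> forall i, nle O (c i *: u i) (\sum_j c j *: u j).

Section Orthogonal.
Variables (R : fieldType) (O S : R -> Prop) (vO : valuation_ring O) (hS : is_subfield S) (g : nat).
Local Notation V := ('rV[R]_g).

Lemma nmax_exists (I : finType) (P : pred I) (F : I -> V) i0 : P i0 ->
  exists2 i, P i & forall j, P j -> nle O (F j) (F i).
Proof.
move=> Pi0; suff: forall s : seq I, (forall i, i \in s -> P i) -> s != [::] ->
    exists2 i, P i & forall j, j \in s -> nle O (F j) (F i).
  case/(_ (enum P)) => [i||i Pi h]; first by rewrite mem_enum.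
    by apply/eqP => e; have := mem_enum P i0; rewrite e in_nil -topredE /= Pi0.
  by exists i => // j Pj; apply: h; rewrite mem_enum.
elim=> [//|i [|i' s'] IH] hP _.
  by exists i; [apply: hP; rewrite inE|move=> j; rewrite inE => /eqP ->; exact: nle_refl].
case: IH => // [j js|k Pk hk]; first by apply: hP; rewrite inE js orbT.
case: (nle_total vO (F i) (F k)) => h.
  by exists k => // j; rewrite inE => /orP[/eqP -> //|]; apply: hk.
exists i; first by apply: hP; rewrite inE eqxx.
move=> j; rewrite inE => /orP[/eqP ->|/hk hj]; first exact: nle_refl.
exact: nle_trans hj h.
Qed.

Lemma orth_free (I : finType) (u : I -> V) (c : I -> R) : orth O S u ->
  (forall i, u i != 0) -> (forall i, S (c i)) -> \sum_i c i *: u i = 0 -> forall i, c i = 0.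
Proof.
move=> hu u0 hc e i; have := hu c hc i; rewrite e => /nle_0 /eqP.
by rewrite scaler_eq0 (negPf (u0 i)) orbF => /eqP.
Qed.

Lemma orth_sub (I J : finType) (h : J -> I) (u : I -> V) : injective h ->
  orth O S u -> orth O S (u \o h).
Proof.
move=> injh hu c hc j; pose c' i := if [pick k | h k == i] is Some k then c k else 0.
have hc' k : c' (h k) = c k.
  rewrite /c'; case: pickP => [l /eqP /injh -> //|/(_ k)]; by rewrite eqxx.
have -> : \sum_j c j *: (u \o h) j = \sum_i c' i *: u i.
  rewrite (bigID (fun i => i \in h @: predT)) /= [X in _ = _ + X]big1 ?addr0; last first.
    move=> i; rewrite /c'; case: pickP => [k /eqP <-|_ _]; last by rewrite scale0r.
    by rewrite imset_f.
  rewrite big_imset /=; last by move=> x y _ _; apply: injh.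
  by apply: eq_bigr => k _; rewrite hc'.
rewrite -hc'; apply: hu => i; rewrite /c'.
by case: pickP => *; [exact: hc|exact: sf0].
Qed.

Lemma orth_adjoin (I : finType) (u : I -> V) (r : V) : orth O S u ->
  (forall a : I -> R, (forall i, S (a i)) -> nle O r (r - \sum_i a i *: u i)) ->
  orth O S (fun i : I + unit => if i is inl k then u k else r).
Proof.
move=> ou hr k hk; rewrite big_sumType /=.
have -> : \sum_(i : unit) k (inr i) *: r = k (inr tt) *: r.
  by rewrite (bigD1 tt) //= big1 ?addr0 //; case.
have h : nle O (k (inr tt) *: r) (\sum_i k (inl i) *: u i + k (inr tt) *: r).
  have [->|k0] := eqVneq (k (inr tt)) 0; first by rewrite scale0r; apply: nle0.
  have -> : \sum_i k (inl i) *: u i + k (inr tt) *: r =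
      k (inr tt) *: (r - \sum_i (- (k (inl i) / k (inr tt))) *: u i).
    rewrite scalerBr addrC; congr (_ + _); rewrite scaler_sumr -sumrN; apply: eq_bigr => i _.
    by rewrite scalerA mulrN scaleNr opprK mulrC divfK.
  by apply/nleZE => //; apply: hr => i; apply: sfN => //; apply: sf_div.
case=> [i|[]] //=; apply: (nle_trans vO (ou (fun i => k (inl i)) (fun i => hk _) i)).
rewrite -[X in nle _ X _](addrK (k (inr tt) *: r)).
by apply: nleB => //; apply: nle_refl.
Qed.

(* Gaussian elimination with the largest coordinate as pivot. *)
Lemma orth_exchange (I : finType) (u : I -> V) (w : nat -> V) N :
  orth O S u -> (forall i, u i != 0) ->
  (forall j, (j < N)%N -> lcomb S predT u (w j)) ->
  (forall c : nat -> R, (forall j, S (c j)) -> \sum_(j < N) c j *: w j = 0 ->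
     forall j, (j < N)%N -> c j = 0) ->
  exists (u' : I -> V) (A : {set I}), [/\ orth O S u', forall i, u' i != 0, #|A| = N,
    forall i, i \in A -> lcomb S predT (fun j : 'I_N => w j) (u' i) &
    [/\ forall i, lcomb S predT u' (u i), forall i, lcomb S predT u (u' i) &
    forall j, (j < N)%N -> lcomb S (mem A) u' (w j)]].
Proof.
move=> hu u0; elim: N => [_ _|N IH hw free].
  exists u, finset.set0; split=> //; first by rewrite cards0.
    by move=> i; rewrite inE.
  by split=> // i; apply: lcomb_gen.
have [|c hc e j jN|u' [A [hu' u'0 cardA hA [huu' hu'u hwA]]]] := IH.
- by move=> j jN; apply: hw; apply: ltnW.
- have := free (fun k => if (k < N)%N then c k else 0).
  move=> /(_ _ _ j (ltnW jN)); rewrite jN; apply.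
    by move=> k; case: ifP => _; [exact: hc|exact: sf0].
  rewrite big_ord_recr /= ltnn scale0r addr0 -[RHS]e.
  by apply: eq_bigr => k _; rewrite ltn_ord.
have [c hc Ew] : lcomb S predT u' (w N).
  by apply: lcomb_sub (hw N (ltnSn _)) => //; apply: lcomb_subspace.
pose t := \sum_(i | i \notin A) c i *: u' i.
have Et : w N = \sum_(i in A) c i *: u' i + t by rewrite Ew (bigID (mem A)).
have hAw x : lcomb S (mem A) u' x -> lcomb S predT (fun j : 'I_N => w j) x.
  by apply: lcomb_sub => //; apply: lcomb_subspace.
have t0 : t != 0.
  apply/eqP => t0; have [|k hk Ek] := hAw (w N).
    by exists c => //; rewrite Et t0 addr0.
  have := free (fun j => if (j == N) then -1 else if insub j is Some j' then k j' else 0).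
  move=> /(_ _ _ N (ltnSn _)); rewrite eqxx => h.
  have /eqP : -1 = 0 :> R.
    apply: h => [j|].
      case: eqP => _; [by apply: (sfN hS); exact: (sf1 hS)|by case: insub => [j'|]; [exact: hk|exact: (sf0 hS)]].
    rewrite big_ord_recr /= eqxx scaleN1r Ek; apply/eqP; rewrite subr_eq0; apply/eqP.
    apply: eq_bigr => j _; rewrite (ltn_eqF (ltn_ord j)).
    by case: insubP => [j' _ /val_inj -> //|]; rewrite ltn_ord.
  by rewrite oppr_eq0 oner_eq0.
have [i1 i1A ci1] : exists2 i, i \notin A & c i != 0.
  apply: contrapT => h; move/eqP: t0; apply; rewrite /t big1 // => i iA.
  have [->|ci] := eqVneq (c i) 0; first by rewrite scale0r.
  by case: h; exists i.
have [i0 i0A hmax] := @nmax_exists I (fun i => i \notin A) (fun i => c i *: u' i) i1 i1A.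
have ci0 : c i0 != 0.
  apply/eqP => e; have := hmax i1 i1A; rewrite e scale0r => /nle_0/eqP.
  by rewrite scaler_eq0 (negPf ci1) (negPf (u'0 i1)).
(* The member at i0 is exchanged for t, the part of w_N outside A. Since c_i0 u'_i0 is a largest
   term of t, each term of t is controlled by it, and orthogonality persists. *)
pose u'' i := if i == i0 then t else u' i.
pose cA i := if i \in A then 0 else c i.
have hcA i : S (cA i) by rewrite /cA; case: ifP => _; [exact: sf0|exact: hc].
have EtA : t = \sum_i cA i *: u' i.
  rewrite (bigID (mem A)) /= big1 ?add0r; last by move=> i iA; rewrite /cA iA scale0r.
  by apply: eq_bigr => i /negPf iA; rewrite /cA iA.
have cA0 : cA i0 = c i0 by rewrite /cA (negPf i0A).
have maxA i : nle O (cA i *: u' i) (c i0 *: u' i0).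
  by rewrite /cA; case: ifPn => iA; [rewrite scale0r; apply: nle0|apply: hmax].
have sw : subspace S (lcomb S predT (fun j : 'I_N.+1 => w j)) by apply: lcomb_subspace.
have NN1 x : lcomb S predT (fun j : 'I_N => w j) x -> lcomb S predT (fun j : 'I_N.+1 => w j) x.
  apply: lcomb_sub => // j _; have := @lcomb_gen _ _ hS _ 'I_N.+1 predT (fun j => w j) (widen_ord (leqnSn N) j).
  exact.
have wN1 : lcomb S predT (fun j : 'I_N.+1 => w j) (w N).
  by have := @lcomb_gen _ _ hS _ 'I_N.+1 predT (fun j => w j) ord_max; apply.
exists u'', (i0 |: A); split.
- move=> e he; pose e' i := (if i == i0 then 0 else e i) + e i0 * cA i.
  have he' i : S (e' i).
    by apply: sfD => //; [case: ifP => _; [exact: sf0|exact: he]|apply: sfM].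
  have -> : \sum_j e j *: u'' j = \sum_j e' j *: u' j.
    under [RHS]eq_bigr => j _ do rewrite scalerDl -scalerA.
    rewrite big_split /= -scaler_sumr -EtA (bigD1 i0) //= /u'' eqxx addrC; congr (_ + _).
    rewrite [RHS](bigD1 i0) //= eqxx scale0r add0r.
    by apply: eq_bigr => j /negPf ji; rewrite ji.
  have h0 : nle O ((e i0 * c i0) *: u' i0) (\sum_j e' j *: u' j).
    by have := hu' e' he' i0; rewrite /e' eqxx add0r cA0.
  have hi i : nle O ((e i0 * cA i) *: u' i) (\sum_j e' j *: u' j).
    by apply: nle_trans h0 => //; rewrite -!scalerA; apply: nleZ => //; exact: vle_refl.
  move=> i; rewrite /u''; case: eqP => [->|/eqP ii].
    rewrite EtA scaler_sumr; apply: nle_sum => // j _; rewrite scalerA; exact: hi.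
  have -> : e i *: u' i = e' i *: u' i - (e i0 * cA i) *: u' i.
    by rewrite /e' (negPf ii) scalerDl addrK.
  by apply: nleB => //; apply: hu'.
- by move=> i; rewrite /u''; case: (i =P i0).
- by rewrite cardsU1 i0A cardA.
- move=> i; rewrite finset.in_setU1 /u''; case: eqP => [_ _|_ /= iA]; last by apply: NN1; apply: hA.
  have -> : t = w N + - \sum_(i in A) c i *: u' i by rewrite Et addrC addKr.
  have [_ wD _] := sw; apply: wD => //; apply: (subspaceN hS) => //.
  by apply: NN1; apply: hAw; exists c.
have su'' P : subspace S (lcomb S P u'') by apply: lcomb_subspace.
have gA i : i \in A -> u'' i = u' i.
  by rewrite /u''; case: eqP => // -> iA; rewrite iA in i0A.
split=> [i|i|j].
- apply: lcomb_sub (huu' i) => // k _.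
  have [->|ki] := eqVneq k i0; last first.
    have -> : u' k = u'' k by rewrite /u'' (negPf ki).
    exact: lcomb_gen.
  have -> : u' i0 = (c i0)^-1 *: (t + - \sum_(i | i != i0) cA i *: u'' i).
    rewrite EtA (bigD1 i0) //= cA0.
    have -> : \sum_(i | i != i0) cA i *: u' i = \sum_(i | i != i0) cA i *: u'' i.
      by apply: eq_bigr => i' /negPf ii; rewrite /u'' ii.
    by rewrite addrK scalerA mulVf // scale1r.
  have [_ wD wZ] := su'' predT; apply: (wZ); first exact: sfV.
  apply: wD; first by have := @lcomb_gen _ _ hS _ I predT u'' i0; rewrite /u'' eqxx; apply.
  apply: (subspaceN hS) => //; apply: (subspace_sum (S := S)) => // i' _; apply: (wZ) => //; exact: lcomb_gen.
- rewrite /u''; case: (i =P i0) => _; last exact: hu'u.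
  rewrite EtA; apply: (subspace_sum (S := S) (X := lcomb S predT u)) => [|k _].
    exact: lcomb_subspace.
  by have [_ _ Z] := lcomb_subspace hS predT u; apply: Z.
have sub x : lcomb S (mem A) u' x -> lcomb S (mem (i0 |: A)) u'' x.
  apply: lcomb_sub => // i' iA; rewrite -gA //; apply: lcomb_gen => //=.
  by apply/finset.setU1P; right.
rewrite ltnS leq_eqVlt => /orP[/eqP ->|/hwA]; last exact: sub.
rewrite Et; have [_ wD _] := su'' (mem (i0 |: A)); apply: wD; first by apply: sub; exists c.
have -> : t = u'' i0 by rewrite /u'' eqxx.
by apply: lcomb_gen => //=; rewrite finset.in_setU1 eqxx.
Qed.
End Orthogonal.

(** * Henselian defectless fields *)

Section Independence.
Variables (K : fieldType) (V : vectType K) (I : finType) (b : I -> V).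
Hypothesis fr : forall c : I -> K, \sum_i c i *: b i = 0 -> forall i, c i = 0.
Let X := [tuple b (enum_val (i : 'I_#|I|)) | i < #|I|].

Let reix (c : 'I_#|I| -> K) : \sum_(i < #|I|) c i *: X`_i = \sum_i c (enum_rank i) *: b i.
Proof.
have EX (i : 'I_#|I|) : X`_i = b (enum_val i) by rewrite -tnth_nth tnth_mktuple.
under eq_bigr => i _ do rewrite EX.
rewrite [RHS](reindex_onto (@enum_val I predT) enum_rank) /=; last by move=> i _; rewrite enum_rankK.
by apply: eq_big => [i|i _]; rewrite enum_valK ?eqxx.
Qed.

Let freeX : free X.
Proof.
apply/freeP => k; rewrite reix => h i.
by rewrite -[i](enum_valK); apply: (fr (c := k \o enum_rank)).
Qed.

Lemma indep_card : (#|I| <= \dim {: V})%N.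
Proof. by have := dimvS (subvf <<X>>); rewrite (eqP freeX) size_tuple. Qed.

Lemma indep_spans : #|I| = \dim {: V} -> forall x, exists c : I -> K, x = \sum_i c i *: b i.
Proof.
move=> cI x; have bX : basis_of {: V} X.
  by rewrite basisEfree freeX subvf size_tuple -cI leqnn.
have /(coord_basis bX) -> : x \in fullv by rewrite memvf.
by rewrite reix; exists (fun i => coord X (enum_rank i) x).
Qed.
End Independence.

Section DefectlessBasis.
Variables (K : fieldType) (OK : K -> Prop) (M : fieldExtType K) (OM : M -> Prop).
Hypotheses (vK : valuation_ring OK) (vM : valuation_ring OM).
Hypothesis ext : extends (GRing.in_alg M) OK OM.

Let vex (a b : K) : vle OM a%:A b%:A <-> vle OK a b. Proof. exact: (vle_ext _ _ vK vM ext). Qed.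

(** After division by a coefficient of largest value, the combination is integral with a coefficient
    1; independence of the residues makes it a unit. *)
Lemma residue_sum f (y : 'I_f -> M) (c : 'I_f -> K) : (forall l, OM (y l)) ->
  (forall a : 'I_f -> K, (forall i, OK (a i)) ->
     vmax OM (\sum_i (a i)%:A * y i) -> forall i, vmax OK (a i)) ->
  forall l0, c l0 != 0 -> exists m, [/\ c m != 0,
    veq OM (\sum_l (c l)%:A * y l) (c m)%:A & forall l, vle OM (c l)%:A (c m)%:A].
Proof.
move=> Oy hy l0 cl0; have [m _ hm] := @vmax_exists _ _ vM _ predT (fun l => (c l)%:A : M) l0 isT.
have cm : c m != 0.
  apply/eqP => e; have := hm l0 isT; rewrite e scale0r => /vle_0/eqP.
  by rewrite scaler_eq0 (negPf cl0) oner_eq0.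
exists m; split=> //; last by move=> l; apply: hm.
have cmA : (c m)%:A != 0 :> M by rewrite scaler_eq0 (negPf cm) oner_eq0.
have Oa l : OK (c l / c m) by apply/vleP => //; apply/vex; apply: hm.
have -> : \sum_l (c l)%:A * y l = (c m)%:A * \sum_l (c l / c m)%:A * y l.
  rewrite mulr_sumr; apply: eq_bigr => l _; rewrite mulrA; congr (_ * _).
  by rewrite -[RHS](rmorphM (GRing.in_alg M)) mulrC divfK.
rewrite -[X in veq _ _ X]mulr1; apply/veqM2lE => //; split.
  by apply/vle1; apply: vr_sum => // l _; apply: vrM => //; apply/ext.
case: (vleVlt OM 1 (\sum_l (c l / c m)%:A * y l)) => // /(vmaxP vM) h.
by have /(vmaxP vK) := hy _ Oa h m; rewrite divff // => /(vlt_irr vK).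
Qed.

(** The products x_k y_l of representatives of the value classes and of a residue basis are
    orthogonal: within one k by independence of the residues, across different k because the values
    lie in different cosets. In the absence of defect there are enough of them to form a basis. *)
Lemma ram_res_basis e f : ram_index_is (GRing.in_alg M) OK OM e ->
  res_degree_is (GRing.in_alg M) OK OM f -> \dim {: M} = (e * f)%N ->
  exists (I : finType) (b : I -> M), [/\ forall u, exists c : I -> K, u = \sum_i (c i)%:A * b i,
    forall i, b i != 0 & forall (c : I -> K) i, vle OM ((c i)%:A * b i) (\sum_j (c j)%:A * b j)].
Proof.
move=> [x [x0 _ xcl]] [y [Oy _ hy]] dimM.
pose b (i : 'I_e * 'I_f) := x i.1 * y i.2.
have y0 l : y l != 0.
  apply/eqP => yl; have := hy (fun k => (k == l)%:R); move=> /(_ _ _ l).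
  rewrite eqxx (vmaxP vK) => h; apply: (vlt_irr vK (x := 1)); apply: h.
    by move=> i; case: eqP => _; [exact: vr1|exact: vr0].
  rewrite (vmaxP vM) big1; first exact/vlt0/oner_neq0.
  by move=> i _; case: eqP => [->|_]; rewrite ?yl ?mulr0 // rmorph0 mul0r.
have b0 i : b i != 0 by rewrite mulf_neq0.
have orb (c : 'I_e * 'I_f -> K) i : vle OM ((c i)%:A * b i) (\sum_j (c j)%:A * b j).
  pose Sk k := \sum_l (c (k, l))%:A * y l.
  have -> : \sum_j (c j)%:A * b j = \sum_k x k * Sk k.
    under [RHS]eq_bigr => k _ do rewrite mulr_sumr.
    by rewrite pair_bigA /=; apply: eq_bigr => -[k l] _; rewrite mulrCA.
  have hS k l : vle OM ((c (k, l))%:A * y l) (Sk k).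
    have [->|ckl] := eqVneq (c (k, l)) 0; first by rewrite scale0r mul0r; apply: vle0.
    have [m [_ [_ h1] h2]] := residue_sum (c := fun l => c (k, l)) Oy hy ckl.
    apply: (vle_trans vM _ h1); rewrite -[X in vle _ _ X]mulr1; apply: (vleM vM) => //.
    exact/vle1.
  have hxS k : vle OM (x k * Sk k) (\sum_k x k * Sk k).
    have [->|xSk] := eqVneq (x k * Sk k) 0; first exact: vle0.
    have [k0 _ hk0] := @vmax_exists _ _ vM _ predT (fun k => x k * Sk k) k isT.
    have xS0 : x k0 * Sk k0 != 0.
      by apply: contraNneq xSk => e0; have := hk0 k isT; rewrite e0 => /vle_0 ->.
    have dom : vlt OM (\sum_k x k * Sk k - x k0 * Sk k0) (x k0 * Sk k0).
      apply: veq_sum_dom => // j _ jk0 hle; move/eqP: jk0; apply.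
      have eqj : veq OM (x j * Sk j) (x k0 * Sk k0) by split=> //; apply: hk0.
      have nz k' : Sk k' != 0 -> exists2 a : K, a != 0 & veq OM (Sk k') a%:A.
        move=> Sk0; have [l cl] : exists l, c (k', l) != 0.
          apply: contrapT => h; move/eqP: Sk0; apply; rewrite /Sk big1 // => l _.
          have [->|cl] := eqVneq (c (k', l)) 0; first by rewrite scale0r mul0r.
          by case: h; exists l.
        by have [m [cm hm _]] := residue_sum (c := fun l => c (k', l)) Oy hy cl; exists (c (k', m)).
      have [a a0 ha] : exists2 a : K, a != 0 & veq OM (Sk k0) a%:A.
        by apply: nz; move: xS0; rewrite mulf_eq0 negb_or => /andP[].
      have [a' a'0 ha'] : exists2 a : K, a != 0 & veq OM (Sk j) a%:A.
        apply: nz; have := veq_neq0 (veq_sym eqj) xS0.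
        by rewrite mulf_eq0 negb_or => /andP[].
      have A0 (d : K) : d != 0 -> d%:A != 0 :> M by move=> d0; rewrite scaler_eq0 (negPf d0) oner_eq0.
      apply: (xcl j k0 (a / a')); first by rewrite mulf_neq0 ?invr_eq0.
      apply/vunitP => //; have xk0 : x k0 * (a / a')%:A != 0 by rewrite mulf_neq0 // A0 // mulf_neq0 ?invr_eq0.
      apply/(veqM2rE vM _ _ xk0); rewrite mul1r divfK //; apply/(veqM2rE vM _ _ (A0 _ a'0)).
      rewrite -mulrA -[_%:A * _%:A](rmorphM (GRing.in_alg M)) divfK //.
      apply: (veq_trans vM (y := x j * Sk j)); first by apply: veqM => //; [exact: veq_refl|exact: veq_sym].
      by apply: veq_trans eqj _ => //; apply: veqM => //; exact: veq_refl.
    apply: (vle_trans vM (hk0 k isT)); have [_] := veq_close vM dom; exact.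
  case: i => k l; apply: vle_trans (hxS k) => //; rewrite /b /= mulrCA.
  by apply: vleM2l => //; apply: hS.
exists ('I_e * 'I_f)%type, b; split=> // u.
have [||c ->] := @indep_spans K M ('I_e * 'I_f)%type b _ _ u.
- move=> c hc i; have := orb c i.
  have -> : \sum_j (c j)%:A * b j = 0 by rewrite -[RHS]hc; apply: eq_bigr => j _; rewrite -scalerAl mul1r.
  by move=> /vle_0/eqP; rewrite mulf_eq0 (negPf (b0 i)) orbF scaler_eq0 oner_eq0 orbF => /eqP.
- by rewrite card_prod !card_ord dimM.
- by exists c; apply: eq_bigr => i _; rewrite -scalerAl mul1r.
Qed.
End DefectlessBasis.

Lemma fieldExt_algebraic (K : fieldType) (M : fieldExtType K) (x : M) :
  exists p : {poly K}, p != 0 /\ root (map_poly (GRing.in_alg M) p) x.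
Proof.
have /polyOver1P [q Eq] := minPolyOver 1%AS x; exists q; split.
  rewrite -(map_poly_eq0 (GRing.in_alg M)) -Eq; exact/monic_neq0/monic_minPoly.
by rewrite -Eq root_minPoly.
Qed.

Lemma pullback_valuation (L M : fieldType) (phi : {rmorphism L -> M}) (O : M -> Prop) :
  valuation_ring O -> valuation_ring (fun x => O (phi x)).
Proof.
move=> vO; split=> [|x y|x y|x].
- by rewrite rmorph1; apply: vr1.
- by rewrite rmorphB; apply: vrB.
- by rewrite rmorphM; apply: vrM.
- by rewrite -(fmorph_eq0 phi) fmorphV; apply: vr_total.
Qed.

Lemma henselian_unique (K : fieldType) (OK : K -> Prop) (M : fieldExtType K) (O1 O2 : M -> Prop) :
  henselian OK -> valuation_ring O1 -> extends (GRing.in_alg M) OK O1 ->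
  valuation_ring O2 -> extends (GRing.in_alg M) OK O2 -> forall x, O1 x <-> O2 x.
Proof.
move=> hens v1 e1 v2 e2 x; have [O' [_ _ un]] := hens M (GRing.in_alg M) (@fieldExt_algebraic K M).
by rewrite (un O1) // (un O2).
Qed.

Section HenselianDefectless.
Variables (K R : fieldType) (iota : {rmorphism K -> R}) (OK : K -> Prop) (O : R -> Prop).
Hypotheses (vK : valuation_ring OK) (vO : valuation_ring O) (ext : extends iota OK O).
Hypotheses (hens : henselian OK) (dfl : defectless OK).
Definition imK' (x : R) := exists a, x = iota a.
Local Notation Kp := imK'.

Lemma imK_subfield : is_subfield Kp.
Proof.
split=> [|_ _ [a ->] [b ->]|_ _ [a ->] [b ->]|_ [a ->]].
- by exists 1; rewrite rmorph1.
- by exists (a - b); rewrite rmorphB.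
- by exists (a * b); rewrite rmorphM.
- by exists a^-1; rewrite fmorphV.
Qed.

Lemma alg_imK x : alg Kp x <-> algebraicOver iota x.
Proof.
split=> [[p [p0 hp px]]|[q q0 qx]]; last first.
  exists (map_poly iota q); split; rewrite ?map_poly_eq0 // => i.
  by rewrite coef_map; exists q`_i.
have hq i : exists a, p`_i = iota a by exact: hp.
pose q : {poly K} := \poly_(i < size p) sval (cid (hq i)).
have Eq : map_poly iota q = p.
  apply/polyP => i; rewrite coef_map coef_poly; case: ltnP => h.
    by case: (cid _) => y /= e; exact/esym.
  by rewrite nth_default //; exact: (rmorph0 iota).
by exists q; rewrite ?Eq // -(map_poly_eq0 iota) Eq.
Qed.

(** The one point at which the definition of defectlessness is unfolded. The elements of s generate
    a finite extension, over which the valuation extends uniquely by henselianity; the defect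
    formula then has the single summand e f, and an orthogonal basis results. *)
Lemma algebraic_orth (s : seq R) : (forall x, x \in s -> alg Kp x) ->
  exists (I : finType) (y : I -> R), [/\ forall i, y i != 0, forall i, alg Kp (y i),
    forall x, x \in s -> exists2 c : I -> R, forall i, Kp (c i) & x = \sum_i c i * y i &
    forall c : I -> R, (forall i, Kp (c i)) -> forall i, vle O (c i * y i) (\sum_j c j * y j)].
Proof.
move=> hs; have [x /hs /alg_imK //|M [phi [phiE phis]]] := @finite_subextension K R iota s.
pose OM x := O (phi x); have vM : valuation_ring OM by apply: pullback_valuation.
have exM : extends (GRing.in_alg M) OK OM by move=> a; rewrite /OM phiE.
have [n [Os [e [f [hO inj all hef dimE]]]]] := dfl M.
have [i hi] := all OM vM exM.
have one j : j = i.
  apply: inj => x; have [v1 e1] := hO j; have [v2 e2] := hO i; exact: (henselian_unique hens v1 e1 v2 e2).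
have dimM : \dim {: M} = (e i * f i)%N.
  by rewrite dimE (bigD1 i) //= big1 ?addn0 // => j; rewrite (one j) eqxx.
have [hram hres] := hef i; have [v1 e1] := hO i.
have [I [b [span b0 orb]]] := ram_res_basis vK v1 e1 hram hres dimM.
have vleE x y : vle (Os i) x y -> vle O (phi x) (phi y).
  by case=> o /hi Oo ->; exists (phi o) => //; rewrite rmorphM.
exists I, (phi \o b); split=> [j|j|x /phis [u <-]|c hc j].
- by rewrite /= fmorph_eq0.
- apply/alg_imK; have [p [p0 pb]] := fieldExt_algebraic (b j); exists p => //.
  rewrite -(eq_map_poly (f := phi \o GRing.in_alg M)) => [|a]; last exact: phiE.
  by rewrite map_poly_comp fmorph_root.
- have [c ->] := span u; exists (fun i => iota (c i)) => [k|]; first by exists (c k).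
  by rewrite rmorph_sum; apply: eq_bigr => k _; rewrite rmorphM /= phiE.
have hc' k : exists a, c k = iota a by exact: hc.
pose c' k := sval (cid (hc' k)); have Ec k : c k = phi (c' k)%:A.
  by rewrite phiE /c'; case: (cid _).
rewrite Ec /= -rmorphM.
have -> : \sum_j c j * phi (b j) = phi (\sum_j (c' j)%:A * b j).
  by rewrite rmorph_sum; apply: eq_bigr => k _; rewrite rmorphM Ec.
exact/vleE/orb.
Qed.

Section Span.
Variables (W : R -> Prop) (d : nat) (T : 'I_d -> R) (g : nat).
Hypothesis ab : abhyankar O (alg Kp) W T.
Let hA := ab_K ab.
Let hW := ab_W ab.

(** The error of a best approximation is orthogonal to the space of approximants. The scalars are
    the relative algebraic closure of K because best approximation requires such a base. *)
Lemma gram_schmidt N (b : 'I_N -> 'rV[R]_g) : (forall i s, W (b i 0 s)) ->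
  exists (I : finType) (u : I -> 'rV[R]_g), [/\ orth O (alg Kp) u, forall i, u i != 0,
    forall i s, W (u i 0 s) & forall j, lcomb (alg Kp) predT u (b j)].
Proof.
elim: N b => [|N IH] b Wb; first by exists 'I_0, (fun=> 0); split; [by move=> c hc []|by case|by case|by case].
have [|I [u [ou u0 Wu hu]]] := IH (fun i => b (lift ord0 i)); first by move=> i s; apply: Wb.
pose n := #|I|; pose v (i : 'I_n) := u (enum_val i).
have [|c hc bc] := best_approximation (b := v) (f := b ord0) ab _ (Wb ord0).
  by move=> i s; apply: Wu.
have reE (k : I -> R) : \sum_(i < n) k (enum_val i) *: v i = \sum_i k i *: u i.
  rewrite [RHS](reindex_onto (@enum_val I predT) enum_rank) /=; last by move=> i _; rewrite enum_rankK.
  by apply: eq_bigl => i; rewrite enum_valK eqxx.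
have reE' (k : 'I_n -> R) : \sum_(i < n) k i *: v i = \sum_i k (enum_rank i) *: u i.
  by rewrite -reE; apply: eq_bigr => i _; rewrite enum_valK.
pose r := b ord0 - \sum_i c i *: v i.
have Eb : b ord0 = r + \sum_i c (enum_rank i) *: u i by rewrite /r reE' subrK.
have [r0|r0] := eqVneq r 0.
  exists I, u; split=> // j; case: (unliftP ord0 j) => [k ->|->]; first exact: hu.
  by exists (fun i => c (enum_rank i)); rewrite ?Eb ?r0 ?add0r.
pose u' (i : I + unit) := if i is inl k then u k else r.
have su' : subspace (alg Kp) (lcomb (alg Kp) predT u') by apply: lcomb_subspace.
exists (I + unit)%type, u'; split.
- apply: orth_adjoin => // a Aa.
  have -> : r - \sum_i a i *: u i = b ord0 - \sum_i (c i + a (enum_val i)) *: v i.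
    under [in RHS]eq_bigr => i _ do rewrite scalerDl.
    by rewrite big_split /= opprD addrA /r reE.
  by apply: bc => i; apply: sfD.
- by case.
- move=> i s; case: i => [i|[]]; first exact: Wu.
  rewrite !mxE summxE; apply: sfB => //; apply: sf_sum => // i _; rewrite mxE; apply: sfM => //.
    exact: (ab_KW ab).
  exact: Wu.
move=> j; case: (unliftP ord0 j) => [k ->|->].
  by apply: lcomb_sub (hu k) => // i _; apply: (@lcomb_gen _ _ hA _ _ predT u' (inl i) isT).
rewrite Eb; have [_ D Z] := su'; apply: D; first exact: (@lcomb_gen _ _ hA _ _ predT u' (inr tt) isT).
by apply: (subspace_sum (S := alg Kp) (X := lcomb (alg Kp) predT u')) => // i _; apply: Z => //; apply: (@lcomb_gen _ _ hA _ _ predT u' (inl i) isT).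
Qed.

(** Descent to scalars in K: the coordinates with respect to u are finitely many elements algebraic
    over K, and are written in a K-orthogonal family y. The products of members of y and u are
    K-orthogonal. *)
Lemma orth_span N (b : 'I_N -> 'rV[R]_g) : (forall i s, W (b i 0 s)) ->
  exists (I : finType) (u : I -> 'rV[R]_g), [/\ orth O Kp u, forall i, u i != 0 &
    forall j, lcomb Kp predT u (b j)].
Proof.
move=> Wb; have hK := imK_subfield; have [I [u [ou u0 Wu hu]]] := gram_schmidt Wb.
have hc j : exists c : I -> R, (forall i, alg Kp (c i)) /\ b j = \sum_i c i *: u i.
  by have [c] := hu j; exists c.
pose c j := sval (cid (hc j)).
have [Ac Ec] : (forall j i, alg Kp (c j i)) /\ forall j, b j = \sum_i c j i *: u i.
  by split=> j; rewrite /c; case: (cid _) => k [].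
have [|Y [y [y0 yA yspan yorth]]] := @algebraic_orth [seq c p.1 p.2 | p : 'I_N * I].
  by move=> x /mapP [[j i] _ ->]; apply: Ac.
pose v (p : I * Y) := y p.2 *: u p.1.
exists (I * Y)%type, v; split.
- move=> k hk [i l]; pose a i := \sum_l k (i, l) * y l.
  have -> : \sum_p k p *: v p = \sum_i a i *: u i.
    under [RHS]eq_bigr => i' _ do rewrite scaler_suml.
    by rewrite pair_bigA /=; apply: eq_bigr => -[i' l'] _; rewrite /v scalerA.
  have Aa i' : alg Kp (a i').
    apply: sf_sum => // l' _; apply: sfM => //; exact: alg_incl.
  apply: (nle_trans vO _ (ou a Aa i)); rewrite /v /= scalerA; apply: nleZ => //; last exact: nle_refl.
  by apply: (yorth (fun l => k (i, l))) => l'; apply: hk.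
- by case=> i l; rewrite /v scaler_eq0 negb_or y0 u0.
move=> j; have sv : subspace Kp (lcomb Kp predT v) by apply: lcomb_subspace.
rewrite Ec; apply: (subspace_sum (S := Kp) (X := lcomb Kp predT v)) => // i _.
have [|k hk ->] := yspan (c j i); first by apply/mapP; exists (j, i); rewrite ?mem_enum.
rewrite scaler_suml; apply: (subspace_sum (S := Kp) (X := lcomb Kp predT v)) => // l _; rewrite -scalerA.
by have [_ _ Z] := sv; apply: Z => //; apply: (@lcomb_gen _ _ hK _ _ predT v (i, l) isT).
Qed.
End Span.
End HenselianDefectless.

(** * Embeddings of a finite extension *)

Lemma common_eigenvector (R : fieldType) n (s : seq 'M[R]_n) (V : 'M[R]_n) : alg_closed R ->
  V != 0 -> {in s &, forall A B, A *m B = B *m A} -> (forall A, A \in s -> (V *m A <= V)%MS) ->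
  exists v : 'rV[R]_n, [/\ v != 0, (v <= V)%MS & forall A, A \in s -> exists a, v *m A = a *: v].
Proof.
move=> cl; elim: s V => [|A s IH] V V0 comm stab.
  by exists (nz_row V); rewrite nz_row_eq0 V0 nz_row_sub.
pose rb := row_base V.
have rbA : (rb *m A <= rb)%MS.
  by rewrite (eq_row_base V) (submx_trans _ (stab A (mem_head _ _))) // submxMr ?eq_row_base.
have [a] : exists a, root (char_poly (rb *m A *m pinvmx rb)) a.
  by apply: cl; rewrite size_char_poly eqSS mxrank_eq0.
rewrite -eigenvalue_root_char => /eigenvalueP [w Ew w0].
have rbE : (w *m rb) *m A = a *: (w *m rb).
  by rewrite -mulmxA -(mulmxKpV rbA) mulmxA Ew -scalemxAl.
have wrb0 : w *m rb != 0.
  by rewrite mulmx_free_eq0 ?row_base_free.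
have wV : (w *m rb <= V)%MS by rewrite (submx_trans (submxMl w rb)) ?eq_row_base.
pose V' := (V :&: eigenspace A a)%MS.
have V'0 : V' != 0.
  apply: contraNneq wrb0 => e; rewrite -submx0 -e sub_capmx wV; exact/eigenspaceP.
have [|B hB|v [v0 vV' hv]] := IH V' V'0.
- by move=> B C hB hC; apply: comm; rewrite inE ?hB ?hC orbT.
- have hB' : B \in A :: s by rewrite inE hB orbT.
  rewrite sub_capmx (submx_trans (submxMr B (capmxSl _ _)) (stab B hB')); apply/eigenspaceP.
  rewrite -mulmxA (comm _ _ hB' (mem_head _ _)) mulmxA.
  by have /eigenspaceP -> := capmxSr V (eigenspace A a); rewrite scalemxAl.
have /andP[vV /eigenspaceP vA] : (v <= V)%MS && (v <= eigenspace A a)%MS by rewrite -sub_capmx.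
exists v; split=> // B; rewrite inE => /orP[/eqP ->|/hv //]; by exists a.
Qed.

Section Embeddings.
Variables (F : fieldType) (M : fieldExtType F).
Local Notation n := (\dim {: M}).
Variables (b : n.-tuple M) (hb : basis_of {: M} b).

(** The coordinates of b_i u form the i-th column, so that for an embedding chi the row (chi b_i) is
    an eigenvector of the transported matrix with eigenvalue chi u. *)
Definition mulmat (u : M) : 'M[F]_n := \matrix_(k, i) coord b k (b`_i * u).

Lemma mulmatE u (i : 'I_n) : b`_i * u = \sum_k mulmat u k i *: b`_k.
Proof. by rewrite {1}(coord_basis hb (memvf (b`_i * u))); apply: eq_bigr => k _; rewrite mxE. Qed.

Lemma mulmatM u w : mulmat (u * w) = mulmat u *m mulmat w.
Proof.
apply/matrixP => k i; rewrite !mxE mulrA mulrAC (mulmatE w) mulr_suml linear_sum /=.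
by apply: eq_bigr => l _; rewrite -scalerAl linearZ /= !mxE mulrC.
Qed.

Lemma mulmat_sum (I : Type) (r : seq I) (P : pred I) (c : I -> F) (w : I -> M) :
  mulmat (\sum_(i <- r | P i) c i *: w i) = \sum_(i <- r | P i) c i *: mulmat (w i).
Proof.
apply/matrixP => k l; rewrite mxE mulr_sumr linear_sum summxE; apply: eq_bigr => i _.
by rewrite !mxE -scalerAr linearZ.
Qed.

Lemma mulmatB u w : mulmat (u - w) = mulmat u - mulmat w.
Proof. by apply/matrixP => k i; rewrite !mxE mulrBr linearB. Qed.

Lemma mulmatZ a u : mulmat (a *: u) = a *: mulmat u.
Proof. by apply/matrixP => k i; rewrite !mxE -scalerAr linearZ. Qed.

Lemma mulmat1 : mulmat 1 = 1%:M.
Proof.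
apply/matrixP => k i; rewrite !mxE mulr1 eq_sym.
by rewrite coord_free ?(basis_free hb) // eq_sym.
Qed.

Variables (R : fieldType) (cl : alg_closed R) (j : {rmorphism F -> R}).
Definition over (chi : M -> R) := forall a, chi a%:A = j a.

Lemma overZ (chi : {rmorphism M -> R}) a u : over chi -> chi (a *: u) = j a * chi u.
Proof. by move=> h; rewrite -h -rmorphM -scalerAl mul1r. Qed.

(** The matrices of all multiplications commute, hence have a common eigenvector inside the
    eigenspace of u for r. Sending each element to its eigenvalue on this vector is a ring morphism
    with value r at u. Separability is not involved. *)
Lemma embed_root u r : root (map_poly j (char_poly (mulmat u))) r ->
  exists2 chi : {rmorphism M -> R}, over chi & chi u = r.
Proof.
pose J w := map_mx j (mulmat w).
have JM w w' : J (w * w') = J w *m J w' by rewrite /J mulmatM map_mxM.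
have JB w w' : J (w - w') = J w - J w' by rewrite /J mulmatB map_mxB.
have J1 : J 1 = 1%:M by rewrite /J mulmat1 map_mx1.
have JC w w' : J w *m J w' = J w' *m J w by rewrite -!JM mulrC.
rewrite map_char_poly -eigenvalue_root_char => V0.
have [||v [v0 vV hv]] := @common_eigenvector R n [seq J b`_i | i : 'I_n] (eigenspace (J u) r) cl V0.
- by move=> _ _ /mapP[i _ ->] /mapP[i' _ ->]; apply: JC.
- move=> _ /mapP[i _ ->]; apply/eigenspaceP; rewrite -mulmxA JC mulmxA.
  by have /eigenspaceP -> := submx_refl (eigenspace (J u) r); rewrite scalemxAl.
have hb' (i : 'I_n) : exists a, v *m J b`_i = a *: v by apply: hv; apply/mapP; exists i; rewrite ?mem_enum.
have hw w : exists a, v *m J w = a *: v.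
  rewrite (coord_basis hb (memvf w)); exists (\sum_i j (coord b i w) * sval (cid (hb' i))).
  rewrite /J mulmat_sum raddf_sum mulmx_sumr scaler_suml; apply: eq_bigr => i _ /=.
  by case: (cid _) => a /= Ea; rewrite map_mxZ -scalemxAr Ea scalerA.
have [i0 vi0] : exists i, v 0 i != 0.
  apply: contrapT => h; move/eqP: v0; apply; apply/rowP => i; rewrite mxE.
  by apply: contrapT => /eqP vi; apply: h; exists i.
have vinj a a' : a *: v = a' *: v -> a = a'.
  by move/rowP => /(_ i0); rewrite !mxE; apply: mulIf.
pose chi w := sval (cid (hw w)).
have hchi w : v *m J w = chi w *: v by rewrite /chi; case: (cid _).
have chiB : zmod_morphism chi.
  by move=> w w'; apply: vinj; rewrite -hchi JB mulmxBr !hchi scalerBl.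
have chiM : monoid_morphism chi.
  split=> [|w w']; apply: vinj; first by rewrite -hchi J1 mulmx1 scale1r.
  by rewrite -hchi JM mulmxA hchi -scalemxAl hchi scalerA.
pose chi' : {rmorphism M -> R} := HB.pack chi (GRing.isZmodMorphism.Build _ _ chi chiB)
  (GRing.isMonoidMorphism.Build _ _ chi chiM).
exists chi'.
  move=> a; apply: vinj; rewrite -hchi /J mulmatZ map_mxZ mulmat1 map_mx1 -scalemxAr.
  by rewrite mulmx1.
by apply: vinj; rewrite -hchi; have /eigenspaceP := vV.
Qed.

Lemma over_root (chi : {rmorphism M -> R}) u : over chi ->
  root (map_poly j (char_poly (mulmat u))) (chi u).
Proof.
move=> hchi; rewrite map_char_poly -eigenvalue_root_char; apply/eigenvalueP.
exists (\row_i chi b`_i).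
  apply/rowP => i; rewrite !mxE mulrC -rmorphM mulmatE rmorph_sum; apply: eq_bigr => k _.
  by rewrite overZ // !mxE mulrC.
apply/eqP => /rowP h; have := oner_neq0 R; rewrite -(rmorph1 chi).
rewrite (coord_basis hb (memvf 1)) rmorph_sum big1 ?eqxx // => i _.
by have := h i; rewrite !mxE overZ // => ->; rewrite mulr0.
Qed.

(** An embedding is determined by the images of the basis, which are roots of finitely many
    polynomials. For each assignment of roots one embedding realizing it is chosen, and some fixed
    embedding where there is none. *)
Lemma embed_finite : exists g (chi : 'I_g -> {rmorphism M -> R}),
  (forall s, over (chi s)) /\
  forall u r, root (map_poly j (char_poly (mulmat u))) r -> exists s, chi s u = r.
Proof.
pose p i := map_poly j (char_poly (mulmat b`_i)).
have hrs i := alg_closed_split (p i) cl.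
pose rs i := sval (cid (hrs i)).
have rsP i r : root (p i) r -> r \in rs i.
  rewrite /rs; case: (cid _) => s /= ->; rewrite rootZ ?root_prod_XsubC //.
  by rewrite lead_coef_eq0 map_poly_eq0 monic_neq0 // char_poly_monic.
pose N := (\max_(i < n) size (rs i))%N.
have n0 : (0 < n)%N by rewrite lt0n dimv_eq0; apply/eqP => /vspaceP/(_ 1); rewrite memvf memv0 oner_eq0.
have [r0 hr0] : exists r, root (map_poly j (char_poly (mulmat 0))) r.
  by apply: cl; rewrite size_map_poly size_char_poly eqSS -lt0n.
have [chi0 over0 _] := embed_root hr0.
pose I : finType := {ffun 'I_n -> 'I_N.+1}.
pose P (f : I) (chi : {rmorphism M -> R}) := over chi /\ forall i : 'I_n, chi b`_i = nth 0 (rs i) (f i).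
pose chi (f : I) := if pselect (exists c, P f c) is left h then sval (cid h) else chi0.
have chi_over f : over (chi f).
  by rewrite /chi; case: pselect => // h; case: (cid _) => c [].
exists #|I|, (fun s => chi (enum_val s)); split=> // u r /embed_root [c oc cu].
have hc (i : 'I_n) : c b`_i \in rs i by apply/rsP/over_root.
have szN (i : 'I_n) : (seq.index (c b`_i)%R (rs i) < N.+1)%N.
  rewrite ltnS (leq_trans (index_size _ _)) // /N; exact: (leq_bigmax (F := fun i : 'I_n => size (rs i))).
pose f : I := [ffun i => Ordinal (szN i)].
have Pf : P f c by split=> // i; rewrite ffunE nth_index.
exists (enum_rank f); rewrite enum_rankK -cu /chi; case: pselect => [h|[]]; last by exists c.
case: (cid _) => c' /= [oc' hc']; rewrite (coord_basis hb (memvf u)) !rmorph_sum.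
by apply: eq_bigr => i _; rewrite !overZ //; case: Pf => _ /(_ i) ->; rewrite hc'.
Qed.
End Embeddings.

Section EmbeddingVector.
Variables (R : fieldType) (cl : alg_closed R) (E : R -> Prop) (hE : is_subfield E).
Local Notation F0 := (sft hE).

Lemma sfvM (x y : F0) : val (x * y) = val x * val y.
Proof. by rewrite rmorphM. Qed.

Lemma sfvV (x : F0) : val x^-1 = (val x)^-1.
Proof. by rewrite fmorphV. Qed.

Lemma sfv_sum (J : finType) (P : pred J) (f : J -> F0) : val (\sum_(i | P i) f i) = \sum_(i | P i) val (f i).
Proof. by rewrite rmorph_sum. Qed.

Lemma sfv_eq0 (x : F0) : (val x == 0) = (x == 0).
Proof. by rewrite fmorph_eq0. Qed.

Variables (M : fieldExtType F0) (b : (\dim {: M}).-tuple M) (hb : basis_of {: M} b).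
Variables (g : nat) (chi : 'I_g -> {rmorphism M -> R}).
Hypothesis hchi : forall s, over (val : F0 -> R) (chi s).
Hypothesis chi_root : forall u r, root (map_poly val (char_poly (mulmat b u))) r ->
  exists s, chi s u = r.
Definition emb (u : M) : 'rV[R]_g := \row_s chi s u.

Lemma embB u w : emb (u - w) = emb u - emb w.
Proof. by apply/rowP => s; rewrite !mxE rmorphB. Qed.

Lemma emb_sum (I : finType) (P : pred I) (c : I -> F0) (f : I -> M) :
  emb (\sum_(i | P i) c i *: f i) = \sum_(i | P i) val (c i) *: emb (f i).
Proof.
apply/rowP => s; rewrite !mxE summxE rmorph_sum; apply: eq_bigr => i _.
by rewrite !mxE; apply: (overZ (j := val)).
Qed.

Lemma emb_ex : 'I_g.
Proof.
suff h : exists s : 'I_g, True by exact: (sval (cid h)).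
have [|r /chi_root [s _]] := cl (p := map_poly val (char_poly (mulmat b 0))); last by exists s.
rewrite size_map_poly size_char_poly eqSS dimv_eq0; apply/eqP => /vspaceP/(_ 1).
by rewrite memvf memv0 oner_eq0.
Qed.

Lemma emb_neq0 u : u != 0 -> emb u != 0.
Proof.
apply: contraNneq => /rowP/(_ emb_ex); rewrite !mxE => /eqP.
by rewrite fmorph_eq0.
Qed.

Lemma emb_alg u s : alg E (chi s u).
Proof.
apply/(algE hE); exists (char_poly (mulmat b u)); first exact/monic_neq0/char_poly_monic.
exact: over_root.
Qed.

Lemma emb_lcomb (S : R -> Prop) (I : finType) (P : pred I) (f : I -> M) x :
  (forall y, S y -> E y) -> lcomb S P (fun i => emb (f i)) x ->
  exists c : I -> F0, (forall i, S (val (c i))) /\ x = emb (\sum_(i | P i) c i *: f i).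
Proof.
move=> SE [c hc ->]; have hv i : exists y : F0, val y = c i by apply: sfv_ex; apply: SE.
exists (fun i => sval (cid (hv i))); split=> [i|]; first by case: (cid _) => y /= ->.
by rewrite emb_sum; apply: eq_bigr => i _; case: (cid _) => y /= ->.
Qed.

End EmbeddingVector.

(** * Graded coefficients and the size of the roots *)

Section Graded.
Variables (R : fieldType) (B : nat -> R -> Prop).
Hypotheses (B0 : forall t, B t 0) (B1 : B 0 1) (BN : forall t x, B t x -> B t (- x))
  (BD : forall t x y, B t x -> B t y -> B t (x + y))
  (BM : forall t t' x y, B t x -> B t' y -> B (t + t')%N (x * y)).

(** Homogeneity of degree t when X has weight 1 and the elements of [B n] have weight n. It serves
    three times: for coefficients bounded by powers of a root, for coefficients of bounded degree,
    and for small coefficients. *)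
Definition graded t (p : {poly R}) :=
  forall i, ((i <= t)%N -> B (t - i) p`_i) /\ ((t < i)%N -> p`_i = 0).

Lemma gradedD t p q : graded t p -> graded t q -> graded t (p + q).
Proof.
move=> hp hq i; have [h1 h2] := hp i; have [h3 h4] := hq i; rewrite coefD; split=> it.
  by apply: BD; auto.
by rewrite h2 ?h4 ?addr0.
Qed.

Lemma gradedN t p : graded t p -> graded t (- p).
Proof.
move=> hp i; have [h1 h2] := hp i; rewrite coefN; split=> it; first by apply: BN; auto.
by rewrite h2 ?oppr0.
Qed.

Lemma gradedM t t' p q : graded t p -> graded t' q -> graded (t + t') (p * q).
Proof.
move=> hp hq i; rewrite coefM; split=> it; last first.
  rewrite big1 // => k _; have [_ h2] := hp k; have [_ h4] := hq (i - k)%N.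
  by case: (ltnP t k) => tk; [rewrite h2 ?mul0r|rewrite h4 ?mulr0 //; lia].
apply: (big_ind (B (t + t' - i))) => // [|k _]; first by move=> *; apply: BD.
have [h1 h2] := hp k; have [h3 h4] := hq (i - k)%N; have ki := ltn_ord k.
case: (ltnP t k) => tk; first by rewrite h2 ?mul0r.
case: (ltnP t' (i - k)) => tk'; first by rewrite h4 ?mulr0.
have -> : (t + t' - i = (t - k) + (t' - (i - k)))%N by lia.
by apply: BM; auto.
Qed.

Lemma graded1 : graded 0 1.
Proof. by move=> i; rewrite coef1; case: i => [|i]; split. Qed.

Lemma graded_prod (I : Type) (s : seq I) (P : I -> {poly R}) :
  (forall i, graded 1 (P i)) -> graded (size s) (\prod_(i <- s) P i).
Proof.
move=> h; elim: s => [|i s IH]; first by rewrite big_nil; exact: graded1.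
by rewrite big_cons /= -add1n; apply: gradedM.
Qed.

Lemma graded_det n (A : 'M[{poly R}]_n) : (forall i j, graded 1 (A i j)) -> graded n (\det A).
Proof.
move=> h; apply: (big_ind (graded n)) => [|p q|s _].
- by move=> i; rewrite coef0; split.
- exact: gradedD.
set pr := \prod_i _; have hs : graded n pr.
  have := @graded_prod 'I_n (enum 'I_n) (fun i => A i (perm.fun_of_perm s i)) (fun i => h _ _).
  by rewrite big_enum /= size_enum_ord.
by case: (perm.odd_perm s); rewrite ?expr1 ?expr0 ?mulN1r ?mul1r //; apply: gradedN.
Qed.

Lemma graded_char_poly n (A : 'M[R]_n) : (forall i j, B 1 (A i j)) -> graded n (char_poly A).
Proof.
move=> h; apply: graded_det => i j k; rewrite !mxE coefB coefMn coefX coefC.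
case: k => [|[|k]] /=; split=> // _; rewrite ?mul0rn ?sub0r ?subr0 ?oppr0 //.
  exact: BN.
by case: eqP.
Qed.
End Graded.

(** The coefficient of X^(n-j) is at most |r0|^j, being a symmetric function of the roots. As r0^n
    equals minus the sum of the lower terms, one of these is at least as large, and there the bound
    is attained. The norm of an element can so be read off its characteristic polynomial. *)
Lemma max_root_norm (R : fieldType) (O : R -> Prop) (p : {poly R}) (rs : seq R) (r0 : R) :
  valuation_ring O -> p = \prod_(r <- rs) ('X - r%:P) -> root p r0 -> r0 != 0 ->
  (forall r, r \in rs -> vle O r r0) ->
  exists2 j, (0 < j <= size rs)%N & veq O p`_(size rs - j) (r0 ^+ j).
Proof.
move=> vO Ep /rootP pr0 r00 hmax; set n := size rs.
pose B t x := vle O x (r0 ^+ t).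
have gp : graded B n p.
  rewrite Ep big_tnth /n -[X in graded _ X _](size_enum_ord (size rs)) -big_enum /=.
  apply: graded_prod => [t||t x y h h'|t t' x y h h'|i].
  - exact: vle0.
  - exact: vle_refl.
  - exact: vleD.
  - by rewrite /B exprD; apply: vleM.
  - move=> k; rewrite coefB coefX coefC; case: k => [|[|k]] /=; split=> // _.
    + rewrite sub0r /B subn0 expr1; apply: (vleN vO); apply: hmax; exact: mem_tnth.
    + by rewrite subr0; exact: vle_refl.
    + by rewrite subr0.
have szp : size p = n.+1 by rewrite Ep size_prod_XsubC.
have lp : p`_n = 1.
  by have /monicP := monic_prod_XsubC rs xpredT id; rewrite -Ep lead_coefE szp.
have : r0 ^+ n != 0 by rewrite expf_neq0.
move: pr0; rewrite horner_coef szp big_ord_recr /= lp mul1r => /eqP; rewrite addrC addr_eq0 => /eqP E.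
rewrite E oppr_eq0 => /(vle_sum_max vO) [i _ hi].
exists (n - i)%N; first by have := ltn_ord i; lia.
have ni := ltnW (ltn_ord i); rewrite subKn //; split.
  by have [h _] := gp i; exact: h.
have /vleN/(vle_trans vO) h : vle O (r0 ^+ n) (- \sum_(i < n) p`_i * r0 ^+ i) by rewrite E; exact: vle_refl.
apply/(vleM2rE vO _ _ (expf_neq0 i r00)); rewrite -exprD subnK //.
by rewrite E; apply: vleN.
Qed.

(** Two terms of the equation have the same value; dividing them gives a power of x. The bound on j
    later yields an exponent that is uniform in a finite extension. *)
Lemma root_norm_power (R : fieldType) (O S : R -> Prop) (p : {poly R}) x : valuation_ring O -> is_subfield S ->
  p != 0 -> (forall i, S p`_i) -> root p x ->
  exists j a, [/\ (0 < j < size p)%N, S a & veq O (x ^+ j) a].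
Proof.
move=> vO hS p0 hp px; have sp := root_size_gt1 p0 px.
move/rootP: px; rewrite horner_coef => E.
have [->|x0] := eqVneq x 0.
  by exists 1%N, 0; split=> //; [exact: sf0|rewrite expr1; apply: veq_refl].
pose F (i : 'I_(size p)) := p`_i * x ^+ i.
have spp : ((size p).-1 < size p)%N by rewrite ltn_predL size_poly_gt0.
have [||i [j [ij Fi Fij]]] := @sum0_two_max _ _ vO _ F (Ordinal spp); first exact: E.
  by rewrite mulf_neq0 ?expf_neq0 //= -lead_coefE lead_coef_eq0.
wlog ltij : i j ij Fi Fij / (i < j)%N => [H|].
  case: (ltngtP i j) => [|lt|/val_inj e]; first exact: H.
    apply: (H j i) => //; [by rewrite eq_sym|exact: veq_neq0 Fij Fi|exact: veq_sym].
  by rewrite e eqxx in ij.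
have pj0 : p`_j != 0 by apply: contraNneq (veq_neq0 Fij Fi) => e; rewrite /F e mul0r.
exists (j - i)%N, (p`_i / p`_j); split; [by rewrite subn_gt0 ltij (leq_ltn_trans (leq_subr _ _))|by apply: sf_div|].
apply/(veqM2lE vO _ _ pj0); rewrite mulrCA mulfV // mulr1.
apply/(veqM2rE vO _ _ (expf_neq0 i x0)); rewrite -mulrA -exprD subnK; last exact: ltnW.
exact: veq_sym.
Qed.

Lemma alg_norm_power (R : fieldType) (O S : R -> Prop) x : valuation_ring O -> is_subfield S ->
  alg S x -> exists j a, [/\ (0 < j)%N, S a & veq O (x ^+ j) a].
Proof.
move=> vO hS [p [p0 hp px]].
by have [j [a [/andP[j0 _] Sa ja]]] := root_norm_power vO hS p0 hp px; exists j, a.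
Qed.

(** * Polynomials of bounded degree *)

Section Box.
Variables (R : fieldType) (S : R -> Prop) (hS : is_subfield S) (d : nat) (T : 'I_d -> R).

Definition box (D : nat) (x : R) := exists p : {mpoly R[d]},
  [/\ forall m, S p@_m, forall m, m \in msupp p -> forall i, (m i <= D)%N & x = p.@[T]].

Lemma box_polyT D x : box D x -> polyT S T x.
Proof. by case=> p [hp _ ->]; exists p. Qed.

Lemma polyT_box x : polyT S T x -> exists D, box D x.
Proof.
case=> p [hp ->]; exists (\max_(m <- msupp p) mdeg m)%N, p; split=> // m hm i.
apply: (leq_trans (n := mdeg m)); last exact: (leq_bigmax_seq (F := fun m => mdeg m)).
by rewrite mdegE (bigD1 i) //= leq_addr.
Qed.

Lemma box_mono D D' x : (D <= D')%N -> box D x -> box D' x.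
Proof. by move=> h [p [hp h1 ->]]; exists p; split=> // m hm i; apply: leq_trans (h1 m hm i) h. Qed.

Lemma box_const D c : S c -> box D c.
Proof.
move=> Sc; exists c%:MP; split; last by rewrite mevalC.
  by move=> m; rewrite mcoeffC; case: eqP => _; rewrite ?mulr1 ?mulr0 //; apply: sf0.
move=> m; rewrite msuppC; case: ifP => // _; rewrite inE => /eqP -> i; by rewrite mnm0E.
Qed.

Lemma box_tmon D f : (forall i, (f i <= D)%N) -> box D (tmon T f).
Proof.
move=> hf; exists 'X_[[multinom f i | i < d]]; split.
- by move=> m; rewrite mcoeffX; case: eqP => _ /=; [exact: sf1|exact: sf0].
- by move=> m; rewrite msuppX inE => /eqP -> i; rewrite mnmE.
- by rewrite mevalX; apply: eq_bigr => i _; rewrite mnmE.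
Qed.

Lemma boxD D x y : box D x -> box D y -> box D (x + y).
Proof.
move=> [p [hp h1 ->]] [q [hq h2 ->]]; exists (p + q); rewrite mevalD; split=> //.
  exact: mcoefD.
by move=> m /msuppD_le; rewrite mem_cat => /orP[/h1|/h2].
Qed.

Lemma boxN D x : box D x -> box D (- x).
Proof.
move=> [p [hp h1 ->]]; exists (- p); rewrite mevalN; split=> //.
  by move=> m; rewrite mcoeffN; apply: sfN.
by move=> m; rewrite (perm_mem (msuppN p)) => /h1.
Qed.

Lemma boxM D D' x y : box D x -> box D' y -> box (D + D') (x * y).
Proof.
move=> [p [hp h1 ->]] [q [hq h2 ->]]; exists (p * q); rewrite mevalM; split=> //.
  exact: mcoefM.
move=> m /msuppM_le /allpairsP [[m1 m2] /= [/h1 h /h2 h' ->]] i.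
by rewrite mnmDE leq_add.
Qed.

Lemma box_sum (I : Type) (r : seq I) (P : pred I) (F : I -> R) D :
  (forall i, P i -> box D (F i)) -> box D (\sum_(i <- r | P i) F i).
Proof.
by move=> h; apply: (big_ind (box D)) => //; [apply: box_const; exact: sf0|move=> *; apply: boxD].
Qed.

Lemma box_lead (O : R -> Prop) D x : valuation_ring O -> vindep O S T -> box D x -> x != 0 ->
  exists c f, [/\ S c, c != 0, forall i, (f i <= D)%N &
    vlt O (x - c * tmon T f) (c * tmon T f)].
Proof.
move=> vO iT [p [hp h1 ->]] p0; have p0' : p != 0 by apply: contraNneq p0 => ->; rewrite meval0.
have [m [ms c0 h]] := vindep_lead vO iT hp p0'; exists p@_m, m; split=> //; last exact: h1.
by move: c0; rewrite mulf_eq0 negb_or => /andP[].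
Qed.

Lemma ratT_lead (O : R -> Prop) x : valuation_ring O -> vindep O S T -> ratT S T x -> x != 0 ->
  exists c f f', [/\ S c, c != 0 &
    vlt O (x - c * (tmon T f / tmon T f')) (c * (tmon T f / tmon T f'))].
Proof.
move=> vO iT [a [b [/polyT_box [D ha] /polyT_box [D' hb] b0 ->]]]; rewrite mulf_eq0 invr_eq0 negb_or.
move=> /andP[a0 _]; have [c [f [Sc c0 _ hc]]] := box_lead vO iT ha a0.
have [c' [f' [Sc' c'0 _ hc']]] := box_lead vO iT hb b0.
have t0 h : tmon T h != 0 by apply: tmon_neq0; case: iT.
exists (c / c'), f, f'; split; [exact: sf_div|by rewrite mulf_neq0 ?invr_eq0|].
set u := c * tmon T f in hc *; set u' := c' * tmon T f' in hc' *.
have u'0 : u' != 0 by rewrite mulf_neq0.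
have -> : c / c' * (tmon T f / tmon T f') = u / u' by rewrite /u /u' invfM mulrACA.
have hb' : veq O b u' by apply: veq_close.
apply/(vltM2rE vO _ _ (mulf_neq0 b0 u'0)).
have -> : (a / b - u / u') * (b * u') = (a - u) * u' - u * (b - u').
  by field; rewrite b0 u'0.
have -> : u / u' * (b * u') = u * b by field.
have u0 : u != 0 by rewrite mulf_neq0.
apply: (vlt_veqr vO (y := u * u')); last by apply: veqM => //; [exact: veq_refl|exact: veq_sym].
apply: vltB => //; first by apply/vltM2rE.
by apply/vltM2lE.
Qed.

Lemma ratT_denom_fin (I : finType) (x : I -> R) : (forall i, ratT S T (x i)) ->
  exists b, [/\ polyT S T b, b != 0 & forall i, polyT S T (b * x i)].
Proof.
move=> hx; have [|b [hb b0 h]] := @ratT_denom _ S d T (\poly_(i < #|I|) odflt 0 (omap x (ohead (drop i (enum I))))) hS.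
  move=> i; rewrite coef_poly; case: ifP => _; last by apply: ratT_const => //; exact: sf0.
  by case: (ohead _) => [j|] /=; [exact: hx|apply: ratT_const => //; exact: sf0].
exists b; split=> // i; have := h (enum_rank i); rewrite coef_poly ltn_ord.
rewrite (drop_nth i) -?cardE ?ltn_ord //= nth_enum_rank //.
Qed.
End Box.

(** * Stability *)

(** With more members in v than in f, some nontrivial combination of the approximants vanishes. The
    same combination of the v equals that of the errors, hence is smaller than its largest term,
    against orthogonality. *)
Lemma orth_close_card (K R : fieldType) (iota : {rmorphism K -> R}) (O : R -> Prop) g
  (P Q : finType) (v : P -> 'rV[R]_g) (f : Q -> 'rV[R]_g) : valuation_ring O ->
  orth O (imK' iota) v -> (forall i, v i != 0) ->
  (forall i, exists2 y, lcomb (imK' iota) predT f y & nlt O (v i - y) (v i)) ->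
  (#|P| <= #|Q|)%N.
Proof.
move=> vO ov v0 hy; rewrite leqNgt; apply/negP => QP.
have hc i : exists c : Q -> K, nlt O (v i - \sum_q iota (c q) *: f q) (v i).
  have [_ [c hc ->] h] := hy i; exists (fun q => sval (cid (hc q))).
  by under eq_bigr => q _ do case: (cid _) => a /= <-.
pose c i := sval (cid (hc i)).
have Ec i : nlt O (v i - \sum_q iota (c i q) *: f q) (v i) by rewrite /c; case: (cid _).
pose A : 'M[K]_(#|P|, #|Q|) := \matrix_(i, q) c (enum_val i) (enum_val q).
have [x [x0 xA]] : exists x : 'rV_(#|P|), x != 0 /\ x *m A = 0.
  exists (nz_row (kermx A)); rewrite nz_row_eq0 -mxrank_eq0 mxrank_ker subn_eq0 -ltnNge.
  split; first exact: leq_ltn_trans (rank_leq_col _) QP.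
  by apply/sub_kermxP/nz_row_sub.
pose a p := iota (x 0 (enum_rank p)).
have sum0 : \sum_p a p *: \sum_q iota (c p q) *: f q = 0.
  under eq_bigr => p _ do rewrite scaler_sumr.
  rewrite exchange_big big1 // => q _; under eq_bigr => p _ do rewrite scalerA -rmorphM.
  rewrite -scaler_suml -rmorph_sum.
  suff -> : \sum_p x 0 (enum_rank p) * c p q = 0 by rewrite rmorph0 scale0r.
  have /rowP/(_ (enum_rank q)) := xA; rewrite !mxE => h; rewrite -[RHS]h.
  rewrite (reindex_onto (@enum_val P predT) enum_rank) /=; last by move=> p _; rewrite enum_rankK.
  by apply: eq_big => [i|i _]; rewrite ?mxE ?enum_valK ?eqxx // enum_rankK.
have [p0 ap0] : exists p, a p != 0.
  apply: contrapT => h; move/eqP: x0; apply; apply/rowP => i; rewrite mxE.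
  apply: contrapT => /eqP xi; apply: h; exists (enum_val i).
  by rewrite /a enum_valK fmorph_eq0.
have [p _ hp] := @nmax_exists _ _ vO _ P predT (fun p => a p *: v p) p0 isT.
have avp : a p *: v p != 0.
  apply: contraTneq (v0 p0) => e; have := hp p0 isT; rewrite e => /nle_0/eqP.
  by rewrite scaler_eq0 (negPf ap0) /= => ->.
have : nlt O (\sum_p a p *: v p) (a p *: v p).
  have -> : \sum_p a p *: v p = \sum_p a p *: (v p - \sum_q iota (c p q) *: f q).
    by under [RHS]eq_bigr => q _ do rewrite scalerBr; rewrite sumrB sum0 subr0.
  apply: nlt_sum => // q _.
  have [->|aq] := eqVneq (a q) 0; first by rewrite scale0r; apply: nlt0.
  by apply: (nlt_le_trans vO _ (hp q isT)); apply/nltZE.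
by apply; apply: ov => i; exists (x 0 (enum_rank i)).
Qed.

Lemma box_growth (n r c d : nat) : (forall m, n * m.+1 ^ d <= r * (m.+1 + c) ^ d)%N -> (n <= r)%N.
Proof.
move=> h; rewrite leqNgt; apply/negP => rn.
(* Bernoulli's inequality in the form (1 + 1/k)^e <= k / (k - e). *)
have grow k e : (e < k)%N -> (k.+1 ^ e * (k - e) <= k ^ e * k)%N.
  elim: e => [|e IH] ek; first by rewrite subn0.
  rewrite !expnS; have := IH (ltnW ek); set a := (k.+1 ^ e)%N; set b := (k ^ e)%N => h1.
  have h2 : (k.+1 * (k - e.+1) <= k * (k - e))%N by nia.
  apply: (@leq_trans (a * (k * (k - e)))); first by rewrite (mulnC k.+1) -mulnA leq_mul2l h2 orbT.
  by rewrite mulnCA -(mulnA k b) leq_mul2l h1 orbT.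
(* For m + 1 = ck, where c is the nonzero shift, the hypothesis bounds n/r by (1 + 1/k)^d. If r < n,
   the previous inequality gives (r+1)(k-d) <= rk, that is k <= (r+1)d, which this choice of k
   excludes. *)
pose k := (r.+1 * d).+1.
have kd : (d < k)%N by rewrite /k ltnS leq_pmull.
case: c h => [|c] h.
  by have := h 0%N; rewrite addn0 !exp1n; lia.
have := h (c.+1 * k).-1; rewrite prednK; last by rewrite muln_gt0.
have -> : (c.+1 * k + c.+1 = c.+1 * k.+1)%N by lia.
rewrite !expnMn => h1.
have h2 : (n * k ^ d <= r * k.+1 ^ d)%N.
  have c0 : (0 < c.+1 ^ d)%N by rewrite expn_gt0.
  by rewrite -(leq_pmul2l c0) mulnCA (mulnCA _ r).
have h3 := grow k d kd; have kd0 : (0 < k ^ d)%N by rewrite expn_gt0.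
have h4 : (r.+1 * k ^ d * (k - d) <= r * k ^ d * k)%N.
  apply: (@leq_trans (r * k.+1 ^ d * (k - d))).
    by rewrite leq_mul2r (leq_trans _ h2) ?orbT // leq_mul2r rn orbT.
  by rewrite -!mulnA leq_mul2l h3 orbT.
have : (r.+1 * (k - d) <= r * k)%N by rewrite -(leq_pmul2l kd0); lia.
rewrite /k in kd *; nia.
Qed.

(** Division by j jl turns the equation into mu - mu' = nu/j + (h' - h)/jl, where the first summand
    lies between 0 and D and the second between -B and B. *)
Lemma exponent_bound (j jl mu mu' h h' nu D B : nat) : (0 < j)%N -> (0 < jl)%N ->
  (mu * (j * jl) + h * j = nu * jl + (mu' * (j * jl) + h' * j))%N ->
  (h <= B)%N -> (h' <= B)%N -> (nu <= j * D)%N -> (mu' <= mu + B)%N /\ (mu <= D + B + mu')%N.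
Proof.
move=> j0 jl0 e hB h'B nuD; have jj : (0 < j * jl)%N by rewrite muln_gt0 j0.
have h1 : (h * j <= B * (j * jl))%N by apply: leq_mul => //; apply: leq_pmulr.
have h2 : (h' * j <= B * (j * jl))%N by apply: leq_mul => //; apply: leq_pmulr.
have h3 : (nu * jl <= D * (j * jl))%N by rewrite mulnA (mulnC D) leq_mul2r nuD orbT.
by split; rewrite -(leq_pmul2r jj) !mulnDl; lia.
Qed.

Section Stability.
Variables (K R : fieldType) (iota : {rmorphism K -> R}) (OK : K -> Prop) (O : R -> Prop).
Hypotheses (vK : valuation_ring OK) (vO : valuation_ring O) (ext : extends iota OK O).
Hypotheses (hens : henselian OK) (dfl : defectless OK) (cl : alg_closed R).
Variables (d : nat) (T : 'I_d -> R).
Local Notation Kp := (imK' iota).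
Hypothesis iT : vindep O Kp T.
Let hK : is_subfield Kp := imK_subfield iota.
Local Notation E := (ratT Kp T).
Variable hE : is_subfield E.
Local Notation F0 := (sft hE).

(** A power of each algebraic element has the value of an element of S; raising a relation to a
    common power brings its coefficients back to S and multiplies all exponents by the same
    number. *)
Lemma vindep_alg (S : R -> Prop) : is_subfield S -> vindep O S T -> vindep O (alg S) T.
Proof.
move=> hS [T0 hT]; split=> // c c' m n Ac Ac' c0 c'0 e.
have [j [a [j0 Sa ha]]] := alg_norm_power vO hS Ac.
have [j' [a' [j'0 Sa' ha']]] := alg_norm_power vO hS Ac'.
have a0 : a ^+ j' != 0 by apply/expf_neq0/(veq_neq0 ha)/expf_neq0.
have a'0 : a' ^+ j != 0 by apply/expf_neq0/(veq_neq0 ha')/expf_neq0.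
have h : veq O (a ^+ j' * tmon T (fun i => m i * (j * j'))%N)
               (a' ^+ j * tmon T (fun i => n i * (j * j'))%N).
  rewrite -!tmonX; apply: (veq_trans vO (y := (c * tmon T m) ^+ (j * j'))).
    rewrite exprMn (exprM c); apply: veqM => //; last exact: veq_refl.
    by apply: veqX => //; apply: veq_sym.
  apply: (veq_trans vO (y := (c' * tmon T n) ^+ (j * j'))); first exact: veqX.
  rewrite exprMn; apply: veqM => //; last exact: veq_refl.
  by rewrite mulnC (exprM c'); apply: veqX.
move=> i; have /(_ i) := hT _ _ _ _ (sfX hS j' Sa) (sfX hS j Sa') a0 a'0 h.
by move/eqP; rewrite eqn_pmul2r ?muln_gt0 ?j0 // => /eqP.
Qed.

Lemma stability_abhyankar : abhyankar O (alg Kp) (alg E) T.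
Proof.
split=> //.
- exact: alg_subfield.
- exact: alg_subfield.
- by move=> x; apply: alg_mono => y; apply: ratT_const.
- by move=> x; apply: alg_alg.
- by move=> x; apply: alg_alg.
- exact: vindep_alg.
- move=> x; apply: alg_mono => y; apply: ratT_mono; first exact: alg_subfield.
  by move=> z; apply: alg_incl.
Qed.

Variables (M : fieldExtType F0) (b : (\dim {: M}).-tuple M) (hb : basis_of {: M} b).
Variables (g : nat) (chi : 'I_g -> {rmorphism M -> R}).
Hypothesis hchi : forall s, over (val : F0 -> R) (chi s).
Hypothesis chi_root : forall u r, root (map_poly val (char_poly (mulmat b u))) r ->
  exists s, chi s u = r.
Local Notation emb := (emb chi).
Let embB u w : emb (u - w) = emb u - emb w. Proof. exact: embB. Qed.
Let emb_sum (I : finType) (P : pred I) (c : I -> F0) (f : I -> M) :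
  emb (\sum_(i | P i) c i *: f i) = \sum_(i | P i) val (c i) *: emb (f i).
Proof. exact: emb_sum. Qed.
Let emb_neq0 u : u != 0 -> emb u != 0. Proof. exact: (emb_neq0 cl chi_root). Qed.
Let emb_alg u s : alg E (chi s u). Proof. exact: (emb_alg hb hchi). Qed.

Lemma tmonE f : E (tmon T f).
Proof.
apply/(ratT_poly hK)/(@box_polyT _ _ _ _ (\max_i f i)); apply: box_tmon => // i.
exact: leq_bigmax.
Qed.

Lemma bound_fin (I : finType) (P : nat -> I -> Prop) :
  (forall i D D', (D <= D')%N -> P D i -> P D' i) -> (forall i, exists D, P D i) ->
  exists D, forall i, P D i.
Proof.
move=> mono hP; exists (\max_i sval (cid (hP i)))%N => i.
by apply: mono (svalP (cid (hP i))); apply: leq_bigmax.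
Qed.

Lemma emb_norm u : u != 0 -> exists s j c f f', [/\ forall s', vle O (chi s' u) (chi s u),
  chi s u != 0, (0 < j)%N, Kp c & c != 0 /\ veq O (chi s u ^+ j) (c * (tmon T f / tmon T f'))].
Proof.
move=> u0; have [s] := nmax vO (emb_neq0 u0); rewrite mxE => su hs.
have [j [a [j0 Ea ha]]] := alg_norm_power vO hE (emb_alg u s).
have a0 : a != 0 by apply: (veq_neq0 ha); rewrite expf_neq0.
have [c [f [f' [Kc c0 h]]]] := ratT_lead hK vO iT Ea a0.
exists s, j, c, f, f'; split=> //; first by move=> s'; have := hs s'; rewrite !mxE.
by split=> //; apply: (veq_trans vO ha); apply: veq_close.
Qed.

(** The factor delta is a common denominator of the matrices of multiplication by the basis
    elements; after scaling, their entries are polynomials in T, of degree at most C in each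
    variable. *)
Lemma scaled_structure : exists delta C, delta != 0 :> F0 /\
  forall i k l : 'I_(\dim {: M}), box Kp T C (val (mulmat b (delta *: b`_i) k l)).
Proof.
pose x (p : 'I_(\dim {: M}) * 'I_(\dim {: M}) * 'I_(\dim {: M})) :=
  val (mulmat b b`_p.1.1 p.1.2 p.2).
have [|dl [hdl dl0 hx]] := @ratT_denom_fin R Kp hK d T _ x; first by move=> p; apply: sfvP.
have [delta Edl] : exists y : F0, val y = dl by apply: sfv_ex; apply: ratT_poly.
have [C hC] := @bound_fin _ (fun D p => box Kp T D (dl * x p)) (fun p D D' => @box_mono _ _ _ _ D D' _)
  (fun p => polyT_box (hx p)).
exists delta, C; split; first by apply: contraNneq dl0 => e; rewrite -Edl e.
by move=> i k l; rewrite mulmatZ mxE; have := hC (i, k, l); rewrite -Edl -rmorphM.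
Qed.

Section Counting.
Variables (delta : F0) (C : nat).
Hypothesis hC : forall i k l : 'I_(\dim {: M}), box Kp T C (val (mulmat b (delta *: b`_i) k l)).

(** Multiplication by u has entries of degree at most m + C, so the coefficient of weight j of its
    characteristic polynomial has degree at most j(m + C). By [max_root_norm] one of these
    coefficients has the value of the j-th power of the norm of u. The linear bound with slope 1 in
    m is what makes the counting sharp. *)
Lemma box_norm m (p : 'I_(\dim {: M}) -> F0) u : (forall i, box Kp T m (val (p i))) ->
  u = \sum_i p i *: (delta *: b`_i) -> u != 0 ->
  exists s j c f, [/\ forall s', vle O (chi s' u) (chi s u), chi s u != 0, (0 < j)%N, Kp c &
    [/\ c != 0, forall i, (f i <= j * (m + C))%N & veq O (chi s u ^+ j) (c * tmon T f)]].
Proof.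
move=> hp Eu u0; have [s] := nmax vO (emb_neq0 u0); rewrite mxE => su hs.
have hs' s' : vle O (chi s' u) (chi s u) by have := hs s'; rewrite !mxE.
set A := map_mx val (mulmat b u); pose P := char_poly A.
have EP : P = map_poly val (char_poly (mulmat b u)) by rewrite map_char_poly.
have [rs Ers] := alg_closed_split P cl.
have {}Ers : P = \prod_(r <- rs) ('X - r%:P).
  by rewrite Ers (monicP (char_poly_monic A)) scale1r.
have szP : size rs = \dim {: M}.
  by apply: succn_inj; rewrite -(size_char_poly A) -/P Ers size_prod_XsubC.
have [|r rrs|j /andP[j0 jn] hj] := max_root_norm vO Ers _ su.
- by rewrite EP; apply: over_root.
- have [|s' <-] := chi_root (u := u) (r := r); last exact: hs'.
  by rewrite -EP Ers root_prod_XsubC.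
have gP : graded (fun t => box Kp T (t * (m + C))) (\dim {: M}) P.
  apply: graded_char_poly => [t||t x|t x y|t t' x y|k l].
  - by apply: box_const => //; apply: sf0.
  - by apply: box_const => //; apply: sf1.
  - exact: boxN.
  - exact: boxD.
  - by rewrite mulnDl; apply: boxM.
  - rewrite mul1n !mxE Eu mulr_sumr linear_sum rmorph_sum; apply: box_sum => // i _.
    rewrite -scalerAr linearZ rmorphM; apply: boxM => //; first exact: (hp i).
    by have := hC i k l; rewrite mxE.
rewrite szP in jn hj; have r0 : chi s u ^+ j != 0 by rewrite expf_neq0.
have [h _] := gP (\dim {: M} - j)%N; have := h (leq_subr _ _); rewrite subKn // => {}h.
have [c [f [Kc c0 hf hlead]]] := box_lead vO iT h (veq_neq0 (veq_sym hj) r0).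
exists s, j, c, f; split=> //; split=> //.
by apply: (veq_trans vO (veq_sym hj)); apply: veq_close.
Qed.

Section Approximation.
Variables (I : finType) (f : I -> M).
Hypotheses (orf : orth O E (fun l => emb (f l))) (f0 : forall l, f l != 0).
Hypothesis maxf : forall u, u != 0 -> exists2 e : I -> R, forall l, E (e l) &
  nlt O (emb u - \sum_l e l *: emb (f l)) (emb u).

(** By maximality u is approximated by a combination of f over E. Each coefficient may be replaced
    by its leading monomial, and comparison of norms bounds the exponents of the monomials that
    matter. So u is approximated from a K-space whose dimension grows like #|I| m^d. *)
Lemma box_approx : exists B, forall m (p : 'I_(\dim {: M}) -> F0) u,
  (forall i, box Kp T m (val (p i))) -> u = \sum_i p i *: (delta *: b`_i) -> u != 0 ->
  exists2 y, lcomb Kp predT (fun q : I * {ffun 'I_d -> 'I_(m.+1 + (C + B * 2))} =>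
      (tmon T (fun i => q.2 i : nat) / tmon T (fun=> B)) *: emb (f q.1)) y &
    nlt O (emb u - y) (emb u).
Proof.
have [T0 _] := iT.
pose Q (B : nat) (l : I) := exists s j c h h', [/\ forall s', vle O (chi s' (f l)) (chi s (f l)),
  (0 < j)%N, Kp c, c != 0 &
  [/\ forall i : 'I_d, (h i <= B)%N, forall i : 'I_d, (h' i <= B)%N &
      veq O (chi s (f l) ^+ j) (c * (tmon T h / tmon T h'))]].
have [B hB] : exists B, forall l, Q B l.
  apply: bound_fin => [l D D' DD' [s [j [c [h [h' [h1 h2 h3 h4 [h5 h6 h7]]]]]]]|l].
    exists s, j, c, h, h'; split=> //; split=> // i; apply: leq_trans DD'; auto.
  have [s [j [c [h [h' [h1 h2 h3 h4 [h5 h6]]]]]]] := emb_norm (f0 l).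
  exists (\max_i h i + \max_i h' i)%N, s, j, c, h, h'; split=> //; split=> // i.
    exact: leq_trans (leq_bigmax i) (leq_addr _ _).
  exact: leq_trans (leq_bigmax (F := h') i) (leq_addl _ _).
(* The exponents mu - mu', shifted by B, range from 0 to (m + C) + 2B; N is their number. *)
exists B => m p u hp Eu u0; set N := (m.+1 + (C + B * 2))%N.
have [e Ee he] := maxf u0.
have eu0 := emb_neq0 u0.
have [s [j [k [nu [smax su j0 Kk [k0 hnu hk]]]]]] := box_norm hp Eu u0.
have leu l : nle O (e l *: emb (f l)) (emb u).
  apply: (nle_trans vO (orf Ee l)).
  rewrite -[X in nle _ X _](subKr (emb u)); apply: nleB => //; first exact: nle_refl.
  exact: nltW.
have step l : exists z : R * {ffun 'I_d -> 'I_N}, Kp z.1 /\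
    nlt O ((e l - z.1 * (tmon T (fun i => z.2 i : nat) / tmon T (fun=> B))) *: emb (f l)) (emb u).
  have N0 : (0 < N)%N by [].
  case: (nleVlt O (emb u) (e l *: emb (f l))) => [ule|ult]; last first.
    by exists (0, [ffun=> Ordinal N0]); rewrite mul0r subr0; split=> //; exact: sf0.
  have el0 : e l != 0.
    by apply: contraNneq eu0 => el0; move: ule; rewrite el0 scale0r => /nle_0/eqP.
  have [c [mu [mu' [Kc c0 ha]]]] := ratT_lead hK vO iT (Ee l) el0.
  set a := c * _ in ha; have ea : veq O (e l) a by apply: veq_close.
  have [t [jl [kl [h [h' [tmax jl0 Kkl kl0 [hh hh' hkl]]]]]]] := hB l.
  set rl := chi t (f l) in hkl tmax; set r := chi s u in su smax hk.
  have e1 : veq O (a * rl) r.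
    apply: (veq_trans vO (y := e l * rl)).
      by apply: veqM => //; [exact: veq_sym|exact: veq_refl].
    split.
      have [s'] := leu l t; rewrite !mxE => h1; exact: vle_trans h1 (smax s').
    have [t'] := ule s; rewrite !mxE => h1; apply: (vle_trans vO h1).
    exact: vleM2l.
  have T0' x : tmon T x != 0 by apply: tmon_neq0.
  (* The equality of norms, raised to the power j jl and freed of negative exponents, so that value
     independence of T applies. *)
  have e2 : veq O (c ^+ (j * jl) * kl ^+ j * tmon T (fun i => mu i * (j * jl) + h i * j)%N)
      (k ^+ jl * tmon T (fun i => nu i * jl + (mu' i * (j * jl) + h' i * j))%N).
    rewrite !tmonD -!tmonX.
    have E1 : c ^+ (j * jl) * kl ^+ j * (tmon T mu ^+ (j * jl) * tmon T h ^+ j) =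
        a ^+ (j * jl) * (kl * (tmon T h / tmon T h')) ^+ j *
        (tmon T mu' ^+ (j * jl) * tmon T h' ^+ j).
      have := T0' h'; have := T0' mu'; rewrite /a !exprMn !exprVn => z1 z2.
      by field; rewrite !expf_neq0.
    have E2 : k ^+ jl * (tmon T nu ^+ jl * (tmon T mu' ^+ (j * jl) * tmon T h' ^+ j)) =
        (k * tmon T nu) ^+ jl * (tmon T mu' ^+ (j * jl) * tmon T h' ^+ j).
      by rewrite exprMn; ring.
    rewrite E1 E2; apply: veqM => //; last exact: veq_refl.
    apply: (veq_trans vO (y := a ^+ (j * jl) * (rl ^+ jl) ^+ j)).
      by apply: veqM => //; [exact: veq_refl|apply: veqX => //; exact: veq_sym].
    rewrite -exprM (mulnC jl) -exprMn; apply: (veq_trans vO (y := r ^+ (j * jl))).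
      exact: veqX.
    by rewrite exprM; apply: veqX.
  have [_ hT] := iT.
  have e3 := hT _ _ _ _ _ _ _ _ e2.
  have {e3} e3 i : (mu i * (j * jl) + h i * j = nu i * jl + (mu' i * (j * jl) + h' i * j))%N.
    apply: e3; rewrite ?mulf_neq0 ?expf_neq0 //; first by apply: sfM => //; apply: sfX.
    exact: sfX.
  have bd i := exponent_bound j0 jl0 (e3 i) (hh i) (hh' i) (hnu i).
  have b2 i : (mu i + B - mu' i < N)%N.
    by have [_ h1] := bd i; rewrite /N muln2 -addnn; move: h1; clear; lia.
  exists (c, [ffun i => Ordinal (b2 i)]); split=> //=.
  have -> : c * (tmon T (fun i => [ffun i => Ordinal (b2 i)] i : nat) / tmon T (fun=> B)) = a.
    rewrite /a; congr (_ * _).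
    apply/(mulIf (T0' (fun=> B)))/(mulIf (T0' mu')); rewrite divfK // -!tmonD.
    rewrite mulrAC divfK // -!tmonD; apply: eq_bigr => i _.
    by have [h1 _] := bd i; rewrite ffunE /= subnK.
  apply: (nlt_le_trans vO _ (leu l)); apply/nltZr => //; first exact: emb_neq0.
  exact: (vlt_veqr vO ha (veq_sym ea)).
pose z l := sval (cid (step l)); pose w l := (z l).1 * (tmon T (fun i => (z l).2 i : nat) / tmon T (fun=> B)).
exists (\sum_l w l *: emb (f l)).
  pose G (q : I * {ffun 'I_d -> 'I_N}) :=
    (tmon T (fun i => q.2 i : nat) / tmon T (fun=> B)) *: emb (f q.1).
  have sv : subspace Kp (lcomb Kp predT G) by apply: lcomb_subspace.
  apply: (subspace_sum (S := Kp) (X := lcomb Kp predT G)) => // l _.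
  rewrite /w -scalerA; have [_ _ Z] := sv; apply: Z.
    by rewrite /z; case: (cid _) => x [].
  exact: (@lcomb_gen _ _ hK _ _ predT G (l, (z l).2) isT).
have -> : emb u - \sum_l w l *: emb (f l) =
    (emb u - \sum_l e l *: emb (f l)) + \sum_l (e l - w l) *: emb (f l).
  under [X in _ = _ + X]eq_bigr => l _ do rewrite scalerBl.
  by rewrite sumrB addrA subrK.
apply: nltD => //; apply: nlt_sum => // l _.
by rewrite /w /z; case: (cid _) => x [].
Qed.
End Approximation.
End Counting.

Section MonomialBasis.
Variables (delta : F0) (m : nat).
Local Notation P := ('I_(\dim {: M}) * {ffun 'I_d -> 'I_m.+1})%type.
Definition emon (p : P) : F0 := sval (cid (sfv_ex hE (tmonE (fun i => p.2 i : nat)))).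
Definition belt (p : P) : M := emon p *: (delta *: b`_p.1).

Lemma emonE p : val (emon p) = tmon T (fun i => p.2 i : nat).
Proof. by rewrite /emon; case: (cid _). Qed.

Lemma belt_sum (c : P -> F0) :
  \sum_p c p *: belt p = \sum_i (\sum_f c (i, f) * emon (i, f)) *: (delta *: b`_i).
Proof.
under [RHS]eq_bigr => i _ do rewrite scaler_suml.
by rewrite pair_bigA /=; apply: eq_bigr => -[i f] _; rewrite /belt scalerA.
Qed.

Lemma belt_box (c : P -> F0) i : (forall p, Kp (val (c p))) ->
  box Kp T m (val (\sum_f c (i, f) * emon (i, f))).
Proof.
move=> hc; rewrite sfv_sum; apply: box_sum => // f _; rewrite sfvM emonE.
apply: (@boxM R Kp hK d T 0 m); first exact: box_const (hc _).
by apply: box_tmon => // k; have := ltn_ord (f k).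
Qed.

Lemma belt_free (c : P -> F0) : delta != 0 -> (forall p, Kp (val (c p))) ->
  \sum_p c p *: belt p = 0 -> forall p, c p = 0.
Proof.
move=> delta0 hc; rewrite belt_sum => h.
have h0 i : \sum_f c (i, f) * emon (i, f) = 0.
  have /freeP fb := basis_free hb.
  suff /eqP : (\sum_f c (i, f) * emon (i, f)) * delta = 0 by rewrite mulf_eq0 (negPf delta0) orbF => /eqP.
  apply: (fb (fun i => (\sum_f c (i, f) * emon (i, f)) * delta)).
  by rewrite -[RHS]h; apply: eq_bigr => k _; rewrite scalerA.
case=> i f; apply/eqP/negPn/negP => cf; have [T0 hT] := iT.
have := congr1 val (h0 i); rewrite sfv_sum => h1.
have t0 q : val (emon q) != 0 by rewrite emonE tmon_neq0.
have [|f1 [f2 [f12 nz hv]]] := sum0_two_max vO h1 (i0 := f).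
  by rewrite sfvM mulf_neq0 // sfv_eq0.
have nz2 := veq_neq0 hv nz; move: nz nz2 hv; rewrite !sfvM !mulf_eq0 !negb_or.
move=> /andP[c1 _] /andP[c2 _]; rewrite !emonE => /(hT _ _ _ _ (hc _) (hc _) c1 c2) e.
by move/eqP: f12; apply; apply/ffunP => k; apply/val_inj; apply: e.
Qed.
End MonomialBasis.

(** The elements [belt] are [M : E](m+1)^d many and independent over K. A K-orthogonal basis of
    their span is approximated from the space of [box_approx], and [orth_close_card] compares the
    two numbers for every m. *)
Lemma stability_count (I : finType) (f : I -> M) :
  orth O E (fun l => emb (f l)) -> (forall l, f l != 0) ->
  (forall u, u != 0 -> exists2 e : I -> R, forall l, E (e l) &
     nlt O (emb u - \sum_l e l *: emb (f l)) (emb u)) -> (\dim {: M} <= #|I|)%N.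
Proof.
move=> orf f0 maxf; have [delta [C [delta0 hC]]] := scaled_structure.
have [B hB] := box_approx hC orf f0 maxf.
apply: (@box_growth _ _ (C + B * 2) d) => m.
pose P := ('I_(\dim {: M}) * {ffun 'I_d -> 'I_m.+1})%type.
pose el (i : 'I_#|{: P}|) : M := belt delta (enum_val i).
have reix (c : 'I_#|{: P}| -> F0) : \sum_i c i *: el i = \sum_p c (enum_rank p) *: belt delta p.
  rewrite [RHS](reindex_onto (@enum_val P predT) enum_rank) /=; last by move=> i _; rewrite enum_rankK.
  by apply: eq_big => [i|i _]; rewrite enum_valK ?eqxx.
(* The orthogonal family u spans a space that may be larger than that of the vectors [emb (el i)].
   The exchange lemma extracts members that lie in the smaller space, as many as there are
   independent vectors. *)
have [|I' [u [ou u0 hu]]] := orth_span vK vO ext hens dfl stability_abhyankar (b := fun i => emb (el i)).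
  by move=> i s; rewrite mxE; apply: emb_alg.
pose w j := if insub j is Some i then emb (el i) else 0.
have wE (i : 'I_#|{: P}|) : w i = emb (el i) by rewrite /w valK.
have [|c hc e j jN|u' [A [ou' u'0 cA hA _]]] := orth_exchange vO hK (w := w) (N := #|{: P}|) ou u0.
- by move=> j jN; rewrite -[j]/(val (Ordinal jN)) wE.
- have hv i : exists y : F0, val y = c i by apply: sfv_ex; apply: ratT_const.
  pose c' i := sval (cid (hv i)); have Ec i : val (c' i) = c i by rewrite /c'; case: (cid _).
  have : emb (\sum_(i < #|{: P}|) c' i *: el i) = 0.
    by rewrite emb_sum -[RHS]e; apply: eq_bigr => i _; rewrite Ec wE.
  rewrite reix => h; have h0 : \sum_(p : P) c' (enum_rank p) *: belt delta p = 0.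
    by apply: contrapT => /eqP /emb_neq0; rewrite h eqxx.
  have := belt_free delta0 _ h0 (enum_val (Ordinal jN)).
  by rewrite enum_valK -Ec => -> //= p; rewrite Ec.
have -> : (\dim {: M} * m.+1 ^ d)%N = #|{: {x | x \in A}}|.
  by rewrite card_sig -[RHS]/#|[pred x | x \in A]| (eq_card (B := mem A)) // cA card_prod card_ffun !card_ord.
have -> : (#|I| * (m.+1 + (C + B * 2)) ^ d)%N = #|{: I * {ffun 'I_d -> 'I_(m.+1 + (C + B * 2))}}|.
  by rewrite card_prod card_ffun !card_ord.
apply: (orth_close_card (iota := iota) (v := fun x : {x | x \in A} => u' (val x)) vO _ _
  (f := fun q : I * {ffun 'I_d -> 'I_(m.+1 + (C + B * 2))} =>
    (tmon T (fun i => q.2 i : nat) / tmon T (fun=> B)) *: emb (f q.1))).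
- exact: (orth_sub hK (h := val) val_inj ou').
- by move=> x; apply: u'0.
case=> i iA /=; have := hA i iA.
have -> : (fun j : 'I_#|{: P}| => w j) = (fun j => emb (el j)) by apply/funext => j; rewrite wE.
move=> /(emb_lcomb hchi (fun y => @ratT_const _ _ _ T hK y)) [c [Kc Ei]]; rewrite Ei; apply: hB.
- move=> k; exact: (belt_box (c := fun p => c (enum_rank p))).
- by rewrite reix belt_sum.
- by apply: contraNneq (u'0 i) => e; rewrite Ei e; apply/eqP/rowP => s; rewrite !mxE rmorph0.
Qed.

(** Take an E-orthogonal family with the greatest number of members. A nonzero u which it does not
    approximate to smaller norm could be adjoined to it, so the counting lemma applies. *)
Theorem stability : exists f : 'I_(\dim {: M}) -> M,
  orth O E (fun l => emb (f l)) /\ forall l, f l != 0.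
Proof.
pose Q r := `[< exists (I : finType) (f : I -> M),
  [/\ orth O E (fun l => emb (f l)), forall l, f l != 0 & #|I| = r] >].
have Qdim r : Q r -> (r <= \dim {: M})%N.
  move=> /asboolP [I [f [orf f0 <-]]]; apply: (indep_card (b := f)) => c hc i.
  have := orth_free orf (fun l => emb_neq0 (f0 l)) (c := fun i => val (c i)) _ _ i.
  move=> /(_ (fun i => sfvP _) _)/eqP; rewrite fmorph_eq0 => h; apply/eqP; apply: h.
  by rewrite -emb_sum hc; apply/rowP => s; rewrite !mxE rmorph0.
have [|r Qr rmax] := ex_maxnP _ Qdim.
  exists 0%N; apply/asboolP; exists 'I_0, (fun=> 0); split; [by move=> c _ []|by case|by rewrite card_ord].
have [I [f [orf f0 cI]]] := asboolW Qr.
have dimr : #|I| = \dim {: M}.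
  apply/eqP; rewrite eqn_leq {1}cI Qdim //=; apply: (stability_count orf f0) => u u0.
  apply: contrapT => nu; have : Q r.+1.
    apply/asboolP; exists (I + unit)%type, (fun i => if i is inl k then f k else u); split.
    - have := @orth_adjoin _ _ _ vO hE _ _ (fun l => emb (f l)) (emb u) orf.
      have -> : (fun l : I + unit => emb (if l is inl k then f k else u)) =
        (fun l => if l is inl k then emb (f k) else emb u) by apply/funext => -[].
      apply=> e he; case: (nleVlt O (emb u) (emb u - \sum_i e i *: emb (f i))) => // h.
      by case: nu; exists e.
    - by case.
    - by rewrite card_sum card_unit addn1 cI.
  by move/rmax; rewrite ltnn.
exists (fun l => f (enum_val (cast_ord (esym dimr) l))); split=> [|l]; last exact: f0.
apply: (orth_sub hE (h := fun l => enum_val (cast_ord (esym dimr) l)) _ orf).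
by move=> l l' /enum_val_inj /cast_ord_inj.
Qed.
End Stability.

(** * Several valuation rings of one field *)

Lemma avoid_exponent g (bad : nat -> 'I_g -> Prop) :
  (forall s m m', bad m s -> bad m' s -> m = m') ->
  exists2 m, (0 < m)%N & forall s, ~ bad m s.
Proof.
move=> inj; apply: contrapT => h.
have hb (m : 'I_g.+1) : exists s, bad m.+1 s.
  by apply: contrapT => nb; apply: h; exists m.+1 => // s bs; apply: nb; exists s.
pose f m := sval (cid (hb m)).
have finj : injective f.
  move=> m m' e; apply/val_inj/succn_inj; apply: (inj (f m)); first exact: svalP (cid (hb m)).
  by rewrite e; apply: svalP (cid (hb m')).
by have := leq_card f finj; rewrite !card_ord ltnn.
Qed.

Section SeveralValuations.
Variables (M : fieldType) (V0 : M -> Prop) (g : nat) (V : 'I_g -> M -> Prop).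
Hypotheses (vV0 : valuation_ring V0) (vV : forall s, valuation_ring (V s)).

Lemma vlt1X (O : M -> Prop) x m : valuation_ring O -> (0 < m)%N -> vlt O x 1 -> vlt O (x ^+ m) 1.
Proof. by case: m => // m vO _ h; rewrite -[X in vlt _ _ X](expr1n _ m.+1); apply: vltX. Qed.
Lemma vgt1X (O : M -> Prop) x m : valuation_ring O -> (0 < m)%N -> vlt O 1 x -> vlt O 1 (x ^+ m).
Proof. by case: m => // m vO _ h; rewrite -[X in vlt _ X _](expr1n _ m.+1); apply: vltX. Qed.

Lemma power_value_inj (O : M -> Prop) x y m m' : valuation_ring O -> vlt O 1 x ->
  veq O y (x ^+ m) -> veq O y (x ^+ m') -> m = m'.
Proof.
move=> vO x1 h h'; wlog mm : m m' h h' / (m <= m')%N => [H|].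
  by case: (leqP m m') => [|/ltnW] h1; [exact: H|apply/esym/H].
apply/eqP; rewrite eqn_leq mm /= leqNgt; apply/negP => lt.
have x0 : x != 0 by apply/(vlt0 vO)/(vle_lt_trans vO _ x1); apply: vle0.
have := vgt1X vO (m := (m' - m)%N) _ x1; rewrite subn_gt0 => /(_ lt) /(vltM2rE vO _ _ (expf_neq0 m x0)).
rewrite mul1r -exprD subnK // => h2; apply: (vlt_irr vO (x := y)).
by apply: (vlt_veql vO h); apply: (vlt_veqr vO h2); apply: veq_sym.
Qed.

Lemma vgt1D (O : M -> Prop) x y : valuation_ring O -> ~ veq O x y -> vlt O 1 x \/ vlt O 1 y ->
  vlt O 1 (x + y).
Proof.
move=> vO ne h; have [xy|yx] := vleVlt O x y.
  have xy' : vlt O x y by move=> yx; apply: ne.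
  rewrite addrC; apply: (vlt_veqr vO) (veq_sym (veq_addl vO xy')).
  by case: h => // h1; apply: vlt_le_trans xy.
apply: (vlt_veqr vO) (veq_sym (veq_addl vO yx)).
by case: h => // h1; apply: vlt_le_trans (vltW vO yx).
Qed.

(* Adding a high power keeps the element small for [V0]; avoiding the finitely
   many exponents for which the two summands have the same value makes it large. *)
Lemma separating_element (P : 'I_g -> Prop) :
  (forall s, P s -> exists2 q, vlt V0 q 1 & vlt (V s) 1 q) ->
  exists2 q, vlt V0 q 1 & forall s, P s -> vlt (V s) 1 q.
Proof.
move=> hP; suff : forall l : seq 'I_g,
    exists2 q, vlt V0 q 1 & forall s, s \in l -> P s -> vlt (V s) 1 q.
  by case/(_ (enum 'I_g)) => q q0 h; exists q => // s; apply: h; rewrite mem_enum.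
elim=> [|s1 l [q q0 hq]].
  by exists 0 => //; apply/(vlt0 vV0); exact: oner_neq0.
have [Ps1|nP] := EM (P s1); last first.
  by exists q => // s; rewrite inE => /orP[/eqP -> //|]; apply: hq.
have [r r0 hr] := hP s1 Ps1.
have [m m0 hm] := @avoid_exponent g (fun m s => vlt (V s) 1 r /\ veq (V s) q (r ^+ m))
  (fun s m m' h h' => power_value_inj (vV s) h.1 h.2 h'.2).
exists (q + r ^+ m); first by apply: vltD => //; apply: vlt1X.
move=> s; rewrite inE => sl Ps.
have h1 : vlt (V s) 1 q \/ vlt (V s) 1 r.
  by case/orP: sl => [/eqP ->|sl]; [right|left; apply: hq].
have [r1|r1] := vleVlt (V s) r 1; last first.
  apply: vgt1D => //; first by move=> e; apply: (hm s).
  by right; apply: vgt1X.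
have q1 : vlt (V s) 1 q by case: h1 => // /(vle_lt_trans (vV s) r1)/vlt_irr.
have rm1 : vle (V s) (r ^+ m) 1 by rewrite -[X in vle _ _ X](expr1n _ m); apply: vleX.
apply: vgt1D => //; last by left.
by move=> e; apply: (vlt_irr (vV s) (x := q)); apply: (vle_lt_trans (vV s) _ q1); apply: vle_trans rm1; case: e.
Qed.
End SeveralValuations.

Section Comparable.
Variables (F : fieldType) (M : fieldExtType F) (V1 V2 : M -> Prop).
Hypotheses (v1 : valuation_ring V1) (v2 : valuation_ring V2).
Hypothesis V12 : forall e : F, V1 e%:A <-> V2 e%:A.

(** For x outside V1 some power has the V1-value of an element e of the base outside V1. Then e is a
    multiple of x^j by an element of V1, so x in V2 would put e into V2, where the base elements are
    the same. *)
Lemma comparable_equal : (forall x, V1 x -> V2 x) -> forall x, V2 x -> V1 x.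
Proof.
move=> sub x V2x; apply: contrapT => nV1.
have x1 : vlt V1 1 x by move/vle1.
have [j [a [j0 [e ->] ha]]] : exists j a, [/\ (0 < j)%N, imK' (GRing.in_alg M) a & veq V1 (x ^+ j) a].
  apply: alg_norm_power => //; first exact: imK_subfield.
  by apply/alg_imK; have [p [p0 px]] := fieldExt_algebraic x; exists p.
have nVe : ~ V1 e%:A.
  move=> /vle1 h; apply: (vlt_irr v1 (x := 1)).
  apply: (vlt_le_trans v1 (vgt1X v1 j0 x1)).
  by case: ha => h1 _; apply: vle_trans h.
have [_ [o V1o Eo]] := ha; apply/nVe/V12; have -> : e%:A = o * x ^+ j by [].
by apply: vrM; [exact: v2|exact: sub|exact: vrX].
Qed.
End Comparable.

Section Incomparable.
Variables (F : fieldType) (M : fieldExtType F) (V1 V2 : M -> Prop).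
Hypotheses (v1 : valuation_ring V1) (v2 : valuation_ring V2).
Hypothesis V12 : forall e : F, V1 e%:A <-> V2 e%:A.

(** By the preceding lemma there are x in V1 only and y in V2 only; x / y is then small for V1 and
    large for V2. *)
Lemma incomparable : ~ (forall x, V1 x <-> V2 x) -> exists2 q, vlt V1 q 1 & vlt V2 1 q.
Proof.
move=> ne; have [x V1x nV2x] : exists2 x, V1 x & ~ V2 x.
  apply: contrapT => h; apply: ne; have sub x : V1 x -> V2 x.
    by move=> V1x; apply: contrapT => nV; apply: h; exists x.
  by move=> x; split; [exact: sub|exact: comparable_equal].
have [y V2y nV1y] : exists2 y, V2 y & ~ V1 y.
  apply: contrapT => h; have sub y : V2 y -> V1 y.
    by move=> V2y; apply: contrapT => nV; apply: h; exists y.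
  have V21 e : V2 e%:A <-> V1 e%:A by rewrite V12.
  exact/nV2x/(comparable_equal v2 v1 V21 sub).
have y1 : vlt V1 1 y by move/vle1.
have x1 : vlt V2 1 x by move/vle1.
have y0 : y != 0 by apply/(vlt0 v1)/(vle_lt_trans v1 _ y1); apply: vle0.
exists (x / y).
  apply/(vltM2rE v1 _ _ y0); rewrite divfK // mul1r.
  by apply: vle_lt_trans y1 => //; apply/vle1.
apply/(vltM2rE v2 _ _ y0); rewrite divfK // mul1r.
by apply: vle_lt_trans x1 => //; apply/vle1.
Qed.
End Incomparable.

(** * The derivative of the characteristic polynomial *)

(* Differentiate the characteristic equation of a + Y u with respect to Y. *)
Lemma char_poly_deriv (F : fieldType) (M : fieldExtType F) (b : (\dim {: M}).-tuple M)
    (hb : basis_of {: M} b) (a u : M) :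
  exists s : {poly F}, (map_poly (GRing.in_alg M) (char_poly (mulmat b a))^`()).[a] * u =
    (map_poly (GRing.in_alg M) s).[a].
Proof.
pose i1 : {rmorphism F -> M} := GRing.in_alg M.
pose N : 'M[{poly F}]_(\dim {: M}) := map_mx polyC (mulmat b a) + 'X *: map_mx polyC (mulmat b u).
pose Phi := char_poly N; pose z : {poly M} := a%:P + u *: 'X.
pose lift : {rmorphism {poly F} -> {poly M}} := map_poly i1.
have root_z : (map_poly lift Phi).[z] = 0.
  have -> : (map_poly lift Phi).[z] = \det (z%:M - map_mx lift N).
    rewrite map_char_poly /char_poly -horner_evalE -det_map_mx; congr (\det _).
    apply/matrixP => k l; rewrite !mxE /= horner_evalE hornerD hornerN hornerC hornerMn hornerX.
    by [].
  (* The basis of M is a nonzero row annihilated by z - N. Multiplying by the adjugate shows that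
     the determinant annihilates it as well, hence vanishes. *)
  set D := _ - _; pose w : 'rV[{poly M}]_(\dim {: M}) := \row_i (b`_i)%:P.
  have wD : w *m D = 0.
    apply/rowP => l; rewrite mulmxBr mul_mx_scalar !mxE.
    apply/eqP; rewrite subr_eq0; apply/eqP.
    have E v : (b`_l * v)%:P = \sum_(k < \dim {: M}) (b`_k)%:P * (i1 (mulmat b v k l))%:P.
      rewrite (mulmatE hb v l) rmorph_sum; apply: eq_bigr => k _ /=.
      by rewrite -polyCM /i1 -[in RHS]mulrC -scalerAl mul1r.
    transitivity (\sum_(k < \dim {: M}) ((b`_k)%:P * (i1 (mulmat b a k l))%:P +
        'X * ((b`_k)%:P * (i1 (mulmat b u k l))%:P))); last first.
      by apply: eq_bigr => k _; rewrite !mxE rmorphD rmorphM /= map_polyX !map_polyC /= mulrDr mulrCA.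
    rewrite big_split /= -mulr_sumr -!E /z mulrDl -polyCM mulrC; congr (_ + _).
    by rewrite -mul_polyC polyCM; ring.
  have : \det D *: w = 0 by rewrite -mul_mx_scalar -mul_mx_adj mulmxA wD mul0mx.
  have [l bl] : exists l : 'I_(\dim {: M}), b`_l != 0.
    apply: contrapT => h; have := oner_neq0 M; rewrite (coord_basis hb (memvf 1)) big1 ?eqxx // => i _.
    by have [->|bi] := eqVneq b`_i 0; [rewrite scaler0|case: h; exists i].
  move=> /rowP/(_ l)/eqP; rewrite !mxE mulf_eq0 polyC_eq0 (negPf bl) orbF => /eqP.
  by [].
have szP : size (char_poly (mulmat b a)) = size Phi by rewrite !size_char_poly.
have P0 i : (Phi`_i).[0] = (char_poly (mulmat b a))`_i.
  have <- : map_poly (horner_eval 0) Phi = char_poly (mulmat b a).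
    rewrite map_char_poly; congr char_poly; apply/matrixP => k l; rewrite !mxE /= horner_evalE.
    by rewrite hornerD hornerM !hornerC hornerX mul0r addr0.
  by rewrite coef_map.
clearbody Phi.
(* The derivative of the equation at Y = 0 is the sum of P'(a) u and of the derivatives of the
   coefficients applied to powers of a; s carries the latter with the opposite sign. *)
pose s : {poly F} := \poly_(i < size Phi) - (Phi`_i)^`().[0].
have szL : size (map_poly lift Phi) = size Phi.
  by apply: size_map_inj_poly; [exact: (map_poly_inj i1)|exact: rmorph0].
have := congr1 (fun p : {poly M} => p^`().[0]) root_z; rewrite linear0 horner0.
rewrite [(map_poly lift Phi).[z] in X in X -> _]horner_coef szL linear_sum horner_sum /=.
have z0 : z.[0] = a by rewrite /z hornerD hornerZ hornerC hornerX mulr0 addr0.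
have z1 : z^`() = u%:P by rewrite /z derivD derivC derivZ derivX add0r alg_polyC.
have lift0 (p : {poly F}) : (lift p).[0] = i1 p.[0].
  by rewrite -[in LHS](rmorph0 i1) horner_map.
have dz i : (z ^+ i)^`().[0] = a ^+ i.-1 *+ i * u.
  elim: i => [|i IH]; first by rewrite expr0 derivC horner0 mul0r.
  rewrite exprS derivM hornerD !hornerM z0 z1 hornerC horner_exp z0 IH mulrA mulrnAr -exprS.
  case: i {IH} => [|i] /=; first by rewrite expr0 mulr0n mul0r addr0 mulr1n mulr1 mul1r.
  by rewrite [in RHS]mulrS mulrDl (mulrC u).
have dl (p : {poly F}) : (lift p)^`() = lift p^`() by exact: deriv_map.
have term i : ((map_poly lift Phi)`_i * z ^+ i)^`().[0] =
    i1 (Phi`_i)^`().[0] * a ^+ i + i1 (char_poly (mulmat b a))`_i * (a ^+ i.-1 *+ i) * u.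
  rewrite coef_map derivM hornerD !hornerM horner_exp z0 -P0 dl !lift0 dz.
  by rewrite mulrA.
under eq_bigr => i _ do rewrite term.
rewrite big_split /= -mulr_suml => /eqP; rewrite addrC addr_eq0 => /eqP E.
exists s; rewrite -deriv_map.
have D (p : {poly M}) n : (size p <= n)%N -> p^`().[a] = \sum_(i < n) p`_i * (a ^+ i.-1 *+ i).
  move=> pn; have {1}-> : p = \sum_(i < n) p`_i *: 'X^i.
    rewrite -poly_def; apply/polyP => i; rewrite coef_poly; case: ltnP => // ni.
    by rewrite nth_default // (leq_trans pn).
  rewrite linear_sum horner_sum; apply: eq_bigr => i _.
  by rewrite /= derivZ derivXn hornerZ hornerMn hornerXn.
rewrite (D _ (size Phi)) ?size_map_poly ?szP //.
under eq_bigr => i _ do rewrite coef_map /=.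
rewrite E (@horner_coef_wide _ (size Phi)) ?size_map_poly ?size_poly // -sumrN.
by apply: eq_bigr => i _; rewrite coef_map coef_poly ltn_ord /= scaleNr mulNr.
Qed.

(** * A generator with a simple residue *)

Section SmallCoefficients.
Variables (R : fieldType) (O : R -> Prop) (vO : valuation_ring O).

Lemma vlt_prod1 x y : vlt O x 1 -> O y -> vlt O (x * y) 1.
Proof.
move=> x1 Oy; rewrite -[X in vlt _ _ X](mulr1 1).
by apply: vlt_leM => //; [exact/vle1|exact: oner_neq0].
Qed.

Lemma vlt1_vr x : vlt O x 1 -> O x.
Proof. by move=> /(vltW vO)/vle1. Qed.

(** Divisibility by X^t modulo the maximal ideal, for polynomials with integral coefficients. *)
Definition small_below t (p : {poly R}) :=
  (forall i, O p`_i) /\ forall i, (i < t)%N -> vlt O p`_i 1.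

Lemma small_below_det n (m : 'I_n -> nat) (A : 'M[{poly R}]_n) :
  (forall i j, small_below (m i) (A i j)) -> small_below (\sum_i m i) (\det A).
Proof.
move=> h; have v01 : vlt O 0 1 by apply/(vlt0 vO); exact: oner_neq0.
have hD t p q : small_below t p -> small_below t q -> small_below t (p + q).
  by move=> [p0 p1] [q0 q1]; split=> i *; rewrite coefD; [apply: vrD|apply: vltD => //; auto].
have hN t p : small_below t p -> small_below t (- p).
  by move=> [p0 p1]; split=> i *; rewrite coefN; [apply: vrN|apply: vltN => //; auto].
have hM t t' p q : small_below t p -> small_below t' q -> small_below (t + t') (p * q).
  move=> [p0 p1] [q0 q1]; split=> i; rewrite coefM.
    by apply: vr_sum => // k _; apply: vrM.
  move=> it; apply: vlt_sum => // [|k _]; first exact: oner_neq0.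
  case: (ltnP k t) => kt; first by apply: vlt_prod1 => //; apply: p1.
  have ki : (k < i.+1)%N := ltn_ord k.
  by rewrite mulrC; apply: vlt_prod1 => //; apply: q1; lia.
apply: (big_ind (small_below (\sum_i m i))) => [|p q|s _].
- by split=> i *; rewrite coef0 //; exact: vr0.
- exact: hD.
set pr := \prod_i _; have hs : small_below (\sum_i m i) pr.
  rewrite /pr; apply: (big_ind2 small_below) => [|t p t' q|i _]; last exact: h.
    by split=> // i; rewrite coef1; case: eqP => _; [exact: vr1|exact: vr0].
  exact: hM.
by case: (perm.odd_perm s); rewrite ?expr1 ?expr0 ?mulN1r ?mul1r //; apply: hN.
Qed.

Lemma horner_close (p : {poly R}) x y : (forall i, O p`_i) -> O x -> O y -> vlt O (x - y) 1 ->
  vlt O (p.[x] - p.[y]) 1.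
Proof.
move=> Op Ox Oy xy; rewrite !horner_coef -sumrB; apply: vlt_sum => // [|i _]; first exact: oner_neq0.
rewrite -mulrBr mulrC; apply: vlt_prod1 => //; rewrite subrXX; apply: vlt_prod1 => //.
by apply: vr_sum => // k _; apply: vrM => //; apply: vrX.
Qed.

Lemma horner_vr (p : {poly R}) x : (forall i, O p`_i) -> O x -> O p.[x].
Proof. by move=> Op Ox; rewrite horner_coef; apply: vr_sum => // i _; apply: vrM => //; apply: vrX. Qed.

Lemma horner_small (p : {poly R}) x : (forall i, vlt O p`_i 1) -> O x -> vlt O p.[x] 1.
Proof.
move=> Op Ox; rewrite horner_coef; apply: vlt_sum => // [|i _]; first exact: oner_neq0.
by apply: vlt_prod1 => //; apply: vrX.
Qed.

Lemma deriv_vr (p : {poly R}) : (forall i, O p`_i) -> forall i, O (p^`())`_i.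
Proof.
move=> Op i; rewrite coef_deriv -mulr_natr; apply: vrM => //.
by elim: (i.+1) => [|k IH]; [exact: vr0|rewrite -[k.+1]addn1 natrD; apply: vrD => //; exact: vr1].
Qed.

Lemma deriv_small (p : {poly R}) : (forall i, vlt O p`_i 1) -> forall i, vlt O (p^`())`_i 1.
Proof.
move=> Op i; rewrite coef_deriv -mulr_natr; apply: vlt_prod1 => //.
by elim: (i.+1) => [|k IH]; [exact: vr0|rewrite -[k.+1]addn1 natrD; apply: vrD => //; exact: vr1].
Qed.

Lemma nlt_bound g (f h : 'rV[R]_g) t : (forall s, vlt O (f 0 s) (h 0 t)) -> nlt O f h.
Proof. by move=> hf /(_ t) [s]; apply: hf. Qed.
End SmallCoefficients.

Section Generator.
Variables (R : fieldType) (O : R -> Prop) (vO : valuation_ring O) (cl : alg_closed R).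
Variables (E : R -> Prop) (hE : is_subfield E).
Local Notation F0 := (sft hE).
Variables (M : fieldExtType F0) (b : (\dim {: M}).-tuple M) (hb : basis_of {: M} b).
Variables (g : nat) (chi : 'I_g -> {rmorphism M -> R}).
Hypothesis hchi : forall s, over (val : F0 -> R) (chi s).
Hypothesis chi_root : forall u r, root (map_poly val (char_poly (mulmat b u))) r ->
  exists s, chi s u = r.
Definition vring s (x : M) := O (chi s x).

Lemma vring_valuation s : valuation_ring (vring s).
Proof. exact: pullback_valuation. Qed.

Lemma vring_vle s x y : vle O (chi s x) (chi s y) <-> vle (vring s) x y.
Proof. by apply: vle_ext => //; exact: vring_valuation. Qed.

Lemma vring_vlt s x y : vlt O (chi s x) (chi s y) <-> vlt (vring s) x y.
Proof. by rewrite /vlt vring_vle. Qed.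

Lemma vring_base s s' (e : F0) : vring s e%:A <-> vring s' e%:A.
Proof. by rewrite /vring !hchi. Qed.

(* A valuation ring over that of E different from all the [vring s] would contain
   the inverse of an element whose characteristic polynomial is X^n modulo small terms. *)
Lemma vring_all (V : M -> Prop) : valuation_ring V -> (forall e : F0, V e%:A <-> O (val e)) ->
  exists s, forall x, V x <-> vring s x.
Proof.
move=> vV hV; apply: contrapT => no.
have [q q0 hq] : exists2 q, vlt V q 1 & forall s, True -> vlt (vring s) 1 q.
  apply: separating_element => // [s|s _]; first exact: vring_valuation.
  apply: incomparable => //; first exact: vring_valuation.
    by move=> e; rewrite hV /vring hchi.
  by move=> h; apply: no; exists s.
have [s0 _] : exists s : 'I_g, True.
  have [|r /chi_root [s _]] := cl (p := map_poly val (char_poly (mulmat b 0))); last by exists s.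
  rewrite size_map_poly size_char_poly eqSS dimv_eq0; apply/eqP => /vspaceP/(_ 1).
  by rewrite memvf memv0 oner_eq0.
have qn0 : q != 0.
  by apply/(vlt0 (vring_valuation s0))/(vle_lt_trans (vring_valuation s0) _ (hq s0 I))/vle0/vring_valuation.
pose P := char_poly (mulmat b q^-1); pose PR := map_poly val P : {poly R}.
have mP : P \is monic by apply: char_poly_monic.
have PRm : PR \is monic by rewrite map_monic.
have [rs Ers] := alg_closed_split PR cl.
have {}Ers : PR = \prod_(r <- rs) ('X - r%:P) by rewrite Ers (monicP PRm) scale1r.
(* Weight 0 stands for integral and positive weight for small. All images of q^-1 are small, so the
   product of the factors X - r is graded and its lower coefficients are small; this contradicts
   that q^-1 is large for V. *)
pose B t x := if t is 0 then O x else vlt O x 1.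
have BO t x : B t x -> O x by case: t => // t /(vltW vO)/vle1.
have gP : graded B (size rs) PR.
  rewrite Ers big_tnth -[X in graded _ X _](size_enum_ord (size rs)) -big_enum /=.
  apply: graded_prod => [[|t]||[|t] x y|t t' x y|i].
  - exact: vr0.
  - exact/(vlt0 vO)/oner_neq0.
  - exact: vr1.
  - exact: vrD.
  - exact: vltD.
  - case: t => [|t] /=.
      case: t' => [|t'] /=; first exact: vrM.
      move=> Ox y1; rewrite mulrC -[X in vlt _ _ X](mulr1 1).
      by apply: vlt_leM => //; [exact/vle1|exact: oner_neq0].
    move=> x1 /BO Oy; rewrite -[X in vlt _ _ X](mulr1 1).
    by apply: vlt_leM => //; [exact/vle1|exact: oner_neq0].
  - move=> k; rewrite coefB coefX coefC; case: k => [|[|k]] /=; split=> // _.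
    + rewrite sub0r; apply: (vltN vO).
      have [|s' <-] := chi_root (u := q^-1) (r := tnth (in_tuple rs) i).
        by rewrite -/P -/PR Ers root_prod_XsubC mem_tnth.
      have := hq s' I; rewrite -vring_vlt rmorph1 fmorphV => h.
      apply/(vltM2rE vO _ _ (z := chi s' q)); first by rewrite fmorph_eq0.
      by rewrite mulVf ?fmorph_eq0 // mul1r.
    + by rewrite subr0; exact: vr1.
    + by rewrite subr0.
have szP : size P = (size rs).+1.
  by rewrite -(size_map_poly (val : F0 -> R)) -/PR Ers size_prod_XsubC.
have small i : (i < size rs)%N -> vlt V (P`_i)%:A 1.
  move=> ir; have [h _] := gP i; have := h (ltnW ir).
  have -> : (size rs - i)%N = (size rs - i).-1.+1 by rewrite prednK // subn_gt0.
  rewrite coef_map /= => {}h h1.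
  apply: h; have [p0|p0] := eqVneq P`_i 0.
    by move: h1; rewrite p0 scale0r => /vle_0/eqP; rewrite oner_eq0.
  have pA : (P`_i)%:A != 0 :> M by rewrite scaler_eq0 (negPf p0) oner_neq0.
  move: h1; rewrite vleP // mul1r -[_^-1](fmorphV (GRing.in_alg M)) => /hV h1.
  by exists (val (P`_i)^-1) => //; rewrite -[sfv _]/(val P`_i) -rmorphM mulVf // rmorph1.
have rootP : (map_poly (GRing.in_alg M) P).[q^-1] = 0.
  have := over_root hb (j := val) q^-1 (hchi s0); rewrite -/P => /rootP.
  have -> : map_poly val P = map_poly (chi s0) (map_poly (GRing.in_alg M) P).
    by rewrite -map_poly_comp; apply: eq_map_poly => x /=; rewrite hchi.
  by rewrite horner_map => /eqP; rewrite fmorph_eq0 => /eqP.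
have q1 : vlt V 1 q^-1.
  by apply/(vltM2rE vV _ _ qn0); rewrite mulVf // mul1r.
have : q^-1 ^+ size rs != 0 by rewrite expf_neq0 // invr_eq0.
move: rootP; rewrite horner_coef size_map_poly szP big_ord_recr /= coef_map.
have -> : P`_(size rs) = 1 by have := monicP mP; rewrite lead_coefE szP.
rewrite /= scale1r mul1r => /eqP; rewrite addrC addr_eq0 => /eqP Eq qn.
apply: (vlt_irr vV (x := q^-1 ^+ size rs)); rewrite {1}Eq; apply: vltN => //.
apply: vlt_sum => // i _; rewrite coef_map /= -[X in vlt _ _ X]mul1r.
apply: vlt_leM => //; first exact: small.
have -> : q^-1 ^+ size rs = q^-1 ^+ i * q^-1 ^+ (size rs - i).
  by rewrite -exprD subnKC // ltnW.
rewrite -[X in vle _ X _]mulr1.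
by apply: vleM2l => //; rewrite -[X in vle _ X _](expr1n _ (size rs - i)); apply: vleX => //; apply: vltW.
Qed.

Variable s0 : 'I_g.
Hypothesis value_trivial : forall u, u != 0 -> exists2 e : F0, e != 0 & veq O (chi s0 u) (val e).
(** Different embeddings may induce the same valuation ring of M. The other valuations are those of
    the indices that are not [same]. *)
Definition same s := forall x, vring s x <-> vring s0 x.

Lemma same_vle s x y : same s -> vle O (chi s x) (chi s y) <-> vle O (chi s0 x) (chi s0 y).
Proof.
move=> h; rewrite !vring_vle; split=> -[o Oo ->]; exists o => //; exact/h.
Qed.

Lemma same_norm s u : same s -> veq O (chi s u) (chi s0 u).
Proof.
move=> h; have [->|u0] := eqVneq u 0; first by rewrite !rmorph0; apply: veq_refl.
have [e e0 he] := value_trivial u0; apply: (veq_trans vO (y := val e)); last exact: veq_sym.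
by rewrite -(hchi s e) /veq !same_vle // (hchi s0 e).
Qed.

(** With q small at s0 and large at the other rings, c = a0^-1 + q^m is close to a0^-1 at s0, and
    large at the others provided the summands do not cancel there; each ring excludes at most one m.
    The inverse of c is as required. No independence of the valuations is needed. *)
Lemma residue_lift (a0 : M) : veq O (chi s0 a0) 1 ->
  exists2 a, vlt O (chi s0 (a - a0)) 1 & forall s, ~ same s -> vlt O (chi s a) 1.
Proof.
move=> a01; have vV s := vring_valuation s.
have a00 : a0 != 0 by have := veq_neq0 (veq_sym a01) (oner_neq0 _); rewrite fmorph_eq0.
have [q q0 hq] : exists2 q, vlt (vring s0) q 1 & forall s, ~ same s -> vlt (vring s) 1 q.
  apply: separating_element => // s ns; apply: incomparable => //; first exact: vring_base.
  by move=> h; apply: ns => x; rewrite h.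
have [m m0 hm] := @avoid_exponent g (fun m s => ~ same s /\ veq (vring s) a0^-1 (q ^+ m))
  (fun s m m' h h' => power_value_inj (vV s) (hq s h.1) h.2 h'.2).
pose c := a0^-1 + q ^+ m.
have qm : vlt O (chi s0 (q ^+ m)) 1.
  by rewrite -(rmorph1 (chi s0)) vring_vlt; apply: vlt1X.
have a0v : veq O (chi s0 a0^-1) 1 by rewrite fmorphV -[X in veq _ _ X]invr1; apply: veqV.
have c1 : veq O (chi s0 c) 1.
  rewrite rmorphD; apply: (veq_trans vO (y := chi s0 a0^-1)) => //.
  by apply: veq_addl => //; apply: vlt_veqr qm (veq_sym a0v).
have c0 : c != 0 by have := veq_neq0 (veq_sym c1) (oner_neq0 _); rewrite fmorph_eq0.
exists c^-1 => [|s ns].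
  have Eq : q ^+ m = c - a0^-1 by rewrite /c addrC addKr.
  have -> : c^-1 - a0 = - (c^-1 * a0 * q ^+ m).
    by rewrite Eq mulrBr mulfK // mulrAC mulVf // mul1r opprB.
  rewrite rmorphN; apply: vltN => //; rewrite !rmorphM fmorphV -[X in vlt _ _ X](mulr1 1) mulrC.
  apply: vlt_leM => //; last exact: oner_neq0.
  rewrite -[X in vle _ _ X](mulr1 1); apply: vleM => //; last by case: a01.
  by rewrite -[X in vle _ _ X]invr1; apply: vleV => //; [exact: oner_neq0|case: c1].
rewrite -(rmorph1 (chi s)) vring_vlt.
have : vlt (vring s) 1 c.
  apply: vgt1D => //; last by right; apply: vgt1X => //; apply: hq.
  by move=> h; apply: (hm s).
by move=> h; apply/(vltM2rE (vV s) _ _ c0); rewrite mulVf // mul1r.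
Qed.

(** * A basis adapted to multiplication by a *)

Section AdaptedBasis.
Local Notation n := (\dim {: M}).
Local Notation emb := (emb chi).
Variables (fb : 'I_n -> M) (f : nat) (a0 a : M) (mp : {poly F0}).
Hypotheses (ofb : orth O E (fun l => emb (fb l))) (fb0 : forall l, fb l != 0).
Hypotheses (mp_monic : mp \is monic) (mp_size : size mp = f.+1) (mpO : forall i, O (val mp`_i)).
Hypotheses (a01 : veq O (chi s0 a0) 1)
  (mp_root : vlt O (map_poly val mp).[chi s0 a0] 1)
  (mp_simple : veq O (map_poly val mp^`()).[chi s0 a0] 1).
Hypothesis res_span : forall u, O (chi s0 u) -> exists2 c : 'I_f -> F0,
  forall i, O (val (c i)) & vlt O (chi s0 u - \sum_i val (c i) * chi s0 a0 ^+ i) 1.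
Hypothesis res_indep : forall c : 'I_f -> F0, (forall i, O (val (c i))) ->
  vlt O (\sum_i val (c i) * chi s0 a0 ^+ i) 1 -> forall i, vlt O (val (c i)) 1.
Hypotheses (a_close : vlt O (chi s0 (a - a0)) 1) (a_small : forall s, ~ same s -> vlt O (chi s a) 1).

Let chiZ s c u : chi s (c *: u) = val c * chi s u. Proof. exact: (overZ (j := val)). Qed.
Let chi_comb s m (c : 'I_m -> F0) (x : nat -> M) :
  chi s (\sum_i c i *: x i) = \sum_i val (c i) * chi s (x i).
Proof. by rewrite rmorph_sum; apply: eq_bigr => i _; rewrite chiZ. Qed.

Let close : vlt O (chi s0 a - chi s0 a0) 1. Proof. by rewrite -rmorphB. Qed.
Let a_unit : veq O (chi s0 a) 1.
Proof.
apply: (veq_trans vO _ a01); apply: veq_close => //; exact: vlt_veqr close (veq_sym a01).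
Qed.
Let Oa0 : O (chi s0 a0). Proof. by apply/vle1; case: a01. Qed.
Let Oa : O (chi s0 a). Proof. by apply/vle1; case: a_unit. Qed.

Lemma a_le1 s : O (chi s a).
Proof.
have [h|h] := EM (same s); last by apply: vlt1_vr => //; apply: a_small.
by apply/vle1; have [h1 _] := same_norm a h; apply: vle_trans h1 _ => //; case: a_unit.
Qed.

Lemma comb_close (c : 'I_f -> F0) : (forall i, O (val (c i))) ->
  vlt O (\sum_i val (c i) * chi s0 a ^+ i - \sum_i val (c i) * chi s0 a0 ^+ i) 1.
Proof.
move=> Oc; pose p : {poly R} := \poly_(i < f) (if insub i is Some k then val (c k) else 0).
have pE x : p.[x] = \sum_i val (c i) * x ^+ i.
  by rewrite horner_poly; apply: eq_bigr => i _; rewrite valK.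
rewrite -!pE; apply: horner_close => // i; rewrite coef_poly; case: ifP => _; last exact: vr0.
by case: insub => [k|]; [exact: Oc|exact: vr0].
Qed.

(** If the norm of u is attained at s0, then u is approximated there by powers of a, whose residues
    span; at the other rings multiplication by a makes everything smaller. If the norm is not
    attained at s0, a u itself is smaller than u. The factor a shifts the powers used to a, ...,
    a^f. *)
Lemma adapted_approx u : u != 0 -> exists c : 'I_f -> F0,
  nlt O (emb (a * u) - emb (\sum_i c i *: a ^+ i.+1)) (emb u).
Proof.
move=> u0; have [t] := nmax vO (emb_neq0 cl chi_root u0); rewrite mxE => ut ht'.
have ht s : vle O (chi s u) (chi t u) by have := ht' s; rewrite !mxE.
have goal (c : 'I_f -> F0) : (forall s, vlt O (chi s (a * u - \sum_i c i *: a ^+ i.+1)) (chi t u)) ->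
    nlt O (emb (a * u) - emb (\sum_i c i *: a ^+ i.+1)) (emb u).
  by move=> h; rewrite -embB; apply: (nlt_bound (t := t)) => s; rewrite !mxE; apply: h.
have [ult|tu] := vleVlt O (chi t u) (chi s0 u); last first.
  exists (fun=> 0); apply: goal => s; rewrite big1 => [|i _]; last by rewrite scale0r.
  rewrite subr0 rmorphM; have [h|h] := EM (same s).
    rewrite mulrC -[X in vlt _ _ X]mulr1; apply: vlt_leM => //; last exact: oner_neq0.
      by apply: (vlt_veql vO (same_norm u h)).
    by apply/vle1/a_le1.
  by rewrite -[X in vlt _ _ X]mul1r; apply: vlt_leM => //; apply: a_small.
have [e e0 he] := value_trivial u0.
have te : veq O (chi t u) (val e) by apply: veq_trans he => //; split.
have ve0 : val e != 0 by rewrite sfv_eq0.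
have [|c Oc hc] := res_span (u := e^-1 *: u).
  apply/vle1; rewrite chiZ sfvV; apply/(vleM2lE vO _ _ ve0); rewrite mulVKf // mulr1.
  by case: he.
have {}hc : vlt O (chi s0 (u - \sum_i (e * c i) *: a ^+ i)) (val e).
  rewrite rmorphB chi_comb; apply/(vltM2lE vO (z := (val e)^-1)); rewrite ?invr_eq0 // mulVf //.
  have -> : (val e)^-1 * (chi s0 u - \sum_i val (e * c i) * chi s0 (a ^+ i)) =
      (chi s0 (e^-1 *: u) - \sum_i val (c i) * chi s0 a0 ^+ i) -
      (\sum_i val (c i) * chi s0 a ^+ i - \sum_i val (c i) * chi s0 a0 ^+ i).
    rewrite mulrBr chiZ sfvV mulr_sumr opprB addrA subrK; congr (_ - _).
    by apply: eq_bigr => i _; rewrite sfvM rmorphXn mulrA mulKf.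
  by apply: vltB => //; apply: comb_close.
exists (fun i => e * c i); apply: goal => s.
have -> : a * u - \sum_i (e * c i) *: a ^+ i.+1 = a * (u - \sum_i (e * c i) *: a ^+ i).
  rewrite mulrBr mulr_sumr; congr (_ - _); apply: eq_bigr => i _.
  by rewrite -scalerAr exprS.
rewrite rmorphM; have [h|h] := EM (same s).
  rewrite mulrC -[X in vlt _ _ X]mulr1; apply: vlt_leM => //; last exact: oner_neq0.
    apply: (vlt_veql vO (same_norm _ h)); exact: vlt_veqr hc (veq_sym te).
  by apply/vle1/a_le1.
rewrite -[X in vlt _ _ X]mul1r; apply: vlt_leM => //; first exact: a_small.
rewrite rmorphB; apply: vleB => //; rewrite chi_comb; apply: vle_sum => // i _.
apply: (vle_trans vO (y := val e)); last by case: te.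
have h1 : vle O (val (c i) * chi s (a ^+ i)) 1.
  by apply/vle1; apply: vrM => //; rewrite rmorphXn; apply: vrX => //; apply: a_le1.
by rewrite sfvM -mulrA; have := vleM2l vO (val e) h1; rewrite mulr1.
Qed.

Lemma adapted_free (c : 'I_f -> F0) : \sum_i c i *: a ^+ i.+1 = 0 -> forall i, c i = 0.
Proof.
move=> h i1; apply/eqP/negPn/negP => ci1.
have a00 : chi s0 a != 0 by apply: (veq_neq0 (veq_sym a_unit)); exact: oner_neq0.
have [i _ hi] := @vmax_exists _ _ vO _ predT (fun i => val (c i)) i1 isT.
have ci : c i != 0.
  apply: contraNneq ci1 => e; have := hi i1 isT; rewrite e rmorph0 => /vle_0/eqP.
  by rewrite sfv_eq0.
have vci : val (c i) != 0 by rewrite sfv_eq0.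
pose c' k := c k / c i.
have Oc' k : O (val (c' k)).
  by rewrite /c' sfvM sfvV; apply/(vleP _ _ vci)/hi.
have s0' : \sum_k val (c' k) * chi s0 a ^+ k = 0.
  apply: (mulIf vci); apply: (mulIf a00); rewrite !mul0r -[RHS](rmorph0 (chi s0)) -[in RHS]h
    (chi_comb s0 c (fun k => a ^+ k.+1)).
  rewrite !mulr_suml; apply: eq_bigr => k _; rewrite sfvM sfvV rmorphXn exprSr.
  have aux (x y z t : R) : x != 0 -> y / x * z * x * t = y * (z * t) by move=> x0; field.
  exact: aux.
have := comb_close Oc'; rewrite s0' sub0r => /(vltN vO); rewrite opprK => /(res_indep Oc')/(_ i).
by rewrite /c' divff // rmorph1 => /(vlt_irr vO).
Qed.

Let emb_sum (J : finType) (P : pred J) (c : J -> F0) (x : J -> M) :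
  emb (\sum_(i | P i) c i *: x i) = \sum_(i | P i) val (c i) *: emb (x i).
Proof. exact: emb_sum. Qed.
Let emb_neq0 u : u != 0 -> emb u != 0. Proof. exact: (emb_neq0 cl chi_root). Qed.
Let emb_eq0 u : emb u = 0 -> u = 0.
Proof. by move=> h; apply: contrapT => /eqP /emb_neq0; rewrite h eqxx. Qed.

Lemma orth_emb_free (I : finType) (h : I -> M) : orth O E (fun l => emb (h l)) ->
  (forall l, h l != 0) -> forall c : I -> F0, \sum_i c i *: h i = 0 -> forall i, c i = 0.
Proof.
move=> oh h0 c hc i; apply/eqP; rewrite -sfv_eq0; apply/eqP.
apply: (orth_free oh (fun l => emb_neq0 (h0 l)) (c := fun i => val (c i))) => [k|]; first exact: sfvP.
by rewrite -emb_sum hc; apply/rowP => s; rewrite !mxE rmorph0.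
Qed.

Lemma lcomb_emb (I : finType) (h : I -> M) u : (exists c : I -> F0, u = \sum_i c i *: h i) ->
  lcomb E predT (fun l => emb (h l)) (emb u).
Proof. by case=> c ->; rewrite emb_sum; exists (fun i => val (c i)) => // i; apply: sfvP. Qed.

(** The exchange lemma provides an orthogonal basis of which f members span a, ..., a^f. Up to terms
    smaller than u, multiplication by a sends u into the span of these f members. *)
Lemma adapted_basis : exists (h : 'I_n -> M) (A : {set 'I_n}), [/\ orth O E (fun l => emb (h l)),
  forall l, h l != 0, #|A| = f & forall u, u != 0 -> exists2 beta : 'I_n -> F0,
    forall k, k \notin A -> beta k = 0 &
    nlt O (emb (a * u) - emb (\sum_k beta k *: h k)) (emb u)].
Proof.
have span u : exists c : 'I_n -> F0, u = \sum_i c i *: fb i.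
  by apply: indep_spans; [exact: orth_emb_free|rewrite card_ord].
have [|c Ec hc j jf|u' [A [ou' u'0 cA _ [_ u'fb wA]]]] :=
  @orth_exchange _ _ _ vO hE _ _ _ (fun j => emb (a ^+ j.+1)) f ofb (fun l => emb_neq0 (fb0 l)).
- by move=> j _; apply: lcomb_emb.
- have hv i : exists y : F0, val y = c i by apply: sfv_ex.
  pose c' (i : 'I_f) := sval (cid (hv i)); have Ec' i : val (c' i) = c i by rewrite /c'; case: (cid _).
  have /adapted_free/(_ (Ordinal jf)) : \sum_(i < f) c' i *: a ^+ i.+1 = 0.
    apply: emb_eq0; rewrite emb_sum -[RHS]hc; apply: eq_bigr => i _.
    by rewrite Ec'.
  by move=> h; rewrite -[j]/(val (Ordinal jf)) -Ec' h rmorph0.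
have hu' i : exists h, u' i = emb h.
  by have [c [_ ->]] := emb_lcomb hchi (fun y Ey => Ey) (u'fb i); exists (\sum_k c k *: fb k).
pose h i := sval (cid (hu' i)); have Eh i : u' i = emb (h i) by rewrite /h; case: (cid _).
have Eu' : u' = fun i => emb (h i) by apply/funext.
have {}ou' : orth O E (fun l => emb (h l)) by rewrite -Eu'.
have h0 l : h l != 0.
  by apply: contraNneq (u'0 l) => e; rewrite Eh e; apply/eqP/rowP => s; rewrite !mxE rmorph0.
exists h, A; split=> // u u0; have [c hc] := adapted_approx u0.
have lA : lcomb E (mem A) u' (emb (\sum_i c i *: a ^+ i.+1)).
  rewrite emb_sum; have sA : subspace E (lcomb E (mem A) u') by apply: lcomb_subspace.
  apply: (subspace_sum (S := E) (X := lcomb E (mem A) u')) => // i _.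
  by have [_ _ Z] := sA; apply: Z; [exact: sfvP|exact: wA].
have [beta Eb hb'] := lA.
have hv k : exists y : F0, val y = (if k \in A then beta k else 0).
  by apply: sfv_ex; case: ifP => _; [exact: Eb|exact: sf0].
pose be k := sval (cid (hv k)); have Ebe k : val (be k) = if k \in A then beta k else 0.
  by rewrite /be; case: (cid _).
exists be => [k /negPf kA|]; first by apply/eqP; rewrite -sfv_eq0 Ebe kA.
suff -> : emb (\sum_k be k *: h k) = emb (\sum_i c i *: a ^+ i.+1) by [].
rewrite hb' emb_sum Eu' [LHS](bigID (mem A)) /= [X in _ + X]big1 ?addr0 => [|i /negPf iA].
  by apply: eq_bigr => i iA; rewrite Ebe iA.
by rewrite Ebe iA scale0r.
Qed.

(** Relative to the norms of the adapted basis, the matrix of multiplication by a is integral, and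
    its rows outside A are small. These n - f rows of the characteristic matrix are divisible by X
    modulo the maximal ideal. *)
Lemma char_poly_small : exists bT : n.-tuple M, [/\ basis_of {: M} bT, (f <= n)%N &
  small_below O (n - f) (map_poly val (char_poly (mulmat bT a)))].
Proof.
have [h [A [oh h0 cA hA]]] := adapted_basis.
pose bT := [tuple h i | i < n].
have EbT (i : 'I_n) : bT`_i = h i by rewrite -tnth_nth tnth_mktuple.
have hbT : basis_of {: M} bT.
  have fbT : free bT.
    apply/freeP => c hc i; apply: (orth_emb_free oh h0 (c := c)); rewrite -[RHS]hc.
    by apply: eq_bigr => k _; rewrite EbT.
  by rewrite basisEfree fbT subvf size_tuple leqnn.
have fn : (f <= n)%N by rewrite -cA -[X in (_ <= X)%N](card_ord n) max_card.
exists bT; split=> //.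
have hD i : exists s, chi s (h i) != 0 /\ forall s', vle O (chi s' (h i)) (chi s (h i)).
  have [s] := nmax vO (emb_neq0 (h0 i)); rewrite mxE => hs1 hs2; exists s; split=> // s'.
  by have := hs2 s'; rewrite !mxE.
pose D i := chi (sval (cid (hD i))) (h i).
have [D0 maxD] : (forall i, D i != 0) /\ forall i s, vle O (chi s (h i)) (D i).
  by split=> i; rewrite /D; case: (cid _) => s [].
pose N := mulmat bT a.
have hN i : a * h i = \sum_k N k i *: h k.
  by rewrite mulrC -EbT (mulmatE hbT); apply: eq_bigr => k _; rewrite EbT.
have entry k i : vle O (val (N k i) * D k) (D i).
  have := oh (fun k => val (N k i)) (fun k => sfvP _) k; rewrite -emb_sum -hN => hk.
  have [s0' h1] := hk (sval (cid (hD k))); move: h1; rewrite !mxE -/(D k) => h1.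
  apply: (vle_trans vO h1); rewrite rmorphM -[X in vle _ _ X]mul1r; apply: vleM => //.
  by apply/vle1; apply: a_le1.
have entryA k i : k \notin A -> vlt O (val (N k i) * D k) (D i).
  move=> kA; have [beta bA hb'] := hA (h i) (h0 i).
  have := oh (fun k => val (N k i - beta k)) (fun k => sfvP _) k.
  rewrite -emb_sum bA // subr0 => hk h1; apply: hb'; apply: (nle_trans vO (h := val (N k i) *: emb (h k))).
    move=> s; exists (sval (cid (hD k))); rewrite [X in vle _ X _]mxE [X in vle _ _ X]mxE.
    by rewrite [emb (h k) _ _]mxE; apply: vle_trans (maxD i s) h1.
  apply: (nle_trans vO hk); rewrite -embB hN -sumrB.
  by under eq_bigr => k' _ do rewrite scalerBl; exact: nle_refl.
pose NR : 'M[R]_n := map_mx val N.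
(* Conjugation by the diagonal matrix of the norms D. This is a computation over R, not a change of
   basis of M, but it preserves the determinant. *)
have -> : map_poly val (char_poly (mulmat bT a)) = \det (\matrix_(k, i)
    ((D k / D i) *: ('X *+ (k == i) - (NR k i)%:P))).
  rewrite map_char_poly -/N -/NR /char_poly.
  pose d1 : 'rV[{poly R}]_n := \row_i (D i)%:P; pose d2 : 'rV[{poly R}]_n := \row_i ((D i)^-1)%:P.
  transitivity (\det (diag_mx d1 *m char_poly_mx NR *m diag_mx d2)).
    rewrite !det_mulmx !det_diag mulrAC -big_split /= big1 ?mul1r // => i _.
    by rewrite !mxE -polyCM mulfV // polyC1.
  congr (\det _); apply/matrixP => k i; rewrite mul_mx_diag mul_diag_mx !mxE.
  by rewrite mulrAC -polyCM mul_polyC.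
have -> : (n - f = \sum_(k < n) (k \notin A))%N.
  have e : (f + #|[predC A]| = n)%N by rewrite -cA cardC card_ord.
  rewrite -{1}e addKn -sum1_card big_mkcond; apply: eq_bigr => k _; rewrite !inE.
  by case: (k \in A).
apply: small_below_det => // k i; rewrite mxE.
have ENR : NR k i = val (N k i) by rewrite mxE.
have Oki : O (D k / D i * NR k i).
  rewrite ENR mulrAC; apply/vleP => //; rewrite mulrC; exact: entry.
split=> [|[|t]]; last 2 first.
- case: (boolP (k \in A)) => // kA _; rewrite coefZ coefB coefMn coefX coefC /= mul0rn sub0r mulrN.
  apply: vltN => //; rewrite mulrAC; apply/(vltM2rE vO _ _ (D0 i)); rewrite divfK // mul1r mulrC ENR.
  exact: entryA.
- by case: (k \in A).
case=> [|[|t]]; rewrite coefZ coefB coefMn coefX coefC /=.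
- by rewrite mul0rn sub0r mulrN; apply: vrN.
- rewrite subr0; case: eqP => [->|_]; last by rewrite mulr0n mulr0; exact: vr0.
  by rewrite divff // mulr1; exact: vr1.
- by rewrite mul0rn subr0 mulr0; exact: vr0.
Qed.

(* Modulo the maximal ideal, the characteristic polynomial is X^(n-f) times the minimal
   polynomial of the residue of a. *)
Theorem simple_generator : exists bT : n.-tuple M, [/\ basis_of {: M} bT,
  forall i, O (val (char_poly (mulmat bT a))`_i),
  veq O (map_poly val (char_poly (mulmat bT a))^`()).[chi s0 a] 1 &
  forall u, exists s : {poly F0},
    (map_poly (GRing.in_alg M) (char_poly (mulmat bT a))^`()).[a] * u =
    (map_poly (GRing.in_alg M) s).[a]].
Proof.
have [bT [hbT fn [PO Psmall]]] := char_poly_small; exists bT.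
pose P := char_poly (mulmat bT a).
have mP : P \is monic by apply: char_poly_monic.
have szP : size P = n.+1 by rewrite size_char_poly.
pose ev (p : {poly F0}) := (map_poly val p).[chi s0 a].
have evE p : ev p = chi s0 (map_poly (GRing.in_alg M) p).[a].
  rewrite -horner_map -map_poly_comp; congr (_.[_]); apply: eq_map_poly => x /=.
  by rewrite hchi.
have Pa : ev P = 0 by apply/rootP/over_root.
have OP i : O (val P`_i) by have := PO i; rewrite coef_map.
rewrite -/P; split=> //.
  (* Here P = r + q X^m with r small. As a is a unit at s0, the equation P(a) = 0 makes q(a)
     small. *)
  pose m := (n - f)%N; pose q := drop_poly m P; pose r := take_poly m P.
  have EP : P = r + q * 'X^m by rewrite poly_take_drop.
  have vO1 : O (1 : R) := vr1 vO.
  have sr i : vlt O (val r`_i) 1.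
    rewrite coef_take_poly; case: ifP => im; first by have := Psmall i im; rewrite coef_map.
    by rewrite rmorph0; apply/(vlt0 vO); exact: oner_neq0.
  have Oq i : O (val q`_i) by rewrite coef_drop_poly.
  have evM p p' : ev (p * p') = ev p * ev p' by rewrite /ev rmorphM hornerM.
  have evD p p' : ev (p + p') = ev p + ev p' by rewrite /ev rmorphD hornerD.
  have evB p p' : ev (p - p') = ev p - ev p' by rewrite /ev rmorphB !hornerE.
  have evX k : ev 'X^k = chi s0 a ^+ k by rewrite /ev map_polyXn hornerXn.
  have evr : vlt O (ev r) 1.
    by apply: horner_small => // i; rewrite coef_map; apply: sr.
  have a_unitX k : veq O (chi s0 a ^+ k) 1 by rewrite -(expr1n _ k); apply: veqX.
  have evq : vlt O (ev q) 1.
    have h := Pa; move: h; rewrite EP evD evM evX => /eqP; rewrite addrC addr_eq0 => /eqP h.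
    apply: (vlt_veql vO (y := ev q * chi s0 a ^+ m)).
      rewrite -[X in veq _ X _]mulr1; apply: veqM => //; [exact: veq_refl|exact: veq_sym].
    by rewrite h; apply: vltN.
  have szq : size q = f.+1 by rewrite size_drop_poly szP subSn ?leq_subr // subKn.
  have mq : q \is monic.
    by rewrite monicE lead_coefE szq /= coef_drop_poly /m subnKC // -[n]/(n.+1.-1) -szP -lead_coefE -monicE.
  have evmp : vlt O (ev mp) 1.
    have := @horner_close _ _ vO (map_poly val mp) (chi s0 a) (chi s0 a0) _ Oa Oa0 close.
    rewrite -/(ev mp) => h; rewrite -[X in vlt _ X _](subrK (map_poly val mp).[chi s0 a0]).
    by apply: vltD => //; apply: h => i; rewrite coef_map; apply: mpO.
  (* Both polynomials are monic of degree f, so dl has degree less than f. Its value at a is small,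
     hence so are its coefficients by independence of the powers of the residue, and q' agrees with
     the derivative of mp at a up to a small term. *)
  pose dl := q - mp.
  have szd : (size dl <= f)%N.
    apply/leq_sizeP => k; rewrite leq_eqVlt => /orP[/eqP <-|fk].
      rewrite coefB -[q`_f]/(q`_f.+1.-1) -[mp`_f]/(mp`_f.+1.-1) -{1}szq -mp_size -!lead_coefE.
      by rewrite (monicP mq) (monicP mp_monic) subrr.
    by rewrite coefB !nth_default ?subrr // ?szq ?mp_size.
  have Od i : O (val dl`_i) by rewrite coefB rmorphB; apply: vrB => //; [exact: Oq|exact: mpO].
  have sd i : vlt O (val dl`_i) 1.
    case: (ltnP i f) => fi; last first.
      by rewrite nth_default ?(leq_trans szd) // rmorph0; apply/(vlt0 vO); exact: oner_neq0.
    apply: (@res_indep (fun k => dl`_k) (fun k => Od k) _ (Ordinal fi)).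
    have h : ev dl = \sum_(k < f) val dl`_k * chi s0 a ^+ k.
      rewrite /ev (@horner_coef_wide _ f) ?size_map_poly //.
      by apply: eq_bigr => k _; rewrite coef_map.
    rewrite -[X in vlt _ X _](subKr (\sum_(k < f) val dl`_k * chi s0 a ^+ k)).
    apply: vltB => //; last by apply: (comb_close (c := fun k : 'I_f => dl`_k)) => k; apply: Od.
    by rewrite -h /dl evB; apply: vltB.
  have evmp' : veq O (ev mp^`()) 1.
    apply: (veq_trans vO _ mp_simple); apply: veq_close => //.
    apply: (vlt_veqr vO (y := 1)); last exact: veq_sym.
    apply: horner_close => // i; rewrite -deriv_map; apply: deriv_vr => // k.
    by rewrite coef_map; apply: mpO.
  have evq' : veq O (ev q^`()) 1.
    apply: (veq_trans vO _ evmp'); apply: veq_close => //.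
    apply: (vlt_veqr vO (y := 1)); last exact: veq_sym.
    rewrite -evB -derivB /ev -deriv_map; apply: horner_small => //.
    by apply: deriv_small => // i; rewrite coef_map; apply: sd.
  rewrite -/(ev P^`()) EP derivD derivM !evD !evM evX.
  have h1 : veq O (ev q^`() * chi s0 a ^+ m) 1 by rewrite -(mulr1 1); apply: veqM.
  have h2 : vlt O (ev q * ev ('X^m)^`()) 1.
    apply: vlt_prod1 => //; apply: horner_vr => // i; rewrite -deriv_map map_polyXn.
    by apply: deriv_vr => // k; rewrite coefXn; case: eqP => _; [exact: vr1|exact: vr0].
  have h3 : vlt O (ev r^`()) 1.
    rewrite /ev -deriv_map; apply: horner_small => //.
    by apply: deriv_small => // i; rewrite coef_map; apply: sr.
  rewrite addrCA; apply: (veq_trans vO _ h1); apply: veq_addl => //.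
  by apply: vlt_veqr (veq_sym h1) => //; apply: vltD.
by move=> u; apply: char_poly_deriv.
Qed.
End AdaptedBasis.
End Generator.

(** * Families with independent values and residues *)

Section Gauss.
Variables (K : fieldType) (OK : K -> Prop) (vK : valuation_ring OK) (r s : nat).

Definition glue (R : Type) (x : 'I_r -> R) (y : 'I_s -> R) (i : 'I_(r + s)) : R :=
  match split i with inl a => x a | inr b => y b end.
Definition lmon (m : 'X_{1..r + s}) : 'I_r -> nat := fun i => m (lshift s i).
Definition rmon (m : 'X_{1..r + s}) : 'X_{1..s} := [multinom m (rshift r i) | i < s].

Lemma tmon_glue (R : fieldType) (x : 'I_r -> R) (y : 'I_s -> R) (m : 'X_{1..r + s}) :
  tmon (glue x y) m = tmon x (lmon m) * tmon y (rmon m).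
Proof.
rewrite /tmon big_split_ord /=; congr (_ * _); apply: eq_bigr => i _; rewrite /glue.
  by rewrite -[lshift s i]/(unsplit (inl i)) unsplitK.
by rewrite -[rshift r i]/(unsplit (inr i)) unsplitK mnmE.
Qed.

Lemma mon_inj (m m' : 'X_{1..r + s}) : lmon m =1 lmon m' -> rmon m = rmon m' -> m = m'.
Proof.
move=> h1 /mnmP h2; apply/mnmP => i; rewrite -[i]splitK; case: (split i) => k /=; first exact: h1.
by have := h2 k; rewrite !mnmE.
Qed.

(** Independence of the residues of y is stated through smallness of integral polynomials, so that
    no residue field has to be chosen in R. *)
Record gauss (R : fieldType) (O : R -> Prop) (j : {rmorphism K -> R}) (x : 'I_r -> R) (y : 'I_s -> R)
  : Prop := Gauss {
  gs_vr : valuation_ring O;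
  gs_ext : extends j OK O;
  gs_x0 : forall i, x i != 0;
  gs_Oy : forall i, O (y i);
  gs_val : forall c m n, c != 0 -> veq O (j c * tmon x m) (tmon x n) -> m =1 n;
  gs_res : forall p : {mpoly K[s]}, (forall m, OK p@_m) -> vlt O (mmap j y p) 1 ->
    forall m, vlt OK p@_m 1 }.

(** Exactly what conditions on finitely many values and residues at a time can ensure for a copy of
    (x, y). That the copy has the same quantifier-free behaviour in K(x, y) is derived from
    [gauss]. *)
Record transfer (R R' : fieldType) (O : R -> Prop) (O' : R' -> Prop) (j : {rmorphism K -> R})
  (j' : {rmorphism K -> R'}) (x : 'I_r -> R) (y : 'I_s -> R) (x' : 'I_r -> R') (y' : 'I_s -> R')
  : Prop := Transfer {
  tr_vr : valuation_ring O';
  tr_ext : extends j' OK O';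
  tr_x0 : forall i, x' i != 0;
  tr_Oy : forall i, O' (y' i);
  tr_val : forall c m n, vle O (j c * tmon x m) (tmon x n) <-> vle O' (j' c * tmon x' m) (tmon x' n);
  tr_res : forall p : {mpoly K[s]}, (forall m, OK p@_m) ->
    (vlt O (mmap j y p) 1 <-> vlt O' (mmap j' y' p) 1) }.

Section OneFamily.
Variables (R : fieldType) (O : R -> Prop) (j : {rmorphism K -> R}) (x : 'I_r -> R) (y : 'I_s -> R).
Hypothesis G : gauss O j x y.
Let vO := gs_vr G.
Let ext := gs_ext G.

Lemma transfer_refl : transfer O O j j x y x y.
Proof. by split=> //; [exact: (gs_x0 G)|exact: (gs_Oy G)]. Qed.

Let tx0 m : tmon x m != 0. Proof. exact: tmon_neq0 (gs_x0 G). Qed.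

Lemma gs_val2 c c' m n : c != 0 -> c' != 0 -> veq O (j c * tmon x m) (j c' * tmon x n) ->
  m =1 n /\ veq OK c c'.
Proof.
move=> c0 c'0 e; have jc'0 : j c' != 0 by rewrite fmorph_eq0.
have e' : veq O (j (c / c') * tmon x m) (tmon x n).
  apply/(veqM2lE vO _ _ jc'0); rewrite mulrA -rmorphM mulrCA divff // mulr1; exact: e.
have mn : m =1 n by apply: (gs_val G _ e'); rewrite mulf_neq0 ?invr_eq0.
split=> //; have E : tmon x m = tmon x n by apply: eq_bigr => i _; rewrite mn.
move: e; rewrite E => /(veqM2rE vO _ _ (tx0 n)); rewrite /veq !(vle_ext _ _ vK vO ext).
by [].
Qed.

Variables (R' : fieldType) (O' : R' -> Prop) (j' : {rmorphism K -> R'}) (x' : 'I_r -> R') (y' : 'I_s -> R').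
Hypothesis Tr : transfer O O' j j' x y x' y'.
Let vO' := tr_vr Tr.
Let ext' := tr_ext Tr.
Let tx'0 m : tmon x' m != 0. Proof. exact: tmon_neq0 (tr_x0 Tr). Qed.

Lemma tr_vle c c' m n : vle O (j c * tmon x m) (j c' * tmon x n) <->
  vle O' (j' c * tmon x' m) (j' c' * tmon x' n).
Proof.
have [->|c'0] := eqVneq c' 0.
  rewrite !rmorph0 !mul0r; split=> /vle_0/eqP; rewrite mulf_eq0 (negPf (tx0 _), negPf (tx'0 _)) orbF.
    by rewrite fmorph_eq0 => /eqP ->; rewrite rmorph0 mul0r; apply: vle_refl.
  by rewrite fmorph_eq0 => /eqP ->; rewrite rmorph0 mul0r; apply: vle_refl.
have := tr_val Tr (c / c') m n.
have -> : vle O (j (c / c') * tmon x m) (tmon x n) <-> vle O (j c * tmon x m) (j c' * tmon x n).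
  have jc'0 : j c' != 0 by rewrite fmorph_eq0.
  by rewrite -(vleM2lE vO _ _ jc'0) mulrA -rmorphM mulrCA divff // mulr1.
have -> : vle O' (j' (c / c') * tmon x' m) (tmon x' n) <->
    vle O' (j' c * tmon x' m) (j' c' * tmon x' n).
  have jc'0 : j' c' != 0 by rewrite fmorph_eq0.
  by rewrite -(vleM2lE vO' _ _ jc'0) mulrA -rmorphM mulrCA divff // mulr1.
by [].
Qed.

Let ty_le (S : fieldType) (V : S -> Prop) (vV : valuation_ring V) (z : 'I_s -> S) m :
  (forall i, V (z i)) -> V (tmon z m).
Proof. by move=> Vz; apply: vr_prod => // i _; apply: vrX. Qed.

(* The terms of maximal value all share the same exponent of x; their y-parts form a
   polynomial with a unit coefficient, whose value at y is a unit. *)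
Lemma gauss_lead (p : {mpoly K[r + s]}) : p != 0 -> exists c m (q : {mpoly K[s]}),
  [/\ c != 0, forall m, OK q@_m, veq O (mmap j y q) 1 /\ veq O' (mmap j' y' q) 1,
    vlt O (mmap j (glue x y) p - j c * tmon x m * mmap j y q) (j c * tmon x m) &
    vlt O' (mmap j' (glue x' y') p - j' c * tmon x' m * mmap j' y' q) (j' c * tmon x' m)].
Proof.
move=> p0; have [|m0 ms hm] := @vmax_seq _ _ vO _ (msupp p) (fun m : 'X_{1..r+s} => j p@_m * tmon x (lmon m)).
  by rewrite msupp_eq0.
pose c := p@_m0; have c0 : c != 0 by rewrite /c -mcoeff_msupp.
pose B (m : 'X_{1..r+s}) := [forall i, lmon m i == lmon m0 i].
pose q : {mpoly K[s]} := \sum_(m <- msupp p | B m) (p@_m / c) *: 'X_[rmon m].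
have Bx (S : fieldType) (z : 'I_r -> S) m : B m -> tmon z (lmon m) = tmon z (lmon m0).
  by move=> /forallP h; apply: eq_bigr => i _; rewrite (eqP (h i)).
have coefq m1 : q@_m1 = \sum_(m <- msupp p | B m) (p@_m / c) * (rmon m == m1)%:R.
  by rewrite /q raddf_sum; apply: eq_bigr => m _ /=; rewrite mcoeffZ mcoeffX.
have Oc m : m \in msupp p -> B m -> OK (p@_m / c).
  move=> mp Bm; apply/(vleP OK _ c0)/(vle_ext _ _ vK vO ext).
  by apply/(vleM2rE vO _ _ (tx0 (lmon m0))); rewrite -{1}(Bx _ x m Bm); apply: hm.
have Oq m : OK q@_m.
  rewrite coefq big_seq_cond; apply: vr_sum => // k /andP[kp Bk]; apply: vrM => //; first exact: Oc.
  by case: eqP => _; [exact: vr1|exact: vr0].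
have q1 : q@_(rmon m0) = 1.
  have Bm0 : B m0 by apply/forallP.
  rewrite coefq big_mkcond (bigD1_seq m0) //= Bm0 eqxx mulr1 divff // big1_seq ?addr0 // => k /andP[k0 _].
  case: ifP => // Bk.
  case: eqP => [e|_]; last by rewrite mulr0.
  by case/eqP: k0; apply: mon_inj => // i; apply/eqP; move/forallP: Bk; apply.
have qunit : veq O (mmap j y q) 1.
  have mv : O (mmap j y q).
    by apply: vr_sum => // m _; apply: vrM => //; [apply/ext|apply: ty_le => //; exact: (gs_Oy G)].
  split; first exact/vle1.
  case: (vleVlt O 1 (mmap j y q)) => // /(gs_res G Oq)/(_ (rmon m0)); rewrite q1 => /(vlt_irr vK) [].
exists c, (lmon m0), q; split=> //.
- split=> //; have mv : O' (mmap j' y' q).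
    by apply: vr_sum => // m _; apply: vrM => //; [apply/ext'|apply: ty_le => //; exact: (tr_Oy Tr)].
  split; first exact/vle1.
  case: (vleVlt O' 1 (mmap j' y' q)) => // /(tr_res Tr Oq) h.
  by case: (vlt_irr vO (x := 1)); case: qunit => _ h1; apply: vle_lt_trans h1 h.
- have -> : mmap j (glue x y) p - j c * tmon x (lmon m0) * mmap j y q =
     \sum_(m <- msupp p | ~~ B m) j p@_m * tmon (glue x y) m.
    rewrite {1}/mmap (bigID B) /= addrAC -[RHS]add0r; congr (_ + _); apply/eqP; rewrite subr_eq0; apply/eqP.
    rewrite /q raddf_sum mulr_sumr; apply: eq_bigr => m Bm.
    rewrite /= mmapZ mmapX rmorphM fmorphV -[mmap1 _ _]/(tmon _ _) tmon_glue (Bx _ x m Bm) -[mmap1 _ _]/(tmon _ _).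
    have jc0 : j c != 0 by rewrite fmorph_eq0.
    by field.
  rewrite big_seq_cond; apply: vlt_sum => // [|m /andP[mp nB]]; first by rewrite mulf_neq0 ?fmorph_eq0.
  rewrite tmon_glue mulrA -[X in vlt _ _ X]mulr1; apply: vlt_leM => //; last exact: oner_neq0.
    move=> h; move/negP: nB; apply; apply/forallP => i; apply/eqP; move: i.
    by have [] := gs_val2 (c := p@_m) (c' := c) _ c0 (conj (hm m mp) h); rewrite -?mcoeff_msupp.
  by apply/vle1; apply: ty_le => //; exact: (gs_Oy G).
have -> : mmap j' (glue x' y') p - j' c * tmon x' (lmon m0) * mmap j' y' q =
   \sum_(m <- msupp p | ~~ B m) j' p@_m * tmon (glue x' y') m.
  rewrite {1}/mmap (bigID B) /= addrAC -[RHS]add0r; congr (_ + _); apply/eqP; rewrite subr_eq0; apply/eqP.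
  rewrite /q raddf_sum mulr_sumr; apply: eq_bigr => m Bm.
  rewrite /= mmapZ mmapX rmorphM fmorphV -[mmap1 _ _]/(tmon _ _) tmon_glue (Bx _ x' m Bm) -[mmap1 _ _]/(tmon _ _).
  have jc0 : j' c != 0 by rewrite fmorph_eq0.
  by field.
rewrite big_seq_cond; apply: vlt_sum => // [|m /andP[mp nB]]; first by rewrite mulf_neq0 ?fmorph_eq0.
rewrite tmon_glue mulrA -[X in vlt _ _ X]mulr1; apply: vlt_leM => //; last exact: oner_neq0.
  move/tr_vle => h; move/negP: nB; apply; apply/forallP => i; apply/eqP; move: i.
  by have [] := gs_val2 (c := p@_m) (c' := c) _ c0 (conj (hm m mp) h); rewrite -?mcoeff_msupp.
by apply/vle1; apply: ty_le => //; exact: (tr_Oy Tr).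
Qed.

Lemma gauss_norm (p : {mpoly K[r + s]}) : p != 0 -> exists c m, [/\ c != 0,
  veq O (mmap j (glue x y) p) (j c * tmon x m) & veq O' (mmap j' (glue x' y') p) (j' c * tmon x' m)].
Proof.
move=> /gauss_lead [c [m [q [c0 _ [q1 q1'] h h']]]]; exists c, m; split=> //.
  have e : veq O (j c * tmon x m * mmap j y q) (j c * tmon x m).
    by rewrite -[X in veq _ _ X]mulr1; apply: veqM => //; exact: veq_refl.
  by apply: (veq_trans vO _ e); apply: veq_close => //; exact: vlt_veqr h (veq_sym e).
have e : veq O' (j' c * tmon x' m * mmap j' y' q) (j' c * tmon x' m).
  by rewrite -[X in veq _ _ X]mulr1; apply: veqM => //; exact: veq_refl.
by apply: (veq_trans vO' _ e); apply: veq_close => //; exact: vlt_veqr h' (veq_sym e).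
Qed.

Lemma gauss_eq0 (p : {mpoly K[r + s]}) : mmap j (glue x y) p = 0 -> p = 0.
Proof.
move=> e; apply: contrapT => /eqP /gauss_norm [c [m [c0 h _]]].
have := veq_neq0 (veq_sym h); rewrite e eqxx => /(_ _)/notF[].
by rewrite mulf_neq0 ?fmorph_eq0.
Qed.

Lemma transfer_neq0 (p : {mpoly K[r + s]}) : p != 0 -> mmap j' (glue x' y') p != 0.
Proof.
move=> /gauss_norm [c [m [c0 _ h]]]; apply: (veq_neq0 (veq_sym h)).
by rewrite mulf_neq0 ?fmorph_eq0.
Qed.

(** On both sides the value of a polynomial is that of the same term c x^m, and such terms compare
    alike by [tr_val]. *)
Lemma transfer_vle (p q : {mpoly K[r + s]}) :
  vle O (mmap j (glue x y) p) (mmap j (glue x y) q) <->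
  vle O' (mmap j' (glue x' y') p) (mmap j' (glue x' y') q).
Proof.
have [->|p0] := eqVneq p 0; first by rewrite !rmorph0; split=> _; apply: vle0.
have [->|q0] := eqVneq q 0.
  rewrite !rmorph0; split=> /vle_0; first by move/gauss_eq0 => e; rewrite e eqxx in p0.
  by move=> e; have := transfer_neq0 p0; rewrite e eqxx.
have [c [m [c0 h h']]] := gauss_norm p0; have [c' [m' [c'0 hq hq']]] := gauss_norm q0.
have := tr_vle c c' m m'; case: h h' hq hq' => [h1 h2] [h3 h4] [h5 h6] [h7 h8] [E1 E2].
split=> H.
  apply: (vle_trans vO' h3); apply: (vle_trans vO' _ h8); apply: E1.
  by apply: (vle_trans vO h2); apply: (vle_trans vO H).
apply: (vle_trans vO h1); apply: (vle_trans vO _ h6); apply: E2.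
by apply: (vle_trans vO' h4); apply: (vle_trans vO' H).
Qed.

(* An integral element p/q of K(x, y) has the residue of A(y)/B(y). *)
Lemma gauss_residue (p q : {mpoly K[r + s]}) : q != 0 ->
  vle O (mmap j (glue x y) p) (mmap j (glue x y) q) ->
  exists A B : {mpoly K[s]}, [/\ forall m, OK A@_m, forall m, OK B@_m,
    veq O (mmap j y B) 1 /\ veq O' (mmap j' y' B) 1,
    vlt O (mmap j (glue x y) p * mmap j y B - mmap j (glue x y) q * mmap j y A) (mmap j (glue x y) q) &
    vlt O' (mmap j' (glue x' y') p * mmap j' y' B - mmap j' (glue x' y') q * mmap j' y' A)
       (mmap j' (glue x' y') q)].
Proof.
set P := mmap j _ p; set Q := mmap j _ q; set P' := mmap j' _ p; set Q' := mmap j' _ q => q0 PQ.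
have Q0 : Q != 0 by apply: contraNneq q0 => /gauss_eq0 ->.
case: (vleVlt O Q P) => [QP|lt]; last first.
  exists 0, 1; rewrite !rmorph0 !rmorph1 !mulr0 !subr0 !mulr1; split=> //.
  - by move=> m; rewrite mcoeff0; exact: vr0.
  - by move=> m; rewrite mcoeff1; case: eqP => _; [exact: vr1|exact: vr0].
  - by split; exact: veq_refl.
  - by move/transfer_vle => h; apply: lt.
have p0 : p != 0.
  by apply/eqP => p0; move: QP; rewrite /P p0 rmorph0 => /vle_0/eqP; rewrite (negPf Q0).
have [c [m [pt [c0 Opt [pt1 pt1'] hp hp']]]] := gauss_lead p0.
have [c' [m' [qt [c'0 Oqt [qt1 qt1'] hq hq']]]] := gauss_lead q0.
have norm (S : fieldType) (V : S -> Prop) (vV : valuation_ring V) (A B C : S) :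
    veq V C 1 -> vlt V (A - B * C) B -> veq V A B.
  move=> C1 h; have e : veq V (B * C) B by rewrite -[X in veq _ _ X]mulr1; apply: veqM => //; exact: veq_refl.
  by apply: (veq_trans vV _ e); apply: veq_close => //; exact: vlt_veqr h (veq_sym e).
have eP := norm _ _ vO _ _ _ pt1 hp; have eQ := norm _ _ vO _ _ _ qt1 hq.
have eQ' := norm _ _ vO' _ _ _ qt1' hq'.
have e : veq O (j c * tmon x m) (j c' * tmon x m').
  by apply: (veq_trans vO (veq_sym eP)); apply: veq_trans eQ => //; split.
have [mm cc] := gs_val2 c0 c'0 e.
have tE (S : fieldType) (z : 'I_r -> S) : tmon z m = tmon z m' by apply: eq_bigr => i _; rewrite mm.
have cc1 : veq OK (c / c') 1 by apply/(veqM2rE vK _ _ c'0); rewrite divfK // mul1r.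
have Occ : OK (c / c') by apply/vle1; case: cc1.
exists ((c / c') *: pt), qt; split=> //.
- by move=> k; rewrite mcoeffZ; apply: vrM.
- rewrite mmapZ; apply: (vlt_veqr vO (y := j c' * tmon x m')); last exact: veq_sym.
  have -> : P * mmap j y qt - Q * (j (c / c') * mmap j y pt) =
      (P - j c * tmon x m * mmap j y pt) * mmap j y qt -
      (Q - j c' * tmon x m' * mmap j y qt) * (j (c / c') * mmap j y pt).
    have jc'0 : j c' != 0 by rewrite fmorph_eq0.
    by rewrite tE rmorphM fmorphV; field.
  rewrite -[X in vlt _ _ X]mulr1; apply: vltB => //; apply: vlt_leM => //; rewrite ?oner_neq0 //.
  + by apply: vlt_veqr hp e.
  + by case: qt1.
  + rewrite -[X in vle _ _ X]mulr1; apply: vleM => //; last by case: pt1.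
    by apply/vle1/ext.
rewrite mmapZ; apply: (vlt_veqr vO' (y := j' c' * tmon x' m')); last exact: veq_sym.
have -> : P' * mmap j' y' qt - Q' * (j' (c / c') * mmap j' y' pt) =
    (P' - j' c * tmon x' m * mmap j' y' pt) * mmap j' y' qt -
    (Q' - j' c' * tmon x' m' * mmap j' y' qt) * (j' (c / c') * mmap j' y' pt).
  have jc'0 : j' c' != 0 by rewrite fmorph_eq0.
  by rewrite tE rmorphM fmorphV; field.
have e' : veq O' (j' c * tmon x' m) (j' c' * tmon x' m').
  by case: e => e1 e2; split; apply/tr_vle.
rewrite -[X in vlt _ _ X]mulr1; apply: vltB => //; apply: vlt_leM => //; rewrite ?oner_neq0 //.
+ by apply: vlt_veqr hp' e'.
+ by case: qt1'.
+ rewrite -[X in vle _ _ X]mulr1; apply: vleM => //; last by case: pt1'.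
  by apply/vle1/ext'.
Qed.
End OneFamily.
End Gauss.

Lemma polyT_mmap (K R : fieldType) (j : {rmorphism K -> R}) d (T : 'I_d -> R) x :
  polyT (imK' j) T x <-> exists p : {mpoly K[d]}, x = mmap j T p.
Proof.
split=> [[q [hq ->]]|[p ->]]; last first.
  exists (map_mpoly j p); split=> [m|]; first by rewrite mcoeff_map_mpoly; exists p@_m.
  rewrite mevalE (perm_big _ (msupp_map_mpoly _ (fmorph_inj j))) /=.
  by apply: eq_bigr => m _; rewrite mcoeff_map_mpoly.
exists (\sum_(m <- msupp q) sval (cid (hq m)) *: 'X_[m]).
rewrite rmorph_sum mevalE; apply: eq_bigr => m _; rewrite /= mmapZ mmapX.
by case: (cid _) => c /= <-.
Qed.

Lemma ratT_mmap (K R : fieldType) (j : {rmorphism K -> R}) d (T : 'I_d -> R) x :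
  ratT (imK' j) T x <-> exists p q : {mpoly K[d]}, mmap j T q != 0 /\ x = mmap j T p / mmap j T q.
Proof.
split=> [[a [b [/polyT_mmap [p ->] /polyT_mmap [q ->] b0 ->]]]|[p [q [q0 ->]]]]; first by exists p, q.
by exists (mmap j T p), (mmap j T q); split=> //; apply/polyT_mmap; [exists p|exists q].
Qed.

(** * Refining the valuation along the residues *)

Section DegreeValuation.
Variables (k : fieldType) (S : k -> Prop) (hS : is_subfield S) (s : nat) (y : 'I_s -> k).
Hypothesis iy : alg_indep S y.
Local Notation poly := {mpoly k[s]}.
Definition over_S (p : poly) := forall m, S p@_m.

Lemma alg_indep_inj (p q : poly) : over_S p -> over_S q -> p.@[y] = q.@[y] -> p = q.
Proof.
move=> hp hq e; apply/eqP; rewrite -subr_eq0; apply/negPn/negP => pq.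
by have /negP := iy pq (mcoefB hS hp hq); rewrite mevalB e subrr eqxx.
Qed.

(** Within S(y), the fractions whose numerator has a leading monomial not above that of the
    denominator: a valuation ring, trivial on S, for which the values of y^m are distinguished by
    the exponents. *)
Definition degree_ring (z : k) : Prop := exists p q, [/\ over_S p, over_S q, q != 0,
  z * q.@[y] = p.@[y] & p = 0 \/ (mlead p <= mlead q)%O].

Lemma degree_ring_const z : S z -> degree_ring z.
Proof.
move=> Sz; exists z%:MP, 1; split.
- by move=> m; rewrite mcoeffC; case: eqP => _; rewrite ?mulr1 ?mulr0 //; exact: sf0.
- by move=> m; rewrite mcoeff1; case: eqP => _; [exact: sf1|exact: sf0].
- exact: oner_neq0.
- by rewrite mevalC meval1 mulr1.
- by right; rewrite mleadC mlead1.
Qed.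

Lemma degree_ring_ratT : forall z, ratT S y z -> z != 0 -> degree_ring z \/ degree_ring z^-1.
Proof.
move=> _ [_ [_ [[p [hp ->]] [q [hq ->]] q0 ->]]]; rewrite mulf_eq0 negb_or => /andP[p0 _].
have p0' : p != 0 by apply: contraNneq p0 => ->; rewrite meval0.
have q0' : q != 0 by apply: contraNneq q0 => ->; rewrite meval0.
case/orP: (Order.TotalTheory.le_total (mlead p) (mlead q)) => h.
  by left; exists p, q; split=> //; [rewrite divfK|right].
by right; exists q, p; split=> //; [rewrite invf_div divfK|right].
Qed.

Lemma meval_neq0 (p : poly) : over_S p -> p != 0 -> p.@[y] != 0.
Proof. by move=> hp p0; apply: iy. Qed.

Lemma degree_ringM z z' : degree_ring z -> degree_ring z' -> degree_ring (z * z').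
Proof.
move=> [p [q [hp hq q0 e h]]] [p' [q' [hp' hq' q'0 e' h']]].
exists (p * p'), (q * q'); split; [exact: mcoefM|exact: mcoefM|exact: mulf_neq0| |].
  by rewrite !mevalM -e -e'; ring.
case: h => [->|h]; first by left; rewrite mul0r.
case: h' => [->|h']; first by left; rewrite mulr0.
have [->|p0] := eqVneq p 0; first by left; rewrite mul0r.
have [->|p'0] := eqVneq p' 0; first by left; rewrite mulr0.
by right; rewrite !mleadM //; exact: lem_add.
Qed.

Lemma degree_ringB z z' : degree_ring z -> degree_ring z' -> degree_ring (z - z').
Proof.
move=> [p [q [hp hq q0 e h]]] [p' [q' [hp' hq' q'0 e' h']]].
exists (p * q' - p' * q), (q * q'); split.
- by apply: mcoefB => //; exact: mcoefM.
- exact: mcoefM.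
- exact: mulf_neq0.
- by rewrite mevalB !mevalM -e -e'; ring.
have b1 : (mlead (p * q') <= mlead (q * q'))%O.
  have [->|p0] := eqVneq p 0; first by rewrite mul0r mlead0 le0m.
  by rewrite !mleadM //; apply: lem_add => //; case: h => // e0; rewrite e0 eqxx in p0.
have b2 : (mlead (p' * q) <= mlead (q * q'))%O.
  have [->|p0] := eqVneq p' 0; first by rewrite mul0r mlead0 le0m.
  by rewrite (mulrC q) !mleadM //; apply: lem_add => //; case: h' => // e0; rewrite e0 eqxx in p0.
have [->|d0] := eqVneq (p * q' - p' * q) 0; [by left|right].
have := msuppB_le (mlead_supp d0); rewrite mem_cat => /orP[]/msupp_le_mlead h1; exact: Order.POrderTheory.le_trans h1 _.
Qed.

Lemma degree_ring_mon (m n : 'X_{1..s}) :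
  degree_ring (tmon y m / tmon y n) -> degree_ring (tmon y n / tmon y m) -> m = n.
Proof.
have X0 (l : 'X_{1..s}) : over_S 'X_[l].
  by move=> l'; rewrite mcoeffX; case: eqP => _; [exact: sf1|exact: sf0].
have XE (l : 'X_{1..s}) : tmon y l = ('X_[l] : poly).@[y] by rewrite mevalX.
have Xn (l : 'X_{1..s}) : tmon y l != 0.
  rewrite XE; apply: meval_neq0 => //; rewrite -mleadc_eq0 mleadXm mcoeffX eqxx; exact: oner_neq0.
have le (m' n' : 'X_{1..s}) : degree_ring (tmon y m' / tmon y n') -> (m' <= n')%O.
  move=> [p [q [hp hq q0 e h]]].
  have E : 'X_[m'] * q = p * 'X_[n'] :> poly.
    apply: alg_indep_inj; [by apply: mcoefM => //; exact: X0|by apply: mcoefM => //; exact: X0|].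
    by rewrite !mevalM -e -!XE; field.
  have X0' (l : 'X_{1..s}) : 'X_[l] != 0 :> poly.
    by rewrite -mleadc_eq0 mleadXm mcoeffX eqxx; exact: oner_neq0.
  have p0 : p != 0.
    by apply/eqP => p0; move/eqP: E; rewrite p0 mul0r mulf_eq0 (negPf (X0' _)) (negPf q0).
  case: h => [p00|h]; first by rewrite p00 eqxx in p0.
  have := congr1 (fun f : poly => mlead f) E; rewrite !mleadM // !mleadXm => E'.
  by rewrite -(lemc_add2l _ _ (mlead q)) E' addmC lemc_add2r.
by move=> /le h1 /le h2; apply: Order.le_anti; rewrite h1 h2.
Qed.

(** The ring just described is a valuation ring of S(y) only; Chevalley's theorem carries it to
    k. *)
Lemma degree_valuation : exists2 V : k -> Prop, valuation_ring V &
  (forall z, S z -> V z) /\ forall m n : 'X_{1..s}, veq V (tmon y m) (tmon y n) -> m = n.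
Proof.
have hR := ratT_subfield y hS.
have vD : valuation_ring (fun z : sft hR => degree_ring (val z)).
  split=> [|z z'|z z'|z z0].
  - by rewrite rmorph1; apply: degree_ring_const; exact: sf1.
  - by rewrite rmorphB; apply: degree_ringB.
  - by rewrite rmorphM; apply: degree_ringM.
  - rewrite sfvV; apply: degree_ring_ratT; first exact: sfvP.
    by rewrite sfv_eq0.
have [V vV ext] := valuation_extends (val : {rmorphism sft hR -> k}) vD.
have VE z : ratT S y z -> V z <-> degree_ring z.
  by move=> /(sfv_ex hR) [w <-]; apply: ext.
exists V => //; split=> [z Sz|m n e].
  by apply/VE; [exact: ratT_const|exact: degree_ring_const].
have Xn (l : 'X_{1..s}) : tmon y l != 0.
  have -> : tmon y l = ('X_[l] : poly).@[y] by rewrite mevalX.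
  apply: meval_neq0; last by rewrite -mleadc_eq0 mleadXm mcoeffX eqxx; exact: oner_neq0.
  by move=> l'; rewrite mcoeffX; case: eqP => _; [exact: sf1|exact: sf0].
have rt (l : 'X_{1..s}) : ratT S y (tmon y l).
  apply: ratT_poly => //; apply: (@box_polyT _ _ _ _ (\max_i l i)).
  by apply: box_tmon => // i; exact: leq_bigmax.
case: e => /vleP h1 /vleP h2; apply: degree_ring_mon; apply/VE; try by apply: sf_div.
  exact: h1.
exact: h2.
Qed.
End DegreeValuation.

(** * Residue maps, reduction of polynomials and the refined valuation *)

Section Residues.
Variables (K L : fieldType) (iota : {rmorphism K -> L}) (OK : K -> Prop) (OL : L -> Prop)
  (k : fieldType) (res : L -> k).
Hypothesis vK : valuation_ring OK.
Hypothesis vL : valuation_ring OL.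
Hypothesis ext : extends iota OK OL.
Hypothesis hres : residue_map OL res.
Local Notation k0 := (Kv_img iota OK res).

Lemma resD x y : OL x -> OL y -> res (x + y) = res x + res y.
Proof. by case: hres => h _ _ _ _; apply: h. Qed.
Lemma resM x y : OL x -> OL y -> res (x * y) = res x * res y.
Proof. by case: hres => _ h _ _ _; apply: h. Qed.
Lemma res1 : res 1 = 1.
Proof. by case: hres. Qed.
Lemma res_eq0 x : OL x -> res x = 0 <-> vlt OL x 1.
Proof. by case: hres => _ _ _ _ h /h ->; exact: vmaxP. Qed.
Lemma res0 : res 0 = 0.
Proof. by apply/res_eq0; [exact: vr0|apply/vlt0 => //; exact: oner_neq0]. Qed.
Lemma resN x : OL x -> res (- x) = - res x.
Proof. by move=> Ox; apply/eqP; rewrite -addr_eq0 -resD ?addNr ?res0 //; exact: vrN. Qed.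
Lemma resB x y : OL x -> OL y -> res (x - y) = res x - res y.
Proof. by move=> Ox Oy; rewrite resD ?resN //; exact: vrN. Qed.
Lemma res_sum (I : Type) (r : seq I) (P : pred I) (F : I -> L) : (forall i, P i -> OL (F i)) ->
  res (\sum_(i <- r | P i) F i) = \sum_(i <- r | P i) res (F i).
Proof.
move=> h; elim: r => [|i r IH]; first by rewrite !big_nil res0.
rewrite !big_cons; case: ifP => // Pi; rewrite resD ?IH //; first exact: h.
exact: vr_sum.
Qed.
Lemma resX x n : OL x -> res (x ^+ n) = res x ^+ n.
Proof. by move=> Ox; elim: n => [|n IH]; rewrite ?res1 // !exprS resM ?IH //; exact: vrX. Qed.
Lemma res_prod (I : Type) (r : seq I) (P : pred I) (F : I -> L) : (forall i, P i -> OL (F i)) ->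
  res (\prod_(i <- r | P i) F i) = \prod_(i <- r | P i) res (F i).
Proof.
move=> h; elim: r => [|i r IH]; first by rewrite !big_nil res1.
rewrite !big_cons; case: ifP => // Pi; rewrite resM ?IH //; first exact: h.
exact: vr_prod.
Qed.
Lemma res_eq x y : OL x -> OL y -> res x = res y <-> vlt OL (x - y) 1.
Proof.
move=> Ox Oy; rewrite -(res_eq0 (vrB vL Ox Oy)) resB //; split=> [->|/eqP]; first by rewrite subrr.
by rewrite subr_eq0 => /eqP.
Qed.
Lemma res_neq0 x : OL x -> res x != 0 <-> veq OL x 1.
Proof.
move=> Ox; split=> [|e]; last first.
  by apply/eqP => /(res_eq0 Ox) h; case: e => _; apply: h.
move=> n0; split; first exact/vle1.
by case: (vleVlt OL 1 x) => // /(res_eq0 Ox) e; rewrite e eqxx in n0.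
Qed.
Lemma resV x : veq OL x 1 -> OL x^-1 /\ res x^-1 = (res x)^-1.
Proof.
move=> e; have Ox : OL x by apply/vle1; case: e.
have Oi : OL x^-1 by have [h _] := veqV vL e; apply/vle1; rewrite invr1 in h.
have x0 : x != 0 by apply: (veq_neq0 (veq_sym e)); exact: oner_neq0.
split=> //; apply: (mulfI (x := res x)); first exact/res_neq0.
by rewrite -resM // divff // res1 divff //; apply/res_neq0.
Qed.

Lemma Kv_subfield : is_subfield k0.
Proof.
split.
- by exists 1; rewrite rmorph1 res1; split=> //; exact: vr1.
- move=> _ _ [a [Oa <-]] [b [Ob <-]]; exists (a - b); split; first exact: vrB.
  by rewrite rmorphB resB //; apply/ext.
- move=> _ _ [a [Oa <-]] [b [Ob <-]]; exists (a * b); split; first exact: vrM.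
  by rewrite rmorphM resM //; apply/ext.
- move=> _ [a [Oa <-]]; have [->|n0] := eqVneq (res (iota a)) 0.
    by rewrite invr0; exists 0; rewrite rmorph0 res0; split=> //; exact: vr0.
  have [h <-] := resV ((res_neq0 (iffRL (ext a) Oa)).1 n0).
  by exists a^-1; rewrite fmorphV; split=> //; apply/ext; rewrite fmorphV.
Qed.

Variable s : nat.
Definition reduction (p : {mpoly K[s]}) : {mpoly k[s]} :=
  \sum_(m <- msupp p) res (iota p@_m) *: 'X_[m].

Lemma reduction_coef p m : (reduction p)@_m = res (iota p@_m).
Proof.
rewrite /reduction raddf_sum /=; have [hm|hm] := boolP (m \in msupp p).
  rewrite (bigD1_seq m) //= mcoeffZ mcoeffX eqxx mulr1 big1 ?addr0 // => i im.
  by rewrite mcoeffZ mcoeffX (negPf im) mulr0.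
rewrite (memN_msupp_eq0 hm) rmorph0 res0 big1_seq // => i /andP[_ hi].
rewrite mcoeffZ mcoeffX; case: eqP => [e|_]; last by rewrite mulr0.
by rewrite -e hi in hm.
Qed.

Lemma reduction_over p : (forall m, OK p@_m) -> forall m, k0 (reduction p)@_m.
Proof. by move=> h m; rewrite reduction_coef; exists p@_m. Qed.

Lemma reduction_lift (q : {mpoly k[s]}) : (forall m, k0 q@_m) ->
  exists2 p : {mpoly K[s]}, (forall m, OK p@_m) & reduction p = q.
Proof.
move=> hq; pose c m := if m \in msupp q then sval (cid (hq m)) else 0.
pose p : {mpoly K[s]} := \sum_(m <- msupp q) c m *: 'X_[m].
have pE m : p@_m = c m.
  rewrite /p raddf_sum /=; have [hm|hm] := boolP (m \in msupp q).
    rewrite (bigD1_seq m) //= mcoeffZ mcoeffX eqxx mulr1 big1 ?addr0 // => i im.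
    by rewrite mcoeffZ mcoeffX (negPf im) mulr0.
  rewrite /c (negPf hm) big1_seq // => i /andP[_ hi].
  rewrite mcoeffZ mcoeffX; case: eqP => [e|_]; last by rewrite mulr0.
  by rewrite -e hi in hm.
exists p; first by move=> m; rewrite pE /c; case: ifP => _; [case: (cid _) => a []|exact: vr0].
apply/mpolyP => m; rewrite reduction_coef pE /c; case: ifPn => hm; first by case: (cid _) => a [].
by rewrite rmorph0 res0 (memN_msupp_eq0 hm).
Qed.

Lemma OL_tmon (y : 'I_s -> L) m : (forall i, OL (y i)) -> OL (tmon y m).
Proof. by move=> Oy; apply: vr_prod => // i _; apply: vrX. Qed.

Lemma res_tmon (y : 'I_s -> L) m : (forall i, OL (y i)) ->
  res (tmon y m) = tmon (fun i => res (y i)) m.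
Proof.
move=> Oy; rewrite res_prod; first by apply: eq_bigr => i _; rewrite resX.
by move=> i _; apply: vrX.
Qed.

Lemma OL_mmap (y : 'I_s -> L) (p : {mpoly K[s]}) : (forall i, OL (y i)) -> (forall m, OK p@_m) ->
  OL (mmap iota y p).
Proof.
by move=> Oy hp; apply: vr_sum => // m _; apply: vrM => //; [apply/ext|exact: OL_tmon].
Qed.

Lemma res_mmap (y : 'I_s -> L) (p : {mpoly K[s]}) : (forall i, OL (y i)) -> (forall m, OK p@_m) ->
  res (mmap iota y p) = (reduction p).@[fun i => res (y i)].
Proof.
move=> Oy hp; have Ot m : OL (tmon y m) by exact: OL_tmon.
have Oi m : OL (iota p@_m) by exact: (iffRL (ext _) (hp m)).
rewrite /reduction rmorph_sum res_sum; last by move=> m _; exact: (vrM vL (Oi m) (Ot m)).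
apply: eq_bigr => m _; rewrite /= mevalZ mevalX resM //.
  by congr (_ * _); exact: res_tmon.
exact: (Ot m).
Qed.

Variables (r : nat) (x : 'I_r -> L) (y : 'I_s -> L).
Hypothesis x0 : forall i, x i != 0.
Hypothesis Oy : forall i, OL (y i).
Hypothesis val_x : forall c m n, c != 0 -> veq OL (iota c * tmon x m) (tmon x n) -> m =1 n.
Hypothesis res_y : alg_indep k0 (fun i => res (y i)).

Lemma gauss_of_indep : gauss OK OL iota x y.
Proof.
split=> // p hp h m; have Om := OL_mmap Oy hp.
have E : reduction p = 0.
  apply/eqP/negPn/negP => n0; have /eqP := res_y n0 (reduction_over hp); apply.
  by rewrite -res_mmap //; apply/res_eq0.
have Om' : OL (iota p@_m) by apply/ext.
have : vlt OL (iota p@_m) 1 by apply/res_eq0; rewrite // -reduction_coef E mcoeff0.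
by rewrite /vlt -(rmorph1 iota) (vle_ext _ _ vK vL ext).
Qed.

(** The composite of OL with a valuation V of the residue field that is trivial on Kv and separates
    monomials in the residues of y. In a comparison of monomials, OL determines the exponents of x,
    and V those of y in the remaining quotient of units. On K nothing changes, as V is trivial on
    Kv. *)
Lemma refined_ring : exists O' : L -> Prop, [/\ valuation_ring O', forall z, O' z -> OL z,
  extends iota OK O' & vindep O' (imK' iota) (glue x y)].
Proof.
have [V vV [V0 Vt]] := degree_valuation Kv_subfield res_y.
pose O' z := OL z /\ V (res z).
have G := gauss_of_indep.
have y1 i : veq OL (y i) 1.
  apply/res_neq0 => //; have := res_y (p := 'X_i); rewrite mevalXU; apply.
    by rewrite -mleadc_eq0 mleadXm mcoeffX eqxx; exact: oner_neq0.
  by move=> m; rewrite mcoeffX; case: eqP => _; [exact: sf1 Kv_subfield|exact: sf0 Kv_subfield].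
have y0 i : y i != 0 by apply: (veq_neq0 (veq_sym (y1 i))); exact: oner_neq0.
have ty1 m : veq OL (tmon y m) 1.
  by apply/res_neq0; rewrite ?res_tmon ?tmon_neq0 //; [exact: OL_tmon|move=> i; apply/res_neq0].
have vO' : valuation_ring O'.
  split.
  - by split; [exact: vr1|rewrite res1; exact: vr1].
  - by move=> a b [Oa Va] [Ob Vb]; split; [exact: vrB|rewrite resB //; exact: vrB].
  - by move=> a b [Oa Va] [Ob Vb]; split; [exact: vrM|rewrite resM //; exact: vrM].
  - move=> z z0; have small w : vlt OL w 1 -> O' w.
      move=> h; have Ow : OL w by apply/vle1; exact: vltW.
      by split=> //; rewrite (iffRL (res_eq0 Ow) h); exact: vr0.
    case: (vleVlt OL 1 z) => [h|]; last by left; apply: small.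
    case: (vleVlt OL 1 z^-1) => [h'|]; last by right; apply: small.
    have e : veq OL z 1.
      by split=> //; have := vleM2l vL z h'; rewrite mulr1 divff.
    have [Oi ri] := resV e; have Oz : OL z by apply/vle1; case: e.
    by case: (vr_total vV (iffRL (res_neq0 Oz) e)) => h1; [left|right]; split=> //; rewrite ri.
have ext' : extends iota OK O'.
  by move=> a; split=> [[/ext]//|Oa]; split; [apply/ext|apply: V0; exists a].
have sub z : O' z -> OL z by case.
exists O'; split=> //; split.
  by move=> i; rewrite /glue; case: (split i).
move=> _ _ m' n' [c ->] [c' ->]; rewrite !fmorph_eq0 => c0 c'0.
pose m := [multinom m' i | i < r + s]; pose n := [multinom n' i | i < r + s].
have -> : tmon (glue x y) m' = tmon (glue x y) m by apply: eq_bigr => i _; rewrite mnmE.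
have -> : tmon (glue x y) n' = tmon (glue x y) n by apply: eq_bigr => i _; rewrite mnmE.
suff mn : veq O' (iota c * tmon (glue x y) m) (iota c' * tmon (glue x y) n) -> m = n.
  by move=> /mn /mnmP h i; have := h i; rewrite !mnmE.
clearbody m n; rewrite !tmon_glue => e.
have subv a b : vle O' a b -> vle OL a b by case=> o [Oo _] ->; exists o.
have e1 : veq OL (iota c * tmon x (lmon m)) (iota c' * tmon x (lmon n)).
  have tr m1 c1 : veq OL (iota c1 * (tmon x (lmon m1) * tmon y (rmon m1))) (iota c1 * tmon x (lmon m1)).
    by rewrite mulrA -[X in veq _ _ X]mulr1; apply: veqM => //; exact: veq_refl.
  apply: (veq_trans vL (veq_sym (tr m c))); apply: veq_trans (tr n c') => //.
  by case: e => h1 h2; split; apply: subv.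
have [lmn cc] := gs_val2 vK G c0 c'0 e1.
have lE : tmon x (lmon m) = tmon x (lmon n) by apply: eq_bigr => i _; rewrite lmn.
suff rmn : rmon m = rmon n by exact: mon_inj lmn rmn.
have txn : tmon x (lmon n) != 0 by exact: tmon_neq0.
have ic' : iota c' != 0 by rewrite fmorph_eq0.
have ty0 a : tmon y a != 0 by exact: tmon_neq0.
set a := rmon m; set b := rmon n; have e2 : veq O' (iota (c / c') * tmon y a) (tmon y b).
  have z0 : iota c' * tmon x (lmon n) != 0 by exact: mulf_neq0.
  apply/(veqM2lE vO' _ _ z0); rewrite rmorphM fmorphV.
  have -> : iota c' * tmon x (lmon n) * (iota c / iota c' * tmon y a) = iota c * (tmon x (lmon m) * tmon y a).
    by rewrite lE; field.
  by rewrite -mulrA.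
have cc1 : veq OK (c / c') 1 by apply/(veqM2rE vK _ _ c'0); rewrite divfK // mul1r.
have Occ : OK (c / c') by apply/vle1; case: cc1.
have [u1 u2] : veq O' (iota (c / c')) 1 by rewrite /veq -(rmorph1 iota) !(vle_ext _ _ vK vO' ext').
have e3 : veq O' (tmon y a) (tmon y b).
  apply: (veq_trans vO' _ e2); rewrite -{1}[tmon y a]mul1r; apply: (veqM vO') (veq_refl vO' _).
  by split.
apply: Vt; have rt l : tmon (fun i => res (y i)) l != 0 by apply: tmon_neq0 => i; apply/res_neq0.
have H (a' b' : 'X_{1..s}) : vle O' (tmon y a') (tmon y b') ->
    vle V (tmon (fun i => res (y i)) a') (tmon (fun i => res (y i)) b').
  move=> /vleP [] // Od Vd; apply/vleP => //; move: Vd.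
  have [Oi ri] := resV (ty1 b'); rewrite resM //; last exact: OL_tmon.
  by rewrite ri !res_tmon.
by case: e3 => h1 h2; split; apply: H.
Qed.

(** Two rings of the algebraic closure are kept: O1 extends the refined ring and serves for
    counting, O2 extends OL and serves for residues. The inclusion of O1 in O2 lets inequalities
    pass from the first to the second. *)
Theorem refinement : exists (W : fieldType) (j : {rmorphism L -> W}) (O1 O2 : W -> Prop),
  [/\ alg_closed W, valuation_ring O1 /\ valuation_ring O2, forall z, O1 z -> O2 z,
    extends (j \o iota) OK O1 /\ extends j OL O2 &
    vindep O1 (imK' (j \o iota)) (fun i => j (glue x y i))].
Proof.
have [O' [vO' sub ext' vi]] := refined_ring.
have [W [j cl]] := exists_alg_closure L.
have [O1 vO1 ext1] := valuation_extends j vO'.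
(* The coarsening of O1 generated by OL. An arbitrary extension of OL to W need not contain O1. *)
pose O2 z := exists2 e, OL e & vle O1 z (j e).
have O12 z : O1 z -> O2 z by move=> h; exists 1; [exact: vr1|rewrite rmorph1; apply/vle1].
have vO2 : valuation_ring O2.
  split.
  - exact: O12 (vr1 vO1).
  - move=> a b [e Oe he] [e' Oe' he'].
    case: (vle_total vO1 (j e) (j e')) => h.
      by exists e' => //; apply: vleB => //; exact: vle_trans h.
    by exists e => //; apply: vleB => //; exact: vle_trans h.
  - by move=> a b [e Oe he] [e' Oe' he']; exists (e * e'); [exact: vrM|rewrite rmorphM; exact: vleM].
  - by move=> z /(vr_total vO1) [] h; [left|right]; apply: O12.
exists W, j, O1, O2; split=> //.
  split=> [a|z]; first by rewrite /= ext1 ext'.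
  split=> [[e Oe]|Oz]; last by exists z => //; exact: vle_refl.
  rewrite (vle_ext _ _ vO' vO1 ext1) => -[o /sub Oo ->]; exact: vrM.
case: vi => T0 vi; split=> [i|c c' m n]; first by rewrite fmorph_eq0.
have tE l : tmon (fun i => j (glue x y i)) l = j (tmon (glue x y) l).
  by rewrite rmorph_prod; apply: eq_bigr => i _; rewrite rmorphXn.
move=> [a ->] [a' ->]; rewrite !fmorph_eq0 => a0 a'0; rewrite !tE /= -!rmorphM.
rewrite /veq !(vle_ext _ _ vO' vO1 ext1); apply: vi; rewrite ?fmorph_eq0 //.
  by exists a.
by exists a'.
Qed.
End Residues.

(** * Transcendence degree *)

Lemma dependency (R : fieldType) (S : R -> Prop) (hS : is_subfield S) (I J : finType)
  (A : I -> J -> R) : (forall i j, S (A i j)) -> (#|J| < #|I|)%N ->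
  exists c : I -> R, [/\ forall i, S (c i), exists i, c i != 0 &
    forall j, \sum_i c i * A i j = 0].
Proof.
move=> hA ltJI; pose B : 'M[sft hS]_(#|I|, #|J|) :=
  \matrix_(i, j) sval (cid (sfv_ex hS (hA (enum_val i) (enum_val j)))).
have [i ki] : exists i, row i (kermx B) != 0.
  apply: contrapT => h; have : kermx B = 0.
    by apply/row_matrixP => i; rewrite row0; apply/eqP/negPn/negP => n0; apply: h; exists i.
  by move/eqP; rewrite kermx_eq0 /row_free => /eqP e; have := rank_leq_col B; rewrite e leqNgt ltJI.
exists (fun l => val (row i (kermx B) 0 (enum_rank l))); split=> [l||j]; first exact: sfvP.
  case/rV0Pn: ki => l hl; exists (enum_val l); rewrite enum_valK.
  by rewrite fmorph_eq0.
have /matrixP/(_ i (enum_rank j)) := mulmx_ker B; rewrite !mxE => /(congr1 val).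
rewrite rmorph0 sfv_sum => E; rewrite -[RHS]E (reindex _ (onW_bij _ (@enum_val_bij I))) /=.
apply: eq_bigr => l _; rewrite enum_valK !mxE; congr (_ * _).
by case: (cid _) => z /= ->; rewrite !enum_rankK.
Qed.

Lemma meval_monomials (R : fieldType) m (z : 'I_m -> R) (I : finType) (c : I -> R) (f : I -> 'X_{1..m}) :
  (\sum_i c i *: 'X_[f i]).@[z] = \sum_i c i * tmon z (f i).
Proof. by rewrite rmorph_sum; apply: eq_bigr => i _; rewrite /= mevalZ mevalX. Qed.

Lemma polynomial_growth (m s N C : nat) :
  (forall h, h.+1 ^ m <= N * (m * (h * C)).+1 ^ s)%N -> (m <= s)%N.
Proof.
(* The inequality is tested at h = c = N A^s: the right side is at most c (c+1)^s, whereas for m > s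
   the left side is at least (c+1)^(s+1). *)
move=> key; rewrite leqNgt; apply/negP => lt; set A := (m * C).+1.
set c := (N * A ^ s)%N; have := key c; apply/negP; rewrite -ltnNge.
apply: (@leq_ltn_trans (c * c.+1 ^ s)); last first.
  by apply: (@leq_trans (c.+1 ^ s.+1)); [rewrite expnS ltn_pmul2r // expn_gt0|rewrite leq_pexp2l].
rewrite {2}/c -mulnA leq_mul2l -expnMn; apply/orP; right.
have le : ((m * (c * C)).+1 <= A * c.+1)%N by rewrite /A; nia.
by clearbody c; clear -le; case: s => // s'; rewrite leq_exp2r.
Qed.

Definition grid_mon s D (nu : {ffun 'I_s -> 'I_D.+1}) : 'X_{1..s} := [multinom (nu i : nat) | i < s].

Lemma grid_mon_inj s D : injective (@grid_mon s D).
Proof.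
move=> n1 n2 /mnmP e; apply/ffunP => i; apply: val_inj.
by have := e i; rewrite !mnmE.
Qed.

Lemma meval_grid (R : fieldType) s D (T : 'I_s -> R) (p : {mpoly R[s]}) :
  (forall m, m \in msupp p -> forall i, (m i <= D)%N) ->
  p.@[T] = \sum_(nu : {ffun 'I_s -> 'I_D.+1}) p@_(grid_mon nu) * tmon T (grid_mon nu).
Proof.
move=> hp; rewrite -meval_monomials; congr meval; apply/mpolyP => m; rewrite raddf_sum /=.
under eq_bigr do rewrite mcoeffZ mcoeffX.
have [hm|hm] := boolP (m \in msupp p).
  have E : grid_mon [ffun k => inord (m k) : 'I_D.+1] = m.
    by apply/mnmP => k; rewrite mnmE ffunE inordK // ltnS; apply: hp.
  rewrite (bigD1 [ffun k => inord (m k)]) //= E eqxx mulr1 big1 ?addr0 // => nu nE.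
  by rewrite -{1}E (inj_eq (@grid_mon_inj _ _)) (negPf nE) mulr0.
rewrite (memN_msupp_eq0 hm) big1 // => nu _; case: eqP => [->|_]; last by rewrite mulr0.
by rewrite (memN_msupp_eq0 hm) mul0r.
Qed.

Section Steinitz.
Variables (R : fieldType) (S : R -> Prop) (hS : is_subfield S).

(* The (h+1)^m monomials in z of degree at most h in each variable have coordinates in
   a space of dimension O(h^s) over S. *)
Lemma steinitz m s (z : 'I_m -> R) (T : 'I_s -> R) : alg_indep S z ->
  (forall i, alg (ratT S T) (z i)) -> (m <= s)%N.
Proof.
move=> iz az; have hE := ratT_subfield T hS.
have [|M [phi [phi0 hphi]]] := @finite_subextension (sft hE) R val (codom z).
  by move=> _ /codomP[i ->]; apply/algE.
have [u hu] : exists u : 'I_m -> M, forall i, phi (u i) = z i.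
  have h i : exists y, phi y = z i by apply: hphi; exact: codom_f.
  by exists (fun i => sval (cid (h i))) => i; case: (cid _).
pose b := vbasis {: M}; have hb : basis_of {: M} b := vbasisP _.
have [delta [hd d0 hdel]] : exists b0 : R, [/\ polyT S T b0, b0 != 0 & forall p : 'I_m * 'I_(\dim {: M}) * 'I_(\dim {: M}),
    polyT S T (b0 * val (mulmat b (u p.1.1) p.1.2 p.2))].
  by apply: ratT_denom_fin => // p; exact: sfvP.
have [dl Edl] := sfv_ex hE (ratT_poly hS hd).
have dl0 : dl != 0 by apply: contraNneq d0 => e; rewrite -Edl e rmorph0.
have mxM (A B : 'M[sft hE]_(\dim {: M})) k l : (A *m B) k l = \sum_i A k i * B i l by rewrite mxE.
have mxZ a (A : 'M[sft hE]_(\dim {: M})) k l : (a *: A) k l = a * A k l by rewrite mxE.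
have mx1 k l : (1%:M : 'M[sft hE]_(\dim {: M})) k l = (k == l)%:R by rewrite mxE.
pose boxm D (w : M) := forall k l, box S T D (val (mulmat b w k l)).
have boxmM D D' w w' : boxm D w -> boxm D' w' -> boxm (D + D')%N (w * w').
  move=> hw hw' k l; rewrite (mulmatM hb) mxM sfv_sum; apply: box_sum => // i _.
  by rewrite sfvM; apply: boxM.
have boxm1 : boxm 0%N 1.
  move=> k l; rewrite (mulmat1 hb) mx1; case: (k == l).
    by rewrite rmorph1; apply: box_const => //; exact: sf1.
  by rewrite rmorph0; apply: box_const => //; exact: sf0.
have boxmX D w n : boxm D w -> boxm (n * D)%N (w ^+ n).
  by move=> hw; elim: n => [|n IH]; rewrite ?mul0n // exprS mulSn; apply: (boxmM).
have [C1 hC1] := @bound_fin _ (fun D p => box S T D (delta * val (mulmat b (u p.1.1) p.1.2 p.2)))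
  (fun p D D' => @box_mono _ _ _ _ D D' _) (fun p => polyT_box (hdel p)).
have [C2 hC2] := polyT_box hd; pose C := maxn C1 C2.
have hCu i : boxm C (dl *: u i).
  move=> k l; rewrite mulmatZ mxZ sfvM Edl; apply: box_mono (hC1 (i, k, l)); exact: leq_maxl.
have hC : boxm C (dl *: 1).
  move=> k l; rewrite mulmatZ (mulmat1 hb) mxZ sfvM Edl mx1; case: (k == l).
    by rewrite rmorph1 mulr1; apply: box_mono hC2; exact: leq_maxr.
  by rewrite rmorph0 mulr0; apply: box_const => //; exact: sf0.
have key h : (h.+1 ^ m <= (\dim {: M} * \dim {: M}) * ((m * (h * C)).+1 ^ s))%N.
  rewrite leqNgt; apply/negP => lt.
  pose I := {ffun 'I_m -> 'I_h.+1}; pose D := (m * (h * C))%N.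
  (* The padding with powers of dl 1 gives all monomials the same factor delta^(mh) and the same
     degree bound m h C, whatever the exponents mu are. *)
  pose w (mu : I) := \prod_i ((dl *: u i) ^+ mu i * (dl *: 1) ^+ (h - mu i)).
  have bw mu : boxm D (w mu).
    have -> : D = (\sum_(i < m) h * C)%N by rewrite sum_nat_const card_ord.
    rewrite /w.
    elim: (index_enum _) => [|i r IH]; first by rewrite !big_nil.
    rewrite !big_cons; apply: (boxmM) => //.
    have -> : (h * C = mu i * C + (h - mu i) * C)%N by rewrite -mulnDl subnKC // -ltnS.
    by apply: (boxmM); apply: (boxmX).
  pose P mu k l := sval (cid (bw mu k l)).
  have hP mu k l := svalP (cid (bw mu k l)).
  pose J := ('I_(\dim {: M}) * 'I_(\dim {: M}) * {ffun 'I_s -> 'I_D.+1})%type.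
  pose gm := @grid_mon s D.
  have [||c [Sc [mu0 cmu0] hc]] := @dependency R S hS I J (fun mu q => (P mu q.1.1 q.1.2)@_(gm q.2)).
  - by move=> mu q; have [] := hP mu q.1.1 q.1.2.
  - by rewrite !card_prod !card_ffun !card_ord.
  have [cs hcs] : exists cs : I -> sft hE, forall mu, val (cs mu) = c mu.
    have h' mu : exists y : sft hE, val y = c mu by apply: sfv_ex; apply: ratT_const.
    by exists (fun mu => sval (cid (h' mu))) => mu; case: (cid _).
  have E0 : \sum_mu cs mu *: w mu = 0.
    have E1 : mulmat b (\sum_mu cs mu *: w mu) = 0.
      rewrite mulmat_sum; apply/matrixP => k l; rewrite summxE mxE; apply: val_inj.
      rewrite sfv_sum rmorph0; transitivity (\sum_mu c mu * (P mu k l).@[T]).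
        apply: eq_bigr => mu _; rewrite mxZ sfvM hcs; congr (_ * _).
        by have [] := hP mu k l.
      have PE mu : (P mu k l).@[T] = \sum_nu (P mu k l)@_(gm nu) * tmon T (gm nu).
        by have [_ hb1 _] := hP mu k l; exact: meval_grid.
      under eq_bigr do rewrite PE mulr_sumr.
      rewrite exchange_big big1 // => nu _; under eq_bigr do rewrite mulrA.
      by rewrite -mulr_suml (hc (k, l, nu)) mul0r.
    have N0 : (0 < \dim {: M})%N by rewrite adim_gt0.
    have z0 i l : (0 : 'M[sft hE]_(\dim {: M})) i l = 0 by rewrite mxE.
    have /eqP : b`_(Ordinal N0) * (\sum_mu cs mu *: w mu) = 0.
      by rewrite (mulmatE hb) E1; apply: big1 => k _; rewrite z0 scale0r.
    rewrite mulf_eq0 => /orP[/eqP b0|/eqP //].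
    have : b`_(Ordinal N0) != 0 by apply: (free_not0 (basis_free hb)); rewrite mem_nth // size_tuple.
    by rewrite b0 eqxx.
  pose q : {mpoly R[m]} := \sum_(mu : I) c mu *: 'X_[grid_mon mu].
  have q0 : q != 0.
    apply: contraNneq cmu0 => e; have := congr1 (fun p : {mpoly R[m]} => p@_(grid_mon mu0)) e.
    rewrite mcoeff0 /q raddf_sum /= (bigD1 mu0) //= mcoeffZ mcoeffX eqxx mulr1 big1 ?addr0 => [->//|mu nmu].
    rewrite mcoeffZ mcoeffX; by rewrite (inj_eq (@grid_mon_inj _ _)) (negPf nmu) mulr0.
  have hq n : S q@_n.
    rewrite /q raddf_sum /=; apply: sf_sum => // mu _; rewrite mcoeffZ mcoeffX.
    by case: eqP => _; rewrite ?mulr1 ?mulr0 //; exact: sf0.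
  suff e : q.@[z] = 0 by have := iz q q0 hq; rewrite e eqxx.
  rewrite /q meval_monomials; apply: (mulfI (x := delta ^+ (m * h))); first exact: expf_neq0.
  rewrite mulr0 mulr_sumr -[RHS](rmorph0 phi) -E0 rmorph_sum; apply: eq_bigr => mu _.
  have -> : delta ^+ (m * h) = \prod_(i < m) (delta ^+ mu i * delta ^+ (h - mu i)).
    transitivity (\prod_(i < m) delta ^+ h); first by rewrite prodr_const card_ord -exprM mulnC.
    by apply: eq_bigr => i _; rewrite -exprD subnKC // -ltnS.
  have phiZ a y : phi (a *: y) = val a * phi y by rewrite -mulr_algl rmorphM phi0.
  rewrite /= phiZ hcs mulrCA; congr (_ * _).
  rewrite rmorph_prod -big_split; apply: eq_bigr => i _ /=.
  by rewrite rmorphM !rmorphXn !phiZ Edl hu rmorph1 mulr1 exprMn mnmE; ring.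
exact: polynomial_growth key.
Qed.
End Steinitz.

Section AlgebraicIndependence.
Variables (R : fieldType) (S : R -> Prop) (hS : is_subfield S).

Lemma alg_indep0 (z : 'I_0 -> R) : alg_indep S z.
Proof.
move=> p p0 _; apply: contraNneq p0 => e.
apply/eqP/mpolyP => m; rewrite mcoeff0 -e mevalE.
have m0 (a : 'X_{1..0}) : a = m by apply/mnmP => -[].
have [hm|hm] := boolP (m \in msupp p).
  rewrite (bigD1_seq m) //= [X in _ * X]big1 ?mulr1 => [|[]//].
  by rewrite big1 ?addr0 // => a; rewrite (m0 a) eqxx.
by rewrite (memN_msupp_eq0 hm) big1_seq // => a; rewrite (m0 a) (negPf hm) andbF.
Qed.

(** A relation between z and T is sorted by powers of z. Some coefficient is a nonzero polynomial in
    T, hence does not vanish at T, and the relation becomes an equation for z over S(T). *)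
Lemma alg_indep_adjoin n (T : 'I_n -> R) z : alg_indep S T -> ~ alg (ratT S T) z ->
  alg_indep S (glue (fun _ : 'I_1 => z) T).
Proof.
move=> iT nz p p0 hp; apply/negP => /eqP E; apply: nz.
pose d (m : 'X_{1..1 + n}) := lmon m 0.
pose C e : {mpoly R[n]} := \sum_(m <- msupp p | d m == e) p@_m *: 'X_[rmon m].
have hC e m : S (C e)@_m.
  rewrite /C raddf_sum /=; apply: sf_sum => // i _; rewrite mcoeffZ mcoeffX.
  by case: eqP => _; rewrite ?mulr1 ?mulr0 //; exact: sf0.
pose D := \max_(m <- msupp p) d m.
pose P : {poly R} := \poly_(e < D.+1) (C e).@[T].
have E' : P.[z] = p.@[glue (fun _ : 'I_1 => z) T].
  rewrite /P horner_poly mevalE [RHS]big_seq.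
  rewrite [RHS](partition_big (fun m => inord (d m) : 'I_D.+1) xpredT) //=; apply: eq_bigr => e _.
  rewrite rmorph_sum mulr_suml big_mkcond [RHS]big_mkcond [RHS]big_seq [LHS]big_seq; apply: eq_bigr => m hm.
  have le : (d m <= D)%N by rewrite /D; exact: (leq_bigmax_seq (F := d)).
  rewrite hm /= -val_eqE /= inordK ?ltnS //; case: eqP => // em.
  rewrite mevalZ mevalX -mulrA; congr (_ * _).
  have -> : \prod_i glue (fun _ : 'I_1 => z) T i ^+ m i = tmon (glue (fun _ : 'I_1 => z) T) m by [].
  by rewrite tmon_glue mulrC /tmon big_ord1 -em.
have [m0 m0p] : exists m, m \in msupp p.
  case: (msupp p) (msupp_eq0 p) => [|m s _]; first by rewrite eqxx (negPf p0).
  by exists m; rewrite mem_head.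
have C0 : C (d m0) != 0.
  apply/eqP => e; move: (m0p); rewrite mcoeff_msupp => /negP; apply.
  have := congr1 (fun q : {mpoly R[n]} => q@_(rmon m0)) e; rewrite mcoeff0 /C raddf_sum /= => sum0.
  rewrite -{}sum0 big_mkcond (bigD1_seq m0) //=.
  rewrite eqxx mcoeffZ mcoeffX eqxx mulr1 big1 ?addr0 // => m mm.
  case: eqP => // dm; rewrite mcoeffZ mcoeffX; case: eqP => [rm|_]; last by rewrite mulr0.
  by case/eqP: mm; apply: mon_inj => // i; rewrite [i]ord1.
exists P; split; [|move=> i|by apply/rootP; rewrite E' E].
  have := iT _ C0 (hC _); apply: contraNneq => /(congr1 (fun q : {poly R} => q`_(d m0))).
  by rewrite coef0 coef_poly ltnS /D (leq_bigmax_seq (F := d)) // => ->.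
rewrite coef_poly; case: ifP => _; last exact: sf0 (ratT_subfield T hS).
by apply: ratT_poly => //; exists (C i).
Qed.

Lemma trdeg_exists (F : R -> Prop) n : (forall m (z : 'I_m -> R), (forall i, F (z i)) ->
  alg_indep S z -> (m <= n)%N) -> exists m, trdeg_is S F m.
Proof.
move=> h; pose P m := `[< exists z : 'I_m -> R, (forall i, F (z i)) /\ alg_indep S z >].
have exP : exists m, P m.
  by exists 0%N; apply/asboolP; exists (fun=> 0); split=> [[]//|]; exact: alg_indep0.
have ubP m : P m -> (m <= n)%N by move=> /asboolP [z [hz iz]]; apply: h iz.
have [m /asboolP [z hz] max] := ex_maxnP exP ubP.
exists m; split; first by exists z.
move=> [z' hz']; have : P m.+1 by apply/asboolP; exists z'.
by move/max; rewrite ltnn.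
Qed.

Lemma trdeg_alg (F : R -> Prop) n (T : 'I_n -> R) z : trdeg_is S F n -> (forall i, F (T i)) ->
  alg_indep S T -> F z -> alg (ratT S T) z.
Proof.
move=> [_ h] FT iT Fz; apply: contrapT => nz; apply: h.
exists (glue (fun _ : 'I_1 => z) T); split; last exact: alg_indep_adjoin.
by move=> i; rewrite /glue; case: split.
Qed.
End AlgebraicIndependence.

(** * Lattices of values *)

Section Lattice.
Variables (G : zmodType) (B Gam : G -> Prop).
Hypothesis B0 : B 0.
Hypothesis BB : forall a b, B a -> B b -> B (a - b).
Hypothesis GB : forall a b, Gam a -> Gam b -> Gam (a - b).
Variables (N : nat) (r : nat) (g0 : 'I_r -> G).
Hypothesis N0 : (0 < N)%N.
Hypothesis Gg0 : forall i, Gam (g0 i).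
Hypothesis pure : forall g, Gam g -> B (g *+ N) -> B g.
Hypothesis ind : forall c : 'I_r -> int, B (\sum_i g0 i *~ c i) -> forall i, c i = 0.
Hypothesis span : forall g, Gam g -> exists a : 'I_r -> int, B (g *+ N - \sum_i g0 i *~ a i).

Let BN a : B a -> B (- a). Proof. by move=> Ba; rewrite -sub0r; apply: BB. Qed.
Let BD a b : B a -> B b -> B (a + b). Proof. by move=> Ba Bb; rewrite -[b]opprK; apply/BB/BN. Qed.
Let BMn a n : B a -> B (a *+ n).
Proof. by move=> Ba; elim: n => [|n IH]; rewrite ?mulr0n // mulrS; apply: BD. Qed.
Let BMz a z : B a -> B (a *~ z).
Proof. by move=> Ba; case: z => n; [exact: BMn|exact/BN/BMn]. Qed.
Let GMz a z : Gam a -> Gam (a *~ z).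
Proof.
move=> Ga; have h0 : Gam 0 by rewrite -(subrr a); apply: GB.
have hN b : Gam b -> Gam (- b) by move=> Gb; rewrite -sub0r; apply: GB.
have hM n : Gam (a *+ n).
  by elim: n => [|n IH]; rewrite ?mulr0n // mulrSr -[X in _ + X]opprK; apply/GB/hN.
by case: z => n; [exact: hM|exact/hN/hM].
Qed.

(** The numbers a_i / N are the rational coordinates of g with respect to g0 modulo B. The common
    denominator N turns Gam into a lattice of integer vectors. *)
Definition assoc_vec g (a : 'I_r -> int) := Gam g /\ B (g *+ N - \sum_i g0 i *~ a i).

Lemma assoc_vecB g h a b z : assoc_vec g a -> assoc_vec h b ->
  assoc_vec (g - h *~ z) (fun i => a i - b i * z).
Proof.
move=> [Gg Bg] [Gh Bh]; split; first by apply/GB/GMz.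
have -> : (g - h *~ z) *+ N - \sum_i g0 i *~ (a i - b i * z) =
    (g *+ N - \sum_i g0 i *~ a i) - (h *+ N - \sum_i g0 i *~ b i) *~ z.
  have Eh : (h *~ z) *+ N = (h *+ N) *~ z by rewrite !pmulrn -!mulrzA mulrC.
  rewrite mulrnBl mulrzBl mulrz_suml Eh; under eq_bigr do rewrite mulrzBr mulrzA.
  by rewrite sumrB !opprB addrACA [RHS]addrACA; congr (_ + _); rewrite addrC.
exact/BB/BMz.
Qed.

(* The vectors [w i] form a triangular basis of the lattice of associated vectors, with
   minimal positive diagonal. *)
Lemma lattice_basis : exists tau : 'I_r -> G, [/\ forall i, Gam (tau i),
  forall c : 'I_r -> int, B (\sum_i tau i *~ c i) -> forall i, c i = 0 &
  forall g, Gam g -> exists c : 'I_r -> int, B (g - \sum_i tau i *~ c i)].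
Proof.
(* The positive integers that occur as first possibly nonzero entry, at position i, of an associated
   vector. N itself occurs, through g0_i. *)
pose P (i : 'I_r) (k : nat) := `[< (0 < k)%N /\ exists g a, [/\ assoc_vec g a,
  forall j : 'I_r, (j < i)%N -> a j = 0 & a i = k%:Z] >].
have exP i : exists k, P i k.
  exists N; apply/asboolP; split=> //; exists (g0 i), (fun j => if j == i then N%:Z else 0).
  split; [|by move=> j ji; case: eqP ji => // ->; rewrite ltnn|by rewrite eqxx].
  split=> //; rewrite (bigD1 i) //= eqxx -pmulrn big1 ?addr0 ?subrr // => j /negPf ->.
  by rewrite mulr0z.
have /choice[f hf] : forall i : 'I_r, exists t : nat * (G * ('I_r -> int)),
    [/\ (0 < t.1)%N, assoc_vec t.2.1 t.2.2, forall j : 'I_r, (j < i)%N -> t.2.2 j = 0, t.2.2 i = t.1%:Z &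
      forall k, P i k -> (t.1 <= k)%N].
  move=> i; case: (ex_minnP (exP i)) => k /asboolP[k0 [g [a [h1 h2 h3]]]] min.
  by exists (k, (g, a)).
pose tau i := (f i).2.1; pose w i := (f i).2.2.
have w0 (i j : 'I_r) : (j < i)%N -> w i j = 0 by case: (hf i) => _ _ + _ _; apply.
have wi i : w i i = (f i).1%:Z by case: (hf i).
have f0 i : (0 < (f i).1)%N by case: (hf i).
have tw i : assoc_vec (tau i) (w i) by case: (hf i).
exists tau; split=> [i|c Bc|g Gg]; first by case: (tw i).
- pose d j := \sum_i w i j * c i.
  have Bd : B (\sum_j g0 j *~ d j).
    have -> : \sum_j g0 j *~ d j = (\sum_i tau i *~ c i) *+ N -
        \sum_i (tau i *+ N - \sum_j g0 j *~ w i j) *~ c i.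
      rewrite -sumrMnl -sumrB (eq_bigr (fun j => \sum_i g0 j *~ (w i j * c i))); last first.
        by move=> j _; rewrite /d mulrz_sumr.
      rewrite exchange_big; apply: eq_bigr => i _ /=; rewrite mulrzBl opprB.
      have Et : (tau i *~ c i) *+ N = (tau i *+ N) *~ c i by rewrite !pmulrn -!mulrzA mulrC.
      rewrite Et addrCA subrr addr0 mulrz_suml.
      by apply: eq_bigr => j _; rewrite mulrzA.
    apply: BB; first exact: BMn.
    by apply: (big_ind B) => // i _; apply: BMz; case: (tw i).
  have d0 := ind Bd; move=> i; have [n] := ubnP (i : nat); elim: n i => // n IH i; rewrite ltnS => ilen.
  have := d0 i; rewrite /d (bigD1 i) //= big1 ?addr0 => [/eqP|j ji]; last first.
    case: (ltngtP j i) => [lt|lt|/val_inj e]; last by rewrite e eqxx in ji.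
      by rewrite (IH j) ?mulr0 //; apply: leq_trans lt ilen.
    by rewrite w0 // mul0r.
  rewrite mulf_eq0 wi => /orP[/eqP e|/eqP //].
  by have := f0 i; move: e => [->].
have [a Ba] := span Gg; have Aa : assoc_vec g a by [].
have ha0 (j : 'I_r) : (j < r - r)%N -> a j = 0 by rewrite subnn.
suff H : forall d g a, (d <= r)%N -> assoc_vec g a -> (forall j : 'I_r, (j < r - d)%N -> a j = 0) ->
   exists c : 'I_r -> int, B (g - \sum_i tau i *~ c i) by exact: H (leqnn r) Aa ha0.
move=> {g a Aa Ba ha0 Gg}; elim=> [|d IH] g a dr Aa ha.
  exists (fun=> 0); rewrite big1 ?subr0; last by move=> i _; rewrite mulr0z.
  case: Aa => Gg Bg; apply: (pure Gg); move: Bg; rewrite big1 ?subr0 // => i _.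
  by rewrite ha ?mulr0z // subn0.
have ir : (r - d.+1 < r)%N by lia.
(* Division with remainder by the minimal diagonal entry: the remainder occurs at position i as
   well, hence is zero. *)
pose i := Ordinal ir; pose q := (a i %/ w i i)%Z.
have wi0 : w i i != 0 by rewrite wi; have := f0 i; case: ((f i).1).
have [|c hc] := IH _ _ (ltnW dr) (assoc_vecB q Aa (tw i)).
  move=> j; have [lt|le] := ltnP j (r - d.+1)%N; first by rewrite ha // w0 // mul0r subrr.
  move=> jd; have -> : j = i by apply: val_inj => /=; lia.
  set y := a i - _; have Ey : y = (a i %% w i i)%Z.
    by rewrite /y {1}(divz_eq (a i) (w i i)) mulrC addrAC subrr add0r.
  have y0 : (0 <= y)%R by rewrite Ey modz_ge0.
  have [k Ek] : exists k : nat, y = k%:Z by exists `|y|%N; rewrite gez0_abs.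
  have lt : (k < (f i).1)%N.
    have : ((a i %% w i i)%Z < w i i)%R by rewrite ltz_pmod // wi ltz_nat f0.
    by rewrite -Ey Ek wi ltz_nat.
  case: (posnP k) => [k0|k0]; first by rewrite Ek k0.
  have : P i k.
    apply/asboolP; split=> //; exists (g - tau i *~ q), (fun l => a l - w i l * q).
    split; [exact: (assoc_vecB q Aa (tw i))| |by rewrite -Ek].
    by move=> l li; rewrite ha // w0 // mul0r subrr.
  by case: (hf i) => _ _ _ _ /[apply]; rewrite leqNgt lt.
exists (fun j => c j + (if j == i then q else 0)).
have -> : \sum_j tau j *~ (c j + (if j == i then q else 0)) = \sum_j tau j *~ c j + tau i *~ q.
  under eq_bigr do rewrite mulrzDr; rewrite big_split /=; congr (_ + _).
  by rewrite (bigD1 i) //= eqxx big1 ?addr0 // => j /negPf ->; rewrite mulr0z.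
by rewrite opprD addrA addrAC.
Qed.
End Lattice.

(** * The value group of a finitely generated extension *)

Section Values.
Variables (K L : fieldType) (iota : {rmorphism K -> L}) (OK : K -> Prop) (OL : L -> Prop)
  (G : zmodType) (le : G -> G -> Prop) (v : L -> G).
Hypothesis vK : valuation_ring OK.
Hypothesis vL : valuation_ring OL.
Hypothesis ext : extends iota OK OL.
Hypothesis hv : value_group_map OL le v.
Local Notation B := (vK_img iota v).

Lemma valM x y : x != 0 -> y != 0 -> v (x * y) = v x + v y.
Proof. by case: hv => h _ _ _; apply: h. Qed.
Lemma val1 : v 1 = 0.
Proof. by apply: (addrI (v 1)); rewrite addr0 -valM ?oner_neq0 // mulr1. Qed.
Lemma valV x : x != 0 -> v x^-1 = - v x.
Proof. by move=> x0; apply/eqP; rewrite -addr_eq0 -valM ?invr_eq0 // mulVf // val1. Qed.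
Lemma val_div x y : x != 0 -> y != 0 -> v (x / y) = v x - v y.
Proof. by move=> x0 y0; rewrite valM ?invr_eq0 // valV. Qed.
Lemma valX x n : x != 0 -> v (x ^+ n) = v x *+ n.
Proof. by move=> x0; elim: n => [|n IH]; rewrite ?val1 // exprS valM ?expf_neq0 // IH mulrS. Qed.
Lemma valXz x z : x != 0 -> v (x ^ z) = v x *~ z.
Proof. by move=> x0; case: z => n; rewrite /= ?valX // valV ?expf_neq0 // valX. Qed.
Lemma val_prod (I : Type) (r : seq I) (P : pred I) (F : I -> L) : (forall i, P i -> F i != 0) ->
  v (\prod_(i <- r | P i) F i) = \sum_(i <- r | P i) v (F i).
Proof.
move=> h; elim: r => [|i r IH]; first by rewrite !big_nil val1.
rewrite !big_cons; case: ifP => // Pi; rewrite valM ?IH //; first exact: h.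
elim: (r) => [|l s IHs]; rewrite ?big_nil ?oner_neq0 // big_cons; case: ifP => // Pl.
by rewrite mulf_neq0 // h.
Qed.
Lemma val_eq x y : x != 0 -> y != 0 -> v x = v y <-> veq OL x y.
Proof.
move=> x0 y0; have xy : x / y != 0 by rewrite mulf_neq0 ?invr_eq0.
have -> : v x = v y <-> v (x / y) = 0.
  by rewrite val_div //; split=> [->|/eqP]; rewrite ?subrr // subr_eq0 => /eqP.
case: hv => _ _ h _; rewrite (h _ xy) vunitP //.
by rewrite -(veqM2rE vL _ _ y0) mul1r divfK.
Qed.
Lemma val_tmon r (x : 'I_r -> L) m : (forall i, x i != 0) -> v (tmon x m) = \sum_i v (x i) *+ m i.
Proof. by move=> x0; rewrite val_prod => [|i _]; [apply: eq_bigr => i _; rewrite valX|exact: expf_neq0]. Qed.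

Lemma vK_img0 : B 0.
Proof. by exists 1; rewrite oner_neq0 rmorph1 val1. Qed.
Lemma vK_imgB a b : B a -> B b -> B (a - b).
Proof.
move=> [x [x0 <-]] [y [y0 <-]]; exists (x / y); rewrite mulf_neq0 ?invr_eq0 //.
by rewrite fmorph_div val_div ?fmorph_eq0.
Qed.
Lemma vF_imgB (F : L -> Prop) : is_subfield F -> forall a b, vF_img v F a -> vF_img v F b -> vF_img v F (a - b).
Proof.
move=> hF a b [x [Fx x0 <-]] [y [Fy y0 <-]]; exists (x / y).
by rewrite mulf_neq0 ?invr_eq0 // val_div //; split=> //; apply: sf_div.
Qed.

(** The equation N X = N g has the solution g in vL, hence by existential closedness a solution in
    vK, and value groups are torsion-free. So vL/vK has no torsion. *)
Lemma value_pure (N : nat) g : ec_ordered_group le B -> (0 < N)%N -> B (g *+ N) -> B g.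
Proof.
move=> ec N0 Bg; pose t := iter N (fun t => GAdd (GVar G 0) t) (GZero G).
have tE e : geval e t = e 0%N *+ N.
  by rewrite /t; elim: N {N0 Bg t} => [|n IH]; rewrite ?mulr0n // mulrS /= IH.
have tc : gconsts B t by rewrite /t; elim: N {N0 Bg t tE}.
have [||e [Be]] := ec (QAtom (OEq t (GConst (g *+ N)))); first by split.
  by exists (fun=> g); rewrite /= tE.
rewrite /= tE => E; have [a [a0 ha]] := Be 0%N; move: E; rewrite -ha.
case: hv => _ /(_ g)[x [x0 xg]] _ _; rewrite -xg -!valX ?fmorph_eq0 // => E.
exists a; split=> //; apply/val_eq; rewrite ?fmorph_eq0 //.
by apply/(veqXE vL _ _ N0)/val_eq; rewrite ?expf_neq0 ?fmorph_eq0.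
Qed.

Lemma val_indep r (x : 'I_r -> L) : (forall i, x i != 0) ->
  (forall c : 'I_r -> int, B (\sum_i v (x i) *~ c i) -> forall i, c i = 0) ->
  forall (c : K) (m n : 'I_r -> nat), c != 0 -> veq OL (iota c * tmon x m) (tmon x n) -> m =1 n.
Proof.
move=> x0 ind c m n c0 /val_eq; rewrite ?mulf_neq0 ?fmorph_eq0 ?tmon_neq0 // => /(_ isT isT).
rewrite valM ?fmorph_eq0 ?tmon_neq0 // !val_tmon // => E i.
suff /ind/(_ i)/eqP : B (\sum_i v (x i) *~ ((n i)%:Z - (m i)%:Z)).
  by rewrite subr_eq0 => /eqP[].
exists c; split=> //; under eq_bigr do rewrite mulrzBr.
by rewrite sumrB; apply/eqP; rewrite -subr_eq0 opprB addrA subr_eq0 addrC; apply/eqP; rewrite -E addrC.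
Qed.

Section Basis.
Variables (r s : nat) (x0 : 'I_r -> L) (y0 : 'I_s -> L) (N e : nat) (z : 'I_e -> L).
Local Notation F := (ratT (imK' iota) z).
Local Notation E0 := (ratT (imK' iota) (glue x0 y0)).
Hypothesis G0 : gauss OK OL iota x0 y0.
Hypothesis pure : forall N g, (0 < N)%N -> B (g *+ N) -> B g.
Hypothesis ind : forall c : 'I_r -> int, B (\sum_i v (x0 i) *~ c i) -> forall i, c i = 0.
Hypothesis Fx : forall i, F (x0 i).
Hypothesis Fz : forall i, alg E0 (z i).

Let hK := imK_subfield iota.
Let hE := ratT_subfield (glue x0 y0) hK.

Lemma E0_value a : E0 a -> a != 0 -> exists c : 'I_r -> int, B (v a - \sum_i v (x0 i) *~ c i).
Proof.
move=> /ratT_mmap[p [q [q0 ->]]]; rewrite mulf_eq0 negb_or => /andP[p0 _].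
have nz (f : {mpoly K[r + s]}) : mmap iota (glue x0 y0) f != 0 ->
   exists c m, c != 0 /\ v (mmap iota (glue x0 y0) f) = v (iota c) + \sum_i v (x0 i) *+ m i.
  move=> f0; have f0' : f != 0 by apply: contraNneq f0 => ->; rewrite rmorph0.
  have [c [m [c0 h _]]] := gauss_norm vK G0 (transfer_refl G0) f0'.
  have x00 := gs_x0 G0.
  exists c, m; split=> //; rewrite -val_tmon // -valM ?fmorph_eq0 ?tmon_neq0 //.
  by apply/val_eq => //; rewrite mulf_neq0 ?fmorph_eq0 ?tmon_neq0.
have [c [m [c0 hc]]] := nz _ p0; have [d [n [d0 hd]]] := nz _ q0.
exists (fun i => (m i)%:Z - (n i)%:Z); exists (c / d); rewrite mulf_neq0 ?invr_eq0 //; split=> //.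
under eq_bigr do rewrite mulrzBr.
rewrite sumrB fmorph_div !val_div ?fmorph_eq0 // hc hd; set u := v _; set w := v _; set X := \sum_i _; set Y := \sum_i _.
by rewrite [in RHS]opprD addrACA addrK.
Qed.

(** Minimal polynomials over E0 have degree at most [F : E0], which bounds the exponent in
    [root_norm_power]. The factorial of this bound then serves as common denominator of the values
    of F. *)
Lemma uniform_power : exists2 N, (0 < N)%N & forall u, F u -> u != 0 ->
  exists j a, [/\ (0 < j <= N)%N, E0 a & veq OL (u ^+ j) a].
Proof.
have [|M [phi [phi0 hphi]]] := @finite_subextension (sft hE) L val (codom z).
  by move=> _ /codomP[i ->]; apply/algE.
exists (\dim {: M}); first exact: adim_gt0.
have im u : F u -> exists w, phi w = u.
  apply: (ratT_min (P := fun u => exists w, phi w = u)) => [|_ [a ->]|i].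
  - split=> [|_ _ [a <-] [b <-]|_ _ [a <-] [b <-]|_ [a <-]]; first by exists 1; rewrite rmorph1.
    + by exists (a - b); rewrite rmorphB.
    + by exists (a * b); rewrite rmorphM.
    + by exists a^-1; rewrite fmorphV.
  - have [w <-] := sfv_ex hE (ratT_const (glue x0 y0) hK (ex_intro _ a erefl)).
    by exists w%:A; rewrite phi0.
  - by apply: hphi; exact: codom_f.
move=> u /im [w <-] u0; have [q Eq] := polyOver1P (minPolyOver 1%AS w).
have q0 : q != 0.
  by apply: contraTneq (monic_minPoly 1%AS w) => q0; rewrite Eq q0 rmorph0 monicE lead_coef0 eq_sym oner_eq0.
have [|i||j [a [/andP[j0 jq] Ea h]]] := @root_norm_power L OL E0 (map_poly val q) (phi w) vL hE.
- by rewrite map_poly_eq0.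
- by rewrite coef_map; exact: sfvP.
- have := root_minPoly 1%AS w; rewrite Eq -(fmorph_root phi) -map_poly_comp.
  by congr (root _ _); apply: eq_map_poly => a /=; rewrite phi0.
exists j, a; split=> //; rewrite j0 -ltnS; apply: leq_trans jq _.
rewrite size_map_poly -(size_map_poly (in_alg M)) -Eq size_minPoly ltnS.
by rewrite adjoin_degreeE dimv1 divn1; apply: dimvS; exact: subvf.
Qed.

(** A multiple of vF lies in the group generated by vK and the values of x0. As vF/vK is
    torsion-free it is a lattice of rank r, and elements whose values form a basis replace x0;
    thereafter the values of F are those of K(x). *)
Theorem value_basis : exists x : 'I_r -> L, [/\ forall i, F (x i), forall i, x i != 0,
  forall (c : K) (m n : 'I_r -> nat), c != 0 -> veq OL (iota c * tmon x m) (tmon x n) -> m =1 n &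
  forall u, F u -> u != 0 -> exists (c : K) (a : 'I_r -> int),
    c != 0 /\ veq OL u (iota c * \prod_i x i ^ a i)].
Proof.
have hF : is_subfield F := ratT_subfield z hK.
have [D D0 hD] := uniform_power.
have x00 := gs_x0 G0.
have h1 i : vF_img v F (v (x0 i)) by exists (x0 i).
have h2 g : vF_img v F g -> B (g *+ D`!) -> B g by move=> _; apply: pure; exact: fact_gt0.
have [|tau [Gtau itau stau]] := @lattice_basis G B (vF_img v F) vK_img0 vK_imgB (vF_imgB hF) D`! r
    (fun i => v (x0 i)) (fact_gt0 D) h1 h2 ind.
  move=> _ [u [Fu u0 <-]]; have [j [a [/andP[j0 jD] Ea ha]]] := hD u Fu u0.
  have a0 : a != 0 by apply: veq_neq0 ha _; exact: expf_neq0.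
  have [c hc] := E0_value Ea a0; have jdiv : (j %| D`!)%N by rewrite dvdn_fact // j0.
  exists (fun i => c i * (D`! %/ j)%N%:Z).
  have -> : v u *+ D`! - \sum_i v (x0 i) *~ (c i * (D`! %/ j)%N%:Z) =
      (v a - \sum_i v (x0 i) *~ c i) *+ (D`! %/ j).
    rewrite mulrnBl -sumrMnl; congr (_ - _); last by apply: eq_bigr => i _; rewrite mulrzA pmulrn.
    have -> : v a = v u *+ j by rewrite -valX //; symmetry; apply/val_eq; rewrite ?expf_neq0.
    by rewrite -mulrnA mulnC divnK.
  elim: (D`! %/ j)%N => [|n IH]; first exact: vK_img0.
  rewrite mulrSr -[X in _ + X]opprK; apply: vK_imgB => //; rewrite -sub0r; apply: vK_imgB => //; exact: vK_img0.
have /choice[x hx] : forall i, exists x, [/\ F x, x != 0 & v x = tau i] by move=> i; exact: Gtau.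
have xn0 i : x i != 0 by case: (hx i).
have vx i : v (x i) = tau i by case: (hx i).
exists x; split=> // [i||u Fu u0]; first by case: (hx i).
  by apply: val_indep => // c; under eq_bigr do rewrite vx; exact: itau.
have [c [a [a0 ha]]] := stau (v u) (ex_intro _ u (And3 Fu u0 erefl)).
have p0 : \prod_i x i ^ c i != 0 by apply/prodf_neq0 => i _; rewrite expfz_neq0.
exists a, c; split=> //; apply/val_eq; rewrite ?mulf_neq0 ?fmorph_eq0 //.
rewrite valM ?fmorph_eq0 // ha val_prod => [|i _]; last by rewrite expfz_neq0.
have -> : \sum_i v (x i ^ c i) = \sum_i tau i *~ c i by apply: eq_bigr => i _; rewrite valXz // vx.
by rewrite subrK.
Qed.
End Basis.
End Values.

(** * Separability over an existentially closed subfield *)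

Section Terms.
Variables (k : fieldType) (S : k -> Prop).

Definition rpow (t : rterm k) n := iter n (RMul t) (ROne k).
Definition rprod n (t : 'I_n -> rterm k) := foldr (fun i u => RMul (t i) u) (ROne k) (enum 'I_n).
Definition mpoly_term n (p : {mpoly k[n]}) :=
  foldr (fun m u => RAdd (RMul (RConst p@_m) (rprod (fun i => rpow (RVar k i) (m i)))) u)
    (RZero k) (msupp p).

Lemma reval_mpoly_term n (p : {mpoly k[n]}) e : reval e (mpoly_term p) = p.@[fun i => e i].
Proof.
have powE t m : reval e (rpow t m) = reval e t ^+ m.
  by elim: m => // m IH; rewrite /= IH exprS.
have prodE t : reval e (@rprod n t) = \prod_i reval e (t i).
  by rewrite -[RHS]big_enum /rprod; elim: (enum _) => [|i s IH]; rewrite ?big_nil // big_cons /= IH.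
rewrite mevalE /mpoly_term; elim: (msupp p) => [|m s IH]; rewrite ?big_nil // big_cons /= IH.
by congr (_ * _ + _); rewrite prodE; apply: eq_bigr => i _; rewrite powE.
Qed.

Lemma rconsts_mpoly_term n (p : {mpoly k[n]}) : (forall m, S p@_m) -> rconsts S (mpoly_term p).
Proof.
move=> hp; rewrite /mpoly_term; elim: (msupp p) => //= m s IH; do 2 split=> //.
by rewrite /rprod; elim: (enum _) => //= i l IHl; split=> //; elim: (m i).
Qed.

Hypothesis ec : ec_field S.

Lemma ec_mpoly n (P Q : seq {mpoly k[n]}) (z : 'I_n -> k) :
  (forall p, p \in P ++ Q -> forall m, S p@_m) ->
  (forall p, p \in P -> p.@[z] = 0) -> (forall q, q \in Q -> q.@[z] != 0) ->
  exists x : 'I_n -> k, [/\ forall i, S (x i), forall p, p \in P -> p.@[x] = 0 &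
    forall q, q \in Q -> q.@[x] != 0].
Proof.
move=> hS hP hQ; pose A (p : {mpoly k[n]}) := QAtom (FEq (mpoly_term p) (RZero k)).
pose f := foldr (fun p f => QAnd (A p) f) (foldr (fun q f => QAnd (QNot (A q)) f) (QTrue _) Q) P.
pose sat (e : nat -> k) (a : field_atom k) := let: FEq t1 t2 := a in reval e t1 = reval e t2.
have fE e : qf_holds (sat e) f <-> (forall p, p \in P -> p.@[fun i : 'I_n => e i] = 0) /\
    (forall q, q \in Q -> q.@[fun i : 'I_n => e i] != 0).
  rewrite /f; elim: P {hS hP f} => [|p P IH] /=; last first.
    rewrite IH reval_mpoly_term; split=> [[h1 [h2 h3]]|[h1 h2]].
      by split=> // p'; rewrite inE => /orP[/eqP ->|/h2].
    by split; [apply: h1; rewrite mem_head|split=> // p' hp'; apply: h1; rewrite inE hp' orbT].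
  split=> [h|[_]]; [split=> //; move: h|]; elim: Q {hQ} => //= q Q IH; rewrite reval_mpoly_term.
    by move=> [h1 h2] q'; rewrite inE => /orP[/eqP ->|/IH]; [apply/eqP|apply].
  move=> h; split; first by apply/eqP; apply: h; rewrite mem_head.
  by apply: IH => q' hq'; apply: h; rewrite inE hq' orbT.
have fS : qf_all (fun a : field_atom k => let: FEq t1 t2 := a in rconsts S t1 /\ rconsts S t2) f.
  rewrite /f; elim: P hS {f fE hP} => [|p P IH] /= hS; last first.
    split; first by split=> //; apply: rconsts_mpoly_term; apply: hS; rewrite mem_head.
    by apply: IH => p' hp'; apply: hS; rewrite inE hp' orbT.
  elim: Q hS {hQ} => //= q Q IH hS; split; last by apply: IH => p' hp'; apply: hS; rewrite inE hp' orbT.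
  by split=> //; apply: rconsts_mpoly_term; apply: hS; rewrite mem_head.
pose e0 i := if insub i is Some j then z j else 0.
have e0E : (fun i : 'I_n => e0 i) = z by apply/funext => i; rewrite /e0 valK.
have [|e [Se /fE h]] := ec fS; first by exists e0; apply/fE; rewrite e0E.
by exists (fun i => e i); case: h.
Qed.

Variable q : nat.
Hypothesis hq : q \in [pchar k].
Hypothesis hS : is_subfield S.

(** MacLane's criterion for the separability of k over S. Existential closedness gives a solution x
    in S of the same relation with nonzero first coordinate; subtracting multiples of z_0 removes
    one term, and the induction continues. *)
Lemma frobenius_dependent n (c z : 'I_n -> k) : (forall i, S (c i)) -> (exists i, c i != 0) ->
  \sum_i c i * z i ^+ q = 0 -> exists d : 'I_n -> k,
  [/\ forall i, S (d i), exists i, d i != 0 & \sum_i d i * z i = 0].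
Proof.
have q0 : (0 < q)%N by rewrite prime_gt0 // (pcharf_prime hq).
have powB x y : (x - y) ^+ q = x ^+ q - y ^+ q :> k.
  by have := pFrobenius_autB_comm hq (mulrC x y); rewrite !pFrobenius_autE.
elim: n c z => [|n IH] c z Sc [i0 ci0]; first by case: i0 {ci0}.
move=> E; have [z0|z0] := eqVneq (z ord0) 0.
  exists (fun i => (i == ord0)%:R); split; first by move=> i; case: eqP => _; [exact: sf1|exact: sf0].
    by exists ord0; rewrite eqxx oner_neq0.
  by apply: big1 => i _; case: eqP => [->|_]; rewrite ?z0 ?mulr0 ?mul0r.
pose p : {mpoly k[n.+1]} := \sum_i c i *: 'X_i ^+ q.
have pE x : p.@[x] = \sum_i c i * x i ^+ q.
  by rewrite rmorph_sum; apply: eq_bigr => i _; rewrite /= mevalZ rmorphXn /= mevalXU.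
have [|p'|p'|x [Sx xp xq]] := @ec_mpoly _ [:: p] [:: 'X_ord0] z.
- move=> p'; rewrite !inE => /orP[/eqP ->|/eqP ->] m.
    rewrite /p raddf_sum /=; apply: sf_sum => // i _; rewrite mpolyXn mcoeffZ mcoeffX.
    by case: eqP => _; rewrite ?mulr1 ?mulr0 //; exact: sf0.
  by rewrite mcoeffX; case: eqP => _; [exact: sf1|exact: sf0].
- by rewrite inE => /eqP ->; rewrite pE.
- by rewrite inE => /eqP ->; rewrite mevalXU.
have {xq} x0 : x ord0 != 0 by have := xq 'X_ord0; rewrite inE eqxx mevalXU; apply.
have {xp} := xp p; rewrite inE eqxx pE => /(_ isT) Ex.
(* The relation satisfied by x expresses c_0 through the other coefficients and the b_i^q, so the
   relation for z becomes one for the elements z_i - b_i z_0. *)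
pose b i := x (lift ord0 i) / x ord0.
have cb : c ord0 = - \sum_(i < n) c (lift ord0 i) * b i ^+ q.
  move: Ex; rewrite big_ord_recl => /eqP; rewrite addr_eq0 => /eqP Ex.
  apply: (mulIf (x := x ord0 ^+ q)); first exact: expf_neq0.
  rewrite Ex mulNr mulr_suml; congr (- _); apply: eq_bigr => i _.
  by rewrite -mulrA -exprMn /b divfK.
have [|||d [Sd [i1 di1] Ed]] := IH (fun i => c (lift ord0 i)) (fun i => z (lift ord0 i) - b i * z ord0).
- by [].
- apply: contrapT => h; have c0 i : c (lift ord0 i) = 0.
    by apply/eqP/negPn/negP => ?; apply: h; exists i.
  move: ci0; have [j ->|->] := unliftP ord0 i0; first by rewrite c0 eqxx.
  by rewrite cb big1 ?oppr0 ?eqxx // => i _; rewrite c0 mul0r.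
- transitivity (\sum_(i < n) c (lift ord0 i) * z (lift ord0 i) ^+ q -
      (\sum_(i < n) c (lift ord0 i) * b i ^+ q) * z ord0 ^+ q).
    rewrite mulr_suml -sumrB; apply: eq_bigr => i _.
    by rewrite powB exprMn mulrBr mulrA.
  by move: E; rewrite big_ord_recl cb mulNr addrC.
exists (fun i => if unlift ord0 i is Some j then d j else - \sum_j d j * b j); split.
- move=> i; case: unliftP => [j _|_]; first exact: Sd.
  by apply: (sfN hS); apply: sf_sum => // j _; apply: sfM => //; apply: sf_div.
- by exists (lift ord0 i1); rewrite liftK.
rewrite big_ord_recl unlift_none mulNr mulr_suml -sumrN -[RHS]Ed -big_split.
by apply: eq_bigr => i _; rewrite liftK /=; ring.
Qed.
End Terms.

(** No irreducibility is asked: a simple root of p is also a simple root of its minimal polynomial,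
    which divides p. *)
Definition sepalg (R : fieldType) (S : R -> Prop) (x : R) : Prop :=
  exists p : {poly R}, [/\ forall i, S p`_i, root p x & ~~ root p^`() x].

Lemma sepalg_mono (R : fieldType) (S S' : R -> Prop) x : (forall z, S z -> S' z) -> sepalg S x -> sepalg S' x.
Proof. by move=> h [p [hp p0 p1]]; exists p; split=> // i; apply: h. Qed.

Lemma sepalg_alg (R : fieldType) (S : R -> Prop) x : sepalg S x -> alg S x.
Proof.
move=> [p [hp p0 p1]]; exists p; split=> //.
by apply: contraNneq p1 => ->; rewrite deriv0 root0.
Qed.

Lemma sepalg_base (R : fieldType) (S : R -> Prop) x : is_subfield S -> S x -> sepalg S x.
Proof.
move=> hS Sx; exists ('X - x%:P); rewrite root_XsubC derivXsubC rootC oner_eq0; split=> // i.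
rewrite coefB coefX coefC; apply: sfB => //; first by case: eqP => _; [exact: sf1|exact: sf0].
by case: eqP => _ //; exact: sf0.
Qed.

Section Relation.
Variables (k : fieldType) (S : k -> Prop) (hS : is_subfield S) (ec : ec_field S).

(* In a relation of minimal degree some partial derivative is nonzero: otherwise it is
   a polynomial in q-th powers, and extracting roots gives one of smaller degree. *)
Lemma separable_relation m (z : 'I_m.+1 -> k) : ~ alg_indep S z ->
  exists i, sepalg (ratT S (fun j => z (lift i j))) (z i).
Proof.
move=> nz; pose P d := `[< exists p : {mpoly k[m.+1]},
  [/\ p != 0, forall n, S p@_n, p.@[z] = 0 & msize p = d] >].
have exP : exists d, P d.
  apply: contrapT => h; apply: nz => p p0 hp; apply/eqP => e; apply: h; exists (msize p).
  by apply/asboolP; exists p.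
case: (ex_minnP exP) => d /asboolP[p [p0 hp pz pd]] min.
have small (p' : {mpoly k[m.+1]}) : p' != 0 -> (forall n, S p'@_n) -> (msize p' < d)%N -> p'.@[z] != 0.
  move=> p'0 hp' lt; apply/eqP => e; have /min : P (msize p') by apply/asboolP; exists p'.
  by rewrite leqNgt lt.
have sz0 : (0 < msize p)%N := leq_ltn_trans (leq0n _) (msize_mdeg_lt (mlead_supp p0)).
have natS n : S n%:R by elim: n => [|n IH]; [exact: sf0|rewrite mulrS; apply: sfD => //; exact: sf1].
have hder i n : S (mderiv i p)@_n by rewrite mcoeff_deriv -mulr_natr; apply: sfM.
have szder i : mderiv i p != 0 -> (msize (mderiv i p) < d)%N.
  move=> d0; rewrite -pd msizeE; apply: (@leq_ltn_trans (msize p).-1); last by rewrite prednK.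
  apply/bigmax_leqP_seq => n hn _; have : (n + U_(i))%MM \in msupp p.
    by rewrite !mcoeff_msupp mcoeff_deriv in hn *; apply: contraNneq hn => ->; rewrite mul0rn.
  by move/msize_mdeg_lt; rewrite mdegD mdeg1 addn1; case: (msize p).
have [[i di]|nd] := EM (exists i, mderiv i p != 0).
  exists i; have := small _ di (hder i) (szder i di).
  pose c (n : 'X_{1..m.+1}) := p@_n * \prod_(j < m) z (lift i j) ^+ n (lift i j).
  pose Q : {poly k} := \sum_(n <- msupp p) c n *: 'X^(n i).
  have mE (n : 'X_{1..m.+1}) : \prod_j z j ^+ n j = z i ^+ n i * \prod_(j < m) z (lift i j) ^+ n (lift i j).
    by rewrite (bigD1_ord i).
  have Q0 : Q.[z i] = 0.
    rewrite -pz mevalE /Q horner_sum; apply: eq_bigr => n _; rewrite hornerZ hornerXn /c mE; ring.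
  have Q1 : (Q^`()).[z i] = (mderiv i p).@[z].
    rewrite /mderiv rmorph_sum /Q raddf_sum horner_sum; apply: eq_bigr => n _ /=.
    rewrite derivZ hornerZ derivXn hornerMn hornerXn mevalZ mevalX mE /c.
    have -> : \prod_(j < m) z (lift i j) ^+ (n - U_(i))%MM (lift i j) = \prod_(j < m) z (lift i j) ^+ n (lift i j).
      by apply: eq_bigr => j _; rewrite mnmBE mnm1E (negPf (neq_lift i j)) subn0.
    by rewrite mnmBE mnm1E eqxx subn1 -mulr_natl; ring.
  move=> nz1; exists Q; split; [move=> l|by apply/rootP|by rewrite /root Q1].
  rewrite /Q coef_sum; have hR := ratT_subfield (fun j => z (lift i j)) hS.
  apply: sf_sum => // n _; rewrite coefZ coefXn; apply: sfM => //; last by case: eqP => _; [exact: sf1|exact: sf0].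
  apply: sfM => //; first exact: ratT_const.
  by apply: sf_prod => // j _; apply: sfX => //; exact: ratT_var.
(* With all partial derivatives zero, the characteristic q is positive and divides every exponent in
   p; the map g below divides the exponents by q. *)
have d0 i : mderiv i p = 0 by apply/eqP/negPn/negP => h; apply: nd; exists i.
have cdiv n i : n \in msupp p -> (n i)%:R = 0 :> k.
  case: (posnP (n i)) => [->//|ni np].
  have E := congr1 (fun q : {mpoly k[m.+1]} => q@_(n - U_(i))%MM) (d0 i); move: E.
  have nU : (n - U_(i) + U_(i) = n)%MM by rewrite submK // lep1mP -lt0n.
  rewrite mcoeff0 mcoeff_deriv nU mnmBE mnm1E eqxx subn1 prednK // => E.
  have {}E : p@_n * (n i)%:R = 0 by rewrite mulr_natr.
  by move/eqP: E; rewrite mulf_eq0 mcoeff_eq0 np => /eqP.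
have [n0 n0p n00] : exists2 n, n \in msupp p & n != 0%MM.
  apply: contrapT => h; have pC : p = (p@_0)%:MP.
    apply/mpolyP => n; rewrite mcoeffC; have [->|n0] := eqVneq n 0%MM; first by rewrite mulr1.
    rewrite mulr0; apply: memN_msupp_eq0; apply/negP => np; apply: h; by exists n.
  by move: pz p0; rewrite pC mevalC mpolyC_eq0 => ->; rewrite eqxx.
have [i0 ni0] : exists i, n0 i != 0%N.
  apply: contrapT => h; case/eqP: n00; apply/mnmP => i; rewrite mnm0E; apply/eqP/negPn/negP => e.
  by apply: h; exists i.
have [q hq] : exists q, q \in [pchar k].
  by apply: (natf0_pchar (n := n0 i0)); [rewrite lt0n|apply/eqP; exact: cdiv].
have q1 : (1 < q)%N by rewrite prime_gt1 // (pcharf_prime hq).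
have qdiv n i : n \in msupp p -> (n i %/ q * q)%N = n i.
  by move=> np; rewrite divnK // (dvdn_pcharf hq); apply/eqP/cdiv.
pose g (n : 'X_{1..m.+1}) := [multinom (n i %/ q)%N | i < m.+1].
have gE n : n \in msupp p -> tmon z (g n) ^+ q = tmon z n.
  by move=> np; rewrite tmonX; apply: eq_bigr => i _; rewrite mnmE qdiv.
pose s := msupp p; pose N := size s; pose sj (j : 'I_N) : 'X_{1..m.+1} := nth 0%MM s j.
have sjs j : sj j \in msupp p by apply: mem_nth.
have ginj : injective (g \o sj).
  move=> j j' /mnmP e; apply/val_inj/eqP; rewrite -(nth_uniq 0%MM (ltn_ord j) (ltn_ord j') (msupp_uniq p)).
  apply/eqP/mnmP => i; rewrite -(qdiv _ i (sjs j)) -(qdiv _ i (sjs j')).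
  by have := e i; rewrite !mnmE => ->.
have [|||d' [Sd [j0 dj0] Ed]] := @frobenius_dependent k S ec q hq hS N (fun j => p@_(sj j)) (fun j => tmon z (g (sj j))).
- by move=> j; apply: hp.
- have ls : (0 < N)%N by rewrite /N /s; case: (msupp p) n0p.
  by exists (Ordinal ls); rewrite -mcoeff_msupp.
- transitivity (\sum_(j < N) p@_(sj j) * tmon z (sj j)); first by apply: eq_bigr => j _; rewrite gE.
  have E : p.@[z] = \sum_(m1 <- s) p@_m1 * tmon z m1 by rewrite mevalE.
  by rewrite -[RHS]pz E (big_nth 0%MM) big_mkord.
pose p' : {mpoly k[m.+1]} := \sum_j d' j *: 'X_[g (sj j)].
have p'j : p'@_(g (sj j0)) = d' j0.
  rewrite /p' raddf_sum (bigD1 j0) //= mcoeffZ mcoeffX eqxx mulr1 big1 ?addr0 // => j jj.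
  by rewrite mcoeffZ mcoeffX (inj_eq ginj) (negPf jj) mulr0.
exfalso; suff [h1 h2 h3] : [/\ p' != 0, forall n, S p'@_n & (msize p' < d)%N].
  by have := small _ h1 h2 h3; rewrite meval_monomials Ed eqxx.
split.
- by apply: contraNneq dj0 => e; rewrite -p'j e mcoeff0.
- move=> n; rewrite /p' raddf_sum /=; apply: sf_sum => // j _; rewrite mcoeffZ mcoeffX.
  by case: eqP => _; rewrite ?mulr1 ?mulr0 //; exact: sf0.
- have n0d : (1 < d)%N.
    rewrite -pd; apply: leq_ltn_trans (msize_mdeg_lt n0p); rewrite lt0n mdeg_eq0.
    by apply: contra n00.
  rewrite msizeE -(prednK (ltnW n0d)) ltnS; apply/bigmax_leqP_seq => n np _.
  have [j ->] : exists j, n = g (sj j).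
    apply: contrapT => h; move: np; rewrite mcoeff_msupp /p' raddf_sum big1 ?eqxx //= => j _.
    by rewrite mcoeffZ mcoeffX; case: eqP => [e|_]; rewrite ?mulr0 //; case: h; exists j.
  have := msize_mdeg_lt (sjs j); rewrite pd.
  have -> : mdeg (sj j) = (mdeg (g (sj j)) * q)%N.
    rewrite !mdegE big_distrl; apply: eq_bigr => i _.
    by rewrite /= -[LHS](qdiv _ i (sjs j)) [X in (_ * q)%N = (X * q)%N]mnmE.
  by move: (mdeg _) => e; case: e => [|e] h; clear -h q1 n0d; nia.
Qed.
End Relation.

(** * Separable algebraic elements: transitivity and primitive elements *)

Section SeparableExtension.
Variables (k : fieldType) (S : k -> Prop) (hS : is_subfield S).

Lemma sepalg_element (M : fieldExtType (sft hS)) (phi : {rmorphism M -> k}) (U : {subfield M})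
  (u : M) (S' : k -> Prop) : (forall z, S' z -> exists2 w, w \in U & phi w = z) ->
  sepalg S' (phi u) -> separable_element U u.
Proof.
move=> hU [p [hp p0 p1]].
have h i : exists2 w, w \in U & phi w = p`_i by apply: hU.
pose P : {poly M} := \poly_(i < size p) s2val (cid2 (h i)).
have Pp : map_poly phi P = p.
  apply/polyP => i; rewrite coef_map coef_poly; case: ltnP => hi; first by case: (cid2 _).
  by transitivity (0 : k); [exact: rmorph0|rewrite nth_default].
have PU : P \is a polyOver U.
  by apply/polyOverP => i; rewrite coef_poly; case: ifP => _; [case: (cid2 _)|exact: mem0v].
have r0 : root P u by rewrite -(fmorph_root phi) Pp.
rewrite separable_nz_der; apply/negP => /eqP e; case/negP: p1.
have [q Eq] := dvdpP _ _ (minPoly_dvdp PU r0).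
rewrite -Pp deriv_map fmorph_root Eq derivM e mulr0 addr0 rootM root_minPoly orbT //.
Qed.

Lemma sepalg_trans m (z : 'I_m -> k) x : (forall i, sepalg S (z i)) -> sepalg (ratT S z) x -> sepalg S x.
Proof.
move=> sz sx; have az : alg S x.
  apply: alg_alg => //; have := sepalg_alg sx; apply: alg_mono.
  apply: ratT_min; [exact: alg_subfield|by move=> y; exact: alg_incl|by move=> i; apply: sepalg_alg].
have [|M [phi [phi0 hphi]]] := @finite_subextension (sft hS) k val (x :: codom z).
  by move=> y; rewrite inE => /orP[/eqP ->|/codomP[i ->]]; apply/algE => //; apply: sepalg_alg.
have [u hu] : exists u, phi u = x by apply: hphi; rewrite mem_head.
have /choice[w hw] : forall i, exists w, phi w = z i.
  by move=> i; apply: hphi; rewrite inE codom_f orbT.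
have base y : S y -> exists2 w0, w0 \in 1%AS & phi w0 = y.
  by move=> /(sfv_ex hS)[a <-]; exists a%:A; rewrite ?phi0 //; apply/vlineP; exists a.
pose U := <<1%AS & codom w>>%AS.
have sep1 : separable 1%AS U.
  apply: separable_Fadjoin_seq; apply/allP => _ /codomP[i ->].
  by apply: (@sepalg_element M phi 1%AS (w i) S base); rewrite hw.
have sepU : separable_element U u.
  apply: (@sepalg_element M phi U u (ratT S z)); last by rewrite hu.
  apply: (ratT_min (P := fun y => exists2 w0, w0 \in U & phi w0 = y)) => [|y /base[w0 h <-]|i].
  - split=> [|_ _ [a ha <-] [b hb <-]|_ _ [a ha <-] [b hb <-]|_ [a ha <-]]; first by exists 1; rewrite ?rmorph1 ?mem1v.
    + by exists (a - b); rewrite ?rmorphB // rpredB.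
    + by exists (a * b); rewrite ?rmorphM // rpredM.
    + by exists a^-1; rewrite ?fmorphV // rpredV.
  - by exists w0 => //; exact: (subvP (subv_adjoin_seq _ _) _ h).
  - by exists (w i); rewrite ?hw //; apply: seqv_sub_adjoin; exact: codom_f.
have sepu : separable_element 1%AS u.
  have h : separable 1%AS <<U; u>>%AS by apply: separable_trans sep1 _; rewrite -adjoin_separable_eq.
  by move/separableP: h; apply; exact: memv_adjoin.
have [q Eq] := polyOver1P (minPolyOver 1%AS u).
have Eq' : map_poly phi (minPoly 1%AS u) = map_poly val q.
  by rewrite Eq -map_poly_comp; apply: eq_map_poly => a /=; rewrite phi0.
exists (map_poly val q); split=> [i||].
- by rewrite coef_map; exact: sfvP.
- by rewrite -Eq' -hu fmorph_root root_minPoly.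
- rewrite -Eq' -hu deriv_map fmorph_root.
  by have := separable_root_der 1%AS u; rewrite sepu.
Qed.

Lemma separable_primitive m (z : 'I_m -> k) : (forall i, sepalg S (z i)) ->
  exists f (mp : {poly sft hS}) (zeta : k), [/\ mp \is monic, size mp = f.+1,
    [/\ zeta != 0, ratT S z zeta, root (map_poly val mp) zeta & ~~ root (map_poly val mp)^`() zeta],
    forall w, ratT S z w -> exists2 c : 'I_f -> k, forall i, S (c i) & w = \sum_i c i * zeta ^+ i &
    forall c : 'I_f -> k, (forall i, S (c i)) -> \sum_i c i * zeta ^+ i = 0 -> forall i, c i = 0].
Proof.
move=> sz.
have [|M [phi [phi0 hphi]]] := @finite_subextension (sft hS) k val (codom z).
  by move=> y /codomP[i ->]; apply/algE => //; apply: sepalg_alg.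
have /choice[w hw] : forall i, exists w, phi w = z i by move=> i; apply: hphi; exact: codom_f.
have base y : S y -> exists2 w0, w0 \in 1%AS & phi w0 = y.
  by move=> /(sfv_ex hS)[a <-]; exists a%:A; rewrite ?phi0 //; apply/vlineP; exists a.
pose U := <<1%AS & codom w>>%AS.
have sep1 : separable 1%AS U.
  apply: separable_Fadjoin_seq; apply/allP => _ /codomP[i ->].
  by apply: (@sepalg_element M phi 1%AS (w i) S base); rewrite hw.
(* The generator has to be nonzero, since its lift must be a unit for the chosen valuation. If the
   standard generator is 0, the extension is trivial and 1 generates it. *)
have [g [g0 Ug sg]] : exists g, [/\ g != 0, U = <<1; g>>%VS :> {vspace M} & separable_element 1%AS g].
  have E := eq_adjoin_separable_generator sep1 (sub1v _).
  have [e|g0] := eqVneq (separable_generator 1%AS U) 0; last first.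
    by exists (separable_generator 1%AS U); split=> //; exact: separable_generatorP.
  exists 1; split; [exact: oner_neq0| |by apply: base_separable; exact: mem1v].
  rewrite E e; apply/eqP; rewrite eqEsubv; apply/andP; split; apply/FadjoinP; split;
    by rewrite ?subv_adjoin // ?mem0v // subvP_adjoin // mem1v.
have inU y : ratT S z y -> exists2 w0, w0 \in U & phi w0 = y.
  apply: (ratT_min (P := fun y => exists2 w0, w0 \in U & phi w0 = y)) => [|y' /base[w0 h <-]|i].
  - split=> [|_ _ [a ha <-] [b hb <-]|_ _ [a ha <-] [b hb <-]|_ [a ha <-]]; first by exists 1; rewrite ?rmorph1 ?mem1v.
    + by exists (a - b); rewrite ?rmorphB // rpredB.
    + by exists (a * b); rewrite ?rmorphM // rpredM.
    + by exists a^-1; rewrite ?fmorphV // rpredV.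
  - by exists w0 => //; exact: (subvP (subv_adjoin_seq _ _) _ h).
  - by exists (w i); rewrite ?hw //; apply: seqv_sub_adjoin; exact: codom_f.
have hR := ratT_subfield z hS.
have Uin w0 : w0 \in U -> ratT S z (phi w0).
  pose hp : {pred M} := fun y => `[< ratT S z (phi y) >].
  suff H : forall s (V : {subfield M}), (forall y, y \in V -> ratT S z (phi y)) ->
     (forall y, y \in s -> ratT S z (phi y)) -> forall y, y \in <<V & s>>%VS -> ratT S z (phi y).
    apply: H => [y /vlineP[a ->]|y /codomP[i ->]]; last by rewrite hw; exact: ratT_var.
    by rewrite phi0; apply: ratT_const => //; exact: sfvP.
  elim=> [|y s IH] V hV hs y'; first by rewrite adjoin_nil subfield_closed; exact: hV.
  rewrite adjoin_cons; apply: (IH <<V; y>>%AS) => [y2 /Fadjoin_polyP[p Vp ->]|y2 hy2]; last first.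
    by apply: hs; rewrite inE hy2 orbT.
  rewrite -horner_map; apply: sf_horner => // [i|]; last by apply: hs; rewrite mem_head.
  by rewrite coef_map; apply: hV; exact: (polyOverP Vp).
have [mp Emp] := polyOver1P (minPolyOver 1%AS g).
have Emp' : map_poly phi (minPoly 1%AS g) = map_poly val mp.
  by rewrite Emp -map_poly_comp; apply: eq_map_poly => a /=; rewrite phi0.
have gU : g \in U by rewrite Ug memv_adjoin.
exists (adjoin_degree 1%AS g), mp, (phi g); split.
- have := monic_minPoly 1%AS g; rewrite Emp !monicE lead_coef_map.
  by rewrite -[X in _ == X](rmorph1 (in_alg M)) (inj_eq (fmorph_inj _)).
- by have := size_minPoly 1%AS g; rewrite Emp size_map_poly.
- split; [by rewrite fmorph_eq0|exact: Uin| |].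
    by rewrite -Emp' fmorph_root root_minPoly.
  by rewrite -Emp' deriv_map fmorph_root; have := separable_root_der 1%AS g; rewrite sg.
- move=> y /inU[w0 w0U <-]; have w0g : w0 \in <<1; g>>%VS by move: w0U; rewrite Ug.
  pose q := Fadjoin_poly 1%AS g w0.
  have q1 i : q`_i \in 1%VS by exact: (polyOverP (Fadjoin_polyOver 1%AS g w0)).
  exists (fun i => phi q`_i) => [i|]; first by have /vlineP[a ->] := q1 i; rewrite phi0; exact: sfvP.
  rewrite -{1}(Fadjoin_poly_eq w0g) (horner_coef_wide _ (size_Fadjoin_poly 1%AS g w0)) rmorph_sum.
  by apply: eq_bigr => i _; rewrite rmorphM rmorphXn.
- move=> c Sc E; have /choice[a ha] : forall i, exists a : sft hS, val a = c i by move=> i; apply: sfv_ex.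
  pose q : {poly M} := \poly_(i < adjoin_degree 1%AS g) (if insub i is Some j then (a j)%:A else 0).
  have qa (i : 'I_(adjoin_degree 1%AS g)) : q`_i = (a i)%:A by rewrite coef_poly ltn_ord valK.
  have q1 : q \is a polyOver 1%VS.
    apply/polyOverP => i; rewrite coef_poly; case: ifP => _; last exact: mem0v.
    by case: insub => [j|]; [apply/vlineP; exists (a j)|exact: mem0v].
  have : root q g.
    apply/rootP; apply: (fmorph_inj phi); rewrite rmorph0 -E.
    rewrite (horner_coef_wide _ (size_poly _ _)) rmorph_sum; apply: eq_bigr => i _.
    by rewrite rmorphM rmorphXn qa phi0 -ha.
  rewrite (root_small_adjoin_poly q1 (size_poly _ _)) => /eqP q0 i.
  by have := qa i; rewrite q0 coef0 -ha => /esym/eqP; rewrite -[_%:A]/(in_alg M _) fmorph_eq0 => /eqP ->; rewrite rmorph0.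
Qed.
End SeparableExtension.

Section SeparatingBasis.
Variables (k : fieldType) (S : k -> Prop) (hS : is_subfield S) (ec : ec_field S).

(** When z is dependent, some z_i is separable over the field of the others; it is removed, and
    transitivity of separability brings it back at the end. *)
Lemma separating_basis m (z : 'I_m -> k) : exists s (f : 'I_s -> 'I_m),
  alg_indep S (fun i => z (f i)) /\ forall i, sepalg (ratT S (fun j => z (f j))) (z i).
Proof.
elim: m z => [|m IH] z.
  by exists 0%N, id; split=> [|[]//]; exact: alg_indep0.
have [iz|/(separable_relation hS ec)[i si]] := EM (alg_indep S z).
  exists m.+1, id; split=> // i; apply: sepalg_base; first exact: ratT_subfield.
  exact: (ratT_var z hS i).
have [s [f [indf hf]]] := IH (fun j => z (lift i j)).
exists s, (fun j => lift i (f j)); split=> // l.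
have [j ->|->] := unliftP i l; first exact: hf.
have hR := ratT_subfield (fun j => z (lift i (f j))) hS.
apply: (sepalg_trans hR hf); apply: sepalg_mono si.
apply: ratT_min => [|y Sy|j]; [exact: ratT_subfield| |exact: ratT_var].
by apply: ratT_const => //; exact: ratT_const.
Qed.
End SeparatingBasis.

(** * Hensel's lemma *)

Lemma irreducible_dvd (K R : fieldType) (j : {rmorphism K -> R}) (p q : {poly K}) r :
  irreducible_poly p -> root (map_poly j p) r -> root (map_poly j q) r -> p %| q.
Proof.
move=> [_ ir] rp rq; have hg : root (map_poly j (gcdp p q)) r by rewrite gcdp_map root_gcd rp rq.
have sg : size (gcdp p q) != 1.
  apply: contraTneq hg => /eqP/size_poly1P[c c0 ->]; by rewrite map_polyC rootC fmorph_eq0.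
by rewrite -(eqp_dvdl _ (ir _ sg (dvdp_gcdl p q))) dvdp_gcdr.
Qed.

Section Hensel.
Variables (K : fieldType) (OK : K -> Prop).
Hypothesis vK : valuation_ring OK.
Hypothesis hens : henselian OK.

(** In the Taylor expansion at a, the quotient of P(b) - P(a) by b - a is P'(a) plus a small term,
    hence a unit, so b - a must vanish. *)
Lemma close_roots_eq (R : fieldType) (O : R -> Prop) (P : {poly R}) a b : valuation_ring O ->
  (forall i, O P`_i) -> O a -> root P a -> root P b -> vlt O (b - a) 1 ->
  veq O (P^`()).[a] 1 -> a = b.
Proof.
move=> vO OP Oa /rootP ra /rootP rb ba e; apply/eqP/negPn/negP => ab.
have h0 : b - a != 0 by rewrite subr_eq0 eq_sym.
have := poly.nderiv_taylor P (mulrC a (b - a)); rewrite addrC subrK rb.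
have ON i m : O (P^`N(i))`_m by rewrite poly.coef_nderivn -mulr_natr; apply: vrM => //;
  elim: ('C(_, _)) => [|k IH]; [exact: vr0|rewrite -[k.+1]addn1 natrD; apply: vrD => //; exact: vr1].
have sP : (1 < size P)%N.
  by apply: (root_size_gt1 (a := a)); [apply/eqP => P0; move: e; rewrite P0 deriv0 horner0 => -[_ /vle_0/eqP]; rewrite oner_eq0|apply/rootP].
case: (size P) sP => [|[|n]] // _.
rewrite 2!big_ord_recl /= poly.nderivn0 ra mul0r add0r poly.nderivn1 expr1.
under eq_bigr do rewrite /bump /= !add1n exprSr mulrA.
rewrite -mulr_suml -mulrDl => /esym/eqP; rewrite mulf_eq0 (negPf h0) orbF addr_eq0 => /eqP E.
have : vlt O (P^`()).[a] 1.
  rewrite E; apply: vltN => //; apply: vlt_sum => // [|i _]; first exact: oner_neq0.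
  rewrite exprSr mulrA mulrC; apply: vlt_prod1 => //.
  apply: vrM => //; first exact: horner_vr.
  by apply: vrX => //; exact: vlt1_vr.
by case: e => _ h; apply.
Qed.

(** Henselianity is uniqueness of extensions, so conjugate roots are equally far from z. Only one
    root of P has the residue of z, hence the minimal polynomial of that root has no other root;
    being a simple root, it lies in K. *)
Theorem hensel (P : {poly K}) z : P \is monic -> (forall i, OK P`_i) -> OK z ->
  vlt OK P.[z] 1 -> veq OK (P^`()).[z] 1 -> exists2 r, root P r & vlt OK (r - z) 1.
Proof.
move=> mP OP Oz Pz P'z; have [R [j cl]] := exists_alg_closure K.
have [O vO ext] := valuation_extends j vK; have vex a b := vle_ext a b vK vO ext.
have vexl a : vlt O (j a) 1 <-> vlt OK a 1 by rewrite /vlt -(rmorph1 j) vex.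
pose P' := map_poly j P; have OP' i : O P'`_i by rewrite coef_map; apply/ext.
have [rs] := alg_closed_split P' cl; rewrite (monicP (monic_map j mP)) scale1r => Ers.
have [r rrs rz] : exists2 r, r \in rs & vlt O (j z - r) 1.
  have : vlt O P'.[j z] 1 by rewrite horner_map; apply/vexl.
  rewrite Ers horner_prod; elim: (rs) => [|r s IH]; first by rewrite big_nil => /(vlt_irr vO).
  rewrite big_cons hornerXsubC => h; case: (vleVlt O 1 (j z - r)) => [h1|]; last by exists r; rewrite ?mem_head.
  have [|r' r's hr'] := IH; last by exists r'; rewrite // inE r's orbT.
  by move=> h2; apply: h; have := vleM vO h1 h2; rewrite mulr1.
have Pr : root P' r by rewrite Ers root_prod_XsubC.
have Ojz : O (j z) by apply/ext.
have Or : O r by rewrite -(subKr (j z) r); apply: vrB => //; exact: vlt1_vr.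
have P'r : veq O (P'^`()).[r] 1.
  have h : vlt O ((P'^`()).[r] - (P'^`()).[j z]) 1.
    by apply: horner_close => //; [exact: deriv_vr|rewrite -opprB; apply: vltN].
  have e : veq O (P'^`()).[j z] 1.
    by rewrite deriv_map horner_map /veq -(rmorph1 j) !vex.
  apply: (veq_trans vO _ e); apply: veq_close => //; exact: vlt_veqr h (veq_sym e).
have [p irp pr] : exists2 p, irreducible_poly p & root (map_poly j p) r.
  by apply: min_irreducible; exists P => //; exact: monic_neq0.
have pP : p %| P := irreducible_dvd irp pr Pr.
have [|M [phi [phi0 hphi]]] := @finite_subextension K R j [:: r].
  by move=> x; rewrite inE => /eqP ->; exists P => //; exact: monic_neq0.
have [u hu] : exists u, phi u = r by apply: hphi; rewrite mem_head.
pose b := vbasis {: M}; have hb : basis_of {: M} b := vbasisP _.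
(* Another root r' is the image of u under an embedding chi of M. The valuations pulled back along
   phi and chi coincide, so r' is close to z as well. *)
have oneroot r' : root (map_poly j p) r' -> r' = r.
  move=> pr'; pose C := char_poly (mulmat b u).
  have Cr : root (map_poly j C) r by rewrite -hu; apply: over_root.
  have pC : map_poly j p %| map_poly j C by rewrite dvdp_map; exact: irreducible_dvd irp pr Cr.
  have [chi hchi chiu] := embed_root hb cl (root_dvdp pC pr').
  pose OM x := O (phi x); have vM : valuation_ring OM by exact: pullback_valuation.
  have chiM : extends chi OM O.
    move=> x; apply: iff_sym; apply: (henselian_unique hens vM _ (pullback_valuation chi vO)) => a.
      by rewrite /OM phi0.
    by rewrite hchi.
  have close (f : {rmorphism M -> R}) (x : M) : extends f OM O -> vlt O (f x) 1 <-> vlt OM x 1.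
    by move=> hf; rewrite /vlt -(rmorph1 f) (vle_ext _ _ vM vO hf).
  have h1 : vlt O (j z - r') 1.
    have -> : j z - r' = chi (z%:A - u) by rewrite rmorphB hchi chiu.
    by apply/(close chi _ chiM)/(close phi) => //; rewrite rmorphB phi0 hu.
  apply/esym/(close_roots_eq vO OP' Or Pr _ _ P'r).
    by apply: root_dvdp pr'; rewrite dvdp_map.
  have -> : r' - r = (j z - r) - (j z - r') by ring.
  exact: vltB.
have [ps Eps] := alg_closed_split (map_poly j p) cl.
have p0 : p != 0 := irredp_neq0 irp.
have lc0 : lead_coef (map_poly j p) != 0 by rewrite lead_coef_eq0 map_poly_eq0.
have allr x : x \in ps -> x = r.
  by move=> xs; apply: oneroot; rewrite Eps rootZ // root_prod_XsubC.
have sps : size ps = 1%N.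
  case: ps Eps allr => [|a [|c ps]] // Eps allr.
    by move: pr; rewrite Eps rootZ // big_nil rootC oner_eq0.
  exfalso; have := allr a; rewrite mem_head => /(_ isT) ea; have := allr c.
  rewrite inE mem_head orbT => /(_ isT) ec.
  (* If r were a multiple root of p it would be a multiple root of P, and P' would vanish at r. *)
  have /dvdpP[q Eq] : map_poly j p %| P' by rewrite dvdp_map.
  have Eq2 : P' = ('X - r%:P) * (('X - r%:P) * (q * ((lead_coef (map_poly j p))%:P * \prod_(x <- ps) ('X - x%:P)))).
    rewrite Eq {1}Eps !big_cons ea ec -mul_polyC; ring.
  case: P'r => _; rewrite Eq2 derivM hornerD !hornerM hornerXsubC subrr !(mul0r, mulr0, addr0).
  by move/vle_0/eqP; rewrite oner_eq0.
have sp : size p = 2%N.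
  by rewrite -(size_map_poly j) Eps size_scale // size_prod_XsubC sps.
have p1 : p`_1 != 0 by have := lead_coef_eq0 p; rewrite lead_coefE sp /= (negPf p0) => ->.
have jr : j (- p`_0 / p`_1) = r.
  move/rootP: pr; rewrite horner_coef size_map_poly sp 2!big_ord_recl big_ord0 /= !coef_map.
  rewrite expr0 mulr1 addr0 expr1 => /eqP; rewrite addrC addr_eq0 => /eqP E.
  rewrite rmorphM fmorphV rmorphN /= -E; field; by rewrite fmorph_eq0.
exists (- p`_0 / p`_1); first by rewrite -(fmorph_root j) jr.
by apply/vexl; rewrite rmorphB jr -opprB; apply: vltN.
Qed.
End Hensel.

(** * Residue fields *)

Section ResidueField.
Variables (K L : fieldType) (iota : {rmorphism K -> L}) (OK : K -> Prop) (OL : L -> Prop)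
  (k : fieldType) (res : L -> k).
Hypothesis vK : valuation_ring OK.
Hypothesis vL : valuation_ring OL.
Hypothesis ext : extends iota OK OL.
Hypothesis hres : residue_map OL res.
Local Notation k0 := (Kv_img iota OK res).
Let hk := Kv_subfield vK vL ext hres.

Section Gauss.
Variables (r s : nat) (x : 'I_r -> L) (y : 'I_s -> L).
Hypothesis G : gauss OK OL iota x y.
Local Notation E := (ratT (imK' iota) (glue x y)).
Local Notation k1 := (ratT k0 (fun i => res (y i))).
Let Oy := gs_Oy G.
Let hE := ratT_subfield (glue x y) (imK_subfield iota).

Lemma residue_fraction a : E a -> OL a -> k1 (res a).
Proof.
move=> /ratT_mmap[p [q [q0 Ea]]] Oa.
have q0' : q != 0 by apply: contraNneq q0 => ->; rewrite rmorph0.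
have pq : vle OL (mmap iota (glue x y) p) (mmap iota (glue x y) q) by apply/vleP; rewrite // -Ea.
have [A [B [OA OB [B1 _] h _]]] := gauss_residue vK G (transfer_refl G) q0' pq.
have rB : res (mmap iota y B) != 0 by apply/(res_neq0 vL hres (OL_mmap vL ext Oy OB)).
have OB' := OL_mmap vL ext Oy OB; have OA' := OL_mmap vL ext Oy OA.
have e : res a * res (mmap iota y B) = res (mmap iota y A).
  rewrite -(resM hres) //; apply/(res_eq vL hres) => //; first exact: vrM.
  apply/(vltM2lE vL _ _ q0); rewrite mulr1 mulrBr mulrA [_ * a]mulrC Ea divfK //.
have -> : res a = res (mmap iota y A) / res (mmap iota y B) by rewrite -e mulfK.
rewrite !(res_mmap vL ext hres) //; apply: sf_div; first exact: ratT_subfield.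
  by apply: ratT_poly => //; exists (reduction iota res A); split=> //; exact: (reduction_over iota vL hres OA).
by apply: ratT_poly => //; exists (reduction iota res B); split=> //; exact: (reduction_over iota vL hres OB).
Qed.

Lemma residue_fraction_lift w : k1 w -> exists a, [/\ E a, OL a & res a = w].
Proof.
have lift z : polyT k0 (fun i => res (y i)) z -> exists a, [/\ E a, OL a & res a = z].
  move=> [q [hq ->]]; have [p hp <-] := reduction_lift vK vL hres hq.
  exists (mmap iota y p); rewrite (res_mmap vL ext hres) //; split=> //; last exact: OL_mmap.
  apply: sf_sum => // m _; apply: sfM => //; first by apply: ratT_const; [exact: imK_subfield|exists p@_m].
  apply: sf_prod => // i _; apply: sfX => //.
  have -> : y i = glue x y (rshift r i) by rewrite /glue -[rshift r i]/(unsplit (inr i)) unsplitK.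
  by apply: ratT_var; exact: imK_subfield.
move=> [u [w' [/lift[a [Ea Oa <-]] /lift[b [Eb Ob <-]] b0 ->]]].
have b1 : veq OL b 1 by apply/(res_neq0 vL hres).
have [Oi ri] := resV vL hres b1.
exists (a / b); split; [exact: sf_div|exact: vrM|by rewrite (resM hres) // ri].
Qed.
End Gauss.

Section FinitelyGenerated.
Variables (r s : nat) (x0 : 'I_r -> L) (y0 : 'I_s -> L) (e : nat) (z : 'I_e -> L).
Hypothesis G : gauss OK OL iota x0 y0.
Local Notation F := (ratT (imK' iota) z).
Local Notation E0 := (ratT (imK' iota) (glue x0 y0)).
Local Notation Fv := (Fv_img OL res F).
Hypothesis Fz : forall i, alg E0 (z i).
Hypothesis Fy : forall i, F (y0 i).
Local Notation k1 := (ratT k0 (fun i => res (y0 i))).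
Let hF := ratT_subfield z (imK_subfield iota).
Let hE := ratT_subfield (glue x0 y0) (imK_subfield iota).

Lemma Fv_subfield : is_subfield Fv.
Proof.
split.
- by exists 1; rewrite (res1 hres); split=> //; [exact: sf1|exact: vr1].
- move=> _ _ [a [Fa Oa <-]] [b [Fb Ob <-]]; exists (a - b).
  by rewrite (resB vL hres) //; split=> //; [exact: sfB|exact: vrB].
- move=> _ _ [a [Fa Oa <-]] [b [Fb Ob <-]]; exists (a * b).
  by rewrite (resM hres) //; split=> //; [exact: sfM|exact: vrM].
- move=> _ [a [Fa Oa <-]]; have [->|n0] := eqVneq (res a) 0.
    by rewrite invr0; exists 0; rewrite (res0 vL hres); split=> //; [exact: sf0|exact: vr0].
  have [h <-] := resV vL hres ((res_neq0 vL hres Oa).1 n0).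
  by exists a^-1; split=> //; exact: sfV.
Qed.

Lemma k0_Fv w : k0 w -> Fv w.
Proof. by move=> [a [Oa <-]]; exists (iota a); split=> //; [apply: ratT_const; [exact: imK_subfield|exists a]|apply/ext]. Qed.

(** Lifts of residues that are independent over the residue field of E0 are independent over E0, so
    their number is at most [F : E0]. *)
Lemma residue_indep_bound : exists D, forall n (t : 'I_n -> k), (forall i, Fv (t i)) ->
  (forall c : 'I_n -> k, (forall i, k1 (c i)) -> \sum_i c i * t i = 0 -> forall i, c i = 0) -> (n <= D)%N.
Proof.
have [|M [phi [phi0 hphi]]] := @finite_subextension (sft hE) L val (codom z).
  by move=> _ /codomP[i ->]; apply/algE.
have im u : F u -> exists w, phi w = u.
  apply: (ratT_min (P := fun u => exists w, phi w = u)) => [|_ [a ->]|i].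
  - split=> [|_ _ [a <-] [b <-]|_ _ [a <-] [b <-]|_ [a <-]]; first by exists 1; rewrite rmorph1.
    + by exists (a - b); rewrite rmorphB.
    + by exists (a * b); rewrite rmorphM.
    + by exists a^-1; rewrite fmorphV.
  - have [w <-] := sfv_ex hE (ratT_const (glue x0 y0) (imK_subfield iota) (ex_intro _ a erefl)).
    by exists w%:A; rewrite phi0.
  - by apply: hphi; exact: codom_f.
exists (\dim {: M}) => n t Ft it.
have /choice[w hw] : forall i, exists w : M, OL (phi w) /\ res (phi w) = t i.
  by move=> i; have [u [/im[w <-] Ou ru]] := Ft i; exists w.
pose OE (a : sft hE) := OL (val a); pose OM (u : M) := OL (phi u).
have vE : valuation_ring OE by exact: pullback_valuation.
have vM : valuation_ring OM by exact: pullback_valuation.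
have exM : extends (GRing.in_alg M) OE OM by move=> a; rewrite /OM phi0.
have := @indep_card (sft hE) M 'I_n w; rewrite card_ord; apply.
move=> c hc i; apply/eqP/negPn/negP => ci.
have [||m [cm h _]] := @residue_sum _ OE M OM vE vM exM n w c _ _ i ci.
- by move=> l; case: (hw l).
- move=> a Oa /(vmaxP vM) h l; apply/(vmaxP vE).
  have e1 : \sum_i res (val (a i)) * t i = 0.
    have <- : res (phi (\sum_i (a i)%:A * w i)) = \sum_i res (val (a i)) * t i.
      rewrite rmorph_sum (res_sum vL hres) => [|j _]; last first.
        by rewrite rmorphM phi0; apply: vrM => //; [exact: Oa|case: (hw j)].
      by apply: eq_bigr => j _; rewrite rmorphM phi0 (resM hres); [case: (hw j) => _ ->|exact: Oa|case: (hw j)].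
    have h' : vlt OL (phi (\sum_i (a i)%:A * w i)) 1.
      by move: h; rewrite /vlt -(vle_ext _ _ vM vL (j := phi) (fun _ => iff_refl _)) rmorph1.
    by apply/(res_eq0 vL hres (vlt1_vr vL h')).
  have k1a j : k1 (res (val (a j))) by apply: (residue_fraction G); [exact: sfvP|exact: Oa].
  have := it _ k1a e1 l; move/(res_eq0 vL hres (Oa l)).
  by rewrite /vlt -(rmorph1 (val : {rmorphism sft hE -> L})) (vle_ext _ _ vE vL (fun _ => iff_refl _)).
move: hc h; under eq_bigr do rewrite -mulr_algl; move=> -> [_ /vle_0/eqP].
by rewrite scaler_eq0 (negPf cm) oner_eq0.
Qed.

(** The residues of y0 together with a family of residues of F that is independent over k1, of
    greatest length. *)
Lemma residue_fg : exists n (t : 'I_n -> k), (forall i, Fv (t i)) /\ forall w, Fv w -> ratT k0 t w.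
Proof.
have [D hD] := residue_indep_bound.
pose P n := `[< exists t : 'I_n -> k, (forall i, Fv (t i)) /\
  forall c : 'I_n -> k, (forall i, k1 (c i)) -> \sum_i c i * t i = 0 -> forall i, c i = 0 >].
have exP : exists n, P n by exists 0%N; apply/asboolP; exists (fun=> 0); split=> [[]|c _ _ []].
have ubP n : P n -> (n <= D)%N by move=> /asboolP[t [Ft it]]; apply: hD it.
have [n /asboolP[t [Ft it]] max] := ex_maxnP exP ubP.
exists (s + n)%N, (glue (fun i => res (y0 i)) t); split=> [i|w Fw].
  by rewrite /glue; case: split => j //; exists (y0 j); split=> //; exact: (gs_Oy G).
have hR := ratT_subfield (glue (fun i => res (y0 i)) t) hk.
have k1R u : k1 u -> ratT k0 (glue (fun i => res (y0 i)) t) u.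
  apply: ratT_min => // [v|i]; first exact: ratT_const.
  have -> : res (y0 i) = glue (fun i => res (y0 i)) t (lshift n i) by rewrite /glue -[lshift n i]/(unsplit (inl i)) unsplitK.
  exact: ratT_var.
have tR i : ratT k0 (glue (fun i => res (y0 i)) t) (t i).
  have {1}-> : t i = glue (fun i => res (y0 i)) t (rshift s i) by rewrite /glue -[rshift s i]/(unsplit (inr i)) unsplitK.
  exact: ratT_var.
apply: contrapT => nw; suff : P n.+1 by move/max; rewrite ltnn.
apply/asboolP; exists (fun i => if unlift ord0 i is Some j then t j else w); split.
  by move=> i; case: unliftP.
move=> c k1c; rewrite big_ord_recl unlift_none => E.
have E' : c ord0 * w + \sum_i c (lift ord0 i) * t i = 0.
  by rewrite -[RHS]E; congr (_ + _); apply: eq_bigr => i _; rewrite liftK.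
have c0 : c ord0 = 0.
  apply/eqP/negPn/negP => c0; apply: nw.
  have -> : w = - (\sum_i c (lift ord0 i) * t i) / c ord0.
    by apply: (mulfI c0); rewrite mulrCA divff // mulr1; apply/eqP; rewrite -addr_eq0 E'.
  apply: sf_div => //; last exact: k1R.
  by apply: (sfN hR); apply: sf_sum => // i _; apply: sfM => //; exact: k1R.
move=> i; have [j ->|->//] := unliftP ord0 i.
by apply: (it (fun j => c (lift ord0 j))) => //; move: E'; rewrite c0 mul0r add0r.
Qed.

(** Existential closedness of Kv gives the finitely generated field Fv a separating transcendence
    basis; by Steinitz exchange it has s members, and lifts of it replace y0. Fv is then a finite
    separable extension with primitive element zeta. *)
Theorem residue_basis : ec_field k0 -> trdeg_is k0 Fv s -> alg_indep k0 (fun i => res (y0 i)) ->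
  exists y : 'I_s -> L, [/\ forall i, F (y i), forall i, OL (y i), alg_indep k0 (fun i => res (y i)) &
  exists f (mp : {poly sft (ratT_subfield (fun i => res (y i)) hk)}) (zeta : k),
    [/\ mp \is monic, size mp = f.+1,
    [/\ zeta != 0, Fv zeta, root (map_poly val mp) zeta & ~~ root (map_poly val mp)^`() zeta],
    forall w, Fv w -> exists2 c : 'I_f -> k, forall i, ratT k0 (fun i => res (y i)) (c i) &
      w = \sum_i c i * zeta ^+ i &
    forall c : 'I_f -> k, (forall i, ratT k0 (fun i => res (y i)) (c i)) ->
      \sum_i c i * zeta ^+ i = 0 -> forall i, c i = 0]].
Proof.
move=> ec td iy0; have [n [t [Ft gt]]] := residue_fg.
have [s' [f [iB sepB]]] := separating_basis hk ec t.
have /choice[u hu] : forall i, exists u, [/\ F u, OL u & res u = t i] by move=> i; exact: Ft.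
have es : s' = s.
  apply/eqP; rewrite eqn_leq; apply/andP; split.
    apply: (steinitz hk iB) => i; apply: (trdeg_alg hk td _ iy0 (Ft (f i))) => j; exists (y0 j); split=> //; exact: (gs_Oy G).
  apply: (steinitz hk iy0) => i; have hB := ratT_subfield (fun j => t (f j)) hk.
  have := gt (res (y0 i)); move=> /(_ _)/(ratT_min (P := alg (ratT k0 (fun j => t (f j))))); apply.
  - exact: alg_subfield.
  - by move=> v kv; apply: alg_incl => //; exact: ratT_const.
  - by move=> j; apply: sepalg_alg.
  - by exists (y0 i); split=> //; exact: (gs_Oy G).
subst s'; exists (fun i => u (f i)).
have yE : (fun i => res (u (f i))) = (fun i => t (f i)) by apply/funext => i; case: (hu (f i)).
split=> [i|i||]; [by case: (hu (f i))|by case: (hu (f i))|by rewrite yE|].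
rewrite yE; have [d [mp [zeta [h1 h2 [h3 h4 h5 h6] h7 h8]]]] := separable_primitive (ratT_subfield (fun i => t (f i)) hk) sepB.
exists d, mp, zeta; split=> //.
  split=> //; apply: ratT_min h4 => [|v kv|i]; [exact: Fv_subfield| |exact: Ft].
  by apply: (ratT_min (S := k0)) kv => [|w kw|i]; [exact: Fv_subfield|exact: k0_Fv|exact: Ft].
have hB := ratT_subfield (fun i => t (f i)) hk.
move=> w /gt tw; apply: h7; apply: ratT_min tw => [|v kv|i]; [exact: ratT_subfield| |exact: ratT_var].
by apply: (ratT_const t hB); exact: ratT_const.
Qed.
End FinitelyGenerated.
End ResidueField.

(** * Realizing the data in an ultrapower *)

Lemma horner_deriv_poly (R : fieldType) n (E : nat -> R) z :
  ((\poly_(i < n) E i)^`()).[z] = \sum_(i < n) E i * (z ^+ i.-1 *+ i).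
Proof.
rewrite poly_def raddf_sum horner_sum; apply: eq_bigr => i _ /=.
by rewrite derivZ derivXn hornerZ hornerMn hornerXn.
Qed.

Lemma umkMn (J : Type) (U : (J -> Prop) -> Prop) (hU : ultra U) (M : J -> fieldType) (f : forall j, M j) n :
  umk hU f *+ n = umk hU (fun j => f j *+ n).
Proof.
elim: n => [|n IH]; first by rewrite mulr0n -umk0; apply/umkP/(uT hU) => j; rewrite mulr0n.
by rewrite mulrS IH umkD; apply/umkP/(uT hU) => j; rewrite mulrS.
Qed.

Lemma upower_vle (K : fieldType) (OK : K -> Prop) (J : Type) (U : (J -> Prop) -> Prop) (hU : ultra U)
  (f g : J -> K) : valuation_ring OK ->
  vle (uO (hU := hU) (fun _ : J => OK)) (umk hU f) (umk hU g) <-> U (fun j => vle OK (f j) (g j)).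
Proof. by move=> vK; apply: uO_vle. Qed.

(** The hypotheses on P and z hold in almost every component, and the roots found there by [hensel]
    define one in the ultrapower. *)
Lemma ultra_hensel (K : fieldType) (OK : K -> Prop) (J : Type) (U : (J -> Prop) -> Prop) (hU : ultra U)
  (P : {poly uprod hU (fun _ : J => K)}) z (O := uO (hU := hU) (fun _ : J => OK)) :
  valuation_ring OK -> henselian OK -> P \is monic -> (forall i, O P`_i) -> O z ->
  vlt O P.[z] 1 -> veq O (P^`()).[z] 1 -> exists2 r, root P r & vlt O (r - z) 1.
Proof.
move=> vK hens mP OP Oz Pz P'z.
move: Oz Pz P'z; elim/umk_ind: z => z /uO_mk Oz.
have one : umk hU (fun _ => 1 : K) = 1 := umk1 hU _.
have size_gt0 : (0 < size P)%N by rewrite size_poly_gt0 monic_neq0.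
have coefs : U (fun j => forall i, OK (upoly P j)`_i).
  have := @u_all _ _ hU 'I_(size P) xpredT (fun i j => OK (ufun P`_i j)) (fun i _ => OP i).
  move=> h; apply: (uS hU h) => j hj i; rewrite coef_poly; case: ltnP => hi; last exact: vr0.
  exact: (hj (Ordinal hi)).
have lead : U (fun j => upoly P j \is monic).
  have : lead_coef P = 1 by exact/monicP.
  rewrite -(ufunK (lead_coef P)) -one => /umkP h.
  apply: (uI hU h (upoly_size P)) => j e sj; rewrite monicE lead_coefE sj coef_poly prednK // leqnn.
  by move: e; rewrite lead_coefE => ->.
have deriv : (P^`()).[umk hU z] = umk hU (fun j => ((upoly P j)^`()).[z j]).
  rewrite -{1}(coefK P) horner_deriv_poly.
  under eq_bigr => i _ do rewrite -[P`_i]ufunK umkX umkMn umkM.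
  by rewrite umk_sum; apply/umkP/(uT hU) => j; rewrite /upoly horner_deriv_poly.
rewrite upoly_horner deriv -one => hz [h2 h3].
have {}hz : U (fun j => vlt OK (upoly P j).[z j] 1) by apply/(uN hU) => h; apply: hz; apply/(upower_vle hU _ _ vK).
move/(upower_vle hU _ _ vK): h2 => h2; move/(upower_vle hU _ _ vK): h3 => h3.
have key : U (fun j => exists r, root (upoly P j) r /\ vlt OK (r - z j) 1).
  have c1 := uI hU coefs lead (fun j a b => conj a b).
  have c2 := uI hU Oz hz (fun j a b => conj a b).
  have c3 := uI hU h2 h3 (fun j a b => conj a b).
  have c4 := uI hU c1 c2 (fun j a b => conj a b).
  apply: (uI hU c4 c3) => j [[a1 a2] [a3 a4]] a5.
  by have [r rr rz] := hensel vK hens a2 a1 a3 a4 a5; exists r.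
have Hex j : exists r, (exists r, root (upoly P j) r /\ vlt OK (r - z j) 1) ->
    root (upoly P j) r /\ vlt OK (r - z j) 1.
  by case: (EM (exists r, root (upoly P j) r /\ vlt OK (r - z j) 1)) => [[r hr]|h]; [exists r|exists 0].
have /choice[r hr] : forall j, exists r, (exists r, root (upoly P j) r /\ vlt OK (r - z j) 1) ->
    root (upoly P j) r /\ vlt OK (r - z j) 1 by exact: Hex.
exists (umk hU r).
  by rewrite rootE upoly_horner; apply/eqP/umk_eq0; apply: (uS hU key) => j /hr[/rootP].
rewrite umkN umkD => /(upower_vle hU _ _ vK) h.
by have [j [/hr[_ a] b]] := uE hU (uI hU key h (fun j a b => conj a b)); exact: (a b).
Qed.

Section Realize.
Variables (K L : fieldType) (iota : {rmorphism K -> L}) (OK : K -> Prop) (OL : L -> Prop)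
  (G : zmodType) (le : G -> G -> Prop) (v : L -> G) (k : fieldType) (res : L -> k).
Hypothesis vK : valuation_ring OK.
Hypothesis vL : valuation_ring OL.
Hypothesis ext : extends iota OK OL.
Hypothesis hv : value_group_map OL le v.
Hypothesis hres : residue_map OL res.
Hypothesis ecG : ec_ordered_group le (vK_img iota v).
Hypothesis eck : ec_field (Kv_img iota OK res).
Variables (r s : nat) (x : 'I_r -> L) (y : 'I_s -> L).
Hypothesis x0 : forall i, x i != 0.
Hypothesis Oy : forall i, OL (y i).

Local Notation cond := (K * ('I_r -> nat) * ('I_r -> nat))%type.
(** An equivalence rather than an inequality: a condition records both true and false
    comparisons. *)
Definition value_cond (c : cond) (x' : 'I_r -> K) :=
  vle OL (iota c.1.1 * tmon x c.1.2) (tmon x c.2) <-> vle OK (c.1.1 * tmon x' c.1.2) (tmon x' c.2).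
Definition residue_cond (p : {mpoly K[s]}) (y' : 'I_s -> K) :=
  (forall m, OK p@_m) -> (vlt OL (mmap iota y p) 1 <-> vlt OK p.@[y'] 1).

(** Finitely many comparisons, each with the truth value it has at x, form a quantifier-free formula
    about the values of x with parameters in vK. *)
Lemma realize_values (cs : seq cond) : exists x' : 'I_r -> K,
  (forall i, x' i != 0) /\ forall c, List.In c cs -> value_cond c x'.
Proof.
pose gmon (m : 'I_r -> nat) : gterm G :=
  foldr (fun i t => GAdd (iter (m i) (GAdd (GVar G i)) (GZero G)) t) (GZero G) (enum 'I_r).
have gmonE e m : geval e (gmon m) = \sum_(i < r) e i *+ m i.
  rewrite -[RHS]big_enum /gmon; elim: (enum _) => [|i t IH]; rewrite ?big_nil // big_cons /= IH.
  by congr (_ + _); elim: (m i) => [|n IHn]; rewrite ?mulr0n // mulrS /= IHn.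
have gmonC m : gconsts (vK_img iota v) (gmon m).
  by rewrite /gmon; elim: (enum _) => //= i t IH; split=> //; elim: (m i).
pose atom (c : cond) := QAtom (OLe (gmon c.2) (GAdd (GConst (v (iota c.1.1))) (gmon c.1.2))).
(* The condition with coefficient 0 always holds and must not be turned into an atom, since v 0
   carries no meaning. *)
pose lit (c : cond) := if c.1.1 == 0 then QTrue _ else
  if `[< vle OL (iota c.1.1 * tmon x c.1.2) (tmon x c.2) >] then atom c else QNot (atom c).
pose sat (e : nat -> G) a := match a with
  | OEq t1 t2 => geval e t1 = geval e t2 | OLe t1 t2 => le (geval e t1) (geval e t2) end.
have satE (z : 'I_r -> L) (e : nat -> G) (c : cond) : (forall i, z i != 0) -> (forall i : 'I_r, e i = v (z i)) ->
    c.1.1 != 0 -> qf_holds (sat e) (atom c) <-> vle OL (iota c.1.1 * tmon z c.1.2) (tmon z c.2).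
  move=> z0 ez c0; have ic0 : iota c.1.1 != 0 by rewrite fmorph_eq0.
  have vt m : geval e (gmon m) = v (tmon z m).
    by rewrite gmonE (val_tmon hv) //; apply: eq_bigr => i _; rewrite ez.
  rewrite /= !vt -(valM hv) ?tmon_neq0 //; case: hv => _ _ _ ->; rewrite ?mulf_neq0 ?tmon_neq0 //.
  by rewrite vleP // tmon_neq0.
pose f := foldr (fun c f => QAnd (lit c) f) (QTrue _) cs.
have fE e : qf_holds (sat e) f <-> forall c, List.In c cs -> qf_holds (sat e) (lit c).
  rewrite /f; elim: cs {f} => [|c cs IH] /=; first by [].
  rewrite IH; split=> [[h1 h2] c' [<-//|/h2//]|h]; split; first by apply: h; left.
  by move=> c' hc'; apply: h; right.
have fS : qf_all (fun a : og_atom G => match a with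
    | OEq t1 t2 | OLe t1 t2 => gconsts (vK_img iota v) t1 /\ gconsts (vK_img iota v) t2 end) f.
  rewrite /f; elim: cs {f fE} => //= c cs IH; split=> //; rewrite /lit; case: eqP => // /eqP c0.
  by case: ifP => _ /=; split=> //; split=> //; exists c.1.1.
pose e0 i := if insub i is Some j then v (x j) else 0.
have e0E (i : 'I_r) : e0 i = v (x i) by rewrite /e0 valK.
have [|e [Be /fE he]] := ecG fS.
  exists e0; apply/fE => c _; rewrite /lit; case: eqP => // /eqP c0.
  have S := satE x e0 c x0 e0E c0.
  by case: asboolP => h; [exact/S|move=> h'; apply: h; exact/S].
have /choice[x' hx'] : forall i : 'I_r, exists a, a != 0 /\ v (iota a) = e i by move=> i; exact: Be.
have x'0 i : x' i != 0 by case: (hx' i).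
exists x'; split=> // c /he; rewrite /lit /value_cond.
have tE m : tmon (fun i => iota (x' i)) m = iota (tmon x' m).
  by rewrite rmorph_prod; apply: eq_bigr => i _; rewrite rmorphXn.
have [->|c0] := eqVneq c.1.1 0; first by rewrite rmorph0 !mul0r; split=> _; apply: vle0.
have S := satE (fun i => iota (x' i)) e c _ _ c0.
have {}S : qf_holds (sat e) (atom c) <-> vle OK (c.1.1 * tmon x' c.1.2) (tmon x' c.2).
  rewrite S => [|i|i]; [by rewrite !tE -rmorphM (vle_ext _ _ vK vL ext)|by rewrite fmorph_eq0|by case: (hx' i)].
by case: asboolP => h; [move/S|move=> /= nh; split=> // /S].
Qed.

(** An integral polynomial is small at y exactly when its reduction vanishes at the residues. The
    conditions are thus finitely many equations P and inequations Q over Kv. *)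
Lemma realize_residues (ps : seq {mpoly K[s]}) : exists y' : 'I_s -> K,
  (forall i, OK (y' i)) /\ forall p, List.In p ps -> residue_cond p y'.
Proof.
pose good (p : {mpoly K[s]}) := `[< forall m, OK p@_m >].
pose small (p : {mpoly K[s]}) := `[< vlt OL (mmap iota y p) 1 >].
pose P := [seq reduction iota res p | p <- ps & good p && small p].
pose Q := [seq reduction iota res p | p <- ps & good p && ~~ small p].
pose ybar i := res (y i).
have redE p : (forall m, OK p@_m) -> (reduction iota res p).@[ybar] = 0 <-> vlt OL (mmap iota y p) 1.
  move=> hp; rewrite -(res_mmap vL ext hres) //; apply: (res_eq0 vL hres); exact: OL_mmap.
have [|p|q|z [Sz zP zQ]] := @ec_mpoly k _ eck s P Q ybar.
- move=> q; rewrite mem_cat /P /Q => /orP[] /mapP[p]; rewrite mem_filter => /andP[/andP[/asboolP hp _] _] ->;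
    exact: (reduction_over iota vL hres hp).
- by rewrite /P => /mapP[p']; rewrite mem_filter => /andP[/andP[/asboolP hp /asboolP h] _] ->; apply/redE.
- rewrite /Q => /mapP[p']; rewrite mem_filter => /andP[/andP[/asboolP hp /asboolP h] _] ->.
  by apply/eqP => /(redE _ hp)/h.
have /choice[y' hy'] : forall i, exists a, OK a /\ res (iota a) = z i by exact: Sz.
have Oy' i : OK (y' i) by case: (hy' i).
exists y'; split=> // p pin hp.
have E : mmap iota (fun i => iota (y' i)) p = iota p.@[y'].
  rewrite /mmap mevalE rmorph_sum; apply: eq_bigr => m _; rewrite rmorphM; congr (_ * _).
  by rewrite rmorph_prod; apply: eq_bigr => i _; rewrite rmorphXn.
have H : (reduction iota res p).@[z] = 0 <-> vlt OK p.@[y'] 1.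
  have zE : z = fun i => res (iota (y' i)) by apply/funext => i; case: (hy' i).
  have OE : OL (iota p.@[y']) by rewrite -E; apply: OL_mmap => // i; apply/ext.
  rewrite {1}zE -(res_mmap vL ext hres) => [|i|//]; last by apply/ext.
  by rewrite E (res_eq0 vL hres OE) /vlt -(rmorph1 iota) (vle_ext _ _ vK vL ext).
have inps : p \in ps by elim: (ps) pin => //= a l IH [->|/IH h]; rewrite inE ?eqxx // h orbT.
rewrite -H; case: (boolP (small p)) => [sp|sp].
  split=> // _; last by apply/asboolP.
  by apply: zP; apply/mapP; exists p => //; rewrite mem_filter inps sp !andbT; apply/asboolP.
split=> [h|h]; first by case/negP: sp; apply/asboolP.
suff /eqP : (reduction iota res p).@[z] != 0 by [].
by apply: zQ; apply/mapP; exists p => //; rewrite mem_filter inps sp !andbT; apply/asboolP.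
Qed.

(** Each condition concerns only x or only y, so values and residues can be realized independently
    of each other. The index set consists of candidate pairs, and the ultrafilter contains the
    solution set of every finite system. *)
Theorem realize : exists (J : Type) (U : (J -> Prop) -> Prop) (hU : ultra U)
  (x' : 'I_r -> uprod hU (fun _ : J => K)) (y' : 'I_s -> uprod hU (fun _ : J => K)),
  transfer OK OL (uO (hU := hU) (fun _ => OK)) iota (udiag hU (R := K)) x y x' y'.
Proof.
pose J := (('I_r -> K) * ('I_s -> K))%type; pose I := (seq cond * seq {mpoly K[s]})%type.
pose B (i : I) (j : J) := [/\ forall l, j.1 l != 0, forall l, OK (j.2 l),
  forall c, List.In c i.1 -> value_cond c j.1 & forall p, List.In p i.2 -> residue_cond p j.2].
have [||U [hU UB]] := @ultra_exists I J B ([::], [::]).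
- move=> [c p] [c' p']; exists (c ++ c', p ++ p') => j [h1 h2 h3 h4]; split; split=> //= a ha;
    by [apply: h3; apply/List.in_or_app; auto|apply: h4; apply/List.in_or_app; auto].
- by move=> [c p]; have [x' [? ?]] := realize_values c; have [y' [? ?]] := realize_residues p; exists (x', y').
pose x' i := umk hU (fun j : J => j.1 i); pose y' i := umk hU (fun j : J => j.2 i).
have tE n (z : 'I_n -> J -> K) m : tmon (fun i => umk hU (z i)) m = umk hU (fun j => tmon (fun i => z i j) m).
  rewrite /tmon; elim: (index_enum _) => [|i l IH]; first by rewrite big_nil -umk1; apply/umkP/(uT hU) => j; rewrite big_nil.
  by rewrite big_cons IH umkX umkM; apply/umkP/(uT hU) => j; rewrite big_cons.
exists J, U, hU, x', y'; split.
- exact: uO_valuation.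
- exact: udiag_ext.
- move=> i; apply/eqP => /umk_eq0 h.
  by have [j [[h1 _ _ _] /eqP]] := uE hU (uI hU (UB ([::], [::])) h (fun j a b => conj a b)); rewrite (negPf (h1 i)).
- by move=> i; rewrite /y'; apply/uO_mk; apply: (uS hU (UB ([::], [::]))) => j [].
- move=> c m n.
  have E1 : udiag hU (R := K) c * tmon x' m = umk hU (fun j : J => c * tmon j.1 m).
    by rewrite tE; exact: umkM.
  rewrite E1 tE (upower_vle hU _ _ vK).
  have h : U (fun j => value_cond (c, m, n) j.1).
    by apply: (uS hU (UB ([:: (c, m, n)], [::]))) => j [_ _ h _]; apply: h; left.
  split=> [H|H]; first by apply: (uS hU h) => j [h1 _]; exact: h1.
  by have [j [[_ h1] h2]] := uE hU (uI hU h H (fun j a b => conj a b)); exact: h1.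
- move=> p hp; have h : U (fun j => residue_cond p j.2).
    by apply: (uS hU (UB ([::], [:: p]))) => j [_ _ _ h]; apply: h; left.
  have E : mmap (udiag hU (R := K)) y' p = umk hU (fun j : J => p.@[j.2]).
    rewrite /mmap (eq_bigr (fun m => umk hU (fun j : J => p@_m * tmon j.2 m))) => [|m _]; last first.
      by rewrite -[mmap1 _ _]/(tmon _ _) tE; exact: umkM.
    by rewrite umk_sum; apply/umkP/(uT hU) => j; rewrite mevalE.
  rewrite E /vlt -umk1 (upower_vle hU _ _ vK) -(uN hU); split=> [H|H].
    by apply: (uS hU h) => j /(_ hp)[h1 _]; exact: h1.
  by have [j [/(_ hp)[_ h1] h2]] := uE hU (uI hU h H (fun j a b => conj a b)); exact: h1.
Qed.
End Realize.

(** * A generator of the residually separable extension *)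

Section ResiduePolynomials.
Variables (L : fieldType) (OL : L -> Prop) (k : fieldType) (res : L -> k).
Hypothesis vL : valuation_ring OL.
Hypothesis hres : residue_map OL res.

Lemma res_comb n (e t : 'I_n -> L) : (forall i, OL (e i)) -> (forall i, OL (t i)) ->
  res (\sum_i e i * t i) = \sum_i res (e i) * res (t i).
Proof.
move=> Oe Ot; rewrite (res_sum vL hres) => [|i _]; last exact: vrM.
by apply: eq_bigr => i _; rewrite (resM hres).
Qed.

Lemma res_horner (Q : {poly L}) (q : {poly k}) a : (forall i, OL Q`_i) -> OL a ->
  (forall i, res Q`_i = q`_i) -> res Q.[a] = q.[res a].
Proof.
move=> OQ Oa Qq; have le : (size q <= size Q)%N.
  by apply/leq_sizeP => i hi; rewrite -Qq nth_default // (res0 vL hres).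
rewrite (horner_coef_wide _ le) horner_coef res_comb // => [|i]; last exact: vrX.
by apply: eq_bigr => i _; rewrite Qq (resX vL hres).
Qed.

Lemma res_deriv (Q : {poly L}) (q : {poly k}) : (forall i, OL Q`_i) ->
  (forall i, res Q`_i = q`_i) -> forall i, res (Q^`())`_i = (q^`())`_i.
Proof.
move=> OQ Qq i; rewrite !coef_deriv -Qq; set u := Q`_i.+1.
have Ou : OL u := OQ _.
have On n : OL (u *+ n) by elim: n => [|n IH]; [exact: vr0|rewrite mulrS; exact: vrD].
elim: (i.+1) => [|n IH]; first by rewrite !mulr0n (res0 vL hres).
by rewrite !mulrS (resD hres) ?IH.
Qed.
End ResiduePolynomials.

Section FiniteGenerator.
Variables (K L : fieldType) (iota : {rmorphism K -> L}) (OK : K -> Prop) (OL : L -> Prop)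
  (k : fieldType) (res : L -> k).
Hypotheses (vK : valuation_ring OK) (vL : valuation_ring OL) (ext : extends iota OK OL)
  (hres : residue_map OL res) (hens : henselian OK) (dfl : defectless OK).
Local Notation k0 := (Kv_img iota OK res).
Let hk := Kv_subfield vK vL ext hres.
Variables (r s e : nat) (x : 'I_r -> L) (y : 'I_s -> L) (z : 'I_e -> L).
Hypothesis G : gauss OK OL iota x y.
Hypothesis res_y : alg_indep k0 (fun i => res (y i)).
Local Notation E := (ratT (imK' iota) (glue x y)).
Local Notation F := (ratT (imK' iota) z).
Hypotheses (Fx : forall i, F (x i)) (Fy : forall i, F (y i)) (Ez : forall i, alg E (z i)).
Hypothesis values : forall u, F u -> u != 0 -> exists (c : K) (a : 'I_r -> int),
  c != 0 /\ veq OL u (iota c * \prod_i x i ^ a i).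
Let hY := ratT_subfield (fun i => res (y i)) hk.
Variables (f : nat) (mp : {poly sft hY}) (a0 : L).
Hypotheses (mp_monic : mp \is monic) (mp_size : size mp = f.+1).
Hypotheses (Fa0 : F a0) (Oa0 : OL a0) (zeta0 : res a0 != 0).
Hypotheses (mp_root : root (map_poly val mp) (res a0)) (mp_sep : ~~ root (map_poly val mp)^`() (res a0)).
Hypothesis mp_span : forall w, Fv_img OL res F w -> exists2 c : 'I_f -> k,
  forall i, ratT k0 (fun i => res (y i)) (c i) & w = \sum_i c i * res a0 ^+ i.
Hypothesis mp_indep : forall c : 'I_f -> k, (forall i, ratT k0 (fun i => res (y i)) (c i)) ->
  \sum_i c i * res a0 ^+ i = 0 -> forall i, c i = 0.

Let hE := ratT_subfield (glue x y) (imK_subfield iota).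
Let hF := ratT_subfield z (imK_subfield iota).

Lemma E_F u : E u -> F u.
Proof.
apply: ratT_min => // [w hw|i]; first by apply: ratT_const => //; exact: imK_subfield.
by rewrite /glue; case: split.
Qed.

Lemma integral_lift : exists Q : {poly L}, [/\ forall i, E Q`_i, forall i, OL Q`_i,
  Q \is monic, size Q = f.+1 & forall i, res Q`_i = (map_poly val mp)`_i].
Proof.
have /choice[l hl] : forall i, exists u, [/\ E u, OL u & res u = val mp`_i].
  by move=> i; apply: (residue_fraction_lift vK vL ext hres G); exact: sfvP.
pose Q : {poly L} := \poly_(i < f.+1) (if i == f then 1 else l i).
have Qf : Q`_f = 1 by rewrite coef_poly ltnSn eqxx.
have sQ : size Q = f.+1 by apply: size_poly_eq; rewrite eqxx oner_neq0.
have cQ i : Q`_i = if (i < f)%N then l i else if i == f then 1 else 0.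
  by rewrite coef_poly ltnS leq_eqVlt; case: ltngtP.
exists Q; split=> // [i|i||i].
- rewrite cQ; case: ifP => _; first by case: (hl i).
  by case: ifP => _; [exact: sf1 hE|exact: sf0 hE].
- rewrite cQ; case: ifP => _; first by case: (hl i).
  by case: ifP => _; [exact: vr1|exact: vr0].
- by rewrite monicE lead_coefE sQ Qf.
rewrite cQ coef_map; case: (ltngtP i f) => [lt|gt|->].
- by case: (hl i).
- by rewrite (res0 vL hres) nth_default ?rmorph0 // mp_size.
- have -> : mp`_f = 1 by move/monicP: mp_monic; rewrite lead_coefE mp_size.
  by rewrite (res1 hres); exact: esym (rmorph1 _).
Qed.

(** The stability theorem is applied for the refined ring O1, where x and y are jointly
    value-independent; everything about residues happens in O2. The last clause singles out the
    valuation of F among those above E by the single condition that a is not small. *)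
Theorem finite_generator : exists (W : fieldType) (j : {rmorphism L -> W}) (O : W -> Prop)
  (hW : is_subfield (ratT (imK' (j \o iota)) (fun i => j (glue x y i))))
  (M : fieldExtType (sft hW)) (phi : {rmorphism M -> W}) (bT : (\dim {: M}).-tuple M) (a : M),
  [/\ valuation_ring O /\ extends j OL O,
      (forall c : sft hW, phi c%:A = val c) /\ (forall u, F u -> exists w, phi w = j u),
      basis_of {: M} bT /\ vlt O (phi a - j a0) 1,
      (forall i, O (val (char_poly (mulmat bT a))`_i)) /\
      veq O (map_poly val (char_poly (mulmat bT a))^`()).[phi a] 1 &
      (forall u, exists q : {poly sft hW},
        (map_poly (GRing.in_alg M) (char_poly (mulmat bT a))^`()).[a] * u =
        (map_poly (GRing.in_alg M) q).[a]) /\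
      forall V : M -> Prop, valuation_ring V -> (forall c : sft hW, V c%:A <-> O (val c)) ->
        ~ vlt V a 1 -> forall u, V u <-> O (phi u)].
Proof.
have [W [j [O1 [O2 [cl [vO1 vO2] O12 [ext1 ext2] vi]]]]] :=
  refinement vK vL ext hres (gs_x0 G) (gs_Oy G) (gs_val G) res_y.
pose hW := ratT_subfield (fun i => j (glue x y i)) (imK_subfield (j \o iota)).
set EW := ratT _ _ in hW.
have jE u : E u -> EW (j u).
  apply: (ratT_min (P := fun u => EW (j u))) => [|_ [c ->]|i].
  - split=> [|p q|p q|p]; rewrite ?rmorph1 ?rmorphB ?rmorphM ?fmorphV; [exact: sf1 hW|exact: sfB|exact: sfM|exact: sfV].
  - by apply: ratT_const; [exact: imK_subfield|exists c].
  - exact: (ratT_var (fun i => j (glue x y i)) (imK_subfield (j \o iota)) i).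
have Ej w : EW w -> exists u, E u /\ j u = w.
  apply: (ratT_min (P := fun w => exists u, E u /\ j u = w)) => [|_ [c ->]|i].
  - split=> [|_ _ [p [hp <-]] [q [hq <-]]|_ _ [p [hp <-]] [q [hq <-]]|_ [p [hp <-]]].
    + by exists 1; rewrite rmorph1; split=> //; exact: sf1 hE.
    + by exists (p - q); rewrite rmorphB; split=> //; exact: sfB.
    + by exists (p * q); rewrite rmorphM; split=> //; exact: sfM.
    + by exists p^-1; rewrite fmorphV; split=> //; exact: sfV.
  - by exists (iota c); split=> //; apply: ratT_const; [exact: imK_subfield|exists c].
  - by exists (glue x y i); split=> //; exact: (ratT_var (glue x y) (imK_subfield iota) i).
have vj1 u : vlt O2 (j u) 1 <-> vlt OL u 1 by rewrite /vlt -(rmorph1 j) (vle_ext _ _ vL vO2 ext2).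
have vje u w : veq O2 (j u) (j w) <-> veq OL u w by rewrite /veq !(vle_ext _ _ vL vO2 ext2).
have [|M [phi [phi0 hphi gen]]] := @generated_extension (sft hW) W val [seq j (z i) | i <- enum 'I_e].
  move=> _ /mapP[i _ ->]; apply/algE; have [p [p0 hp pz]] := Ez i.
  by exists (map_poly j p); rewrite map_poly_eq0 fmorph_root; split=> // l; rewrite coef_map; exact: jE.
have inF u : exists u', F u' /\ j u' = phi u.
  apply: (gen (fun w => exists u', F u' /\ j u' = w)) => [|c|_ /mapP[i _ ->]].
  - split=> [|_ _ [p [hp <-]] [q [hq <-]]|_ _ [p [hp <-]] [q [hq <-]]|_ [p [hp <-]]].
    + by exists 1; rewrite rmorph1; split=> //; exact: sf1 hF.
    + by exists (p - q); rewrite rmorphB; split=> //; exact: sfB.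
    + by exists (p * q); rewrite rmorphM; split=> //; exact: sfM.
    + by exists p^-1; rewrite fmorphV; split=> //; exact: sfV.
  - by have [u' [/E_F Fu Eu]] := Ej _ (sfvP c); exists u'.
  - by exists (z i); split=> //; exact: (ratT_var z (imK_subfield iota) i).
have onto u : F u -> exists w, phi w = j u.
  apply: (ratT_min (P := fun u => exists w, phi w = j u)) => [|_ [c ->]|i].
  - split=> [|p q [p' hp] [q' hq]|p q [p' hp] [q' hq]|p [p' hp]].
    + by exists 1; rewrite !rmorph1.
    + by exists (p' - q'); rewrite !rmorphB hp hq.
    + by exists (p' * q'); rewrite !rmorphM hp hq.
    + by exists p'^-1; rewrite !fmorphV hp.
  - have Ec : E (iota c) by apply: ratT_const; [exact: imK_subfield|exists c].
    by have [c' Ec'] := sfv_ex hW (jE _ Ec); exists c'%:A; rewrite phi0.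
  - by apply: hphi; apply/mapP; exists i; rewrite ?mem_enum.
pose b := vbasis {: M}; have hb : basis_of {: M} b := vbasisP _.
have [g [chi [hchi chi_root]]] := embed_finite hb cl (val : {rmorphism sft hW -> W}).
(* The inclusion phi is added as index 0, so that the given valuation of F is among those considered
   and has a name. *)
pose chi' (i : 'I_g.+1) := if unlift ord0 i is Some t then chi t else phi.
have hchi' t : over (val : sft hW -> W) (chi' t).
  by rewrite /chi'; case: unliftP => [i _|_] //; exact: hchi.
have chi_root' u w : root (map_poly val (char_poly (mulmat b u))) w -> exists t, chi' t u = w.
  by move=> /chi_root[t ht]; exists (lift ord0 t); rewrite /chi' liftK.
have chi0 : chi' ord0 = phi by rewrite /chi' unlift_none.
have [fb [ofb1 fb0]] := stability vK vO1 ext1 hens dfl cl vi hb hchi' chi_root'.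
(* Orthogonality consists of inequalities for O1, which remain true in the larger ring O2. *)
have ofb : orth O2 EW (fun l => emb chi' (fb l)).
  move=> c hc i t; have [t' ht'] := ofb1 c hc i t; exists t'.
  by case: ht' => o /O12 Oo ->; exists o.
have Oja0 : O2 (j a0) by apply/ext2.
have [a0M Ea0M] := onto _ Fa0.
have a01 : veq O2 (chi' ord0 a0M) 1.
  by rewrite chi0 Ea0M -(rmorph1 j); apply/vje/(res_neq0 vL hres Oa0).
have [a aclose asmall] := residue_lift vO2 hchi' a01.
have vtriv u : u != 0 -> exists2 c : sft hW, c != 0 & veq O2 (chi' ord0 u) (val c).
  rewrite chi0 => u0; have [u' [Fu' Eu']] := inF u.
  have u'0 : u' != 0 by have := u0; rewrite -(fmorph_eq0 phi) -Eu' fmorph_eq0.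
  have [c [m [c0 hc]]] := values Fu' u'0.
  have Ec : E (iota c * \prod_i x i ^ m i).
    apply: sfM => //; first by apply: ratT_const; [exact: imK_subfield|exists c].
    apply: sf_prod => // i _; have Ex : E (x i).
      have -> : x i = glue x y (lshift s i) by rewrite /glue -[lshift s i]/(unsplit (inl i)) unsplitK.
      exact: (ratT_var (glue x y) (imK_subfield iota)).
    by case: (m i) => n; [exact: sfX|apply: sfV => //; exact: sfX].
  have [c' Ec'] := sfv_ex hW (jE _ Ec); exists c'.
    apply/eqP => c'0; move/eqP: Ec'; rewrite c'0 rmorph0 eq_sym fmorph_eq0 mulf_eq0 fmorph_eq0 (negPf c0) /=.
    by apply/negP/prodf_neq0 => i _; exact: expfz_neq0 (gs_x0 G i).
  by rewrite Ec' -Eu'; apply/vje.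
have [Q [EQ OQ mQ sQ rQ]] := integral_lift.
have hEQ i : EW (map_poly j Q)`_i by rewrite coef_map; exact: jE.
have [q Eq] := sf_poly hW hEQ.
have mq : q \is monic by rewrite -(map_monic (val : {rmorphism sft hW -> W})) Eq monic_map.
have sq : size q = f.+1 by rewrite -(size_map_poly (val : {rmorphism sft hW -> W})) Eq size_map_poly.
have Oq i : O2 (val q`_i).
  by rewrite -(coef_map (val : {rmorphism sft hW -> W})) Eq coef_map; apply/ext2.
have rQa : res Q.[a0] = 0 by rewrite (res_horner vL hres OQ Oa0 rQ); exact/rootP.
have OQa : OL Q.[a0] by exact: horner_vr.
have ODQ i : OL (Q^`())`_i by exact: deriv_vr.
have h_root : vlt O2 (map_poly val q).[chi' ord0 a0M] 1.
  by rewrite chi0 Ea0M Eq horner_map; apply/vj1/(res_eq0 vL hres OQa).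
have h_simple : veq O2 (map_poly val q^`()).[chi' ord0 a0M] 1.
  rewrite chi0 Ea0M -deriv_map Eq deriv_map horner_map -(rmorph1 j); apply/vje/(res_neq0 vL hres).
    exact: horner_vr.
  by rewrite (res_horner vL hres ODQ Oa0 (res_deriv vL hres OQ rQ)).
have h_span u : O2 (chi' ord0 u) -> exists2 c : 'I_f -> sft hW,
    forall i, O2 (val (c i)) & vlt O2 (chi' ord0 u - \sum_i val (c i) * chi' ord0 a0M ^+ i) 1.
  rewrite chi0 Ea0M => Ou; have [u' [Fu' Eu']] := inF u.
  have Ou' : OL u' by apply/ext2; rewrite Eu'.
  have [c k1c Ec] := mp_span (ex_intro _ u' (And3 Fu' Ou' erefl)).
  have /choice[l hl] : forall i, exists w, [/\ E w, OL w & res w = c i].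
    by move=> i; exact: (residue_fraction_lift vK vL ext hres G (k1c i)).
  have Ol i : OL (l i) by case: (hl i).
  have /choice[d hd] : forall i, exists w : sft hW, val w = j (l i).
    by move=> i; apply: sfv_ex; apply: jE; case: (hl i).
  exists d => [i|]; first by rewrite hd; apply/ext2.
  have -> : phi u - \sum_i val (d i) * j a0 ^+ i = j (u' - \sum_i l i * a0 ^+ i).
    by rewrite rmorphB Eu' rmorph_sum; congr (_ - _); apply: eq_bigr => i _; rewrite hd rmorphM rmorphXn.
  have Oa i : OL (a0 ^+ i) by exact: vrX.
  have Os : OL (\sum_i l i * a0 ^+ i) by apply: vr_sum => // i _; exact: vrM.
  apply/vj1/(res_eq vL hres Ou' Os); rewrite Ec (res_comb vL hres) //.
  by apply: eq_bigr => i _; rewrite (resX vL hres) //; case: (hl i) => _ _ ->.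
have h_indep (c : 'I_f -> sft hW) : (forall i, O2 (val (c i))) ->
    vlt O2 (\sum_i val (c i) * chi' ord0 a0M ^+ i) 1 -> forall i, vlt O2 (val (c i)) 1.
  rewrite chi0 Ea0M => Oc.
  have /choice[l hl] : forall i, exists w, E w /\ j w = val (c i) by move=> i; apply: Ej; exact: sfvP.
  have Ol i : OL (l i) by apply/ext2; case: (hl i) => _ ->.
  have -> : \sum_i val (c i) * j a0 ^+ i = j (\sum_i l i * a0 ^+ i).
    by rewrite rmorph_sum; apply: eq_bigr => i _; rewrite rmorphM rmorphXn; case: (hl i) => _ ->.
  have Oa i : OL (a0 ^+ i) by exact: vrX.
  have Os : OL (\sum_i l i * a0 ^+ i) by apply: vr_sum => // i _; exact: vrM.
  move=> /vj1/(res_eq0 vL hres Os); rewrite (res_comb vL hres) // => e0 i.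
  have k1l i' : ratT k0 (fun i => res (y i)) (res (l i')).
    by apply: (residue_fraction vK vL ext hres G) => //; case: (hl i').
  have [_ <-] := hl i; apply/vj1/(res_eq0 vL hres (Ol i)); apply: (mp_indep k1l).
  by rewrite -[RHS]e0; apply: eq_bigr => i' _; rewrite (resX vL hres).
have [bT [hbT OP P'a gena]] := simple_generator vO2 cl hchi' chi_root' vtriv ofb fb0 mq sq Oq a01
  h_root h_simple h_span h_indep aclose asmall.
exists W, j, O2, hW, M, phi, bT, a; split=> //.
- by split=> //; rewrite -Ea0M -chi0 -rmorphB.
- by split=> //; rewrite -chi0.
split=> // V vV hV na u; have [t ht] := vring_all vO2 cl hb hchi' chi_root' vV hV.
(* Were the ring of index t different from that of phi, a would be small for it by the choice of
   a. *)
have sm : same O2 chi' ord0 t.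
  apply: contrapT => ns; apply: na; have := asmall t ns.
  rewrite -(rmorph1 (chi' t)) (vring_vlt vO2) /vlt => h [o /ht Vo Eo]; apply: h; by exists o.
by rewrite ht; have := sm u; rewrite /vring chi0.
Qed.
End FiniteGenerator.

(** * The embedding over the ultrapower *)

Section TransferMorphism.
Variables (K L W R' : fieldType) (iota : {rmorphism K -> L}) (OK : K -> Prop) (OL : L -> Prop).
Hypotheses (vK : valuation_ring OK) (vL : valuation_ring OL).
Variables (r s : nat) (x : 'I_r -> L) (y : 'I_s -> L).
Hypothesis G : gauss OK OL iota x y.
Variables (O' : R' -> Prop) (j' : {rmorphism K -> R'}) (x' : 'I_r -> R') (y' : 'I_s -> R').
Hypothesis Tr : transfer OK OL O' iota j' x y x' y'.
Variables (j : {rmorphism L -> W}) (O : W -> Prop).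
Hypotheses (vO : valuation_ring O) (ext : extends j OL O).
Local Notation T := (glue x y).
Local Notation T' := (glue x' y').
Variable hW : is_subfield (ratT (imK' (j \o iota)) (fun i => j (T i))).
Local Notation F0 := (sft hW).

Lemma mmap_comp n (t : 'I_n -> L) (p : {mpoly K[n]}) :
  mmap (j \o iota) (fun i => j (t i)) p = j (mmap iota t p).
Proof.
rewrite rmorph_sum; apply: eq_bigr => m _; rewrite rmorphM; congr (_ * _).
by rewrite rmorph_prod; apply: eq_bigr => i _; rewrite rmorphXn.
Qed.

Lemma fraction_ex (c : F0) : exists p q : {mpoly K[r + s]}, q != 0 /\
  val c = j (mmap iota T p / mmap iota T q).
Proof.
have /ratT_mmap[p [q []]] := sfvP c; rewrite !mmap_comp fmorph_eq0 => q0 ->.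
exists p, q; split; last by rewrite fmorph_div.
by apply: contraNneq q0 => ->; rewrite rmorph0.
Qed.

Let nz q : q != 0 -> mmap iota T q != 0.
Proof. by move=> q0; apply: contraNneq q0 => /(gauss_eq0 vK G (transfer_refl G)) ->. Qed.
Let nz' q : q != 0 -> mmap j' T' q != 0.
Proof. exact: (transfer_neq0 vK G Tr). Qed.

(** An element of E is written as a fraction p(T)/q(T) and sent to p(T')/q(T'). Independence of T
    makes the result independent of the fraction, and that of T' keeps the denominator nonzero. *)
Definition transfer_fun (c : F0) : R' :=
  let h := cid (fraction_ex c) in let h' := cid (svalP h) in
  mmap j' T' (sval h) / mmap j' T' (sval h').

Lemma transfer_funE c p q : q != 0 -> val c = j (mmap iota T p / mmap iota T q) ->
  transfer_fun c = mmap j' T' p / mmap j' T' q.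
Proof.
rewrite /transfer_fun; case: (cid _) => p1 /= h; case: (cid _) => q1 /= [q10 ->] q0 /fmorph_inj E.
have /eqP : mmap iota T (p1 * q - p * q1) = 0.
  rewrite rmorphB !rmorphM /=; apply/eqP; rewrite subr_eq0; apply/eqP.
  apply: (mulIf (invr_neq0 (nz q10))); apply: (mulIf (invr_neq0 (nz q0))).
  move/eqP: E; rewrite (eqr_div _ _ (nz q10) (nz q0)) => /eqP E.
  by rewrite E.
move=> /eqP/(gauss_eq0 vK G (transfer_refl G))/eqP; rewrite subr_eq0 => /eqP e.
have := congr1 (mmap j' T') e; rewrite !rmorphM /= => e'.
apply: (mulIf (nz' q0)); apply: (mulIf (nz' q10)); rewrite divfK ?nz' //.
by rewrite mulrAC divfK ?nz' // e'.
Qed.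

Lemma transfer_fun_zmod : zmod_morphism transfer_fun.
Proof.
move=> c d; have [p [q [q0 Ec]]] := fraction_ex c; have [p1 [q1 [q10 Ed]]] := fraction_ex d.
rewrite (transfer_funE q0 Ec) (transfer_funE q10 Ed).
rewrite (@transfer_funE _ (p * q1 - p1 * q) (q * q1)); first 1 last.
- exact: mulf_neq0.
- transitivity (val c - val d); first exact: rmorphB.
  rewrite /= Ec Ed -rmorphB; congr (j _); rewrite rmorphB !rmorphM /=.
  by have := nz q0; have := nz q10; set a := mmap _ _ q1; set b := mmap _ _ q => a0 b0; field; rewrite a0 b0.
rewrite rmorphB !rmorphM /=.
by have := nz' q0; have := nz' q10; set a := mmap _ _ q1; set b := mmap _ _ q => a0 b0; field; rewrite a0 b0.
Qed.

Lemma transfer_fun_monoid : monoid_morphism transfer_fun.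
Proof.
split=> [|c d].
  rewrite (@transfer_funE _ 1 1) ?oner_neq0 //; first by rewrite divff // nz' ?oner_neq0.
  by rewrite divff ?nz ?oner_neq0 // rmorph1; exact: rmorph1.
have [p [q [q0 Ec]]] := fraction_ex c; have [p1 [q1 [q10 Ed]]] := fraction_ex d.
rewrite (transfer_funE q0 Ec) (transfer_funE q10 Ed).
rewrite (@transfer_funE _ (p * p1) (q * q1)); first 1 last.
- exact: mulf_neq0.
- transitivity (val c * val d); first exact: rmorphM.
  rewrite /= Ec Ed -rmorphM; congr (j _); rewrite !rmorphM /=.
  by have := nz q0; have := nz q10; set a := mmap _ _ q1; set b := mmap _ _ q => a0 b0; field; rewrite a0 b0.
rewrite !rmorphM /=.
by have := nz' q0; have := nz' q10; set a := mmap _ _ q1; set b := mmap _ _ q => a0 b0; field; rewrite a0 b0.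
Qed.

Definition transfer_morphism : {rmorphism F0 -> R'} := HB.pack transfer_fun
  (GRing.isZmodMorphism.Build _ _ _ transfer_fun_zmod) (GRing.isMonoidMorphism.Build _ _ _ transfer_fun_monoid).

Lemma transfer_fun_const (c : F0) a : val c = j (iota a) -> transfer_fun c = j' a.
Proof.
have mm1 (R : fieldType) (i : {rmorphism K -> R}) (t : 'I_(r + s) -> R) : mmap i t 1 = 1.
  exact: rmorph1.
move=> Ec; have h : val c = j (mmap iota T a%:MP / mmap iota T 1) by rewrite mmapC mm1 divr1.
by rewrite (transfer_funE (oner_neq0 _) h) mmapC mm1 divr1.
Qed.

Lemma transfer_fun_ring c : O' (transfer_fun c) <-> O (val c).
Proof.
have [p [q [q0 Ec]]] := fraction_ex c; rewrite (transfer_funE q0 Ec) Ec ext.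
rewrite -(vleP O' _ (nz' q0)) -(vleP OL _ (nz q0)); apply: iff_sym.
exact: (transfer_vle vK G Tr).
Qed.
End TransferMorphism.

Section Widen.
Variables (K : fieldType) (s : nat).

(** Polynomials in y are regarded as polynomials in y and a0, the family for which the residue
    conditions are transferred. *)
Definition widen (p : {mpoly K[s]}) : {mpoly K[s + 1]} :=
  \sum_(m <- msupp p) p@_m *: 'X_[[multinom glue m (fun _ : 'I_1 => 0%N) i | i < s + 1]].

Lemma widen_mmap (R : fieldType) (j : {rmorphism K -> R}) (y : 'I_(s + 1) -> R) p :
  mmap j y (widen p) = mmap j (fun i => y (lshift 1 i)) p.
Proof.
rewrite rmorph_sum; apply: eq_bigr => m _; rewrite /= mmapZ mmapX; congr (_ * _).
rewrite /mmap1 big_split_ord /= big_ord1 mnmE /glue -[rshift s _]/(unsplit (inr _)) unsplitK expr0 mulr1.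
by apply: eq_bigr => i _; rewrite mnmE -[lshift 1 i]/(unsplit (inl i)) unsplitK.
Qed.

Lemma widen_integral (OK : K -> Prop) p : valuation_ring OK -> (forall m, OK p@_m) ->
  forall m, OK (widen p)@_m.
Proof.
move=> vK hp m; rewrite /widen raddf_sum /=; apply: vr_sum => // n _.
by rewrite mcoeffZ mcoeffX; case: eqP => _; rewrite ?mulr1 ?mulr0 //; exact: vr0.
Qed.
End Widen.

Lemma unit_approx (R : fieldType) (O : R -> Prop) a b c : valuation_ring O ->
  veq O b 1 -> vlt O (a * b - c) 1 -> vlt O a 1 <-> vlt O c 1.
Proof.
move=> vO b1 h; have b0 : b != 0 by apply: (veq_neq0 (veq_sym b1)); exact: oner_neq0.
have -> : vlt O a 1 <-> vlt O (a * b) 1.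
  rewrite -(vltM2rE vO _ _ b0) mul1r; split=> H; first exact: vlt_veqr H b1.
  exact: vlt_veqr H (veq_sym b1).
split=> H; first by rewrite -[c](subKr (a * b)); exact: vltB.
by rewrite -[a * b](subrK c); exact: vltD.
Qed.

Section Embedding.
Variables (K L W R' : fieldType) (iota : {rmorphism K -> L}) (OK : K -> Prop) (OL : L -> Prop).
Hypotheses (vK : valuation_ring OK) (vL : valuation_ring OL).
Variables (r s : nat) (x : 'I_r -> L) (y : 'I_s -> L) (a0 : L).
Hypotheses (G : gauss OK OL iota x y) (Oa0 : OL a0).
Local Notation yp := (glue y (fun _ : 'I_1 => a0)).
Variables (O' : R' -> Prop) (j' : {rmorphism K -> R'}) (x' : 'I_r -> R') (yp' : 'I_(s + 1) -> R').
Hypothesis Trp : transfer OK OL O' iota j' x yp x' yp'.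
Let y' i := yp' (lshift 1 i).
Let zeta := yp' (rshift s 0).
Variables (j : {rmorphism L -> W}) (O : W -> Prop).
Hypotheses (vO : valuation_ring O) (ext : extends j OL O).
Variable hW : is_subfield (ratT (imK' (j \o iota)) (fun i => j (glue x y i))).
Local Notation F0 := (sft hW).
Let vO' : valuation_ring O' := tr_vr Trp.

Let ypE : (fun i => yp (lshift 1 i)) = y.
Proof. by apply/funext => i; rewrite /glue -[lshift 1 i]/(unsplit (inl i)) unsplitK. Qed.
Let ypz : yp (rshift s 0) = a0.
Proof. by rewrite /glue -[rshift s _]/(unsplit (inr _)) unsplitK. Qed.

Lemma transfer_restrict : transfer OK OL O' iota j' x y x' y'.
Proof.
split; [exact: vO'|exact: (tr_ext Trp)|exact: (tr_x0 Trp)|move=> i; exact: (tr_Oy Trp)|exact: (tr_val Trp)|].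
move=> p hp; have := tr_res Trp (widen_integral vK hp); by rewrite !widen_mmap ypE.
Qed.
Let Tr := transfer_restrict.

Definition theta : {rmorphism F0 -> R'} := transfer_morphism vK G Tr hW.
Let ev (p : {mpoly K[s + 1]}) := mmap iota yp p.
Let ev' (p : {mpoly K[s + 1]}) := mmap j' yp' p.
Let Oyp i : OL (yp i).
Proof. by rewrite /glue; case: split => // l; exact: (gs_Oy G). Qed.
Let Oev p : (forall m, OK p@_m) -> OL (ev p).
Proof. by apply: OL_mmap => //; exact: (gs_ext G). Qed.
Let Oev' p : (forall m, OK p@_m) -> O' (ev' p).
Proof. by apply: OL_mmap; [exact: vO'|exact: (tr_ext Trp)|exact: (tr_Oy Trp)]. Qed.
Let vj1 u : vlt O (j u) 1 <-> vlt OL u 1.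
Proof. by rewrite /vlt -(rmorph1 j) (vle_ext _ _ vL vO ext). Qed.

Lemma coef_approx (c : F0) : O (val c) -> exists A B : {mpoly K[s + 1]},
  [/\ forall m, OK A@_m, forall m, OK B@_m, veq OL (ev B) 1 /\ veq O' (ev' B) 1,
      vlt O (val c * j (ev B) - j (ev A)) 1 & vlt O' (theta c * ev' B - ev' A) 1].
Proof.
move=> Oc; have [p [q [q0 Ec]]] := fraction_ex c.
have nq : mmap iota (glue x y) q != 0 by apply: contraNneq q0 => /(gauss_eq0 vK G (transfer_refl G)) ->.
have nq' : mmap j' (glue x' y') q != 0 := transfer_neq0 vK G Tr q0.
have pq : vle OL (mmap iota (glue x y) p) (mmap iota (glue x y) q).
  by apply/vleP => //; apply/ext; rewrite -Ec.
have [A [B [OA OB [B1 B1'] h h']]] := gauss_residue vK G Tr q0 pq.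
exists (widen A), (widen B); rewrite /ev /ev' !widen_mmap ypE; split=> //.
- exact: widen_integral.
- exact: widen_integral.
- rewrite Ec -rmorphM -rmorphB; apply/vj1; apply/(vltM2lE vL _ _ nq).
  by rewrite mulr1 mulrBr mulrA mulrCA divff // mulr1.
- rewrite /theta /= (transfer_funE vK G Tr q0 Ec); apply/(vltM2lE vO' _ _ nq').
  by rewrite mulr1 mulrBr mulrA mulrCA divff // mulr1.
Qed.

(** Up to small terms, Q(a0) is a quotient q/B of integral polynomials over K in y and a0 with B a
    unit, and the same q and B work for the copies. Whether Q(a0) is small is thus a condition on
    residues that [tr_res] transfers. *)
Lemma poly_approx (Q : {poly F0}) : (forall i, O (val Q`_i)) -> exists q B : {mpoly K[s + 1]},
  [/\ forall m, OK q@_m, forall m, OK B@_m, veq OL (ev B) 1 /\ veq O' (ev' B) 1,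
      vlt O ((map_poly val Q).[j a0] * j (ev B) - j (ev q)) 1 &
      vlt O' ((map_poly theta Q).[zeta] * ev' B - ev' q) 1].
Proof.
have OK1 m : OK ((1 : {mpoly K[s + 1]})@_m) by rewrite mcoeff1; case: eqP => _; [exact: vr1|exact: vr0].
have OKM (p q : {mpoly K[s + 1]}) : (forall m, OK p@_m) -> (forall m, OK q@_m) -> forall m, OK (p * q)@_m.
  move=> hp hq m; rewrite mcoeffM; apply: vr_sum => // i _; exact: vrM.
elim/poly_ind: Q => [_|Q c IH OQ].
  exists 0, 1; rewrite /ev /ev' !rmorph0 !rmorph1 !horner0 !mul0r !subr0; split=> //.
  - by move=> m; rewrite mcoeff0; exact: vr0.
  - by split; exact: veq_refl.
  - by apply/(vlt0 vO); exact: oner_neq0.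
  - by apply/(vlt0 vO'); exact: oner_neq0.
have [|q [B [Oq OB [B1 B1'] h h']]] := IH.
  by move=> i; have := OQ i.+1; rewrite coefD coefMX coefC /= addr0.
have [|A [C [OA OC [C1 C1'] hc hc']]] := @coef_approx c.
  by have := OQ 0%N; rewrite coefD coefMX coefC /= add0r.
exists (q * C * 'X_(rshift s 0) + B * A), (B * C).
have OZ m : OK (('X_(rshift s 0) : {mpoly K[s + 1]})@_m).
  by rewrite mcoeffX; case: eqP => _; [exact: vr1|exact: vr0].
have Z : ev 'X_(rshift s 0) = a0 by rewrite /ev mmapX mmap1U ypz.
have Z' : ev' 'X_(rshift s 0) = zeta by rewrite /ev' mmapX mmap1U.
have Oz' : O' zeta := tr_Oy Trp _.
have hornS (S : fieldType) (f : {rmorphism F0 -> S}) z :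
    (map_poly f (Q * 'X + c%:P)).[z] = (map_poly f Q).[z] * z + f c.
  have -> : map_poly f (Q * 'X + c%:P) = map_poly f Q * 'X + (f c)%:P.
    by rewrite rmorphD rmorphM; congr (_ * _ + _); [exact: map_polyX|exact: map_polyC].
  by rewrite !hornerE.
have small (S : fieldType) (V : S -> Prop) (vV : valuation_ring V) (Qz c1 z b e1 q1 a1 : S) :
    V z -> V b -> V e1 -> vlt V (Qz * b - q1) 1 -> vlt V (c1 * e1 - a1) 1 ->
    vlt V ((Qz * z + c1) * (b * e1) - (q1 * e1 * z + b * a1)) 1.
  move=> Oz Ob Oe h1 h2.
  have -> : (Qz * z + c1) * (b * e1) - (q1 * e1 * z + b * a1) =
     (Qz * b - q1) * (e1 * z) + (c1 * e1 - a1) * b by ring.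
  by apply: vltD => //; apply: vlt_prod1 => //; exact: vrM.
split.
- by move=> m; rewrite mcoeffD; apply: vrD => //; [apply: (OKM) => //; apply: (OKM)|apply: (OKM)].
- exact: OKM.
- rewrite /ev /ev' !rmorphM; split; rewrite -[X in veq _ _ X]mulr1; exact: veqM.
- rewrite hornS.
  have -> : ev (q * C * 'X_(rshift s 0) + B * A) = ev q * ev C * a0 + ev B * ev A.
    by rewrite -Z /ev rmorphD !rmorphM.
  have -> : ev (B * C) = ev B * ev C by rewrite /ev rmorphM.
  rewrite rmorphD !rmorphM /=; apply: small => //; apply/ext => //; exact: Oev.
- rewrite hornS.
  have -> : ev' (q * C * 'X_(rshift s 0) + B * A) = ev' q * ev' C * zeta + ev' B * ev' A.
    by rewrite -Z' /ev' rmorphD !rmorphM.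
  have -> : ev' (B * C) = ev' B * ev' C by rewrite /ev' rmorphM.
  by apply: small => //; exact: Oev'.
Qed.

Lemma poly_small (Q : {poly F0}) : (forall i, O (val Q`_i)) ->
  vlt O (map_poly val Q).[j a0] 1 <-> vlt O' (map_poly theta Q).[zeta] 1.
Proof.
move=> /poly_approx[q [B [Oq OB [B1 B1'] h h']]].
have jB : veq O (j (ev B)) 1 by rewrite -(rmorph1 j) /veq !(vle_ext _ _ vL vO ext).
rewrite (unit_approx vO jB h) vj1 (unit_approx vO' B1' h').
exact: (tr_res Trp Oq).
Qed.

Variables (M : fieldExtType F0) (phi : {rmorphism M -> W}) (b : (\dim {: M}).-tuple M) (a : M).
Local Notation P := (char_poly (mulmat b a)).
Hypotheses (phi0 : forall c : F0, phi c%:A = val c) (hb : basis_of {: M} b).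
Hypotheses (a_close : vlt O (phi a - j a0) 1) (OP : forall i, O (val P`_i))
  (P'a : veq O (map_poly val P^`()).[phi a] 1).
Hypothesis gen : forall u, exists q : {poly F0},
  (map_poly (GRing.in_alg M) P^`()).[a] * u = (map_poly (GRing.in_alg M) q).[a].
Hypothesis unique : forall V : M -> Prop, valuation_ring V -> (forall c : F0, V c%:A <-> O (val c)) ->
  ~ vlt V a 1 -> forall u, V u <-> O (phi u).
Hypothesis a0_unit : veq OL a0 1.
Hypothesis hensel' : forall (Q : {poly R'}) z, Q \is monic -> (forall i, O' Q`_i) -> O' z ->
  vlt O' Q.[z] 1 -> veq O' (Q^`()).[z] 1 -> exists2 t, root Q t & vlt O' (t - z) 1.

(** The residual conditions on P at a0 hold for its transferred image at zeta, so Hensel's lemma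
    gives a root t, and a can be sent to it. The image of F stays in the ultrapower because P'(t) is
    nonzero and P'(a) u is a polynomial in a. *)
Theorem ultrapower_embedding : exists (S : fieldType) (J : {rmorphism R' -> S}) (chi : {rmorphism M -> S}),
  [/\ forall u, exists t, J t = chi u, forall c, chi c%:A = J (theta c) &
      forall u t, J t = chi u -> O' t <-> O (phi u)].
Proof.
have Oja0 : O (j a0) by apply/ext.
have Ophi : O (phi a) by rewrite -[phi a](subrK (j a0)); apply: vrD => //; exact: vlt1_vr.
have thO c : O' (theta c) <-> O (val c) := transfer_fun_ring vK G Tr ext c.
have Pphi : (map_poly val P).[phi a] = 0.
  by apply/rootP; apply: over_root => // c; exact: phi0.
have OP' i : O (map_poly val P)`_i by rewrite coef_map; exact: OP.
have hm : vlt O (j a0 - phi a) 1 by rewrite -opprB; exact: vltN.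
have P0 : vlt O (map_poly val P).[j a0] 1.
  by have := horner_close vO OP' Oja0 Ophi hm; rewrite Pphi subr0.
have ODP i : O (val (P^`())`_i).
  by have := deriv_vr vO OP' i; rewrite deriv_map coef_map.
have ODP' i : O (map_poly val P^`())`_i by rewrite coef_map; exact: ODP.
have P1 : ~ vlt O (map_poly val P^`()).[j a0] 1.
  move=> h; have := horner_close vO ODP' Ophi Oja0 a_close => h'.
  case: P'a => _; suff : vlt O (map_poly val P^`()).[phi a] 1 by [].
  by rewrite -[X in vlt _ X _](subrK (map_poly val P^`()).[j a0]); exact: vltD.
pose Q := map_poly theta P.
have mQ : Q \is monic by rewrite map_monic char_poly_monic.
have OQ i : O' Q`_i by rewrite coef_map; apply/thO.
have Oz : O' zeta := tr_Oy Trp _.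
have z1 : ~ vlt O' zeta 1.
  have h := @tr_res _ _ _ _ _ _ _ _ _ _ _ _ _ _ Trp 'X_(rshift s 0) _.
  move=> hz; have : vlt OL (mmap iota yp 'X_(rshift s 0)) 1.
    apply/h; last by rewrite mmapX mmap1U.
    by move=> m; rewrite mcoeffX; case: eqP => _; [exact: vr1|exact: vr0].
  by rewrite mmapX mmap1U ypz; case: a0_unit => _ h2 h1; exact: h1.
have ODQ i : O' (Q^`())`_i by exact: deriv_vr.
have [t rt tz] : exists2 t, root Q t & vlt O' (t - zeta) 1.
  apply: hensel' => //; first by apply/(poly_small OP).
  split; first by apply/vle1; apply: horner_vr.
  case: (vleVlt O' 1 (Q^`()).[zeta]) => // h; case: P1; apply/(poly_small ODP).
  by rewrite -deriv_map.
have Ot : O' t by rewrite -[t](subrK zeta); apply: vrD => //; exact: vlt1_vr.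
have t1 : ~ vlt O' t 1.
  move=> h; apply: z1; rewrite -[zeta](subKr t); exact: vltB.
have Q't : (Q^`()).[t] != 0.
  apply/eqP => e; have h := horner_close vO' ODQ Ot Oz tz; case: P1; apply/(poly_small ODP).
  by rewrite -deriv_map; move: h; rewrite e sub0r => /(vltN vO'); rewrite opprK.
(* Embeddings are constructed into algebraically closed fields; hence the detour through S, from
   which [onto] returns to R'. *)
have [S [J cl]] := exists_alg_closure R'.
have [OS vS extS] := valuation_extends J vO'.
have rP : root (map_poly (J \o theta) P) (J t) by rewrite map_poly_comp fmorph_root.
have [chi hchi chia] := embed_root hb cl rP.
have chi_poly (q : {poly F0}) : chi (map_poly (GRing.in_alg M) q).[a] = J (map_poly theta q).[t].
  rewrite -!horner_map chia -!map_poly_comp; congr (_.[_]); apply: eq_map_poly => c /=; exact: hchi.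
have onto u : exists w, J w = chi u.
  have [q Eq] := gen u; have := congr1 chi Eq; rewrite rmorphM !chi_poly => E.
  exists ((map_poly theta q).[t] / (Q^`()).[t]); rewrite fmorph_div -E /Q deriv_map mulrC mulKf //.
  by rewrite fmorph_eq0 -deriv_map.
exists S, J, chi; split=> // u w Ew.
(* The pulled-back ring lies above that of E, as theta is isometric, and a is not small for it
   because t is not; so [unique] identifies it. *)
pose V m := OS (chi m); have vV : valuation_ring V by exact: pullback_valuation.
have hV c : V c%:A <-> O (val c) by rewrite /V hchi extS thO.
have nV : ~ vlt V a 1.
  rewrite /vlt -(vle_ext 1 a vV vS (fun _ => iff_refl _)) rmorph1 chia -(rmorph1 J) (vle_ext _ _ vO' vS extS).
  exact: t1.
by rewrite -(unique vV hV nV u) /V -Ew extS.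
Qed.
End Embedding.

(** * Choice of a finitely generated subextension *)

Lemma gauss_alg_indep (K R : fieldType) (OK : K -> Prop) (vK : valuation_ring OK) r s (O : R -> Prop)
  (j : {rmorphism K -> R}) (x : 'I_r -> R) (y : 'I_s -> R) :
  gauss OK O j x y -> alg_indep (imK' j) (glue x y).
Proof.
move=> G p p0 hp; pose q := \sum_(m <- msupp p) sval (cid (hp m)) *: 'X_[m].
have qE : map_mpoly j q = p.
  rewrite [RHS]mpolyE rmorph_sum; apply: eq_bigr => m _; rewrite /= map_mpolyZ map_mpolyX.
  by case: (cid _) => c /= <-.
have qT : mmap j (glue x y) q = p.@[glue x y].
  rewrite rmorph_sum mevalE; apply: eq_bigr => m _; rewrite /= mmapZ mmapX.
  by case: (cid _) => c /= <-.
apply/eqP; rewrite -qT => /(gauss_eq0 vK G (transfer_refl G)) q0.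
by move: p0; rewrite -qE q0 rmorph0 eqxx.
Qed.

Lemma trdeg_is_sub (R : fieldType) (S F F1 : R -> Prop) n (t : 'I_n -> R) : trdeg_is S F n ->
  (forall u, F1 u -> F u) -> (forall i, F1 (t i)) -> alg_indep S t -> trdeg_is S F1 n.
Proof.
move=> [_ max] sub Ft it; split; first by exists t.
by move=> [t' [Ft' it']]; apply: max; exists t'; split=> // i; apply: sub.
Qed.

Section Subextension.
Variables (K L : fieldType) (iota : {rmorphism K -> L}) (OK : K -> Prop) (OL : L -> Prop)
  (G : zmodType) (le : G -> G -> Prop) (v : L -> G) (k : fieldType) (res : L -> k).
Hypotheses (vK : valuation_ring OK) (vL : valuation_ring OL) (ext : extends iota OK OL).
Hypotheses (hv : value_group_map OL le v) (hres : residue_map OL res).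
Hypothesis wtd : without_transcendence_defect iota OK OL v res.
Local Notation k0 := (Kv_img iota OK res).

(** The two cases in the definition of extensions without transcendence defect: if the transcendence
    degree of L over K is finite, only L itself is known to satisfy the equality, and F = L;
    otherwise F is generated by e. *)
Lemma defectless_overfield N (e : 'I_N -> L) : exists (F : L -> Prop) n,
  [/\ is_subfield F, forall a, F (iota a), forall i, F (e i), trdeg_is (imK iota) F n &
      no_td_sub iota OK OL v res F].
Proof.
have hK := imK_subfield iota; case: wtd => w1 w2.
case: (EM (exists n, trdeg_is (imK iota) (fun _ => True) n)) => [[n tn]|no].
  by exists (fun _ => True), n; split.
pose F := ratT (imK' iota) e; have hF : is_subfield F := ratT_subfield e hK.
have [|n tn] := @trdeg_exists _ (imK iota) F N.
  move=> m z Fz iz; apply: (steinitz hK iz) => i; apply: (alg_incl hF); exact: Fz.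
have FK a : F (iota a) by apply: ratT_const => //; exists a.
exists F, n; split=> //; first by move=> i; exact: ratT_var.
apply: w2 => [m tm|]; first by apply: no; exists m.
by case: hF => _ h1 h2 h3; split.
Qed.

(** Elements of the overfield with independent values and residues are added to e as generators.
    They are algebraically independent and as many as the transcendence degree of the overfield, so
    that the finitely generated field also satisfies the equality. *)
Lemma subextension_data N (e : 'I_N -> L) : exists M (z : 'I_M -> L) r s (x0 : 'I_r -> L) (y0 : 'I_s -> L),
  let F := ratT (imK' iota) z in
  [/\ forall i, F (e i), (forall i, F (x0 i)) /\ (forall i, F (y0 i)),
      [/\ forall i, x0 i != 0, forall i, OL (y0 i),
          forall c : 'I_r -> int, vK_img iota v (\sum_i v (x0 i) *~ c i) -> forall i, c i = 0 &
          alg_indep k0 (fun i => res (y0 i))],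
      trdeg_is k0 (Fv_img OL res F) s & trdeg_is (imK' iota) F (r + s)].
Proof.
have hK := imK_subfield iota.
have [F [n [hF FK Fe tn ntd]]] := defectless_overfield e.
have [s [r [ts [[g [Fg ig]] _] En]]] := ntd n tn.
have [[w [Fw iw]] _] := ts.
have /choice[x0 hx] : forall i, exists u, [/\ F u, u != 0 & v u = g i] := Fg.
have /choice[y0 hy] : forall i, exists u, [/\ F u, OL u & res u = w i] := Fw.
have Ew : (fun i => res (y0 i)) = w by apply/funext => i; case: (hy i).
have indx (c : 'I_r -> int) : vK_img iota v (\sum_i v (x0 i) *~ c i) -> forall i, c i = 0.
  rewrite (eq_bigr (fun i => g i *~ c i)) => [|i _]; first exact: ig.
  by case: (hx i) => _ _ ->.
have x00 i : x0 i != 0 by case: (hx i).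
have Oy0 i : OL (y0 i) by case: (hy i).
pose z := glue e (glue x0 y0).
have ze i : z (lshift _ i) = e i by rewrite /z /glue -[lshift _ i]/(unsplit (inl i)) unsplitK.
have zx i : z (rshift _ (lshift _ i)) = x0 i.
  by rewrite /z /glue -[rshift _ _]/(unsplit (inr _)) unsplitK -[lshift _ i]/(unsplit (inl i)) unsplitK.
have zy i : z (rshift _ (rshift _ i)) = y0 i.
  by rewrite /z /glue -[rshift N _]/(unsplit (inr _)) unsplitK -[rshift r i]/(unsplit (inr i)) unsplitK.
have zF u : ratT (imK' iota) z u -> F u.
  apply: (ratT_min (P := F)) => // [_ [a ->]//|i]; rewrite /z /glue.
  case: split => [i'|i']; first exact: Fe.
  by case: split => l; [case: (hx l)|case: (hy l)].
have Fx i : ratT (imK' iota) z (x0 i) by rewrite -zx; exact: ratT_var.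
have Fy i : ratT (imK' iota) z (y0 i) by rewrite -zy; exact: ratT_var.
have G0 : gauss OK OL iota x0 y0.
  apply: (gauss_of_indep vK vL ext hres) => //; last by rewrite Ew.
  by move=> c m m' c0 h i; apply: (val_indep vL hv x00 indx c0 h).
exists _, z, r, s, x0, y0; split=> //.
- by move=> i; rewrite -ze; exact: ratT_var.
- by split=> //; rewrite Ew.
- apply: (trdeg_is_sub ts) (iw) => [u [a [Fa Oa <-]]|i]; first by exists a; split=> //; exact: zF.
  by rewrite -Ew; exists (y0 i).
- have tn' : trdeg_is (imK iota) F (r + s) by rewrite addnC -En.
  by apply: (trdeg_is_sub tn' zF) (gauss_alg_indep vK G0) => i; rewrite /glue; case: split.
Qed.

Hypotheses (hens : henselian OK) (dfl : defectless OK).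
Hypotheses (ecG : ec_ordered_group le (vK_img iota v)) (eck : ec_field k0).

Theorem embedding N (e : 'I_N -> L) :
  exists (J : Type) (U : (J -> Prop) -> Prop) (hU : ultra U) (M W S : fieldType)
    (j : {rmorphism L -> W}) (phi : {rmorphism M -> W})
    (I : {rmorphism uprod hU (fun _ => K) -> S}) (chi : {rmorphism M -> S}),
  [/\ forall i, exists u, phi u = j (e i),
      forall c, exists u, phi u = j (iota c) /\ chi u = I (udiag hU c),
      forall u, exists t, I t = chi u &
      forall u t y, I t = chi u -> phi u = j y -> uO (hU := hU) (fun _ => OK) t <-> OL y].
Proof.
have hK := imK_subfield iota.
have [M [z [r [s [x0 [y0 /= [Fe [Fx0 Fy0] [x00 Oy0 indx indy] ts tn]]]]]]] := subextension_data e.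
have G0 : gauss OK OL iota x0 y0.
  apply: (gauss_of_indep vK vL ext hres) => //.
  by move=> c m m' c0 h i; apply: (val_indep vL hv x00 indx c0 h).
have algz (x : 'I_r -> L) (y : 'I_s -> L) : gauss OK OL iota x y -> (forall i, ratT (imK' iota) z (x i)) ->
    (forall i, ratT (imK' iota) z (y i)) -> forall i, alg (ratT (imK' iota) (glue x y)) (z i).
  move=> G1 Fx Fy i; apply: (trdeg_alg hK tn _ (gauss_alg_indep vK G1)); last exact: ratT_var.
  by move=> l; rewrite /glue; case: split.
have Fz := algz _ _ G0 Fx0 Fy0.
have [x [Fx xn0 indx' values]] :=
  value_basis vK vL hv G0 (fun N g => value_pure vL hv ecG) indx Fx0 Fz.
have [y [Fy Oy indy' [f [mp [zeta [mp_monic mp_size [zeta0 [a0 [Fa0 Oa0 ea0]] mp_root mp_sep] mp_span mp_indep]]]]]] :=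
  residue_basis vK vL ext hres G0 Fz Fy0 eck ts indy.
subst zeta.
have G1 : gauss OK OL iota x y by exact: (gauss_of_indep vK vL ext hres).
(* The residue conditions are realized for y together with a0; the last member of [yp'] is the
   approximate root to which Hensel's lemma is applied. *)
have [J [U [hU [x' [yp' Tr]]]]] := realize vK vL ext hv hres ecG eck (x := x)
   (y := glue y (fun _ : 'I_1 => a0)) xn0 (fun i => ltac:(rewrite /glue; case: split => ? //)).
have [W [j [O [hW [M1 [phi [bT [a [[vO extO] [phi0 phiF] [hb a_close] [OP P'a] [gen unique]]]]]]]]]] :=
  finite_generator hens dfl G1 indy' Fx Fy (algz _ _ G1 Fx Fy) values mp_monic mp_size Fa0 Oa0 zeta0
    mp_root mp_sep mp_span mp_indep.
have [S [I [chi [onto chi0 isom]]]] := ultrapower_embedding vK vL G1 Oa0 Tr vO extO phi0 hb a_close OP P'a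
  gen unique ((res_neq0 vL hres Oa0).1 zeta0) (fun Q t => ultra_hensel vK hens).
exists J, U, hU, M1, W, S, j, phi, I, chi; split=> //.
- by move=> i; apply: phiF.
- move=> c; have [c' Ec] : exists c' : sft hW, val c' = j (iota c).
    by apply: (sfv_ex hW); apply: ratT_const; [exact: imK_subfield|exists c].
  exists (c'%:A); rewrite phi0 chi0; split=> //; congr (I _).
  exact: (transfer_fun_const vK G1 (transfer_restrict vK Tr) Ec).
- by move=> u t w E Ew; rewrite (isom u t E) Ew extO.
Qed.
End Subextension.

(** * Transfer of quantifier-free formulas *)

(** One more than the largest index of a variable. Only finitely many values of an assignment
    matter, which is why finitely generated subextensions suffice. *)
Fixpoint rbound (T : Type) (t : rterm T) : nat :=
  match t with
  | RVar n => n.+1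
  | RAdd t1 t2 | RMul t1 t2 => maxn (rbound t1) (rbound t2)
  | ROpp t1 | RInv t1 => rbound t1
  | _ => 0%N
  end.

Definition vf_bound (T : Type) (a : vf_atom T) : nat :=
  match a with VEq t1 t2 => maxn (rbound t1) (rbound t2) | VInO t => rbound t end.

Fixpoint qf_bound (T : Type) (f : qf (vf_atom T)) : nat :=
  match f with
  | QAtom a => vf_bound a
  | QNot f1 => qf_bound f1
  | QAnd f1 f2 | QOr f1 f2 => maxn (qf_bound f1) (qf_bound f2)
  | _ => 0%N
  end.

Definition vf_sat (L : fieldType) (O : L -> Prop) (e : nat -> L) (a : vf_atom L) : Prop :=
  match a with
  | VEq t1 t2 => reval e t1 = reval e t2
  | VInO t => O (reval e t) end.

Definition vf_params (T : Type) (S : T -> Prop) (a : vf_atom T) : Prop :=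
  match a with VEq t1 t2 => rconsts S t1 /\ rconsts S t2 | VInO t => rconsts S t end.

Section Los.
Variables (K L : fieldType) (iota : {rmorphism K -> L}) (OK : K -> Prop) (OL : L -> Prop).
Hypothesis ext : extends iota OK OL.
Variables (J : Type) (U : (J -> Prop) -> Prop) (hU : ultra U) (M W S : fieldType)
  (j : {rmorphism L -> W}) (phi : {rmorphism M -> W})
  (I : {rmorphism uprod hU (fun _ => K) -> S}) (chi : {rmorphism M -> S}).
Hypothesis const : forall c, exists u, phi u = j (iota c) /\ chi u = I (udiag hU c).
Hypothesis isometric : forall u t y, I t = chi u -> phi u = j y ->
  uO (hU := hU) (fun _ => OK) t <-> OL y.
Variables (N : nat) (e : nat -> L) (eps : nat -> J -> K).
(** The family g is a preimage in the ultrapower of the embedded element y. Both live in auxiliary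
    overfields W and S, so the correspondence runs through an element of M. *)
Definition represents (g : J -> K) (y : L) := exists u, phi u = j y /\ chi u = I (umk hU g).
Hypothesis epsP : forall n, (n < N)%N -> represents (eps n) (e n).

Lemma represents_term t : (rbound t <= N)%N -> rconsts (imK iota) t ->
  exists g, represents g (reval e t) /\ forall i, iota (g i) = reval (fun n => iota (eps n i)) t.
Proof.
elim: t => [n|c|||t1 IH1 t2 IH2|t1 IH1|t1 IH1 t2 IH2|t1 IH1] /= ht hc.
- by exists (eps n); split=> //; apply: epsP.
- by case: hc => a ->; exists (fun _ => a); split=> //; exact: const.
- by exists (fun _ => 0); split=> [|i]; [exists 0; rewrite !rmorph0; split=> //; exact/esym/rmorph0|rewrite rmorph0].
- by exists (fun _ => 1); split=> [|i]; [exists 1; rewrite !rmorph1; split=> //; exact/esym/rmorph1|rewrite rmorph1].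
- move: ht hc; rewrite geq_max => /andP[b1 b2] [c1 c2].
  have [g1 [[u1 [p1 q1]] h1]] := IH1 b1 c1; have [g2 [[u2 [p2 q2]] h2]] := IH2 b2 c2.
  exists (fun i => g1 i + g2 i); split=> [|i]; last by rewrite rmorphD h1 h2.
  exists (u1 + u2); rewrite !rmorphD p1 p2 q1 q2; split=> //.
  by rewrite -rmorphD; congr (I _); exact: umkD.
- have [g1 [[u1 [p1 q1]] h1]] := IH1 ht hc.
  exists (fun i => - g1 i); split=> [|i]; last by rewrite rmorphN h1.
  exists (- u1); rewrite !rmorphN p1 q1; split=> //.
  by rewrite -rmorphN; congr (I _); exact: umkN.
- move: ht hc; rewrite geq_max => /andP[b1 b2] [c1 c2].
  have [g1 [[u1 [p1 q1]] h1]] := IH1 b1 c1; have [g2 [[u2 [p2 q2]] h2]] := IH2 b2 c2.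
  exists (fun i => g1 i * g2 i); split=> [|i]; last by rewrite rmorphM h1 h2.
  exists (u1 * u2); rewrite !rmorphM p1 p2 q1 q2; split=> //.
  by rewrite -rmorphM; congr (I _); exact: umkM.
- have [g1 [[u1 [p1 q1]] h1]] := IH1 ht hc.
  exists (fun i => (g1 i)^-1); split=> [|i]; last by rewrite fmorphV h1.
  exists (u1^-1); rewrite !fmorphV p1 q1; split=> //.
  by rewrite -fmorphV; congr (I _); exact: umkV.
Qed.

Lemma represents_eq g1 g2 y1 y2 : represents g1 y1 -> represents g2 y2 ->
  U (fun i => g1 i = g2 i) <-> y1 = y2.
Proof.
move=> [u1 [p1 q1]] [u2 [p2 q2]]; rewrite -(umkP hU g1 g2); split=> [E|E].
  by apply: (fmorph_inj j); rewrite -p1 -p2; congr (phi _); apply: (fmorph_inj chi); rewrite q1 q2 E.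
apply: (fmorph_inj I); rewrite -q1 -q2; congr (chi _); apply: (fmorph_inj phi).
by rewrite p1 p2 E.
Qed.

(** The theorem of Los for quantifier-free formulas, combined with the embedding: atoms are compared
    through [represents] and [isometric], connectives through the ultrafilter properties. *)
Lemma los (f : qf (vf_atom L)) : (qf_bound f <= N)%N -> qf_all (vf_params (imK iota)) f ->
  U (fun i => qf_holds (vf_sat OL (fun n => iota (eps n i))) f) <-> qf_holds (vf_sat OL e) f.
Proof.
elim: f => [[t1 t2|t]|||f1 IH1|f1 IH1 f2 IH2|f1 IH1 f2 IH2] /= hb hp.
- move: hb hp; rewrite geq_max => /andP[b1 b2] [c1 c2].
  have [g1 [r1 h1]] := represents_term b1 c1; have [g2 [r2 h2]] := represents_term b2 c2.
  rewrite -(represents_eq r1 r2); split=> h; apply: (uS hU h) => i; rewrite -h1 -h2.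
    exact: fmorph_inj.
  by move=> ->.
- have [g [[u [p q]] h]] := represents_term hb hp.
  rewrite -(isometric (esym q) p) uO_mk.
  by split=> hu; apply: (uS hU hu) => i; rewrite -h ext.
- by split=> // _; exact: (uT hU).
- by split=> // h; have [] := uE hU h.
- by rewrite (uN hU) IH1.
- move: hb hp; rewrite geq_max => /andP[b1 b2] [c1 c2].
  rewrite -(IH1 b1 c1) -(IH2 b2 c2); split=> [h|[h1 h2]]; last exact: (uI hU h1 h2).
  by split; apply: (uS hU h) => i [].
- move: hb hp; rewrite geq_max => /andP[b1 b2] [c1 c2].
  rewrite -(IH1 b1 c1) -(IH2 b2 c2); split=> [/(uOr hU)//|[h|h]]; apply: (uS hU h) => i; tauto.
Qed.
End Los.

(* (K,OK) henselian defectless, (L,OL) an extension along iota without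
   transcendence defect; (G,le,v) a value group of (L,OL) (so vK is the image
   of K^x), (k,res) a residue field of (L,OL) (so Kv is the image of OK).
   If vK is e.c. in vL and Kv is e.c. in Lv, then (K,v) (= the image of K)
   is e.c. in (L,v). *)
Theorem theorem1p3 (K L : fieldType) (iota : {rmorphism K -> L})
  (OK : K -> Prop) (OL : L -> Prop)
  (G : zmodType) (le : G -> G -> Prop) (v : L -> G)
  (k : fieldType) (res : L -> k) :
  valuation_ring OK -> valuation_ring OL -> extends iota OK OL ->
  value_group_map OL le v -> residue_map OL res ->
  henselian OK -> defectless OK ->
  without_transcendence_defect iota OK OL v res ->
  ec_ordered_group le (vK_img iota v) ->
  ec_field (Kv_img iota OK res) ->
  ec_valued_field OL (imK iota).
Proof.
move=> vK vL ext hv hres hens dfl wtd ecG eck f fS [e he].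
have [J [U [hU [M [W [S [j [phi [I [chi [vars const onto isometric]]]]]]]]]]] :=
  embedding vK vL ext hv hres wtd hens dfl ecG eck (fun i : 'I_(qf_bound f) => e i).
have /choice[eps epsP] : forall n, exists g : J -> K, (n < qf_bound f)%N ->
    represents j phi I chi g (e n).
  (* Variables beyond the bound do not occur in f and receive the value 0. *)
  move=> n; case: (ltnP n (qf_bound f)) => [lt|_]; last by exists (fun _ => 0).
  have [u Eu] := vars (Ordinal lt); have [t Et] := onto u.
  by exists (ufun t) => _; exists u; rewrite ufunK.
have [i hi] := uE hU ((los ext const isometric epsP (leqnn _) fS).2 he).
by exists (fun n => iota (eps n i)); split=> // n; exists (eps n i).
Qed.
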